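(* Let $\Lambda=\{\lambda_n,\mu_n\}_{n=1}^{\infty}$ belong to the class $ABCD$ and let $-\infty<\gamma<\beta<\infty$. Let $W(\Lambda,\gamma,\beta)$ be the set of functions on $(\gamma,\beta)$ that admit a representation $\sum_{n=1}^\infty\big(\sum_{k=0}^{\mu_n-1}c_{n,k}x^k\big)e^{\lambda_nx}$ converging pointwise at every point of $(\gamma,\beta)$. (i) Let $V(\Lambda,\gamma,\beta)$ be the set of functions $f\in C(\gamma,\beta,\{G_n\})$ satisfying $F(D)f(x)=0$ for all $x\in(\gamma,\beta)$. Then $V(\Lambda,\gamma,\beta)=W(\Lambda,\gamma,\beta)$. (ii) If $f\in W(\Lambda,\gamma,\beta)$ and $f\in L^p(\gamma,\beta)$ for some $p\ge1$, then $f$ belongs to the closed span of $E_\Lambda$ in $L^p(\gamma,\beta)$.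
   Context: A multiplicity sequence $\Lambda=\{\lambda_n,\mu_n\}_{n=1}^\infty$ consists of distinct nonzero complex numbers $\lambda_n$ with $|\lambda_n|\to\infty$, $|\lambda_n|\le|\lambda_{n+1}|$, and positive integers $\mu_n$. $A^0_{|z|}$ is the space of entire functions $F$ with: for every $\epsilon>0$ there is $M_\epsilon$ with $|F(z)|\le M_\epsilon e^{\epsilon|z|}$ on $\mathbb{C}$. $\Lambda$ is an interpolating variety for $A^0_{|z|}$ if for every doubly indexed complex sequence $(a_{n,k})_{n\in\mathbb{N},0\le k\le\mu_n-1}$ with $\sup_n\sum_{k}|a_{n,k}|e^{-\epsilon|\lambda_n|}<\infty$ for every $\epsilon>0$ there is $f\in A^0_{|z|}$ with $f^{(k)}(\lambda_n)/k!=a_{n,k}$ for all $n,k$. $\Lambda\in ABCD$ means: (A) $\sum_n\mu_n/|\lambda_n|<\infty$; (B) $\sup_n|\arg\lambda_n|<\pi/2$; (C) $\Lambda$ is an interpolating variety for $A^0_{|z|}$; (D) $n_\Lambda(t)\log t/t=O(1)$ as $t\to\infty$, where $n_\Lambda(t)=\sum_{|\lambda_n|\le t}\mu_n$. $F(z)=\prod_n(1-z/\lambda_n)^{\mu_n}$, $G(z)=\prod_n(1+z/|\lambda_n|)^{\mu_n}$, $G_n=G^{(n)}(0)/n!$. The class $C(\gamma,\beta,\{G_n\})$ consists of infinitely differentiable $f$ on $(\gamma,\beta)$ such that $\sum_{n\ge0}\frac{G^{(n)}(0)}{n!}|f^{(n)}(x)|$ converges uniformly on $(\gamma+\epsilon,\beta-\epsilon)$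 for every $\epsilon>0$; for such $f$, $F(D)f(x)=\sum_{n\ge0}\frac{F^{(n)}(0)}{n!}f^{(n)}(x)$. $E_\Lambda=\{x^ke^{\lambda_n x}:n\in\mathbb{N},\ 0\le k\le\mu_n-1\}$. *)

(* Defs.v *)
From Stdlib Require Import Reals ClassicalEpsilon Factorial.
From Coquelicot Require Import Coquelicot.

Open Scope R_scope.

Definition cexp (z : C) : C :=
  (exp (Re z) * cos (Im z), exp (Re z) * sin (Im z)).

Definition Carg (z : C) : R :=
  if Rlt_dec 0 (Re z) then atan (Im z / Re z)
  else if Rlt_dec (Re z) 0 then
    (if Rle_dec 0 (Im z) then atan (Im z / Re z) + PI
     else atan (Im z / Re z) - PI)
  else if Rlt_dec 0 (Im z) then PI / 2
  else if Rlt_dec (Im z) 0 then - (PI / 2)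
  else 0.

Fixpoint Csum (N : nat) (a : nat -> C) : C :=
  match N with
  | O => RtoC 0
  | S N => Cplus (Csum N a) (a N)
  end.

Definition Cder_tower (f : C -> C) (g : nat -> C -> C) : Prop :=
  g O = f /\
  forall (k : nat) (z : C),
    is_derive (K := C_AbsRing) (V := C_NormedModule) (g k) z (g (S k) z).

(* the derivatives f^{(k)} of an entire function (well defined since the
   tower is unique when it exists) *)
Definition Cder_n (f : C -> C) : nat -> C -> C :=
  epsilon (inhabits (fun _ => f)) (fun g => Cder_tower f g).

Definition entire (f : C -> C) : Prop :=
  forall z : C, ex_derive (K := C_AbsRing) (V := C_NormedModule) f z.

Definition taylor_coef (f : C -> C) (n : nat) : C :=
  Cdiv (Cder_n f n (RtoC 0)) (RtoC (INR (fact n))).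

Definition Rder_tower (a b : R) (f : R -> C) (g : nat -> R -> C) : Prop :=
  (forall x, a < x < b -> g O x = f x) /\
  forall (k : nat) (x : R), a < x < b ->
    is_derive (K := R_AbsRing) (V := C_R_NormedModule) (g k) x (g (S k) x).

(* indices shifted: n = 0,1,2,... corresponds to the paper's n = 1,2,3,... *)
Definition multiplicity_seq (lam : nat -> C) (mu : nat -> nat) : Prop :=
  (forall n, lam n <> RtoC 0) /\
  (forall n m, n <> m -> lam n <> lam m) /\
  (forall n, (0 < mu n)%nat) /\
  (forall n, Cmod (lam n) <= Cmod (lam (S n))) /\
  is_lim_seq (fun n => Cmod (lam n)) p_infty.

Definition nLam (lam : nat -> C) (mu : nat -> nat) (t : R) : R :=
  Series (fun n => if Rle_dec (Cmod (lam n)) t then INR (mu n) else 0).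

Definition A0 (f : C -> C) : Prop :=
  entire f /\
  forall eps : R, 0 < eps ->
    exists M : R, forall z : C, Cmod (f z) <= M * exp (eps * Cmod z).

Definition interpolating_A0 (lam : nat -> C) (mu : nat -> nat) : Prop :=
  forall a : nat -> nat -> C,
    (forall eps : R, 0 < eps ->
       exists B : R, forall n : nat,
         sum_f_R0 (fun k => Cmod (a n k)) (pred (mu n))
           * exp (- eps * Cmod (lam n)) <= B) ->
    exists f : C -> C,
      A0 f /\
      forall n k : nat, (k < mu n)%nat ->
        Cdiv (Cder_n f k (lam n)) (RtoC (INR (fact k))) = a n k.

Definition condA (lam : nat -> C) (mu : nat -> nat) : Prop :=
  ex_series (fun n => INR (mu n) / Cmod (lam n)).

Definition condB (lam : nat -> C) : Prop :=
  exists theta : R, theta < PI / 2 /\ forall n, Rabs (Carg (lam n)) <= theta.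

Definition condD (lam : nat -> C) (mu : nat -> nat) : Prop :=
  exists M t0 : R, forall t : R, t0 <= t ->
    Rabs (nLam lam mu t * ln t / t) <= M.

Definition ABCD (lam : nat -> C) (mu : nat -> nat) : Prop :=
  condA lam mu /\ condB lam /\ interpolating_A0 lam mu /\ condD lam mu.

Fixpoint Cpow (z : C) (k : nat) : C :=
  match k with O => RtoC 1 | S k => Cmult (Cpow z k) z end.

Fixpoint Fpart (lam : nat -> C) (mu : nat -> nat) (N : nat) (z : C) : C :=
  match N with
  | O => RtoC 1
  | S N => Cmult (Fpart lam mu N z)
                 (Cpow (Cminus (RtoC 1) (Cdiv z (lam N))) (mu N))
  end.

Fixpoint Gpart (lam : nat -> C) (mu : nat -> nat) (N : nat) (z : C) : C :=
  match N with
  | O => RtoC 1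
  | S N => Cmult (Gpart lam mu N z)
                 (Cpow (Cplus (RtoC 1) (Cdiv z (RtoC (Cmod (lam N))))) (mu N))
  end.

Definition Clim (u : nat -> C) : C :=
  epsilon (inhabits (RtoC 0))
    (fun l => filterlim u eventually (locally (T := C_NormedModule) l)).

Definition Fprod lam mu (z : C) : C := Clim (fun N => Fpart lam mu N z).
Definition Gprod lam mu (z : C) : C := Clim (fun N => Gpart lam mu N z).

Definition classC lam mu (a b : R) (f : R -> C) (g : nat -> R -> C) : Prop :=
  Rder_tower a b f g /\
  forall eps : R, 0 < eps ->
    exists S : R -> C,
      forall delta : R, 0 < delta ->
        exists N0 : nat, forall N : nat, (N0 <= N)%nat ->
          forall x : R, a + eps < x < b - eps ->
            Cmod (Cminus
                    (Csum N (fun n => Cmult (taylor_coef (Gprod lam mu) n)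
                                            (RtoC (Cmod (g n x)))))
                    (S x)) < delta.

Definition Vclass lam mu (a b : R) (f : R -> C) : Prop :=
  exists g : nat -> R -> C,
    classC lam mu a b f g /\
    forall x : R, a < x < b ->
      is_series (K := C_AbsRing) (V := C_NormedModule)
        (fun n => Cmult (taylor_coef (Fprod lam mu) n) (g n x)) (RtoC 0).

Definition Eblock lam mu (c : nat -> nat -> C) (n : nat) (x : R) : C :=
  Cmult (Csum (mu n) (fun k => Cmult (c n k) (RtoC (x ^ k))))
        (cexp (Cmult (lam n) (RtoC x))).

Definition Wclass lam mu (a b : R) (f : R -> C) : Prop :=
  exists c : nat -> nat -> C,
    forall x : R, a < x < b ->
      is_series (K := C_AbsRing) (V := C_NormedModule)
        (fun n => Eblock lam mu c n x) (f x).

Definition span_E lam mu (P : R -> C) : Prop :=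
  exists (N : nat) (c : nat -> nat -> C),
    forall x : R, P x = Csum N (fun n => Eblock lam mu c n x).

From mathcomp Require Import all_boot all_algebra.
From mathcomp Require Import all_classical all_reals all_analysis.
From mathcomp Require Import Rstruct Rstruct_topology.
Import numFieldNormedType.Exports.

Local Open Scope classical_set_scope.
Local Open Scope ring_scope.
Local Open Scope ereal_scope.

(* the real line as a measurable type (Borel/Lebesgue sets); convertible to R *)
Notation RR := (Real.sort R).

Definition Cmeasurable (a b : R) (f : R -> C) : Prop :=
  measurable_fun [set x : RR | (a < x < b)%R] (fun x : RR => (Re (f x) : RR)) /\
  measurable_fun [set x : RR | (a < x < b)%R] (fun x : RR => (Im (f x) : RR)).

Definition Lp_int (a b p : R) (f : R -> C) : \bar RR :=
  \int[lebesgue_measure]_(x in [set y : RR | (a < y < b)%R])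
     (((Cmod (f x) : RR) `^ (p : RR))%:E).

Definition in_Lp (a b p : R) (f : R -> C) : Prop :=
  Cmeasurable a b f /\ Lp_int a b p f < +oo.

Definition in_closed_span_Lp lam mu (a b p : R) (f : R -> C) : Prop :=
  forall eps : R, (0 < eps)%R ->
    exists P : R -> C, span_E lam mu P /\
      Lp_int a b p (fun x => Cminus (f x) (P x)) < (((eps : RR) `^ (p : RR))%:E).

(* Main.v *)
(* W in V.  The terms of a convergent expansion are bounded on some subinterval (Baire), and
   the coefficients of a polynomial are controlled by its values at equispaced nodes; this
   gives |c_n| <= M_eta exp(-(beta - eta) Re lam_n).  The expansion is then absolutely
   summable below beta together with its derivatives, and F(D) acts block by block.

   V in W.  For mu' <= mu put w_{mu'} = F_{mu'}(D) f, where F_{mu'} has the zeros lam_n with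
   multiplicities mu'_n.  Then w_{mu'}' = lam_k (w_{mu'} - w_{mu' + delta_k}), so removing from
   F the zero lam_n yields a block v_n = F^{[n]}(D) u_n of frequency lam_n.  The function
   f - sum_{n<N} u_n is annihilated by F_{>=N}(D), that is, F_{>=N}(D) f is the sum of the
   F_{>=N}(D) u_n for n < N, and N -> oo gives f = sum u_n.  This limit needs the lower bound
   |c| <= M_eps exp(eps |lam_n|) |F^{[n]}(D) c| on blocks.  If it failed, it would fail along
   a lacunary set S; dividing a function of A^0 that interpolates 1 on S and 0 off S by
   its zeros off S gives a contradiction.

   Closed span.  Below beta the expansion of f converges absolutely, so f(. - h) is a uniform
   limit of elements of the span for h > 0.  As h -> 0, f(. - h) tends to f in L^p, because f
   is continuous up to gamma and the integral of |f|^p near beta is small. *)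
Require Import Defs.
From Stdlib Require Import Reals Lra Lia ClassicalEpsilon FunctionalExtensionality Factorial.
From Stdlib Require Import ssreflect.
From Coquelicot Require Import Coquelicot.
Open Scope R_scope.

(** * Complex series *)

(** Interpolating 1 at one zero and 0 at the others gives a lower bound whose constant depends on
    [n]. Uniformity requires one function that serves infinitely many [n] at once, equal to 1 on [S]
    and to 0 off [S]. Division then treats the zeros off [S] only; the zeros inside [S] are
    estimated by hand, which works when [S] is so sparse that their factors stay away from 0. The
    argument by contradiction leaves the choice of [S] free. The majorant [G] enters through one
    inequality: every product with multiplicities [mu' <= mu] has coefficients bounded by those of
    [G]. Hence all [F_{mu'}(D) f] converge absolutely, zeros can be removed and restored one at a
    time, and sums can be exchanged. On a single frequency these operators act on finitely many
    coefficients, with norms bounded by majorants at [|lam_n| + mu_n]. Condition (B) compares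
    [Re lam_n] with [|lam_n|]; condition (A) gives [mu_n = o(|lam_n|)] and the final summability.
    Interpolating functions are only known to be complex differentiable, which is why Cauchy's
    formula is proved. *)

Fixpoint Rsum (N : nat) (a : nat -> R) : R :=
  match N with O => 0 | S N => Rsum N a + a N end.

Lemma Rsum_sum_n a N : sum_n a N = Rsum (S N) a.
Proof.
elim: N => [|N IH]; first by rewrite sum_O /= Rplus_0_l.
by rewrite sum_Sn IH.
Qed.

Lemma Rsum_ext N a b : (forall n, (n < N)%nat -> a n = b n) -> Rsum N a = Rsum N b.
Proof.
elim: N => [|N IH] //= H.
rewrite IH; last by move=> n Hn; apply: H; lia.
by rewrite (H N) //; lia.
Qed.

Lemma Rsum_le N a b : (forall n, (n < N)%nat -> a n <= b n) -> Rsum N a <= Rsum N b.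
Proof.
elim: N => [|N IH] /= H; first by lra.
have := IH (fun n Hn => H n (Nat.lt_lt_succ_r _ _ Hn)).
have := H N (Nat.lt_succ_diag_r N). lra.
Qed.

Lemma Rsum_ge0 N a : (forall n, (n < N)%nat -> 0 <= a n) -> 0 <= Rsum N a.
Proof.
elim: N => [|N IH] /= H; first by lra.
have := IH (fun n Hn => H n (Nat.lt_lt_succ_r _ _ Hn)).
have := H N (Nat.lt_succ_diag_r N). lra.
Qed.

Lemma Rsum_plus N a b : Rsum N (fun n => a n + b n) = Rsum N a + Rsum N b.
Proof. by elim: N => [|N IH] /=; [ring | rewrite IH; ring]. Qed.

Lemma Rsum_scal N k a : Rsum N (fun n => k * a n) = k * Rsum N a.
Proof. by elim: N => [|N IH] /=; [ring | rewrite IH; ring]. Qed.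

Lemma Rsum_incr N a : Rsum (S N) a = a 0%nat + Rsum N (fun n => a (S n)).
Proof. by elim: N => [|N IH]; [move=> /=; ring | move: IH => /= ->; ring]. Qed.

Lemma Rsum_mono a N M : (forall n, 0 <= a n) -> (N <= M)%nat -> Rsum N a <= Rsum M a.
Proof. by move=> H; elim=> [|m _ IH] /=; [lra | have := H m; lra]. Qed.

Lemma Rsum_term_le N a k :
  (forall n, (n < N)%nat -> 0 <= a n) -> (k < N)%nat -> a k <= Rsum N a.
Proof.
elim: N => [|N IH] H Hk; first by lia.
have H0 : forall n, (n < N)%nat -> 0 <= a n by move=> n Hn; apply: H; lia.
have HN : 0 <= a N by apply: H; lia.
have [->|Hlt] : k = N \/ (k < N)%nat by lia.
- have /= := Rsum_ge0 N a H0; lra.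
- have /= := IH H0 Hlt; lra.
Qed.

Lemma Rsum_lim a : ex_series a -> is_lim_seq (fun N => Rsum N a) (Series a).
Proof.
move=> /Series_correct H; apply/is_lim_seq_incr_1.
apply: is_lim_seq_ext; last exact: H.
by move=> n; rewrite Rsum_sum_n.
Qed.

Lemma Series_le_bound (a : nat -> R) B :
  (forall N, Rsum N a <= B) -> ex_series a -> Series a <= B.
Proof.
move=> H Ha.
exact: (is_lim_seq_le _ (fun _ => B) (Series a) B H (Rsum_lim a Ha) (is_lim_seq_const B)).
Qed.

Lemma ex_series_bound (a : nat -> R) B :
  (forall n, 0 <= a n) -> (forall N, Rsum N a <= B) -> ex_series a.
Proof.
move=> H0 HB.
have [l Hl] : ex_finite_lim_seq (fun n => Rsum (S n) a).
  apply: (ex_finite_lim_seq_incr _ B) => n; last exact: HB.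
  by rewrite /= ; have := H0 (S n); lra.
exists l; apply: is_lim_seq_ext Hl => n; by rewrite Rsum_sum_n.
Qed.

Lemma Rsum_le_Series (a : nat -> R) N :
  (forall n, 0 <= a n) -> ex_series a -> Rsum N a <= Series a.
Proof.
move=> H0 Ha.
have Hl := Rsum_lim a Ha.
have /= := is_lim_seq_incr_compare _ _ Hl _ N; apply.
by move=> n /=; have := H0 n; lra.
Qed.

Lemma Series_ge0 (a : nat -> R) : (forall n, 0 <= a n) -> ex_series a -> 0 <= Series a.
Proof. by move=> H0 Ha; have := Rsum_le_Series a 0 H0 Ha. Qed.

Lemma Series_split (a : nat -> R) M :
  ex_series a -> Series a = Rsum M a + Series (fun n => a (M + n)%nat).
Proof.
elim: M => [|M IH] Ha /=; first by rewrite Rplus_0_l; apply: Series_ext.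
rewrite (IH Ha) (Series_incr_1 (fun n => a (M + n)%nat)); last exact: (proj1 (ex_series_incr_n (V := R_NormedModule) a M) Ha).
rewrite Nat.add_0_r -!Rplus_assoc; congr (_ + _).
by apply: Series_ext => n; congr a; lia.
Qed.

Lemma Series_tail_small (a : nat -> R) eps :
  ex_series a -> (forall n, 0 <= a n) -> 0 < eps ->
  exists M, forall N, (M <= N)%nat -> Series (fun n => a (N + n)%nat) < eps.
Proof.
move=> Ha H0 He.
have /is_lim_seq_spec /(_ (mkposreal _ He)) [M HM] := Rsum_lim a Ha.
exists M => N HN; have /= := HM N HN; rewrite (Series_split a N) //.
by move=> /Rabs_def2; lra.
Qed.

Lemma ex_series_le0 (a b : nat -> R) :
  (forall n, 0 <= a n <= b n) -> ex_series b -> ex_series a.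
Proof.
move=> H; apply: ex_series_le => n.
rewrite /norm /= /abs /= Rabs_pos_eq; by have := H n; lra.
Qed.

(** * Limits and absolutely convergent sums in the complex plane *)

Definition limC (u : nat -> C) (l : C) :=
  forall eps : R, 0 < eps ->
    exists N, forall n, (N <= n)%nat -> Cmod (u n - l) < eps.

Definition summ (a : nat -> C) := ex_series (fun n => Cmod (a n)).

(** Built on the total [Series], so that sums can be written without a convergence proof; the value
    is meaningful where both real series converge, which [summ] guarantees. *)
Definition CS (a : nat -> C) : C :=
  (Series (fun n => Re (a n)), Series (fun n => Im (a n))).

Lemma Cmod_Rabs_le (z : C) : Cmod z <= Rabs (Re z) + Rabs (Im z).
Proof.
have -> : z = (RtoC (Re z) + Ci * RtoC (Im z))%C.
  by case: z => x y; rewrite /Ci /Cplus /Cmult /RtoC /Re /Im /=; congr pair; ring.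
apply: Rle_trans (Cmod_triangle _ _) _.
rewrite Cmod_mult Cmod_Ci !Cmod_R.
case: z => x y; rewrite /Ci /Cplus /Cmult /RtoC /Re /Im /=.
by rewrite !Rmult_0_l !Rmult_0_r !Rmult_1_l; apply: Req_le; congr (Rabs _ + Rabs _); ring.
Qed.

Lemma im_le_Cmod (z : C) : Rabs (Im z) <= Cmod z.
Proof. by have := Rmax_Cmod z; have := Rmax_r (Rabs (fst z)) (Rabs (snd z)); rewrite /Im; lra. Qed.

Lemma summ_Re a : summ a -> ex_series (fun n => Re (a n)).
Proof.
move=> H; apply: ex_series_le H => n.
by rewrite /norm /= /abs /=; apply: re_le_Cmod.
Qed.

Lemma summ_Im a : summ a -> ex_series (fun n => Im (a n)).
Proof.
move=> H; apply: ex_series_le H => n.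
by rewrite /norm /= /abs /=; apply: im_le_Cmod.
Qed.

Lemma summ_le a (b : nat -> R) : (forall n, Cmod (a n) <= b n) -> ex_series b -> summ a.
Proof. by move=> H; apply: ex_series_le0 => n; split; [apply: Cmod_ge_0 | apply: H]. Qed.

Lemma summ_ext a b : (forall n, a n = b n) -> summ a -> summ b.
Proof. by move=> H; apply: ex_series_ext => n; rewrite H. Qed.

Lemma CS_ext a b : (forall n, a n = b n) -> CS a = CS b.
Proof. by move=> H; rewrite /CS; congr pair; apply: Series_ext => n; rewrite H. Qed.

Lemma summ_plus a b : summ a -> summ b -> summ (fun n => a n + b n)%C.
Proof.
move=> Ha Hb; apply: (summ_le _ (fun n => Cmod (a n) + Cmod (b n))).
- by move=> n; apply: Cmod_triangle.
- exact: (ex_series_plus (V := R_NormedModule)) Ha Hb.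
Qed.

Lemma summ_scal k a : summ a -> summ (fun n => k * a n)%C.
Proof.
move=> Ha; apply: (ex_series_ext (fun n => Cmod k * Cmod (a n))).
- by move=> n; rewrite Cmod_mult.
- exact: (ex_series_scal_l (V := R_NormedModule)) Ha.
Qed.

Lemma CS_plus a b : summ a -> summ b -> CS (fun n => a n + b n)%C = (CS a + CS b)%C.
Proof.
move=> Ha Hb; rewrite /CS /Cplus /=; congr pair.
- by rewrite -Series_plus; [apply: Series_ext | apply: summ_Re | apply: summ_Re].
- by rewrite -Series_plus; [apply: Series_ext | apply: summ_Im | apply: summ_Im].
Qed.

Lemma CS_scal k a : summ a -> CS (fun n => k * a n)%C = (k * CS a)%C.
Proof.
move=> Ha; rewrite /CS /Cmult /=; congr pair.
- rewrite -!Series_scal_l -Series_minus; last 2 first.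
  + exact: (ex_series_scal_l (V := R_NormedModule)) (summ_Re _ Ha).
  + exact: (ex_series_scal_l (V := R_NormedModule)) (summ_Im _ Ha).
  by apply: Series_ext.
- rewrite -!Series_scal_l -Series_plus; last 2 first.
  + exact: (ex_series_scal_l (V := R_NormedModule)) (summ_Im _ Ha).
  + exact: (ex_series_scal_l (V := R_NormedModule)) (summ_Re _ Ha).
  by apply: Series_ext.
Qed.

Lemma CS_opp a : summ a -> CS (fun n => - a n)%C = (- CS a)%C.
Proof.
move=> Ha; rewrite (CS_ext _ (fun n => (-(1)) * a n)%C); last by move=> n; ring.
by rewrite CS_scal //; ring.
Qed.

Lemma summ_opp a : summ a -> summ (fun n => - a n)%C.
Proof. by apply: ex_series_ext => n; rewrite Cmod_opp. Qed.

Lemma CS_minus a b : summ a -> summ b -> CS (fun n => a n - b n)%C = (CS a - CS b)%C.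
Proof. by move=> Ha Hb; rewrite /Cminus CS_plus ?CS_opp //; apply: summ_opp. Qed.

Lemma summ_minus a b : summ a -> summ b -> summ (fun n => a n - b n)%C.
Proof. by move=> Ha Hb; apply: summ_plus => //; apply: summ_opp. Qed.

Lemma CS_incr a : summ a -> CS a = (a 0%nat + CS (fun n => a (S n)))%C.
Proof.
move=> Ha; rewrite /CS /Cplus /= (Series_incr_1 (fun n => Re (a n))) ?(Series_incr_1 (fun n => Im (a n))) //.
- exact: summ_Im.
- exact: summ_Re.
Qed.

Lemma summ_incr a : summ a <-> summ (fun n => a (S n)).
Proof. exact: (ex_series_incr_1 (V := R_NormedModule) (fun n => Cmod (a n))). Qed.

Lemma summ_shift a M : summ a -> summ (fun n => a (M + n)%nat).
Proof. move=> H. exact: (proj1 (ex_series_incr_n (V := R_NormedModule) (fun n => Cmod (a n)) M) H). Qed.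

Lemma CS_split a M : summ a -> CS a = (Csum M a + CS (fun n => a (M + n)%nat))%C.
Proof.
elim: M => [|M IH] Ha /=; first by rewrite Cplus_0_l; apply: CS_ext.
rewrite (IH Ha) (CS_incr (fun n => a (M + n)%nat)); last exact: summ_shift.
rewrite Nat.add_0_r Cplus_assoc; congr (_ + _)%C.
by apply: CS_ext => n; congr a; lia.
Qed.

(** The factor 2 comes from treating real and imaginary parts separately. It is good enough for
    [CS_lim], after which [CS_Cmod_le] recovers the constant 1 by passing to the limit in the
    triangle inequality. *)
Lemma CS_Cmod_2le a : summ a -> Cmod (CS a) <= 2 * Series (fun n => Cmod (a n)).
Proof.
move=> Ha; apply: Rle_trans (Cmod_Rabs_le _) _; rewrite /CS /=.
have H1 : Rabs (Series (fun n => Re (a n))) <= Series (fun n => Cmod (a n)).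
  apply: Rle_trans (Series_Rabs _ _) _.
  - by apply: ex_series_le0 Ha => n; split; [apply: Rabs_pos | apply: re_le_Cmod].
  - by apply: Series_le Ha => n; split; [apply: Rabs_pos | apply: re_le_Cmod].
have H2 : Rabs (Series (fun n => Im (a n))) <= Series (fun n => Cmod (a n)).
  apply: Rle_trans (Series_Rabs _ _) _.
  - by apply: ex_series_le0 Ha => n; split; [apply: Rabs_pos | apply: im_le_Cmod].
  - by apply: Series_le Ha => n; split; [apply: Rabs_pos | apply: im_le_Cmod].
lra.
Qed.

Lemma CS_lim a : summ a -> limC (fun N => Csum N a) (CS a).
Proof.
move=> Ha eps He.
have [M HM] := Series_tail_small _ (eps/2) Ha (fun n => Cmod_ge_0 _) ltac:(lra).
exists M => n Hn; rewrite (CS_split a n Ha).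
replace (Csum n a - (Csum n a + CS (fun k => a (n + k)%nat)))%C
  with (- CS (fun k => a (n + k)%nat))%C by ring.
rewrite Cmod_opp; have := CS_Cmod_2le _ (summ_shift _ n Ha); have := HM n Hn; lra.
Qed.

Lemma Csum_Cmod N a : Cmod (Csum N a) <= Rsum N (fun n => Cmod (a n)).
Proof.
elim: N => [|N IH] /=; first by rewrite Cmod_0; lra.
apply: Rle_trans (Cmod_triangle _ _) _; lra.
Qed.

Lemma limC_unique u l l' : limC u l -> limC u l' -> l = l'.
Proof.
move=> H H'; apply: NNPP => Hne.
have Hp : 0 < Cmod (l - l').
  apply/Cmod_gt_0 => E; apply: Hne.
  by rewrite -(Cplus_0_r l') -E; ring.
have [N HN] := H (Cmod (l - l') / 2) ltac:(lra).
have [N' HN'] := H' (Cmod (l - l') / 2) ltac:(lra).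
have h := HN (N + N')%nat ltac:(lia); have h' := HN' (N + N')%nat ltac:(lia).
have := Cmod_triangle (u (N + N')%nat - l') (- (u (N + N')%nat - l)).
rewrite Cmod_opp.
replace (u (N + N')%nat - l' + - (u (N + N')%nat - l))%C with (l - l')%C by ring.
lra.
Qed.

Lemma limC_le u l B : limC u l -> (forall n, Cmod (u n) <= B) -> Cmod l <= B.
Proof.
move=> H HB; apply: Rnot_lt_le => Hlt.
have [N HN] := H (Cmod l - B) ltac:(lra).
have h := HN N ltac:(lia).
have := Cmod_triangle (u N) (- (u N - l)); rewrite Cmod_opp.
replace (u N + - (u N - l))%C with l by ring.
have := HB N; lra.
Qed.

Lemma CS_Cmod_le a : summ a -> Cmod (CS a) <= Series (fun n => Cmod (a n)).
Proof.
move=> Ha; apply: limC_le (CS_lim a Ha) _ => n.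
apply: Rle_trans (Csum_Cmod _ _) _.
apply: Rsum_le_Series => //; move=> k; exact: Cmod_ge_0.
Qed.

Lemma CS_bound a (b : nat -> R) :
  (forall n, Cmod (a n) <= b n) -> ex_series b -> Cmod (CS a) <= Series b.
Proof.
move=> H Hb; apply: Rle_trans (CS_Cmod_le _ (summ_le _ _ H Hb)) _.
by apply: Series_le Hb => n; split; [apply: Cmod_ge_0 | apply: H].
Qed.

Lemma limC_const l : limC (fun _ => l) l.
Proof. by move=> eps He; exists 0%nat => n _; rewrite /Cminus Cplus_opp_r Cmod_0. Qed.

Lemma limC_ext u v l : (forall n, u n = v n) -> limC u l -> limC v l.
Proof. by move=> H Hu eps He; have [N HN] := Hu eps He; exists N => n Hn; rewrite -H; apply: HN. Qed.

Lemma limC_eventually u v l N0 :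
  (forall n, (N0 <= n)%nat -> u n = v n) -> limC u l -> limC v l.
Proof.
move=> H Hu eps He; have [N HN] := Hu eps He; exists (N + N0)%nat => n Hn.
by rewrite -H; [apply: HN|]; lia.
Qed.

Lemma limC_plus u v l l' : limC u l -> limC v l' -> limC (fun n => u n + v n)%C (l + l')%C.
Proof.
move=> Hu Hv eps He.
have [N HN] := Hu (eps / 2) ltac:(lra); have [M HM] := Hv (eps / 2) ltac:(lra).
exists (N + M)%nat => n Hn.
have h := HN n ltac:(lia); have h' := HM n ltac:(lia).
replace (u n + v n - (l + l'))%C with ((u n - l) + (v n - l'))%C by ring.
have := Cmod_triangle (u n - l) (v n - l'); lra.
Qed.

Lemma limC_scal k u l : limC u l -> limC (fun n => k * u n)%C (k * l)%C.
Proof.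
move=> Hu eps He.
have Hk := Cmod_ge_0 k.
have [N HN] := Hu (eps / (Cmod k + 1)) ltac:(apply: Rdiv_lt_0_compat; lra).
exists N => n Hn; have h := HN n Hn.
replace (k * u n - k * l)%C with (k * (u n - l))%C by ring.
rewrite Cmod_mult.
have h0 := Cmod_ge_0 (u n - l).
apply: (Rle_lt_trans _ ((Cmod k + 1) * Cmod (u n - l))); first by nra.
apply: (Rlt_le_trans _ ((Cmod k + 1) * (eps / (Cmod k + 1)))); first by apply: Rmult_lt_compat_l; lra.
by apply: Req_le; field; lra.
Qed.

Lemma limC_bounded (u : nat -> C) l : limC u l -> exists B, forall n, Cmod (u n) <= B.
Proof.
move=> /(_ 1 Rlt_0_1) [N HN].
exists (Rsum N (fun n => Cmod (u n)) + (Cmod l + 1)) => n.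
have H0 : forall n, 0 <= Cmod (u n) by move=> k; apply: Cmod_ge_0.
have [Hn|Hn] : (n < N)%nat \/ (N <= n)%nat by lia.
- have := Rsum_term_le N (fun n => Cmod (u n)) n (fun k _ => H0 k) Hn; have := Cmod_ge_0 l; lra.
- have := HN n Hn; have := Rsum_ge0 N _ (fun k _ => H0 k).
  have := Cmod_triangle (u n - l) l; replace (u n - l + l)%C with (u n) by ring; lra.
Qed.

Lemma Rsum_small N (u : nat -> nat -> R) eps :
  0 < eps ->
  (forall k, (k < N)%nat -> forall e, 0 < e -> exists M, forall n, (M <= n)%nat -> u n k < e) ->
  exists M, forall n, (M <= n)%nat -> Rsum N (u n) < eps.
Proof.
move=> He H; elim: N eps He H => [|N IH] eps He H /=; first by exists 0%nat.
have [M HM] := IH (eps/2) ltac:(lra) (fun k Hk => H k ltac:(lia)).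
have [M' HM'] := H N ltac:(lia) (eps/2) ltac:(lra).
exists (M + M')%nat => n Hn.
have := HM n ltac:(lia); have := HM' n ltac:(lia); lra.
Qed.

(** Dominated convergence for series. The first [M] terms converge one by one, and the rest is at
    most twice the tail of [b], which explains the choice of [eps/4]. *)
Lemma tannery (a : nat -> nat -> C) (l : nat -> C) (b : nat -> R) :
  ex_series b -> (forall N m, Cmod (a N m) <= b m) ->
  (forall m, limC (fun N => a N m) (l m)) ->
  limC (fun N => CS (a N)) (CS l).
Proof.
move=> Hb Hab Hl eps He.
have Hlb m : Cmod (l m) <= b m by apply: limC_le (Hl m) _.
have Hb0 m : 0 <= b m by apply: Rle_trans (Cmod_ge_0 _) (Hlb m).
have [M HM] := Series_tail_small b (eps/4) Hb Hb0 ltac:(lra).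
have [N0 HN0] := Rsum_small M (fun N m => Cmod (a N m - l m)) (eps/2) ltac:(lra)
  (fun k _ e He' => Hl k e He').
exists N0 => N HN.
have Hd m : Cmod (a N m - l m) <= 2 * b m.
  have := Cmod_triangle (a N m) (- l m); rewrite Cmod_opp.
  have := Hab N m; have := Hlb m; rewrite /Cminus; lra.
have H2b : ex_series (fun m => 2 * b m) by apply: (ex_series_scal_l (V := R_NormedModule)).
rewrite -CS_minus; [|exact: summ_le (Hab N) Hb|exact: summ_le Hlb Hb].
apply: Rle_lt_trans (CS_Cmod_le _ (summ_le _ _ Hd H2b)) _.
rewrite (Series_split _ M); last exact: (summ_le _ _ Hd H2b).
have h1 := HN0 N HN.
have h2 : Series (fun n => Cmod (a N (M + n)%nat - l (M + n)%nat)) <= 2 * Series (fun n => b (M + n)%nat).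
  rewrite -Series_scal_l; apply: Series_le.
  - by move=> n; split; [apply: Cmod_ge_0 | apply: Hd].
  - apply: (ex_series_scal_l (V := R_NormedModule)).
    exact: (proj1 (ex_series_incr_n (V := R_NormedModule) b M) Hb).
have := HM M (Nat.le_refl _); lra.
Qed.

Lemma ex_series_0 : ex_series (fun _ : nat => 0).
Proof.
apply: (ex_series_bound _ 0) => [n|N]; first by lra.
by elim: N => [|N IH] /=; lra.
Qed.

Lemma ex_series_Rsum K (a : nat -> nat -> R) :
  (forall k, (k < K)%nat -> ex_series (a k)) -> ex_series (fun n => Rsum K (fun k => a k n)).
Proof.
elim: K => [|K IH] H /=.
  exact: ex_series_0.
apply: (ex_series_plus (V := R_NormedModule)); last by apply: H; lia.
by apply: IH => k Hk; apply: H; lia.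
Qed.

Lemma Series_Rsum K (a : nat -> nat -> R) :
  (forall k, (k < K)%nat -> ex_series (a k)) ->
  Series (fun n => Rsum K (fun k => a k n)) = Rsum K (fun k => Series (a k)).
Proof.
elim: K => [|K IH] H /=.
  rewrite (Series_ext _ (fun n => 0 * 0)); last by move=> n; ring.
  by rewrite Series_scal_l; ring.
rewrite Series_plus; last 2 first.
- by apply: ex_series_Rsum => k Hk; apply: H; lia.
- by apply: H; lia.
by rewrite IH // => k Hk; apply: H; lia.
Qed.

Lemma Series_eq_fin (a : nat -> R) N :
  (forall n, (N <= n)%nat -> a n = 0) -> ex_series a /\ Series a = Rsum N a.
Proof.
move=> H.
have Ht : ex_series (fun n => a (N + n)%nat).
  by apply: (ex_series_ext (fun _ => 0)) ex_series_0 => n; rewrite H //; lia.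
have Ha : ex_series a by exact: (proj2 (ex_series_incr_n (V := R_NormedModule) a N) Ht).
split=> //; rewrite (Series_split a N) //.
rewrite (Series_ext _ (fun n => 0 * 0)); last by move=> n; rewrite H; [ring|lia].
by rewrite Series_scal_l; ring.
Qed.

Lemma CS_eq_fin (a : nat -> C) N :
  (forall n, (N <= n)%nat -> a n = RtoC 0) -> summ a /\ CS a = Csum N a.
Proof.
move=> H.
have Ha : summ a by apply: (proj1 (Series_eq_fin _ N _)) => n Hn; rewrite H // Cmod_0.
split=> //; rewrite (CS_split a N Ha).
rewrite (CS_ext _ (fun n => 0 * a (N + n)%nat)%C); last by move=> n; rewrite H; [ring|lia].
by rewrite CS_scal; [ring | apply: summ_shift].
Qed.

Lemma tonelli (a : nat -> nat -> R) :
  (forall i j, 0 <= a i j) -> (forall i, ex_series (a i)) ->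
  ex_series (fun i => Series (a i)) ->
  (forall j, ex_series (fun i => a i j)) /\ ex_series (fun j => Series (fun i => a i j)).
Proof.
move=> H0 Hi HS.
have Hj j : ex_series (fun i => a i j).
  apply: ex_series_le0 HS => i; split; first exact: H0.
  apply: Rle_trans (Rsum_le_Series (a i) (S j) (H0 i) (Hi i)).
  by apply: (Rsum_term_le (S j) (a i) j) => //; lia.
split=> //; apply: (ex_series_bound _ (Series (fun i => Series (a i)))).
- by move=> j; apply: Series_ge0.
- move=> N; rewrite -(Series_Rsum N (fun j i => a i j)) //.
  apply: Series_le HS => i; split; first by apply: Rsum_ge0.
  exact: Rsum_le_Series.
Qed.

Lemma Csum_ext N a b : (forall n, (n < N)%nat -> a n = b n) -> Csum N a = Csum N b.
Proof.
elim: N => [|N IH] //= H.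
rewrite IH; last by move=> n Hn; apply: H; lia.
by rewrite (H N) //; lia.
Qed.

Lemma Csum_plus N a b : Csum N (fun n => a n + b n)%C = (Csum N a + Csum N b)%C.
Proof. by elim: N => [|N IH] /=; [ring | rewrite IH; ring]. Qed.

Lemma Csum_scal N k a : Csum N (fun n => k * a n)%C = (k * Csum N a)%C.
Proof. by elim: N => [|N IH] /=; [ring | rewrite IH; ring]. Qed.

Lemma Csum_zero N a : (forall n, (n < N)%nat -> a n = RtoC 0) -> Csum N a = RtoC 0.
Proof.
elim: N => [|N IH] //= H; rewrite IH ?H; [ring|lia|].
by move=> n Hn; apply: H; lia.
Qed.

Lemma Csum_incr N a : Csum (S N) a = (a 0%nat + Csum N (fun n => a (S n)))%C.
Proof. by elim: N => [|N IH]; [move=> /=; ring | move: IH => /= ->; ring]. Qed.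

Lemma CS_Csum K (a : nat -> nat -> C) :
  (forall k, (k < K)%nat -> summ (a k)) ->
  summ (fun n => Csum K (fun k => a k n)) /\
  CS (fun n => Csum K (fun k => a k n)) = Csum K (fun k => CS (a k)).
Proof.
elim: K => [|K IH] H /=; first by have := CS_eq_fin (fun _ => RtoC 0) 0 (fun n _ => eq_refl).
have [H1 H2] := IH (fun k Hk => H k ltac:(lia)).
split; first by apply: summ_plus => //; apply: H; lia.
by rewrite CS_plus ?H2 //; apply: H; lia.
Qed.

(** The outer sum is a limit of finite sums, which commute with [CS]; [tannery] applies with the
    column sums of the moduli, summable by [tonelli], as dominating series. *)
Lemma fubini (a : nat -> nat -> C) :
  (forall i, summ (a i)) -> ex_series (fun i => Series (fun j => Cmod (a i j))) ->
  (forall j, summ (fun i => a i j)) /\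
  ex_series (fun j => Series (fun i => Cmod (a i j))) /\
  summ (fun i => CS (a i)) /\
  CS (fun i => CS (a i)) = CS (fun j => CS (fun i => a i j)).
Proof.
move=> Hi HS.
have [Hj HSj] := tonelli (fun i j => Cmod (a i j)) (fun _ _ => Cmod_ge_0 _) Hi HS.
have Hs : summ (fun i => CS (a i)) by apply: summ_le HS => i; apply: CS_Cmod_le.
split=> //; split=> //; split=> //; apply: limC_unique (CS_lim _ Hs) _.
apply: (limC_ext (fun N => CS (fun j => Csum N (fun i => a i j)))).
  by move=> N; rewrite (proj2 (CS_Csum N a (fun k _ => Hi k))).
apply: (tannery _ _ _ HSj) => [N j|j]; last exact: (CS_lim (fun i => a i j) (Hj j)).
apply: Rle_trans (Csum_Cmod _ _) _.
apply: Rsum_le_Series; [move=> ?; exact: Cmod_ge_0 | exact: Hj].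
Qed.

(** * Coefficients of the canonical products *)

(* [Pc l mu N] and [Gc r mu N] are the coefficient sequences of the partial products of
   [(1 - l_n w)^mu_n] and [(1 + r_n w)^mu_n], [Fi] and [Gi] those of the infinite products;
   [mu] is a free parameter, so that zeros can be added and removed. *)
Definition lin (l : C) (a : nat -> C) (m : nat) : C :=
  match m with O => a O | S k => (a (S k) - l * a k)%C end.

Definition glin (r : R) (a : nat -> R) (m : nat) : R :=
  match m with O => a O | S k => a (S k) + r * a k end.

Definition delta0 (m : nat) : R := match m with O => 1 | S _ => 0 end.

Fixpoint Pc (l : nat -> C) (mu : nat -> nat) (N : nat) : nat -> C :=
  match N with
  | O => fun m => RtoC (delta0 m)
  | S N => Nat.iter (mu N) (lin (l N)) (Pc l mu N)
  end.

Fixpoint Gc (r : nat -> R) (mu : nat -> nat) (N : nat) : nat -> R :=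
  match N with
  | O => delta0
  | S N => Nat.iter (mu N) (glin (r N)) (Gc r mu N)
  end.

Fixpoint Gev (r : nat -> R) (mu : nat -> nat) (N : nat) (x : R) : R :=
  match N with O => 1 | S N => Gev r mu N x * (1 + r N * x) ^ (mu N) end.

Definition bump (mu : nat -> nat) (k n : nat) : nat :=
  if Nat.eqb n k then S (mu n) else mu n.

Lemma Csum_telescope (u : nat -> C) N : (u 0%nat + Csum N (fun n => u (S n) - u n))%C = u N.
Proof. by elim: N => [|N IH] /=; [ring | rewrite Cplus_assoc IH; ring]. Qed.

Lemma Rsum_telescope (u : nat -> R) N : Rsum N (fun n => u (S n) - u n) = u N - u 0%nat.
Proof. by elim: N => [|N IH] /=; [ring | rewrite IH; ring]. Qed.

Lemma exp_mono x y : x <= y -> exp x <= exp y.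
Proof. by case=> [H|->]; [apply: Rlt_le; apply: exp_increasing | apply: Rle_refl]. Qed.

Lemma lin_comm l k a : lin l (lin k a) = lin k (lin l a).
Proof.
apply: functional_extensionality => -[|[|m]] //=; ring.
Qed.

Lemma iter_lin_comm l k n a : lin k (Nat.iter n (lin l) a) = Nat.iter n (lin l) (lin k a).
Proof. by elim: n => [|n IH] //=; rewrite lin_comm IH. Qed.

(** The factors [lin] commute, so the additional factor, inserted at stage [k] of the product, can
    be pulled to the front. *)
Lemma Pc_bump l mu k N : (k < N)%nat -> Pc l (bump mu k) N = lin (l k) (Pc l mu N).
Proof.
elim: N => [|N IH] Hk /=; first by lia.
rewrite {1}/bump; case: Nat.eqb_spec => [->|Hne].
- rewrite /= iter_lin_comm -iter_lin_comm; congr (lin _ (Nat.iter _ _ _)).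
  suff : forall M, (M <= k)%nat -> Pc l (bump mu k) M = Pc l mu M by apply.
  elim=> [|M IHM] HM //=; rewrite IHM; last by lia.
  by rewrite /bump; case: Nat.eqb_spec => //; lia.
- by rewrite IH ?iter_lin_comm //; lia.
Qed.

Lemma glin_ge0 r a m : 0 <= r -> (forall n, 0 <= a n) -> 0 <= glin r a m.
Proof. by move=> Hr H; case: m => [|m] //=; have := H (S m); have := H m; nra. Qed.

Lemma iter_glin_ge0 r n a m : 0 <= r -> (forall n, 0 <= a n) -> 0 <= Nat.iter n (glin r) a m.
Proof. by move=> Hr H; elim: n m => [|n IH] m //=; apply: glin_ge0. Qed.

Lemma delta0_ge0 m : 0 <= delta0 m.
Proof. by case: m => [|m] /=; lra. Qed.

Lemma Gc_ge0 r mu N m : (forall n, 0 <= r n) -> 0 <= Gc r mu N m.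
Proof. by move=> Hr; elim: N m => [|N IH] m /=; [apply: delta0_ge0 | apply: iter_glin_ge0]. Qed.

Lemma lin_bound l a b m :
  (forall n, Cmod (a n) <= b n) -> Cmod (lin l a m) <= glin (Cmod l) b m.
Proof.
move=> H; case: m => [|m] //=.
apply: Rle_trans (Cmod_triangle _ _) _; rewrite Cmod_opp Cmod_mult.
by have := H (S m); have := H m; have := Cmod_ge_0 l; nra.
Qed.

Lemma iter_lin_bound l n a b m :
  (forall m, Cmod (a m) <= b m) -> Cmod (Nat.iter n (lin l) a m) <= Nat.iter n (glin (Cmod l)) b m.
Proof. by move=> H; elim: n m => [|n IH] m //=; apply: lin_bound. Qed.

Lemma delta0_Cmod m : Cmod (RtoC (delta0 m)) <= delta0 m.
Proof. by rewrite Cmod_R Rabs_pos_eq; [lra | apply: delta0_ge0]. Qed.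

Lemma Pc_le_Gc l mu N m : Cmod (Pc l mu N m) <= Gc (fun n => Cmod (l n)) mu N m.
Proof. by elim: N m => [|N IH] m /=; [apply: delta0_Cmod | apply: iter_lin_bound]. Qed.

Lemma iter_glin_incr r n a m : 0 <= r -> (forall n, 0 <= a n) -> a m <= Nat.iter n (glin r) a m.
Proof.
move=> Hr H; elim: n => [|n IH] /=; first by lra.
apply: Rle_trans IH _.
case: m => [|m] /=; first by lra.
by have := iter_glin_ge0 r n a m Hr H; nra.
Qed.

(** Not only the coefficients but also their increments are dominated by those of the majorant. The
    latter telescope below a finite limit, which is what gives convergence in [Fi_lim]. *)
Lemma iter_lin_incr l n a b m :
  (forall m, Cmod (a m) <= b m) ->
  Cmod (Nat.iter n (lin l) a m - a m) <= Nat.iter n (glin (Cmod l)) b m - b m.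
Proof.
move=> H; elim: n => [|n IH] /=; first by rewrite /Cminus Cplus_opp_r Cmod_0; lra.
have Hs : Cmod (lin l (Nat.iter n (lin l) a) m - Nat.iter n (lin l) a m)
   <= glin (Cmod l) (Nat.iter n (glin (Cmod l)) b) m - Nat.iter n (glin (Cmod l)) b m.
  case: m {IH} => [|m] /=; first by rewrite /Cminus Cplus_opp_r Cmod_0; lra.
  set u := Nat.iter n _ _; set v := Nat.iter n _ _.
  replace (u (S m) - l * u m - u (S m))%C with (- (l * u m))%C by ring.
  rewrite Cmod_opp Cmod_mult.
  have := iter_lin_bound l n a b m H; rewrite -/u -/v; have := Cmod_ge_0 l; nra.
have := Cmod_triangle (lin l (Nat.iter n (lin l) a) m - Nat.iter n (lin l) a m)
   (Nat.iter n (lin l) a m - a m).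
set x := lin _ _ _; set y := Nat.iter _ _ _ _.
replace (x - y + (y - a m))%C with (x - a m)%C by ring.
move: Hs IH; rewrite -/x -/y; lra.
Qed.

Lemma Pc_incr l mu N m :
  Cmod (Pc l mu (S N) m - Pc l mu N m)
  <= Gc (fun n => Cmod (l n)) mu (S N) m - Gc (fun n => Cmod (l n)) mu N m.
Proof. by apply: iter_lin_incr => k; apply: Pc_le_Gc. Qed.

Lemma Gc_incr r mu N m : (forall n, 0 <= r n) -> Gc r mu N m <= Gc r mu (S N) m.
Proof. by move=> Hr; apply: iter_glin_incr => // n; apply: Gc_ge0. Qed.

Lemma glin_mono r a b m :
  0 <= r -> (forall n, a n <= b n) -> glin r a m <= glin r b m.
Proof. by move=> Hr H; case: m => [|m] //=; have := H (S m); have := H m; nra. Qed.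

Lemma iter_glin_mono r k n a b m :
  0 <= r -> (forall n, 0 <= a n <= b n) -> (k <= n)%nat ->
  Nat.iter k (glin r) a m <= Nat.iter n (glin r) b m.
Proof.
move=> Hr H; elim: n m => [|n IH] m Hk.
- have -> : k = 0%nat by lia. by have /= := H m; lra.
- have [->|Hlt] : k = S n \/ (k <= n)%nat by lia.
  + have HH j : Nat.iter n (glin r) a j <= Nat.iter n (glin r) b j.
      elim: n j {IH Hk} => [|n IH] j /=; first by have := H j; lra.
      exact: glin_mono.
    exact: glin_mono.
  + apply: Rle_trans (IH m Hlt) _.
    apply: (iter_glin_incr r 1 (Nat.iter n (glin r) b) m Hr) => j.
    by apply: iter_glin_ge0 => // i; have := H i; lra.
Qed.

Lemma Gc_mono r mu mu' N m :
  (forall n, 0 <= r n) -> (forall n, (mu' n <= mu n)%nat) -> Gc r mu' N m <= Gc r mu N m.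
Proof.
move=> Hr Hm; elim: N m => [|N IH] m /=; first by lra.
by apply: iter_glin_mono => // n; split => //; apply: Gc_ge0.
Qed.

Lemma Rsum_glin r a x M B :
  0 <= r -> 0 <= x -> (forall n, 0 <= a n) ->
  (forall M, Rsum M (fun m => a m * x ^ m) <= B) ->
  Rsum M (fun m => glin r a m * x ^ m) <= B * (1 + r * x).
Proof.
move=> Hr Hx Ha HB.
have H0 m : 0 <= a m * x ^ m by apply: Rmult_le_pos => //; apply: pow_le.
have HB0 : 0 <= B by have := HB 0%nat.
have Hrx : 0 <= r * x by nra.
case: M => [|M] /=; first by nra.
have -> : Rsum M (fun m => glin r a m * x ^ m) + glin r a M * x ^ M =
  Rsum (S M) (fun m => a m * x ^ m) + r * x * Rsum M (fun m => a m * x ^ m).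
  elim: M => [|M IH] /=; first by ring.
  by rewrite IH /=; ring.
have := HB (S M); have := HB M; have : 0 <= r * x by nra.
have := Rsum_ge0 M _ (fun m _ => H0 m); nra.
Qed.

(** The coefficients are nonnegative, so truncation at degree [M] can only decrease the value of the
    product at [x]. *)
Lemma Rsum_Gc r mu N x M :
  (forall n, 0 <= r n) -> 0 <= x ->
  Rsum M (fun m => Gc r mu N m * x ^ m) <= Gev r mu N x.
Proof.
move=> Hr Hx; elim: N M => [|N IH] M /=.
  case: M => [|M] /=; first by lra.
  suff : Rsum M (fun m => delta0 m * x ^ m) + delta0 M * x ^ M = 1 by lra.
  by elim: M => [|M IH] /=; [ring | rewrite IH; ring].
elim: (mu N) M => [|k IHk] M /=; first by rewrite Rmult_1_r; apply: IH.
apply: Rle_trans (Rsum_glin (r N) _ x M _ (Hr N) Hx _ IHk) _; last by apply: Req_le; ring.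
by move=> n; apply: iter_glin_ge0 => // j; apply: Gc_ge0.
Qed.

Lemma one_plus_pow_le_exp y k : 0 <= y -> (1 + y) ^ k <= exp (INR k * y).
Proof.
move=> Hy; elim: k => [|k IH]; first by rewrite Rmult_0_l exp_0 /=; lra.
rewrite S_INR Rmult_plus_distr_r Rmult_1_l exp_plus /=.
have : 1 + y <= exp y by apply: exp_ineq1_le.
have := exp_pos (INR k * y); have : 0 <= (1 + y) ^ k by apply: pow_le; lra.
nra.
Qed.

Lemma Gev_ge0 r mu N x : (forall n, 0 <= r n) -> 0 <= x -> 0 <= Gev r mu N x.
Proof.
move=> Hr Hx; elim: N => [|N IH] /=; first by lra.
by apply: Rmult_le_pos => //; apply: pow_le; have := Hr N; nra.
Qed.

Lemma Gev_exp r mu N x : (forall n, 0 <= r n) -> 0 <= x ->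
  Gev r mu N x <= exp (x * Rsum N (fun n => INR (mu n) * r n)).
Proof.
move=> Hr Hx; elim: N => [|N IH] /=; first by rewrite Rmult_0_r exp_0; lra.
rewrite Rmult_plus_distr_l exp_plus.
apply: Rmult_le_compat => //; first by apply: Gev_ge0.
- by apply: pow_le; have := Hr N; nra.
- apply: Rle_trans (one_plus_pow_le_exp _ _ _) _; first by have := Hr N; nra.
  by apply: Req_le; congr exp; ring.
Qed.

Lemma one_plus_pow_subexp c k eps : 0 <= c -> 0 < eps ->
  exists M, 0 <= M /\ forall x, 0 <= x -> (1 + c * x) ^ k <= M * exp (eps * x).
Proof.
move=> Hc; elim: k eps => [|k IH] eps He.
  exists 1; split; first by lra.
  by move=> x Hx /=; rewrite Rmult_1_l -exp_0; apply: exp_mono; nra.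
have [M [HM0 HM]] := IH (eps / 2) ltac:(lra).
exists (M * (1 + 2 * c / eps)).
have Hq : 0 <= 2 * c / eps.
  by apply: Rmult_le_pos; [lra | apply: Rlt_le; apply: Rinv_0_lt_compat].
split; first by nra.
move=> x Hx /=.
have h1 := HM x Hx.
have h2 : 1 + c * x <= (1 + 2 * c / eps) * exp (eps / 2 * x).
  have h3 : 1 + eps / 2 * x <= exp (eps / 2 * x) by apply: exp_ineq1_le.
  apply: (Rle_trans _ ((1 + 2 * c / eps) * (1 + eps / 2 * x))); last by apply: Rmult_le_compat_l; lra.
  have -> : (1 + 2 * c / eps) * (1 + eps / 2 * x) = 1 + c * x + 2 * c / eps + eps / 2 * x by field; lra.
  nra.
have -> : eps * x = eps / 2 * x + eps / 2 * x by field.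
rewrite exp_plus.
have h4 : 0 <= (1 + c * x) ^ k by apply: pow_le; nra.
have h5 : 0 <= 1 + c * x by nra.
have -> : M * (1 + 2 * c / eps) * (exp (eps / 2 * x) * exp (eps / 2 * x)) =
   ((1 + 2 * c / eps) * exp (eps / 2 * x)) * (M * exp (eps / 2 * x)) by ring.
by apply: Rmult_le_compat.
Qed.

Lemma Gev_subexp r mu N eps : (forall n, 0 <= r n) -> 0 < eps ->
  exists M, 0 <= M /\ forall x, 0 <= x -> Gev r mu N x <= M * exp (eps * x).
Proof.
move=> Hr; elim: N eps => [|N IH] eps He /=.
  exists 1; split; first by lra.
  by move=> x Hx; rewrite Rmult_1_l -exp_0; apply: exp_mono; nra.
have [M [HM0 HM]] := IH (eps / 2) ltac:(lra).
have [M' [HM0' HM']] := one_plus_pow_subexp (r N) (mu N) (eps / 2) (Hr N) ltac:(lra).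
exists (M * M'); split; first by nra.
move=> x Hx.
have -> : eps * x = eps / 2 * x + eps / 2 * x by field.
rewrite exp_plus.
have -> : M * M' * (exp (eps / 2 * x) * exp (eps / 2 * x)) =
   (M * exp (eps / 2 * x)) * (M' * exp (eps / 2 * x)) by ring.
apply: Rmult_le_compat; [by apply: Gev_ge0| |by apply: HM|by apply: HM'].
by apply: pow_le; have := Hr N; nra.
Qed.

Lemma Gev_split r mu N K x : (forall n, 0 <= r n) -> 0 <= x -> (N <= K)%nat ->
  Gev r mu K x <= Gev r mu N x *
    exp (x * (Rsum K (fun n => INR (mu n) * r n) - Rsum N (fun n => INR (mu n) * r n))).
Proof.
move=> Hr Hx; elim=> [|m _ IH] /=; first by rewrite Rminus_diag Rmult_0_r exp_0; lra.
set S1 := Rsum m _; set S0 := Rsum N _.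
have -> : x * (S1 + INR (mu m) * r m - S0) = x * (S1 - S0) + INR (mu m) * (r m * x) by ring.
rewrite exp_plus -Rmult_assoc.
apply: Rmult_le_compat => //; first by apply: Gev_ge0.
- by apply: pow_le; have := Hr m; nra.
- by apply: one_plus_pow_le_exp; have := Hr m; nra.
Qed.

(** * Infinite products under the summability condition *)

Definition wsum (r : nat -> R) (mu : nat -> nat) : Prop :=
  (forall n, 0 <= r n) /\ ex_series (fun n => INR (mu n) * r n).

Lemma wsum_term_ge0 r mu : wsum r mu -> forall n, 0 <= INR (mu n) * r n.
Proof. by move=> [Hr _] n; apply: Rmult_le_pos => //; apply: pos_INR. Qed.

Lemma wsum_mono r mu mu' : (forall n, (mu' n <= mu n)%nat) -> wsum r mu -> wsum r mu'.
Proof.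
move=> Hm Hw; split; first by case: Hw.
apply: ex_series_le0 (proj2 Hw) => n; split.
- by apply: Rmult_le_pos; [apply: pos_INR | case: Hw].
- by apply: Rmult_le_compat_r; [case: Hw | apply: le_INR].
Qed.

Definition Gi (r : nat -> R) (mu : nat -> nat) (m : nat) : R :=
  real (Lim_seq (fun N => Gc r mu N m)).

Lemma Gev_le_exp r mu N x : wsum r mu -> 0 <= x ->
  Gev r mu N x <= exp (x * Series (fun n => INR (mu n) * r n)).
Proof.
move=> Hw Hx; apply: Rle_trans (Gev_exp _ _ _ _ (proj1 Hw) Hx) _.
apply: exp_mono; apply: Rmult_le_compat_l => //.
by apply: Rsum_le_Series; [apply: wsum_term_ge0 | case: Hw].
Qed.

Lemma Gi_lim r mu m : wsum r mu -> is_lim_seq (fun N => Gc r mu N m) (Gi r mu m).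
Proof.
move=> Hw; apply: Lim_seq_correct'.
apply: (ex_finite_lim_seq_incr _ (exp (1 * Series (fun n => INR (mu n) * r n)))).
- by move=> n; apply: Gc_incr; case: Hw.
- move=> n; apply: Rle_trans (Gev_le_exp _ _ n 1 Hw ltac:(lra)).
  apply: Rle_trans; last exact: (Rsum_Gc r mu n 1 (S m) (proj1 Hw) Rle_0_1).
  have -> : Gc r mu n m = Gc r mu n m * 1 ^ m by rewrite pow1; ring.
  apply: (Rsum_term_le (S m) (fun m => Gc r mu n m * 1 ^ m)); last by lia.
  by move=> k _; rewrite pow1 Rmult_1_r; apply: Gc_ge0; case: Hw.
Qed.

Lemma Gc_le_Gi r mu N m : wsum r mu -> Gc r mu N m <= Gi r mu m.
Proof.
move=> Hw; have /= := is_lim_seq_incr_compare _ _ (Gi_lim r mu m Hw) _ N; apply.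
by move=> n; apply: Gc_incr; case: Hw.
Qed.

Lemma Gi_ge0 r mu m : wsum r mu -> 0 <= Gi r mu m.
Proof. by move=> Hw; apply: Rle_trans (Gc_le_Gi r mu 0 m Hw); apply: Gc_ge0; case: Hw. Qed.

Lemma Gi_mono r mu mu' m : wsum r mu -> (forall n, (mu' n <= mu n)%nat) -> Gi r mu' m <= Gi r mu m.
Proof.
move=> Hw Hm.
apply: (is_lim_seq_le (fun N => Gc r mu' N m) (fun N => Gc r mu N m) (Gi r mu' m) (Gi r mu m)).
- by move=> n; apply: Gc_mono => //; case: Hw.
- by apply: Gi_lim; apply: wsum_mono Hw.
- exact: Gi_lim.
Qed.

Lemma is_lim_seq_Rsum K (u : nat -> nat -> R) (l : nat -> R) :
  (forall k, is_lim_seq (fun n => u n k) (l k)) -> is_lim_seq (fun n => Rsum K (u n)) (Rsum K l).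
Proof.
move=> H; elim: K => [|K IH] /=; first exact: is_lim_seq_const.
exact: is_lim_seq_plus'.
Qed.

Lemma Rsum_Gi r mu x M B : wsum r mu -> 0 <= x -> (forall N, Gev r mu N x <= B) ->
  Rsum M (fun m => Gi r mu m * x ^ m) <= B.
Proof.
move=> Hw Hx HB.
apply: (is_lim_seq_le (fun N => Rsum M (fun m => Gc r mu N m * x ^ m)) (fun _ => B)
  (Rsum M (fun m => Gi r mu m * x ^ m)) B); last exact: is_lim_seq_const.
- by move=> n; apply: Rle_trans (HB n); apply: Rsum_Gc => //; case: Hw.
- apply: is_lim_seq_Rsum => k; apply: is_lim_seq_mult'; [exact: Gi_lim | exact: is_lim_seq_const].
Qed.

Lemma Gi_term_ge0 r mu x m : wsum r mu -> 0 <= x -> 0 <= Gi r mu m * x ^ m.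
Proof. by move=> Hw Hx; apply: Rmult_le_pos; [apply: Gi_ge0 | apply: pow_le]. Qed.

Lemma ex_series_Gi r mu x : wsum r mu -> 0 <= x -> ex_series (fun m => Gi r mu m * x ^ m).
Proof.
move=> Hw Hx; apply: ex_series_bound.
- by move=> n; apply: Gi_term_ge0.
- by move=> N; apply: Rsum_Gi => // n; apply: Gev_le_exp.
Qed.

Lemma Series_Gi_le r mu x B : wsum r mu -> 0 <= x -> (forall N, Gev r mu N x <= B) ->
  Series (fun m => Gi r mu m * x ^ m) <= B.
Proof.
move=> Hw Hx HB; apply: Series_le_bound; last exact: ex_series_Gi.
by move=> N; apply: Rsum_Gi.
Qed.

Lemma Gev_mono_N r mu N K x : (forall n, 0 <= r n) -> 0 <= x -> (N <= K)%nat ->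
  Gev r mu N x <= Gev r mu K x.
Proof.
move=> Hr Hx; elim=> [|m _ IH] /=; first by lra.
have h : 1 <= (1 + r m * x) ^ mu m by apply: pow_R1_Rle; have := Hr m; nra.
have := Gev_ge0 r mu m x Hr Hx; nra.
Qed.

(** The first [N] factors form a polynomial, bounded by [M * exp (eps/2 * x)]; the other factors
    contribute at most the exponential of [x] times a tail of the series, and that tail is below
    [eps/2]. *)
Lemma Gi_subexp r mu eps : wsum r mu -> 0 < eps ->
  exists M, 0 <= M /\ forall x, 0 <= x -> Series (fun m => Gi r mu m * x ^ m) <= M * exp (eps * x).
Proof.
move=> Hw He; have [Hr Hs] := Hw.
have [N HN] := Series_tail_small _ (eps/2) Hs (wsum_term_ge0 _ _ Hw) ltac:(lra).
have [M [HM0 HM]] := Gev_subexp r mu N (eps/2) Hr ltac:(lra).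
exists M; split => // x Hx; apply: Series_Gi_le => // K.
(* [Gev_split] requires at least [N] factors, and additional factors only increase the value. *)
apply: (Rle_trans _ (Gev r mu (N + K) x)); first by apply: Gev_mono_N => //; lia.
apply: Rle_trans (Gev_split r mu N (N + K) x Hr Hx ltac:(lia)) _.
have -> : eps * x = eps / 2 * x + x * (eps / 2) by field.
rewrite exp_plus -Rmult_assoc.
apply: Rmult_le_compat; [by apply: Gev_ge0| |by apply: HM|].
  by apply: Rlt_le; apply: exp_pos.
apply: exp_mono; apply: Rmult_le_compat_l => //.
have := HN N (Nat.le_refl _); have := Series_split _ N Hs.
have := Rsum_le_Series _ (N + K) (wsum_term_ge0 _ _ Hw) Hs; lra.
Qed.

(** Written as a telescoping series, whose absolute convergence follows from comparison with the
    increments of [Gc]. *)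
Definition Fi (l : nat -> C) (mu : nat -> nat) (m : nat) : C :=
  (Pc l mu 0 m + CS (fun N => Pc l mu (S N) m - Pc l mu N m))%C.

Lemma Fi_lim l mu m : wsum (fun n => Cmod (l n)) mu -> limC (fun N => Pc l mu N m) (Fi l mu m).
Proof.
move=> Hw; have [Hr Hs] := Hw.
apply: (limC_ext (fun N => Pc l mu 0 m + Csum N (fun N => Pc l mu (S N) m - Pc l mu N m))%C).
  by move=> N; rewrite (Csum_telescope (fun N => Pc l mu N m)).
apply: limC_plus; first exact: limC_const.
apply: CS_lim.
apply: (summ_le _ (fun N => Gc (fun n => Cmod (l n)) mu (S N) m - Gc (fun n => Cmod (l n)) mu N m)).
  by move=> n; apply: Pc_incr.
apply: (ex_series_bound _ (Gi (fun n => Cmod (l n)) mu m)).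
- by move=> n; have := Gc_incr _ mu n m Hr; lra.
- move=> N.
  have -> : Rsum N (fun N => Gc (fun n => Cmod (l n)) mu (S N) m - Gc (fun n => Cmod (l n)) mu N m)
    = Gc (fun n => Cmod (l n)) mu N m - Gc (fun n => Cmod (l n)) mu 0 m.
    by rewrite (Rsum_telescope (fun N => Gc (fun n => Cmod (l n)) mu N m)).
  have := Gc_le_Gi _ mu N m Hw; have := Gc_ge0 _ mu 0 m Hr; lra.
Qed.

Lemma Fi_le_Gi l mu m : wsum (fun n => Cmod (l n)) mu ->
  Cmod (Fi l mu m) <= Gi (fun n => Cmod (l n)) mu m.
Proof.
move=> Hw; apply: limC_le (Fi_lim l mu m Hw) _ => n.
by apply: Rle_trans (Pc_le_Gc _ _ _ _) _; apply: Gc_le_Gi.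
Qed.

Lemma bump_wsum r mu k : wsum r mu -> wsum r (bump mu k).
Proof.
move=> [Hr Hs]; split=> //.
apply/(ex_series_incr_n (V := R_NormedModule) _ (S k)).
apply: (ex_series_ext (fun n => INR (mu (S k + n)%nat) * r (S k + n)%nat)).
  by move=> n; rewrite /bump; case: Nat.eqb_spec => //; lia.
exact: (proj1 (ex_series_incr_n (V := R_NormedModule) _ (S k)) Hs).
Qed.

Lemma Fi_bump l mu k m : wsum (fun n => Cmod (l n)) mu ->
  Fi l (bump mu k) m = lin (l k) (Fi l mu) m.
Proof.
move=> Hw.
apply: limC_unique (Fi_lim l (bump mu k) m (bump_wsum _ _ _ Hw)) _.
apply: (limC_eventually (fun N => lin (l k) (Pc l mu N) m) _ _ (S k)).
  by move=> n Hn; rewrite Pc_bump //; lia.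
case: m => [|m] /=; first exact: Fi_lim.
apply: limC_plus; first exact: Fi_lim.
apply: (limC_ext (fun N => (- l k) * Pc l mu N m)%C); first by move=> n; ring.
replace (- (l k * Fi l mu m))%C with (- l k * Fi l mu m)%C by ring.
by apply: limC_scal; apply: Fi_lim.
Qed.

Lemma Gc_bump r mu k N m : (k < N)%nat -> Gc r (bump mu k) N m = glin (r k) (Gc r mu N) m.
Proof.
have Hc : forall l k a, glin l (glin k a) = glin k (glin l a).
  by move=> l k' a; apply: functional_extensionality => -[|[|j]] //=; ring.
have Hi : forall l k n a, glin k (Nat.iter n (glin l) a) = Nat.iter n (glin l) (glin k a).
  by move=> l k' n a; elim: n => [|n IH] //=; rewrite Hc IH.
move=> Hk; suff -> : Gc r (bump mu k) N = glin (r k) (Gc r mu N) by [].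
elim: N Hk => [|N IH] Hk /=; first by lia.
rewrite {1}/bump; case: Nat.eqb_spec => [->|Hne].
- rewrite /= Hi -Hi; congr (glin _ (Nat.iter _ _ _)).
  suff : forall M, (M <= k)%nat -> Gc r (bump mu k) M = Gc r mu M by apply.
  elim=> [|M IHM] HM //=; rewrite IHM; last by lia.
  by rewrite /bump; case: Nat.eqb_spec => //; lia.
- by rewrite IH ?Hi //; lia.
Qed.

(** The new factor adds [r k * Gi r mu m] to a nonnegative coefficient. In [RD_WW] this controls a
    series in which a coefficient of index [m] multiplies a derivative of order [m+1]. *)
Lemma Gi_bump_ge r mu k m : wsum r mu -> r k * Gi r mu m <= Gi r (bump mu k) (S m).
Proof.
move=> Hw.
have H1 : is_lim_seq (fun N => r k * Gc r mu (N + S k)%nat m) (r k * Gi r mu m).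
  apply: is_lim_seq_mult'; first exact: is_lim_seq_const.
  by apply/(is_lim_seq_incr_n (fun N => Gc r mu N m)); apply: Gi_lim.
apply: (is_lim_seq_le _ (fun _ => Gi r (bump mu k) (S m)) (r k * Gi r mu m) (Gi r (bump mu k) (S m))); [ | exact: H1 | exact: is_lim_seq_const].
move=> n; apply: Rle_trans (Gc_le_Gi _ _ (n + S k) _ (bump_wsum _ _ _ Hw)).
rewrite Gc_bump /=; last by lia.
have := Gc_ge0 r mu (n + S k) (S m) (proj1 Hw); lra.
Qed.

Lemma Pc_0 l mu N : Pc l mu N 0%nat = RtoC 1.
Proof.
elim: N => [|N IH] //=.
by elim: (mu N) => [|k IHk] //=.
Qed.

Lemma Gc_0 r mu N : Gc r mu N 0%nat = 1.
Proof.
elim: N => [|N IH] //=.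
by elim: (mu N) => [|k IHk] //=.
Qed.

Lemma Fi_0 l mu : wsum (fun n => Cmod (l n)) mu -> Fi l mu 0%nat = RtoC 1.
Proof.
move=> Hw; apply: limC_unique (Fi_lim l mu 0 Hw) _.
by apply: limC_ext (limC_const _) => n; rewrite Pc_0.
Qed.

Lemma Gi_0 r mu : wsum r mu -> Gi r mu 0%nat = 1.
Proof.
move=> Hw; have H := is_lim_seq_unique _ _ (Gi_lim r mu 0 Hw).
have : Lim_seq (fun N => Gc r mu N 0%nat) = Finite 1.
  by rewrite (Lim_seq_ext _ (fun _ => 1)) ?Lim_seq_const // => n; rewrite Gc_0.
by rewrite H => -[].
Qed.

Definition tailmu (mu : nat -> nat) (N n : nat) : nat := if Nat.ltb n N then 0%nat else mu n.

Lemma tailmu_le mu N n : (tailmu mu N n <= mu n)%nat.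
Proof. by rewrite /tailmu; case: Nat.ltb; lia. Qed.

Lemma tailmu_Series r mu N : wsum r mu ->
  Series (fun n => INR (tailmu mu N n) * r n) = Series (fun n => INR (mu (N + n)%nat) * r (N + n)%nat).
Proof.
move=> Hw; have [_ Ht] := wsum_mono _ _ _ (tailmu_le mu N) Hw.
rewrite (Series_split _ N Ht).
have -> : Rsum N (fun n => INR (tailmu mu N n) * r n) = 0.
  rewrite (Rsum_ext _ _ (fun n => 0 * 0)); first by rewrite Rsum_scal; ring.
  by move=> n Hn; rewrite /tailmu; have /Nat.ltb_lt -> := Hn; rewrite /=; ring.
rewrite Rplus_0_l; apply: Series_ext => n.
by rewrite /tailmu; have /Nat.ltb_ge -> : (N <= N + n)%nat by lia.
Qed.

(** Once the first [N] zeros are removed, the majorant at 1 is at most the exponential of a tail,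
    made smaller than [1 + eps]. Its constant coefficient is 1, so each of the others is below
    [eps]. *)
Lemma Fi_tail_lim l mu m : wsum (fun n => Cmod (l n)) mu ->
  limC (fun N => Fi l (tailmu mu N) m) (RtoC (delta0 m)).
Proof.
move=> Hw; have Hwt N := wsum_mono _ _ _ (tailmu_le mu N) Hw.
case: m => [|m].
  by apply: limC_ext (limC_const _) => n; rewrite Fi_0.
move=> eps He.
have [M HM] := Series_tail_small _ (ln (1 + eps)) (proj2 Hw) (wsum_term_ge0 _ _ Hw)
  ltac:(rewrite -ln_1; apply: ln_increasing; lra).
exists M => N HN.
have -> : (Fi l (tailmu mu N) (S m) - RtoC (delta0 (S m)))%C = Fi l (tailmu mu N) (S m) by rewrite /=; ring.
apply: Rle_lt_trans (Fi_le_Gi _ _ _ (Hwt N)) _.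
set r := fun n => Cmod (l n).
have h : Rsum (S (S m)) (fun m => Gi r (tailmu mu N) m * 1 ^ m) <= exp (1 * Series (fun n => INR (tailmu mu N n) * r n)).
  by apply: Rsum_Gi => //; [lra | move=> K; apply: Gev_le_exp => //; lra].
have h0 : Gi r (tailmu mu N) (S m) <= Rsum (S m) (fun n => Gi r (tailmu mu N) (S n) * 1 ^ (S n)).
  apply: Rle_trans; last first.
    apply: (Rsum_term_le (S m) (fun n => Gi r (tailmu mu N) (S n) * 1 ^ (S n)) m); last by lia.
    by move=> k _; apply: Gi_term_ge0 => //; lra.
  by rewrite pow1; lra.
have h2 : exp (Series (fun n => INR (mu (N + n)%nat) * r (N + n)%nat)) < 1 + eps.
  by rewrite -[X in _ < X]exp_ln; [apply: exp_increasing; apply: HM | lra].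
move: h; rewrite Rsum_incr (tailmu_Series r mu N Hw) (Gi_0 r _ (Hwt N)) pow_O !Rmult_1_l.
set X := Rsum _ _ in h0 *; move=> h; lra.
Qed.

(** * Entire power series *)

(** Complex differentiability in epsilon form with [Cmod] as the only norm, in which the remainder
    estimates below are stated. *)
Definition CD (f : C -> C) (z l : C) : Prop :=
  forall eps, 0 < eps -> exists d, 0 < d /\
    forall h : C, Cmod h < d -> Cmod (f (z + h) - f z - h * l)%C <= eps * Cmod h.

Lemma CD_is_derive f z l :
  is_derive (K := C_AbsRing) (V := C_NormedModule) f z l <-> CD f z l.
Proof.
split.
- move=> [_ H] eps He.
  have [d Hd] := H z (fun P HP => HP) (mkposreal eps He).
  exists d; split; first exact: cond_pos.
  move=> h Hh; have := Hd (z + h)%C.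
  rewrite /ball /= /AbsRing_ball /abs /minus /plus /opp /norm /scal /= /mult /=.
  replace (z + h + - z)%C with h by ring.
  by move=> /(_ Hh).
- move=> H; split; first exact: is_linear_scal_l.
  move=> x' /is_filter_lim_locally_unique <- eps.
  have [d [Hd0 Hd]] := H eps (cond_pos eps).
  exists (mkposreal d Hd0) => y; rewrite /ball /= /AbsRing_ball /abs /minus /plus /opp /norm /scal /= /mult /= => Hy.
  have := Hd _ Hy.
  by have -> : (z + (y + - z))%C = y by change (z + ((y : C) + - z) = (y : C))%C; ring.
Qed.

Lemma CD_unique f z l l' : CD f z l -> CD f z l' -> l = l'.
Proof.
move=> H H'; apply: NNPP => Hne.
have Hp : 0 < Cmod (l - l').
  apply/Cmod_gt_0 => E; apply: Hne.
  by rewrite -(Cplus_0_r l') -E; ring.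
have [d [Hd0 Hd]] := H (Cmod (l - l') / 4) ltac:(lra).
have [d' [Hd0' Hd']] := H' (Cmod (l - l') / 4) ltac:(lra).
set t := Rmin d d' / 2.
have Hm : 0 < Rmin d d' by apply: Rmin_pos.
have := Rmin_l d d'; have := Rmin_r d d' => h1 h2.
have Ht : Cmod (RtoC t) = t by rewrite Cmod_R Rabs_pos_eq // /t; lra.
have a1 := Hd (RtoC t) ltac:(rewrite Ht /t; lra).
have a2 := Hd' (RtoC t) ltac:(rewrite Ht /t; lra).
have := Cmod_triangle (f (z + t)%C - f z - t * l') (- (f (z + t)%C - f z - t * l)).
replace (f (z + t)%C - f z - t * l' + - (f (z + t)%C - f z - t * l))%C with (t * (l - l'))%C by ring.
rewrite Cmod_opp Cmod_mult; move: a1 a2; rewrite Ht => a1 a2 a3.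
have Ht0 : 0 < t by rewrite /t; lra.
nra.
Qed.

Lemma Cder_tower_unique f g g' : Cder_tower f g -> Cder_tower f g' -> g = g'.
Proof.
move=> [H0 H] [H0' H']; apply: functional_extensionality => k.
elim: k => [|k IH]; first by rewrite H0 H0'.
apply: functional_extensionality => z.
have /CD_is_derive h := H k z; have /CD_is_derive h' := H' k z.
by apply: CD_unique h _; rewrite IH.
Qed.

(** [Cder_n] is chosen by [epsilon]; uniqueness of derivatives makes any tower over [f] the chosen
    one. *)
Lemma Cder_n_tower f g : Cder_tower f g -> Cder_n f = g.
Proof.
move=> H; symmetry; apply: (Cder_tower_unique f) => //.
exact: (epsilon_spec (inhabits (fun _ => f)) (fun g => Cder_tower f g) (ex_intro _ g H)).
Qed.

Definition PS (a : nat -> C) (z : C) : C := CS (fun m => a m * z ^ m)%C.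

(** The sum of the moduli of the terms at radius [r], used in place of the maximum modulus: it can
    be estimated directly on quotients by linear factors, and it bounds the operator [Op a] on
    blocks ([nb_Op]). *)
Definition nr (a : nat -> C) (r : R) : R := Series (fun m => Cmod (a m) * r ^ m).

Definition entS (a : nat -> C) : Prop :=
  forall r, 0 <= r -> ex_series (fun m => Cmod (a m) * r ^ m).

Definition dS (a : nat -> C) (m : nat) : C := (RtoC (INR (S m)) * a (S m))%C.

Lemma nr_term_ge0 a r : 0 <= r -> forall m, 0 <= Cmod (a m) * r ^ m.
Proof. by move=> Hr m; apply: Rmult_le_pos; [apply: Cmod_ge_0 | apply: pow_le]. Qed.

Lemma nr_ge0 a r : 0 <= r -> entS a -> 0 <= nr a r.
Proof. by move=> Hr Ha; apply: Series_ge0; [apply: nr_term_ge0 | apply: Ha]. Qed.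

Lemma entS_summ a z : entS a -> summ (fun m => a m * z ^ m)%C.
Proof.
move=> Ha; apply: ex_series_ext (Ha (Cmod z) (Cmod_ge_0 z)) => n.
by rewrite Cmod_mult Cmod_pow.
Qed.

Lemma INR_le_pow2 m : INR m <= 2 ^ m.
Proof.
elim: m => [|m IH]; first by rewrite /=; lra.
rewrite S_INR /=.
have : 1 <= 2 ^ m by apply: pow_R1_Rle; lra.
lra.
Qed.

Lemma entS_dS a : entS a -> entS (dS a).
Proof.
move=> Ha r Hr.
apply: (ex_series_le0 _ (fun m => Cmod (a (S m)) * (2 * (r + 1)) ^ (S m))).
  move=> m; split; first exact: nr_term_ge0.
  rewrite /dS Cmod_mult Cmod_R Rabs_pos_eq; last exact: pos_INR.
  have -> : INR (S m) * Cmod (a (S m)) * r ^ m = Cmod (a (S m)) * (INR (S m) * r ^ m) by ring.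
  apply: Rmult_le_compat_l; first exact: Cmod_ge_0.
  rewrite Rpow_mult_distr; apply: Rmult_le_compat; [exact: pos_INR|exact: pow_le|exact: INR_le_pow2|].
  apply: (Rle_trans _ ((r + 1) ^ m)); first by apply: pow_incr; lra.
  have h : 0 <= (r + 1) ^ m by apply: pow_le; lra.
  by rewrite /=; nra.
exact: (proj1 (ex_series_incr_1 (V := R_NormedModule) _) (Ha (2 * (r + 1)) ltac:(lra))).
Qed.

Lemma pow_taylor2 (z h : C) R m : Cmod z + Cmod h <= R -> 1 <= R ->
  Cmod ((z + h) ^ S m - z ^ S m - h * (RtoC (INR (S m)) * z ^ m))%C
    <= Cmod h ^ 2 * (INR (S m) ^ 2 * R ^ S m).
Proof.
move=> HR H1.
have Hz := Cmod_ge_0 z; have Hh := Cmod_ge_0 h.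
have Hh2 : 0 <= Cmod h ^ 2 by nra.
elim: m => [|m IH].
  replace ((z + h) ^ 1 - z ^ 1 - h * (RtoC (INR 1) * z ^ 0))%C with (RtoC 0) by (simpl; ring).
  by rewrite Cmod_0 /=; nra.
have -> : ((z + h) ^ S (S m) - z ^ S (S m) - h * (RtoC (INR (S (S m))) * z ^ S m))%C
 = ((z + h) * ((z + h) ^ S m - z ^ S m - h * (RtoC (INR (S m)) * z ^ m)) + h * h * (RtoC (INR (S m)) * z ^ m))%C.
  by rewrite (S_INR (S m)) RtoC_plus /=; ring.
apply: Rle_trans (Cmod_triangle _ _) _.
rewrite !Cmod_mult Cmod_pow Cmod_R (Rabs_pos_eq (INR (S m))); last exact: pos_INR.
have hzh : Cmod (z + h) <= R by have := Cmod_triangle z h; lra.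
have hz : Cmod z ^ m <= R ^ m by apply: pow_incr; lra.
have hp : 0 <= R ^ m by apply: pow_le; lra.
have hI := pos_INR (S m).
have e1 : Cmod (z + h) * Cmod ((z + h) ^ S m - z ^ S m - h * (RtoC (INR (S m)) * z ^ m))%C
  <= R * (Cmod h ^ 2 * (INR (S m) ^ 2 * R ^ S m)).
  by apply: Rmult_le_compat => //; apply: Cmod_ge_0.
have e2 : Cmod h * Cmod h * (INR (S m) * Cmod z ^ m) <= Cmod h ^ 2 * (INR (S m) * (R * R * R ^ m)).
  have -> : Cmod h * Cmod h = Cmod h ^ 2 by ring.
  apply: Rmult_le_compat_l => //; apply: Rmult_le_compat_l => //.
  have : 1 * 1 <= R * R by nra. nra.
rewrite (S_INR (S m)).
apply: Rle_trans (Rplus_le_compat _ _ _ _ e1 e2) _.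
have -> : R * (Cmod h ^ 2 * (INR (S m) ^ 2 * R ^ S m)) + Cmod h ^ 2 * (INR (S m) * (R * R * R ^ m))
  = Cmod h ^ 2 * ((INR (S m) ^ 2 + INR (S m)) * (R * R * R ^ m)) by rewrite /=; ring.
apply: Rmult_le_compat_l => //.
have -> : R ^ S (S m) = R * R * R ^ m by rewrite /=; ring.
apply: Rmult_le_compat_r; first by apply: Rmult_le_pos => //; nra.
by nra.
Qed.

(** The second-order remainder is bounded term by term. The factor [INR (S m) ^ 2 <= 4 ^ S m] of
    [pow_taylor2] is absorbed by summing at radius [4 * R], where an entire series still
    converges. *)
Lemma PS_CD a z : entS a -> CD (PS a) z (PS (dS a) z).
Proof.
move=> Ha.
set R := Cmod z + 1.
have HR : 1 <= R by rewrite /R; have := Cmod_ge_0 z; lra.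
have HbS : ex_series (fun m => Cmod (a (S m)) * (4 * R) ^ S m).
  exact: (proj1 (ex_series_incr_1 (V := R_NormedModule) _) (Ha (4 * R) ltac:(lra))).
set K := Series (fun m => Cmod (a (S m)) * (4 * R) ^ S m).
have HK : 0 <= K.
  apply: Series_ge0 => // n.
  by apply: Rmult_le_pos; [apply: Cmod_ge_0 | apply: pow_le; lra].
have Hq h : Cmod h <= 1 -> Cmod (PS a (z + h) - PS a z - h * PS (dS a) z)%C <= Cmod h ^ 2 * K.
  move=> Hh.
  have -> : (PS a (z + h) - PS a z - h * PS (dS a) z)%C =
    CS (fun m => a (S m) * ((z + h) ^ S m - z ^ S m - h * (RtoC (INR (S m)) * z ^ m)))%C.
    rewrite (CS_ext _ (fun m => (a (S m) * (z + h) ^ S m - a (S m) * z ^ S m) - h * (dS a m * z ^ m))%C); last by move=> m; rewrite /dS; ring.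
    have s1 := entS_summ a (z + h)%C Ha; have s2 := entS_summ a z Ha.
    have s3 := entS_summ (dS a) z (entS_dS a Ha).
    rewrite CS_minus; [|apply: summ_minus; [exact: (proj1 (summ_incr _) s1)|exact: (proj1 (summ_incr _) s2)]|exact: summ_scal].
    rewrite CS_minus; [|exact: (proj1 (summ_incr _) s1)|exact: (proj1 (summ_incr _) s2)].
    rewrite CS_scal // /PS (CS_incr _ s1) (CS_incr _ s2) /=; ring.
  rewrite /K -Series_scal_l; apply: CS_bound; last exact: (ex_series_scal_l (V := R_NormedModule)).
  move=> n; rewrite Cmod_mult.
  have -> : Cmod h ^ 2 * (Cmod (a (S n)) * (4 * R) ^ S n) = Cmod (a (S n)) * (Cmod h ^ 2 * (4 * R) ^ S n) by ring.
  apply: Rmult_le_compat_l; first exact: Cmod_ge_0.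
  apply: Rle_trans (pow_taylor2 z h R n _ HR) _; first by rewrite /R; lra.
  apply: Rmult_le_compat_l; first by apply: pow_le; apply: Cmod_ge_0.
  rewrite Rpow_mult_distr; apply: Rmult_le_compat_r; first by apply: pow_le; lra.
  have -> k : 4 ^ k = (2 ^ k) ^ 2 by elim: k => [|k IH] /=; [ring | rewrite IH /=; ring].
  by apply: pow_incr; split; [apply: pos_INR | apply: INR_le_pow2].
move=> eps He.
exists (Rmin 1 (eps / (K + 1))); split.
  by apply: Rmin_pos; [lra | apply: Rdiv_lt_0_compat; lra].
move=> h Hh; have h1 := Rmin_l 1 (eps / (K + 1)); have h2 := Rmin_r 1 (eps / (K + 1)).
apply: Rle_trans (Hq h ltac:(lra)) _.
have h0 := Cmod_ge_0 h.
have h3 : Cmod h * (K + 1) <= eps.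
  apply: (Rle_trans _ (eps / (K + 1) * (K + 1))); first by apply: Rmult_le_compat_r; lra.
  by apply: Req_le; field; lra.
rewrite /=; nra.
Qed.

Lemma iter_dS n a k : (Nat.iter n dS a k * RtoC (INR (fact k)))%C = (RtoC (INR (fact (n + k))) * a (n + k)%nat)%C.
Proof.
elim: n k => [|n IH] k /=; first by ring.
rewrite {1}/dS.
have -> : (RtoC (INR (S k)) * Nat.iter n dS a (S k) * RtoC (INR (fact k)) =
   Nat.iter n dS a (S k) * RtoC (INR (fact (S k))))%C.
  by rewrite (fact_simpl k) mult_INR RtoC_mult; ring.
rewrite IH; have -> : (n + S k)%nat = S (n + k) by lia.
by rewrite fact_simpl.
Qed.

Lemma entS_iter_dS n a : entS a -> entS (Nat.iter n dS a).
Proof. by move=> Ha; elim: n => [|n IH] //=; apply: entS_dS. Qed.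

Lemma PS_tower a : entS a -> Cder_tower (PS a) (fun k => PS (Nat.iter k dS a)).
Proof.
move=> Ha; split=> // k z; apply/CD_is_derive; apply: PS_CD.
exact: entS_iter_dS.
Qed.

Lemma PS_at_0 a : PS a (RtoC 0) = a 0%nat.
Proof.
have H n : (1 <= n)%nat -> (a n * RtoC 0 ^ n)%C = RtoC 0.
  by case: n => [|n] Hn; [lia | rewrite /=; ring].
by rewrite /PS (proj2 (CS_eq_fin _ 1 H)) /=; ring.
Qed.

Lemma taylor_coef_PS a n : entS a -> taylor_coef (PS a) n = a n.
Proof.
move=> Ha; rewrite /taylor_coef (Cder_n_tower _ _ (PS_tower a Ha)) PS_at_0.
have := iter_dS n a 0; rewrite Nat.add_0_r /=.
have Hf : RtoC (INR (fact n)) <> RtoC 0 by move=> [] /INR_fact_neq_0.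
move=> H; have -> : Nat.iter n dS a 0%nat = (RtoC (INR (fact n)) * a n)%C by rewrite -H; ring.
by field.
Qed.

Lemma filterlim_limC u l :
  filterlim u eventually (locally (T := C_NormedModule) l) <-> limC u l.
Proof.
split.
- move=> H eps He.
  have Hs : 0 < sqrt 2 by apply: sqrt_lt_R0; lra.
  have [N HN] := proj1 (filterlim_locally (U := C_NormedModule) u l) H (mkposreal (eps / sqrt 2) (Rdiv_lt_0_compat _ _ He Hs)).
  exists N => n Hn.
  have := C_NormedModule_mixin_compat2 l (u n) _ (HN n Hn).
  rewrite /minus /plus /opp /= => h.
  apply: Rlt_le_trans h _; apply: Req_le; field; lra.
- move=> H; apply/(filterlim_locally (U := C_NormedModule)) => eps.
  have [N HN] := H eps (cond_pos eps).
  by exists N => n Hn; apply: C_NormedModule_mixin_compat1; apply: HN.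
Qed.

Lemma Clim_limC u l : limC u l -> Clim u = l.
Proof.
move=> H; apply: (limC_unique u) => //.
apply/filterlim_limC.
apply: (epsilon_spec (inhabits (RtoC 0)) (fun l => filterlim u eventually (locally (T := C_NormedModule) l)) (ex_intro _ l _)).
exact/filterlim_limC.
Qed.

Lemma Csum_sum_n a N : sum_n (G := C_AbelianMonoid) a N = Csum (S N) a.
Proof.
elim: N => [|N IH]; first by rewrite sum_O /= Cplus_0_l.
by rewrite sum_Sn IH.
Qed.

Lemma is_series_limC a l :
  is_series (K := C_AbsRing) (V := C_NormedModule) a l <-> limC (fun N => Csum N a) l.
Proof.
rewrite /is_series; split.
- move=> /filterlim_limC H eps He; have [N HN] := H eps He.
  exists (S N) => -[|n] Hn; first by lia.
  by rewrite -Csum_sum_n; apply: HN; lia.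
- move=> H; apply/filterlim_limC => eps He; have [N HN] := H eps He.
  exists N => n Hn.
  by move: (HN (S n) ltac:(lia)); rewrite -Csum_sum_n.
Qed.

Lemma entS_lin l a : entS a -> entS (lin l a).
Proof.
move=> Ha r Hr.
apply/(ex_series_incr_1 (V := R_NormedModule)).
apply: (ex_series_le0 _ (fun m => Cmod (a (S m)) * r ^ S m + (Cmod l * r) * (Cmod (a m) * r ^ m))).
  move=> m; split; first exact: nr_term_ge0.
  rewrite /=; have := Cmod_triangle (a (S m)) (- (l * a m)); rewrite Cmod_opp Cmod_mult.
  have : 0 <= r * r ^ m by apply: Rmult_le_pos => //; apply: pow_le.
  rewrite /Cminus; nra.
apply: (ex_series_plus (V := R_NormedModule)).
- exact: (proj1 (ex_series_incr_1 (V := R_NormedModule) _) (Ha r Hr)).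
- by apply: (ex_series_scal_l (V := R_NormedModule)); apply: Ha.
Qed.

Lemma PS_lin l a z : entS a -> PS (lin l a) z = ((1 - l * z) * PS a z)%C.
Proof.
move=> Ha; have s1 := entS_summ a z Ha.
rewrite /PS (CS_incr _ (entS_summ _ z (entS_lin l a Ha))).
rewrite (CS_ext (fun n => lin l a (S n) * z ^ S n)%C (fun m => a (S m) * z ^ S m - (l * z) * (a m * z ^ m))%C); last by move=> m; rewrite /=; ring.
rewrite CS_minus; [|exact: (proj1 (summ_incr _) s1)|exact: summ_scal].
by rewrite CS_scal // (CS_incr _ s1) /=; ring.
Qed.

Lemma entS_delta0 : entS (fun m => RtoC (delta0 m)).
Proof.
move=> r Hr.
apply: (proj1 (Series_eq_fin _ 1 _)) => -[|n] Hn; first by lia.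
by rewrite /= Cmod_0; ring.
Qed.

Lemma entS_iter_lin l n a : entS a -> entS (Nat.iter n (lin l) a).
Proof. by move=> Ha; elim: n => [|n IH] //=; apply: entS_lin. Qed.

Lemma entS_Pc l mu N : entS (Pc l mu N).
Proof. by elim: N => [|N IH] /=; [apply: entS_delta0 | apply: entS_iter_lin]. Qed.

Lemma entS_le a (b : nat -> R) :
  (forall m, Cmod (a m) <= b m) -> (forall r, 0 <= r -> ex_series (fun m => b m * r ^ m)) -> entS a.
Proof.
move=> H Hb r Hr; apply: ex_series_le0 (Hb r Hr) => m; split; first exact: nr_term_ge0.
by apply: Rmult_le_compat_r; [apply: pow_le | apply: H].
Qed.

Lemma entS_Fi l mu : wsum (fun n => Cmod (l n)) mu -> entS (Fi l mu).
Proof.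
move=> Hw; apply: (entS_le _ (Gi (fun n => Cmod (l n)) mu)).
- by move=> m; apply: Fi_le_Gi.
- by move=> r Hr; apply: ex_series_Gi.
Qed.

Fixpoint Cprod (l : nat -> C) (mu : nat -> nat) (N : nat) (z : C) : C :=
  match N with
  | O => RtoC 1
  | S N => (Cprod l mu N z * Defs.Cpow (1 - l N * z) (mu N))%C
  end.

Lemma Cprod_PS l mu N z : Cprod l mu N z = PS (Pc l mu N) z.
Proof.
elim: N => [|N IH] /=.
  have H n : (1 <= n)%nat -> (RtoC (delta0 n) * z ^ n)%C = RtoC 0.
    by case: n => [|n] Hn; [lia | rewrite /=; ring].
  by rewrite /PS (proj2 (CS_eq_fin _ 1 H)) /=; ring.
rewrite IH; elim: (mu N) => [|k IHk] /=; first by ring.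
rewrite PS_lin; last by apply: entS_iter_lin; apply: entS_Pc.
by rewrite -IHk; ring.
Qed.

Lemma PS_Pc_lim l mu z : wsum (fun n => Cmod (l n)) mu ->
  limC (fun N => PS (Pc l mu N) z) (PS (Fi l mu) z).
Proof.
move=> Hw.
apply: (tannery _ _ (fun m => Gi (fun n => Cmod (l n)) mu m * Cmod z ^ m)).
- by apply: ex_series_Gi => //; apply: Cmod_ge_0.
- move=> N m; rewrite Cmod_mult Cmod_pow; apply: Rmult_le_compat_r; first by apply: pow_le; apply: Cmod_ge_0.
  by apply: Rle_trans (Pc_le_Gc _ _ _ _) _; apply: Gc_le_Gi.
- move=> m; apply: (limC_ext (fun N => z ^ m * Pc l mu N m)%C); first by move=> n; ring.
  replace (Fi l mu m * z ^ m)%C with (z ^ m * Fi l mu m)%C by ring.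
  by apply: limC_scal; apply: Fi_lim.
Qed.

Definition lF (lam : nat -> C) (n : nat) : C := (/ lam n)%C.
Definition rL (lam : nat -> C) (n : nat) : R := / Cmod (lam n).

Lemma taylor_F lam mu n :
  wsum (fun n => Cmod (lF lam n)) mu ->
  taylor_coef (Fprod lam mu) n = Fi (lF lam) mu n.
Proof.
move=> Hw; rewrite -(taylor_coef_PS _ n (entS_Fi _ _ Hw)); congr taylor_coef.
apply: functional_extensionality => z; apply: Clim_limC.
apply: limC_ext (PS_Pc_lim _ _ z Hw) => N; rewrite -Cprod_PS.
elim: N => [|N IH] //=; rewrite IH; congr (_ * Defs.Cpow _ _)%C.
by rewrite /lF /Cdiv; ring.
Qed.

(** [1 + r w] is [1 - (-r) w], so the results on [Pc] and [Fi] also yield the Taylor coefficients of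
    [Gprod]. *)
Lemma Pc_real (r : nat -> R) mu N m : Pc (fun n => - RtoC (r n))%C mu N m = RtoC (Gc r mu N m).
Proof.
elim: N m => [|N IH] m //=.
elim: (mu N) m => [|k IHk] m //=.
by case: m => [|m] /=; rewrite !IHk // RtoC_plus RtoC_mult; ring.
Qed.

Lemma taylor_G lam mu n :
  (forall n, lam n <> RtoC 0) -> wsum (rL lam) mu ->
  taylor_coef (Gprod lam mu) n = RtoC (Gi (rL lam) mu n).
Proof.
move=> H0 Hw.
have Hl k : Cmod (- RtoC (rL lam k)) = rL lam k.
  by rewrite Cmod_opp Cmod_R Rabs_pos_eq //; case: Hw.
have Hw' : wsum (fun n => Cmod (- RtoC (rL lam n))) mu.
  by have -> : (fun n => Cmod (- RtoC (rL lam n))) = rL lam by apply: functional_extensionality.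
have -> : RtoC (Gi (rL lam) mu n) = Fi (fun n => - RtoC (rL lam n))%C mu n.
  apply: limC_unique (Fi_lim _ mu n Hw') => eps He.
  have /is_lim_seq_spec /(_ (mkposreal _ He)) [N HN] := Gi_lim _ _ n Hw.
  by exists N => k Hk; rewrite Pc_real -RtoC_minus Cmod_R; apply: HN.
rewrite -(taylor_coef_PS _ n (entS_Fi _ _ Hw')); congr taylor_coef.
apply: functional_extensionality => z; apply: Clim_limC.
apply: limC_ext (PS_Pc_lim _ _ z Hw') => N; rewrite -Cprod_PS.
elim: N => [|N IH] //=; rewrite IH; congr (_ * Defs.Cpow _ _)%C.
rewrite /rL RtoC_inv; first by rewrite /Cdiv; ring.
by apply: Rgt_not_eq; apply/Cmod_gt_0.
Qed.

(** * Differential operators on exponential polynomials *)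

(* A sequence [c] stands for the exponential polynomial [(sum_k c_k x^k) e^(lam x)];
   [Db] is then [d/dx], [Lb l] is [1 - l d/dx] and [Op a] is [sum_m a_m (d/dx)^m]. *)
Definition Db (lam : C) (c : nat -> C) (k : nat) : C :=
  (lam * c k + RtoC (INR (S k)) * c (S k))%C.

Lemma DbE lam c k : Db lam c k = (lam * c k + RtoC (INR (S k)) * c (S k))%C.
Proof. by []. Qed.

Lemma iter_DbE m lam c k :
  Nat.iter (S m) (Db lam) c k =
  (lam * Nat.iter m (Db lam) c k + RtoC (INR (S k)) * Nat.iter m (Db lam) c (S k))%C.
Proof. by []. Qed.

Definition Lb (l lam : C) (c : nat -> C) (k : nat) : C := (c k - l * Db lam c k)%C.

Definition Op (a : nat -> C) (lam : C) (c : nat -> C) (k : nat) : C :=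
  CS (fun m => a m * Nat.iter m (Db lam) c k)%C.

Definition supp (mu : nat) (c : nat -> C) : Prop := forall k, (mu <= k)%nat -> c k = RtoC 0.

Definition nb (mu : nat) (c : nat -> C) : R := Rsum mu (fun k => Cmod (c k)).

Lemma nb_ge0 mu c : 0 <= nb mu c.
Proof. by apply: Rsum_ge0 => n _; apply: Cmod_ge_0. Qed.

Lemma Cmod_le_nb mu c k : supp mu c -> Cmod (c k) <= nb mu c.
Proof.
move=> Hs; have [Hk|Hk] : (k < mu)%nat \/ (mu <= k)%nat by lia.
- by apply: (Rsum_term_le mu (fun k => Cmod (c k))) => // n _; apply: Cmod_ge_0.
- by rewrite Hs // Cmod_0; apply: nb_ge0.
Qed.

Lemma supp_mono mu mu' c : (mu <= mu')%nat -> supp mu c -> supp mu' c.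
Proof. by move=> H Hs k Hk; apply: Hs; lia. Qed.

Lemma supp_Db mu lam c : supp mu c -> supp mu (Db lam c).
Proof. by move=> Hs k Hk; rewrite /Db !Hs; [ring|lia|lia]. Qed.

Lemma supp_iter_Db mu lam c m : supp mu c -> supp mu (Nat.iter m (Db lam) c).
Proof. by move=> Hs; elim: m => [|m IH] //=; apply: supp_Db. Qed.

Lemma supp_Lb mu l lam c : supp mu c -> supp mu (Lb l lam c).
Proof. by move=> Hs k Hk; rewrite /Lb (supp_Db mu) // Hs //; ring. Qed.

Lemma nb_shift mu c : supp mu c ->
  Rsum mu (fun k => INR (S k) * Cmod (c (S k))) <= INR mu * nb mu c.
Proof.
move=> Hs; apply: (Rle_trans _ (Rsum mu (fun k => INR mu * Cmod (c (S k))))).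
  apply: Rsum_le => n Hn; apply: Rmult_le_compat_r; first exact: Cmod_ge_0.
  by apply: le_INR; lia.
rewrite Rsum_scal; apply: Rmult_le_compat_l; first exact: pos_INR.
have h := Rsum_incr mu (fun k => Cmod (c k)).
move: h; rewrite /= Hs // Cmod_0 -/(nb mu c); have := Cmod_ge_0 (c 0%nat); lra.
Qed.

(** The derivative is [lam] times the identity plus a shift whose weights are at most [mu] on the
    support. This is the origin of the radius [Cmod lam + INR mu] at which majorants are
    evaluated. *)
Lemma nb_Db mu lam c : supp mu c -> nb mu (Db lam c) <= (Cmod lam + INR mu) * nb mu c.
Proof.
move=> Hs; rewrite Rmult_plus_distr_r; apply: Rle_trans; last first.
  by apply: Rplus_le_compat_l; apply: nb_shift Hs.
rewrite /nb -Rsum_scal -Rsum_plus; apply: Rsum_le => n _.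
apply: Rle_trans (Cmod_triangle _ _) _; rewrite !Cmod_mult Cmod_R Rabs_pos_eq; last exact: pos_INR.
by lra.
Qed.

Lemma nb_iter_Db mu lam c m : supp mu c ->
  nb mu (Nat.iter m (Db lam) c) <= (Cmod lam + INR mu) ^ m * nb mu c.
Proof.
move=> Hs; elim: m => [|m IH] /=; first by lra.
apply: Rle_trans (nb_Db _ _ _ (supp_iter_Db _ _ _ m Hs)) _.
rewrite Rmult_assoc; apply: Rmult_le_compat_l => //.
by have := Cmod_ge_0 lam; have := pos_INR mu; lra.
Qed.

Lemma iter_Db_bound mu lam c m k : supp mu c ->
  Cmod (Nat.iter m (Db lam) c k) <= (Cmod lam + INR mu) ^ m * nb mu c.
Proof.
move=> Hs; apply: Rle_trans (nb_iter_Db _ _ _ m Hs).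
by apply: Cmod_le_nb; apply: supp_iter_Db.
Qed.

Lemma rad_ge0 lam mu : 0 <= Cmod lam + INR mu.
Proof. by have := Cmod_ge_0 lam; have := pos_INR mu; lra. Qed.

Lemma Op_summ a mu lam c k : entS a -> supp mu c ->
  summ (fun m => a m * Nat.iter m (Db lam) c k)%C.
Proof.
move=> Ha Hs; apply: (summ_le _ (fun m => nb mu c * (Cmod (a m) * (Cmod lam + INR mu) ^ m))).
- move=> m; rewrite Cmod_mult.
  have := iter_Db_bound mu lam c m k Hs; have := Cmod_ge_0 (a m); nra.
- by apply: (ex_series_scal_l (V := R_NormedModule)); apply: Ha; apply: rad_ge0.
Qed.

Lemma supp_Op a mu lam c : supp mu c -> supp mu (Op a lam c).
Proof.
move=> Hs k Hk; rewrite /Op.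
rewrite (proj2 (CS_eq_fin _ 0 _)) // => n _.
by rewrite (supp_iter_Db _ _ _ n Hs) //; ring.
Qed.

Lemma iter_Db_S m lam c : Nat.iter m (Db lam) (Db lam c) = Nat.iter (S m) (Db lam) c.
Proof. by elim: m => [|m IH] //=; rewrite IH. Qed.

Lemma iter_Db_lin m lam p c q d k :
  Nat.iter m (Db lam) (fun k => p * c k + q * d k)%C k =
  (p * Nat.iter m (Db lam) c k + q * Nat.iter m (Db lam) d k)%C.
Proof. by elim: m k => [|m IH] k //=; rewrite !DbE !IH; ring. Qed.

Lemma Op_lin a mu lam p c q d k : entS a -> supp mu c -> supp mu d ->
  Op a lam (fun k => p * c k + q * d k)%C k = (p * Op a lam c k + q * Op a lam d k)%C.
Proof.
move=> Ha Hc Hd; rewrite /Op -!CS_scal; [|exact: Op_summ Ha Hd|exact: Op_summ Ha Hc].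
rewrite -CS_plus; [|apply: summ_scal; exact: Op_summ Ha Hc|apply: summ_scal; exact: Op_summ Ha Hd].
by apply: CS_ext => m; rewrite iter_Db_lin; ring.
Qed.

Lemma Op_Db a mu lam c : entS a -> supp mu c -> Op a lam (Db lam c) = Db lam (Op a lam c).
Proof.
move=> Ha Hs; apply: functional_extensionality => k.
rewrite [RHS]DbE /Op -!CS_scal; [|exact: Op_summ Ha Hs|exact: Op_summ Ha Hs].
rewrite -CS_plus; [|apply: summ_scal; exact: Op_summ Ha Hs|apply: summ_scal; exact: Op_summ Ha Hs].
by apply: CS_ext => m; rewrite iter_Db_S iter_DbE; ring.
Qed.

Lemma Op_Lb a mu l lam c : entS a -> supp mu c -> Op a lam (Lb l lam c) = Lb l lam (Op a lam c).
Proof.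
move=> Ha Hs; apply: functional_extensionality => k.
have -> : Lb l lam c = (fun k => 1 * c k + (- l) * Db lam c k)%C.
  by apply: functional_extensionality => j; rewrite /Lb; ring.
rewrite (Op_lin _ mu) //; last exact: supp_Db.
by rewrite (Op_Db _ mu) // /Lb; ring.
Qed.

Lemma Op_lin_coef a mu l lam c : entS a -> supp mu c ->
  Op (lin l a) lam c = Lb l lam (Op a lam c).
Proof.
move=> Ha Hs; rewrite -(Op_Lb _ mu) //; apply: functional_extensionality => k.
have -> : Lb l lam c = (fun k => 1 * c k + (- l) * Db lam c k)%C.
  by apply: functional_extensionality => j; rewrite /Lb; ring.
rewrite (Op_lin _ mu) //; last exact: supp_Db.
have s1 := Op_summ a mu lam c k Ha Hs.
have s2 := Op_summ a mu lam _ k Ha (supp_Db _ lam _ Hs).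
rewrite /Op (CS_incr _ (Op_summ _ mu lam c k (entS_lin l a Ha) Hs)) (CS_incr _ s1).
rewrite (CS_ext (fun n => lin l a (S n) * Nat.iter (S n) (Db lam) c k)%C
  (fun n => a (S n) * Nat.iter (S n) (Db lam) c k - l * (a n * Nat.iter n (Db lam) (Db lam c) k))%C); last first.
  by move=> n; rewrite iter_Db_S /=; ring.
rewrite CS_minus; [|exact: (proj1 (summ_incr _) s1)|exact: summ_scal].
by rewrite CS_scal // /=; ring.
Qed.

Lemma Op_iter_lin a mu l lam c n : entS a -> supp mu c ->
  Op (Nat.iter n (lin l) a) lam c = Nat.iter n (Lb l lam) (Op a lam c).
Proof.
move=> Ha Hs; elim: n => [|n IH] //=.
by rewrite (Op_lin_coef _ mu) ?IH //; apply: entS_iter_lin.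
Qed.

Lemma nb_CS_bound mu (f : nat -> nat -> C) (b : nat -> R) :
  (forall k, summ (f k)) -> (forall m, Rsum mu (fun k => Cmod (f k m)) <= b m) -> ex_series b ->
  Rsum mu (fun k => Cmod (CS (f k))) <= Series b.
Proof.
move=> Hf Hb Hs.
apply: (Rle_trans _ (Rsum mu (fun k => Series (fun m => Cmod (f k m))))).
  by apply: Rsum_le => n _; apply: CS_Cmod_le.
rewrite -(Series_Rsum mu (fun k m => Cmod (f k m))); last by move=> k _; apply: Hf.
by apply: Series_le Hs => n; split=> //; apply: Rsum_ge0 => k _; apply: Cmod_ge_0.
Qed.

Lemma nb_Op a mu lam c : entS a -> supp mu c ->
  nb mu (Op a lam c) <= nr a (Cmod lam + INR mu) * nb mu c.
Proof.
move=> Ha Hs; rewrite /nr -Series_scal_r.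
apply: (nb_CS_bound mu (fun k m => a m * Nat.iter m (Db lam) c k)%C).
- by move=> k; apply: Op_summ Ha Hs.
- move=> m; rewrite (Rsum_ext _ _ (fun k => Cmod (a m) * Cmod (Nat.iter m (Db lam) c k))); last by move=> k _; rewrite Cmod_mult.
  rewrite Rsum_scal Rmult_assoc; apply: Rmult_le_compat_l; first exact: Cmod_ge_0.
  exact: nb_iter_Db.
- by apply: ex_series_scal_r; apply: Ha; apply: rad_ge0.
Qed.

Lemma Op_delta0 lam c : Op (fun m => RtoC (delta0 m)) lam c = c.
Proof.
apply: functional_extensionality => k.
have H n : (1 <= n)%nat -> (RtoC (delta0 n) * Nat.iter n (Db lam) c k)%C = RtoC 0.
  by case: n => [|n] Hn; [lia | rewrite /=; ring].
by rewrite /Op (proj2 (CS_eq_fin _ 1 H)) /=; ring.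
Qed.

(** [1 - l D] is the scalar [1 - l lam] minus [l] times the weighted shift, and the shift has norm
    at most [mu]. *)
Lemma nb_Lb_ge mu l lam c : supp mu c ->
  (Cmod (1 - l * lam) - Cmod l * INR mu) * nb mu c <= nb mu (Lb l lam c).
Proof.
move=> Hs.
have h1 : Cmod (1 - l * lam) * nb mu c <=
   Rsum mu (fun k => Cmod (Lb l lam c k) + Cmod l * (INR (S k) * Cmod (c (S k)))).
  rewrite /nb -Rsum_scal; apply: Rsum_le => k _.
  rewrite -Cmod_mult.
  have -> : ((1 - l * lam) * c k)%C = (Lb l lam c k + l * (RtoC (INR (S k)) * c (S k)))%C.
    by rewrite /Lb /Db; ring.
  apply: Rle_trans (Cmod_triangle _ _) _.
  by rewrite !Cmod_mult Cmod_R Rabs_pos_eq; [lra | apply: pos_INR].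
rewrite Rsum_plus Rsum_scal in h1.
have h2 := nb_shift mu c Hs; have h3 := Cmod_ge_0 l.
rewrite -/(nb mu (Lb l lam c)) in h1; nra.
Qed.

(** At its own frequency the diagonal entry [1 - lam / lam] vanishes; only the shift remains, and
    the degree drops. *)
Lemma Lb_own mu lam c : lam <> RtoC 0 -> supp (S mu) c -> supp mu (Lb (/ lam) lam c).
Proof.
move=> H0 Hs k Hk; rewrite /Lb /Db (Hs (S k)); last by lia.
by field.
Qed.

Lemma supp_iter_Lb_own n mu lam c : lam <> RtoC 0 -> supp (n + mu) c ->
  supp mu (Nat.iter n (Lb (/ lam) lam) c).
Proof.
move=> H0; elim: n mu => [|n IH] mu Hs //=.
apply: Lb_own => //; apply: IH.
by have -> : (n + S mu = S n + mu)%nat by lia.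
Qed.

Lemma Op_Pc_lim l mu' mu lam c k : wsum (fun n => Cmod (l n)) mu' -> supp mu c ->
  limC (fun N => Op (Pc l mu' N) lam c k) (Op (Fi l mu') lam c k).
Proof.
move=> Hw Hs.
apply: (tannery _ _ (fun m => Gi (fun n => Cmod (l n)) mu' m * (Cmod lam + INR mu) ^ m * nb mu c)).
- by apply: ex_series_scal_r; apply: ex_series_Gi => //; apply: rad_ge0.
- move=> N m; rewrite Cmod_mult Rmult_assoc; apply: Rmult_le_compat; [exact: Cmod_ge_0|exact: Cmod_ge_0| |exact: iter_Db_bound].
  by apply: Rle_trans (Pc_le_Gc _ _ _ _) _; apply: Gc_le_Gi.
- move=> m; apply: (limC_ext (fun N => Nat.iter m (Db lam) c k * Pc l mu' N m)%C); first by move=> n; ring.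
  rewrite (Cmult_comm (Fi l mu' m)).
  by apply: limC_scal; apply: Fi_lim.
Qed.

Lemma limC_nb_ge mu (u : nat -> nat -> C) (c : nat -> C) B :
  (forall k, limC (fun n => u n k) (c k)) -> (forall n, B <= nb mu (u n)) -> B <= nb mu c.
Proof.
move=> H HB; apply: Rnot_lt_le => Hlt.
have [M HM] := Rsum_small mu (fun n k => Cmod (u n k - c k)) (B - nb mu c) ltac:(lra) (fun k _ e He => H k e He).
have h := HM M (Nat.le_refl _).
have : nb mu (u M) <= nb mu c + Rsum mu (fun k => Cmod (u M k - c k)).
  rewrite /nb -Rsum_plus; apply: Rsum_le => k _.
  have := Cmod_triangle (u M k - c k) (c k).
  replace (u M k - c k + c k)%C with (u M k) by ring; lra.
have := HB M; lra.
Qed.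

Lemma Op_top a mu lam c : entS a -> supp (S mu) c -> Op a lam c mu = (PS a lam * c mu)%C.
Proof.
move=> Ha Hs; rewrite Cmult_comm /PS -CS_scal; last exact: entS_summ.
apply: CS_ext => m.
have -> : Nat.iter m (Db lam) c mu = (lam ^ m * c mu)%C.
  elim: m => [|m IH]; first by rewrite /=; ring.
  by rewrite iter_DbE IH (supp_iter_Db _ _ _ m Hs) //= ; ring.
by ring.
Qed.

Definition edelta (mu k : nat) : C := if Nat.eqb k mu then RtoC 1 else RtoC 0.

(** By [Op_top] the operator is triangular with all diagonal entries equal to [PS a lam]; the system
    is solved from the top coefficient downwards. *)
Lemma Op_solve a mu lam v : entS a -> PS a lam <> RtoC 0 -> supp mu v ->
  exists u, supp mu u /\ Op a lam u = v.
Proof.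
move=> Ha H0; elim: mu v => [|mu IH] v Hv.
  exists (fun _ => RtoC 0); split=> //.
  apply: functional_extensionality => k; rewrite (supp_Op a 0) //; last by lia.
  by rewrite Hv //; lia.
set t := (v mu / PS a lam)%C.
have He : supp (S mu) (edelta mu) by move=> k Hk; rewrite /edelta; case: Nat.eqb_spec => //; lia.
have Hv' : supp mu (fun k => v k - t * Op a lam (edelta mu) k)%C.
  move=> k Hk; have [->|Hlt] : k = mu \/ (S mu <= k)%nat by lia.
  - by rewrite Op_top // /edelta Nat.eqb_refl /t; field.
  - by rewrite Hv // (supp_Op a (S mu)) //; ring.
have [u [Hu Hu']] := IH _ Hv'.
exists (fun k => 1 * u k + t * edelta mu k)%C; split.
  by move=> k Hk; rewrite Hu ?He //; [ring | lia].
apply: functional_extensionality => k.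
rewrite (Op_lin _ (S mu)) //; last by apply: supp_mono Hu; lia.
by rewrite Hu'; ring.
Qed.

(** * Division by linear factors *)

(* Coefficients of [a(w) / (1 - l w)]. *)
Fixpoint divl (l : C) (a : nat -> C) (m : nat) : C :=
  match m with O => a O | S k => (a (S k) + l * divl l a k)%C end.

Lemma RsumS N a : Rsum (S N) a = Rsum N a + a N.
Proof. by []. Qed.

Lemma lin_divl l a : lin l (divl l a) = a.
Proof. by apply: functional_extensionality => -[|m] //=; ring. Qed.

Lemma Rsum_divl l a r M : 0 <= r ->
  Rsum M (fun m => Cmod (divl l a m) * r ^ m) <=
  Rsum M (fun m => Cmod (a m) * r ^ m) + Cmod l * r * Rsum M (fun m => Cmod (divl l a m) * r ^ m).
Proof.
move=> Hr; have Hl := Cmod_ge_0 l; have Hlr : 0 <= Cmod l * r by nra.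
have H0 a' m : 0 <= Cmod (a' m) * r ^ m by apply: nr_term_ge0.
have Hi : forall M, Rsum (S M) (fun m => Cmod (divl l a m) * r ^ m) <=
  Rsum (S M) (fun m => Cmod (a m) * r ^ m) + Cmod l * r * Rsum M (fun m => Cmod (divl l a m) * r ^ m).
  elim=> [|N IH]; first by rewrite /=; lra.
  have e : Cmod (divl l a (S N)) * r ^ S N <= Cmod (a (S N)) * r ^ S N + Cmod l * r * (Cmod (divl l a N) * r ^ N).
    have := Cmod_triangle (a (S N)) (l * divl l a N); rewrite Cmod_mult.
    have : 0 <= r ^ S N by apply: pow_le.
    rewrite [divl l a (S N)]/=; set A := Cmod (a (S N) + _); set B := Cmod (a _) => hp ht.
    have -> : B * r ^ S N + Cmod l * r * (Cmod (divl l a N) * r ^ N) = (B + Cmod l * Cmod (divl l a N)) * r ^ S N by rewrite /=; ring.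
    exact: Rmult_le_compat_r.
  rewrite (RsumS (S N) (fun m => Cmod (divl l a m) * r ^ m)) (RsumS (S N) (fun m => Cmod (a m) * r ^ m)).
  rewrite (RsumS N (fun m => Cmod (divl l a m) * r ^ m)) Rmult_plus_distr_l.
  move: IH e; rewrite (RsumS N (fun m => Cmod (divl l a m) * r ^ m)).
  rewrite (RsumS N (fun m => Cmod (a m) * r ^ m)); lra.
case: M => [|M]; first by rewrite /=; lra.
apply: Rle_trans (Hi M) _; apply: Rplus_le_compat_l; apply: Rmult_le_compat_l => //.
by apply: Rsum_mono; [move=> n; apply: H0 | lia].
Qed.

(** The point [1 / l] lies outside the disc of radius [r], where [1 / (1 - l w)] is a geometric
    series. *)
Lemma divl_small l a r : 0 <= r -> Cmod l * r < 1 -> ex_series (fun m => Cmod (a m) * r ^ m) ->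
  nr (divl l a) r <= nr a r / (1 - Cmod l * r).
Proof.
move=> Hr Hl Ha.
have HB M : Rsum M (fun m => Cmod (divl l a m) * r ^ m) <= nr a r / (1 - Cmod l * r).
  apply: (Rmult_le_reg_r (1 - Cmod l * r)); first by lra.
  have -> : nr a r / (1 - Cmod l * r) * (1 - Cmod l * r) = nr a r by field; lra.
  have := Rsum_divl l a r M Hr.
  have := Rsum_le_Series _ M (nr_term_ge0 a r Hr) Ha; rewrite -/(nr a r); lra.
apply: Series_le_bound => //.
by apply: ex_series_bound HB; apply: nr_term_ge0.
Qed.

Lemma divl_Csum lam a m : lam <> RtoC 0 ->
  (divl (/ lam) a m * lam ^ m)%C = Csum (S m) (fun i => a i * lam ^ i)%C.
Proof.
move=> H0; elim: m => [|m IH]; first by rewrite /=; ring.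
have -> : Csum (S (S m)) (fun i => a i * lam ^ i)%C = (Csum (S m) (fun i => a i * lam ^ i) + a (S m) * lam ^ S m)%C by [].
by rewrite -IH /=; field.
Qed.

Lemma pow_ge0_le x y n : 0 <= x <= y -> 0 <= x ^ n <= y ^ n.
Proof. by move=> H; split; [apply: pow_le; lra | apply: pow_incr]. Qed.

(** Here the zero lies well inside the disc. Read backwards, the recursion
    [b_m = lam (b_{m+1} - a_{m+1})] contracts by 1/2 with respect to the weights [r ^ m], since
    [Cmod lam <= r/2]; summed up, it gives the bound apart from a boundary term
    [Cmod (b M) * r ^ M]. *)
Lemma divl_big lam a r : lam <> RtoC 0 -> entS a -> PS a lam = RtoC 0 -> 2 * Cmod lam <= r ->
  ex_series (fun m => Cmod (divl (/ lam) a m) * r ^ m) /\ nr (divl (/ lam) a) r <= nr a r.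
Proof.
move=> H0 Ha Hz Hr.
have Hlp : 0 < Cmod lam by apply/Cmod_gt_0.
have Hr0 : 0 <= r by lra.
set b := divl (/ lam) a.
have Hs := entS_summ a lam Ha.
have Hat := Ha r Hr0.
(* Since [PS a lam = 0], the partial sum given by [divl_Csum] is minus the remaining tail. This
   makes the boundary term tend to 0. *)
have Htail m : Cmod (b m) * r ^ m <= Series (fun i => Cmod (a (S m + i)%nat) * r ^ (S m + i)).
  have e : (b m * lam ^ m)%C = (- CS (fun i => a (S m + i)%nat * lam ^ (S m + i)))%C.
    rewrite /b divl_Csum //.
    have := CS_split _ (S m) Hs; rewrite -/(PS a lam) Hz => h.
    rewrite -(Cplus_0_l (- _)%C) h; ring.
  have e1 : Cmod (b m) * Cmod lam ^ m <= Series (fun i => Cmod (a (S m + i)%nat) * Cmod lam ^ (S m + i)).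
    rewrite -Cmod_pow -Cmod_mult e Cmod_opp.
    apply: Rle_trans (CS_Cmod_le _ (summ_shift _ (S m) Hs)) _.
    by apply: Req_le; apply: Series_ext => i; rewrite Cmod_mult Cmod_pow.
  have hl : 0 < Cmod lam ^ m by apply: pow_lt.
  apply: (Rmult_le_reg_l (Cmod lam ^ m)) => //.
  have -> : Cmod lam ^ m * (Cmod (b m) * r ^ m) = r ^ m * (Cmod (b m) * Cmod lam ^ m) by ring.
  apply: (Rle_trans _ (r ^ m * Series (fun i => Cmod (a (S m + i)%nat) * Cmod lam ^ (S m + i)))).
    by apply: Rmult_le_compat_l => //; apply: pow_le.
  rewrite -!Series_scal_l; apply: Series_le => [i|].
    split.
      apply: Rmult_le_pos; first by apply: pow_le.
      by apply: nr_term_ge0; lra.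
    have hh := pow_ge0_le (Cmod lam) r (S i) ltac:(lra).
    have -> : (S m + i = m + S i)%nat by lia.
    rewrite !pow_add.
    have h1 : 0 <= r ^ m by apply: pow_le.
    have h2 := Cmod_ge_0 (a (m + S i)%nat).
    have -> : r ^ m * (Cmod (a (m + S i)%nat) * (Cmod lam ^ m * Cmod lam ^ S i)) =
      (Cmod lam ^ m * r ^ m * Cmod (a (m + S i)%nat)) * Cmod lam ^ S i by ring.
    have -> : Cmod lam ^ m * (Cmod (a (m + S i)%nat) * (r ^ m * r ^ S i)) =
      (Cmod lam ^ m * r ^ m * Cmod (a (m + S i)%nat)) * r ^ S i by ring.
    apply: Rmult_le_compat_l; last by lra.
    by apply: Rmult_le_pos => //; apply: Rmult_le_pos => //; lra.
  apply: (ex_series_scal_l (V := R_NormedModule)).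
  exact: (proj1 (ex_series_incr_n (V := R_NormedModule) (fun i => Cmod (a i) * r ^ i) (S m)) Hat).
have Hrec m : Cmod (b m) * r ^ m <= / 2 * (Cmod (b (S m)) * r ^ S m + Cmod (a (S m)) * r ^ S m).
  have e : b m = (lam * (b (S m) + - a (S m)))%C.
    by rewrite /b /=; field.
  have h : Cmod (b m) <= Cmod lam * (Cmod (b (S m)) + Cmod (a (S m))).
    rewrite {1}e Cmod_mult; apply: Rmult_le_compat_l; first by lra.
    by apply: Rle_trans (Cmod_triangle _ _) _; rewrite Cmod_opp; lra.
  have hp : 0 <= r ^ m by apply: pow_le.
  have h1 := Cmod_ge_0 (b (S m)); have h2 := Cmod_ge_0 (a (S m)).
  apply: (Rle_trans _ (Cmod lam * (Cmod (b (S m)) + Cmod (a (S m))) * r ^ m)).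
    exact: Rmult_le_compat_r.
  rewrite [r ^ S m]/=.
  have -> : / 2 * (Cmod (b (S m)) * (r * r ^ m) + Cmod (a (S m)) * (r * r ^ m)) =
     (/ 2 * r) * ((Cmod (b (S m)) + Cmod (a (S m))) * r ^ m) by ring.
  rewrite Rmult_assoc; apply: Rmult_le_compat_r; last by lra.
  by apply: Rmult_le_pos => //; lra.
have HA M : Rsum M (fun m => Cmod (a (S m)) * r ^ S m) <= nr a r.
  have := Rsum_le_Series _ (S M) (nr_term_ge0 a r Hr0) Hat.
  rewrite Rsum_incr -/(nr a r); have := nr_term_ge0 a r Hr0 0; lra.
(* When [Hrec] is summed, half of the left side reappears on the right and is absorbed. *)
have HB M : Rsum M (fun m => Cmod (b m) * r ^ m) <= nr a r + Cmod (b M) * r ^ M.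
  have h : Rsum M (fun m => Cmod (b m) * r ^ m) <= Rsum M (fun m => / 2 * (Cmod (b (S m)) * r ^ S m + Cmod (a (S m)) * r ^ S m)).
    by apply: Rsum_le => m _.
  move: h; rewrite Rsum_scal Rsum_plus.
  have := Rsum_incr M (fun m => Cmod (b m) * r ^ m).
  have := nr_term_ge0 b r Hr0 0; have := HA M.
  rewrite (RsumS M (fun m => Cmod (b m) * r ^ m)); lra.
have HN N : Rsum N (fun m => Cmod (b m) * r ^ m) <= nr a r.
  apply: Rnot_lt_le => Hlt.
  have [M HM] := Series_tail_small _ (Rsum N (fun m => Cmod (b m) * r ^ m) - nr a r) Hat (nr_term_ge0 a r Hr0) ltac:(lra).
  have h := HM (S (N + M)) ltac:(lia).
  have := HB (N + M)%nat; have := Htail (N + M)%nat.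
  have := Rsum_mono _ N (N + M) (nr_term_ge0 b r Hr0) ltac:(lia); lra.
have He : ex_series (fun m => Cmod (b m) * r ^ m) by apply: ex_series_bound HN; apply: nr_term_ge0.
by split=> //; apply: Series_le_bound.
Qed.

Lemma ex_series_nr_mono a r r' : 0 <= r <= r' ->
  ex_series (fun m => Cmod (a m) * r' ^ m) -> ex_series (fun m => Cmod (a m) * r ^ m).
Proof.
move=> Hr; apply: ex_series_le0 => m; split; first by apply: nr_term_ge0; lra.
by apply: Rmult_le_compat_l; [apply: Cmod_ge_0 | apply: pow_incr].
Qed.

Lemma nr_mono a r r' : 0 <= r <= r' -> entS a -> nr a r <= nr a r'.
Proof.
move=> Hr Ha; apply: Series_le; last by apply: Ha; lra.
move=> m; split; first by apply: nr_term_ge0; lra.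
by apply: Rmult_le_compat_l; [apply: Cmod_ge_0 | apply: pow_incr].
Qed.

Lemma entS_divl lam a : lam <> RtoC 0 -> entS a -> PS a lam = RtoC 0 -> entS (divl (/ lam) a).
Proof.
move=> H0 Ha Hz r Hr; have Hl := Cmod_ge_0 lam.
apply: (ex_series_nr_mono _ r (r + 2 * Cmod lam)); first by lra.
by apply: (proj1 (divl_big lam a _ H0 Ha Hz _)); lra.
Qed.

(* That is, [a(w)] has a zero of order [mu] at [lam]. *)
Definition vanish (a : nat -> C) (lam : C) (mu : nat) : Prop :=
  forall c, supp mu c -> forall k, Op a lam c k = RtoC 0.

Lemma vanish_PS a lam mu : entS a -> vanish a lam (S mu) -> PS a lam = RtoC 0.
Proof.
move=> Ha Hv.
have He : supp 1 (edelta 0) by move=> [|k] Hk //; lia.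
have := Op_top a 0 lam (edelta 0) Ha He.
rewrite (Hv _ (supp_mono 1 (S mu) _ ltac:(lia) He)) /edelta /= => ->; ring.
Qed.

(** Integration solves [(1 - D / lam) d = c] at the cost of one degree. The quotient applied to [c]
    is then [a] applied to [d], which is 0. *)
Lemma vanish_divl_own a lam mu : lam <> RtoC 0 -> entS a -> vanish a lam (S mu) ->
  vanish (divl (/ lam) a) lam mu.
Proof.
move=> H0 Ha Hv c Hc k.
have Hb := entS_divl lam a H0 Ha (vanish_PS a lam mu Ha Hv).
set d := fun k : nat => match k with O => RtoC 0 | S j => (- lam * c j / RtoC (INR (S j)))%C end.
have Hd : supp (S mu) d.
  by move=> [|j] Hj //=; rewrite Hc; [rewrite /Cdiv; ring | lia].
have Hn j : RtoC (INR (S j)) <> RtoC 0 by move=> h; apply: (not_0_INR (S j)) => //; exact: (RtoC_inj _ _ h).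
have E : Lb (/ lam) lam d = c.
  apply: functional_extensionality => j; rewrite /Lb DbE.
  have -> : d (S j) = (- lam * c j / RtoC (INR (S j)))%C by [].
  by move: (RtoC (INR (S j))) (Hn j) (d j) => q Hq y; field.
by rewrite -E (Op_Lb _ (S mu)) // -(Op_lin_coef _ (S mu)) // lin_divl; apply: Hv.
Qed.

(** At a different frequency [1 - D / lam] is invertible on blocks of the same length, so [c] is the
    image of a block [d] with the same support, and the quotient applied to [c] is [a] applied to
    [d]. *)
Lemma vanish_divl_other a lam lam' mu : lam <> RtoC 0 -> lam' <> lam -> entS a ->
  PS a lam = RtoC 0 -> vanish a lam' mu -> vanish (divl (/ lam) a) lam' mu.
Proof.
move=> H0 Hne Ha Hz Hv c Hc k.
have Hb := entS_divl lam a H0 Ha Hz.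
have Hd0 := entS_delta0.
have [|d [Hd E]] := Op_solve _ mu lam' c (entS_lin (/ lam) _ Hd0) _ Hc.
  rewrite PS_lin // (_ : PS (fun m => RtoC (delta0 m)) lam' = RtoC 1); last first.
    by rewrite -(Cprod_PS (fun _ => RtoC 0) (fun _ => 0%nat) 0).
  move=> h; apply: Hne.
  have -> : lam' = (lam - lam * ((1 - / lam * lam') * 1))%C by field.
  by rewrite h; ring.
rewrite -E (Op_lin_coef _ mu) // Op_delta0 (Op_Lb _ mu) // -(Op_lin_coef _ mu) // lin_divl.
exact: Hv.
Qed.

Definition Xb (c : nat -> C) (k : nat) : C := match k with O => RtoC 0 | S j => c j end.

Lemma XbS c k : Xb c (S k) = c k.
Proof. by []. Qed.

Lemma iter_Db_Xb lam c m k :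
  Nat.iter (S m) (Db lam) (Xb c) k =
  (Xb (Nat.iter (S m) (Db lam) c) k + RtoC (INR (S m)) * Nat.iter m (Db lam) c k)%C.
Proof.
elim: m k => [|m IH] k.
  have -> : Nat.iter 1 (Db lam) (Xb c) k = Db lam (Xb c) k by [].
  rewrite DbE; case: k => [|k]; first by rewrite /=; ring.
  rewrite (S_INR (S k)) RtoC_plus.
  rewrite !XbS; change (Nat.iter 1 (Db lam) c k) with (Db lam c k).
  by rewrite DbE; change (INR 1) with 1; change (Nat.iter 0 (Db lam) c) with c; ring.
rewrite iter_DbE !IH.
rewrite (S_INR (S m)) RtoC_plus; case: k => [|k].
- by rewrite !XbS [Xb _ 0%nat]/= [Xb _ 0%nat]/= !iter_DbE; change (INR 1) with 1; ring.
- rewrite !XbS !iter_DbE (S_INR (S k)) RtoC_plus; ring.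
Qed.

(** Leibniz rule: the commutator of [a(D)] with multiplication by [x], encoded by [Xb], is
    [a'(D)]. *)
Lemma Op_Xb a mu lam c k : entS a -> supp mu c ->
  Op a lam (Xb c) k = (Xb (Op a lam c) k + Op (dS a) lam c k)%C.
Proof.
move=> Ha Hs.
have HX : supp (S mu) (Xb c) by move=> [|j] Hj //=; apply: Hs; lia.
rewrite {1}/Op (CS_incr _ (Op_summ _ _ _ _ k Ha HX)).
rewrite (CS_ext _ (fun m => a (S m) * Xb (Nat.iter (S m) (Db lam) c) k + dS a m * Nat.iter m (Db lam) c k)%C); last first.
  by move=> m; rewrite iter_Db_Xb /dS; ring.
have s2 := Op_summ _ _ lam _ k (entS_dS a Ha) Hs.
rewrite -/(Op (dS a) lam c k).
case: k s2 => [|k] s2.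
- rewrite (CS_ext _ (fun m => dS a m * Nat.iter m (Db lam) c 0%nat)%C) /=; last by move=> m; ring.
  by rewrite -/(Op _ _ _ _); ring.
- have s1 := Op_summ _ _ lam _ k Ha Hs.
  rewrite CS_plus //; last exact: (proj1 (summ_incr _) s1).
  have E : Op a lam c k = (a 0%nat * c k + CS (fun n => a (S n) * Nat.iter (S n) (Db lam) c k))%C by exact: CS_incr s1.
  rewrite -/(Op (dS a) lam c (S k)) XbS E [Nat.iter 0 _ _]/= XbS.
  have -> : CS (fun n => (a (S n) * Xb (Nat.iter (S n) (Db lam) c) (S k))%C) = CS (fun n => (a (S n) * Nat.iter (S n) (Db lam) c k)%C) by [].
  ring.
Qed.

(** A polynomial is a constant plus [x] times a polynomial of lower degree; the Leibniz rule [Op_Xb]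
    trades that degree for one derivative of [a]. *)
Lemma vanish_of_jets a lam mu : entS a ->
  (forall j, (j < mu)%nat -> PS (Nat.iter j dS a) lam = RtoC 0) -> vanish a lam mu.
Proof.
elim: mu a => [|mu IH] a Ha Hj c Hc k.
  by rewrite (supp_Op a 0) //; lia.
set c' := fun k => c (S k).
have Hc' : supp mu c' by move=> j Hj'; apply: Hc; lia.
have He : supp 1 (edelta 0) by move=> [|j] Hj' //; lia.
have -> : c = (fun k => c 0%nat * edelta 0 k + 1 * Xb c' k)%C.
  by apply: functional_extensionality => -[|j]; rewrite /edelta /c' /=; ring.
have HX : supp (S mu) (Xb c') by move=> [|j] Hj' //=; apply: Hc'; lia.
rewrite (Op_lin _ (S mu)) //; last by apply: supp_mono He; lia.
have Hjd j : (j < mu)%nat -> PS (Nat.iter j dS (dS a)) lam = RtoC 0.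
  by move=> Hj'; rewrite -Nat.iter_succ_r; apply: Hj; lia.
rewrite (Op_Xb _ mu) // (IH (dS a) (entS_dS a Ha) Hjd c' Hc').
have -> : Xb (Op a lam c') k = RtoC 0.
  by case: k => [|k] //=; apply: IH => // j Hj'; apply: Hj; lia.
have -> : Op a lam (edelta 0) k = RtoC 0.
  case: k => [|k]; last by apply: (supp_Op a 1) => //; lia.
  rewrite Op_top //; have := Hj 0%nat ltac:(lia); rewrite /= => ->; ring.
ring.
Qed.

(** * The lower bound obtained from interpolation *)

(** For [x <= 1/2] the factor [1 / (1 - x)] is at most [1 + 2x]. The exponential form lets the costs
    of successive zeros add up in the exponent. *)
Lemma divl_small_exp lam a r : lam <> RtoC 0 -> entS a -> 0 <= r -> 2 * r < Cmod lam ->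
  nr (divl (/ lam) a) r <= nr a r * exp (2 * r / Cmod lam).
Proof.
move=> H0 Ha Hr Hl.
have Hlp : 0 < Cmod lam by apply/Cmod_gt_0.
set x := r / Cmod lam.
have Hx0 : 0 <= x by apply: Rdiv_le_0_compat.
have Hx : x < / 2.
  apply: (Rmult_lt_reg_r (Cmod lam)) => //.
  by rewrite /x /Rdiv Rmult_assoc Rinv_l; lra.
have e : Cmod (/ lam) * r = x by rewrite Cmod_inv // /x; field; lra.
apply: Rle_trans (divl_small (/ lam) a r Hr _ (Ha r Hr)) _; first by rewrite e; lra.
rewrite e /Rdiv; apply: Rmult_le_compat_l; first exact: nr_ge0.
have -> : 2 * r * / Cmod lam = 2 * x by rewrite /x; field; lra.
apply: (Rle_trans _ (1 + 2 * x)); last exact: exp_ineq1_le.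
apply: (Rmult_le_reg_r (1 - x)); first by lra.
rewrite Rinv_l; [nra|lra].
Qed.

(** One zero removed [n] times, with everything that the induction over the zeros carries along:
    what remains of this zero, the other zeros, and the norm at radii that are large or small
    compared with [Cmod lam]. *)
Lemma iter_divl lam a n p : lam <> RtoC 0 -> entS a -> vanish a lam (n + p) ->
  let b := Nat.iter n (divl (/ lam)) a in
  entS b /\ vanish b lam p /\ Nat.iter n (lin (/ lam)) b = a /\
  (forall lam' mu, lam' <> lam -> vanish a lam' mu -> vanish b lam' mu) /\
  (forall r, 2 * Cmod lam <= r -> nr b r <= nr a r) /\
  (forall r, 0 <= r -> 2 * r < Cmod lam -> nr b r <= nr a r * exp (2 * r * (INR n * / Cmod lam))).
Proof.
move=> H0 Ha; elim: n p => [|n IH] p Hv /=.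
  split=> //; split=> //; split=> //; split=> //; split; first by move=> r _; lra.
  by move=> r _ _; rewrite Rmult_0_l Rmult_0_r exp_0; lra.
have [h1 [h2 [h3 [h4 [h5 h6]]]]] := IH (S p) ltac:(by have -> : (n + S p = S n + p)%nat by lia).
have Hz := vanish_PS _ _ _ h1 h2.
split; first exact: entS_divl.
split; first exact: vanish_divl_own.
split; first by rewrite -[RHS]h3 -Nat.iter_succ Nat.iter_succ_r lin_divl.
split; first by move=> lam' mu' Hne Hv'; apply: vanish_divl_other => //; apply: h4.
split.
  move=> r Hr; apply: Rle_trans (h5 r Hr).
  exact: (proj2 (divl_big lam _ r H0 h1 Hz Hr)).
move=> r Hr Hl.
apply: Rle_trans (divl_small_exp lam _ r H0 h1 Hr Hl) _.
have -> : 2 * r * (INR (S n) * / Cmod lam) = 2 * r * (INR n * / Cmod lam) + 2 * r / Cmod lam.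
  by rewrite S_INR /Rdiv; ring.
rewrite exp_plus -Rmult_assoc; apply: Rmult_le_compat_r; first by apply: Rlt_le; apply: exp_pos.
exact: h6.
Qed.

Fixpoint Qd (lam : nat -> C) (mu : nat -> nat) (a : nat -> C) (K : nat) : nat -> C :=
  match K with O => a | S K => Nat.iter (mu K) (divl (/ lam K)) (Qd lam mu a K) end.

Lemma Qd_facts lam mu a K :
  (forall n, lam n <> RtoC 0) -> (forall n m, n <> m -> lam n <> lam m) ->
  entS a -> (forall k, vanish a (lam k) (mu k)) ->
  entS (Qd lam mu a K) /\ (forall j, (K <= j)%nat -> vanish (Qd lam mu a K) (lam j) (mu j)).
Proof.
move=> H0 Hd Ha Hv; elim: K => [|K [IH1 IH2]] //=.
have hv : vanish (Qd lam mu a K) (lam K) (mu K + 0) by rewrite Nat.add_0_r; apply: IH2; lia.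
have [h1 [_ [_ [h4 _]]]] := iter_divl (lam K) _ _ _ (H0 K) IH1 hv.
split=> // j Hj; apply: h4; last by apply: IH2; lia.
by apply: Hd; lia.
Qed.

(** [a] is the product of the polynomial [Pc] and the quotient [Qd], and the operators compose
    accordingly. *)
Lemma Qd_Op lam mu a K lam' mu' c :
  (forall n, lam n <> RtoC 0) -> (forall n m, n <> m -> lam n <> lam m) ->
  entS a -> (forall k, vanish a (lam k) (mu k)) -> supp mu' c ->
  Op a lam' c = Op (Qd lam mu a K) lam' (Op (Pc (lF lam) mu K) lam' c).
Proof.
move=> H0 Hd Ha Hv Hc; elim: K => [|K IH]; first by rewrite /= Op_delta0.
have [h1 h2] := Qd_facts lam mu a K H0 Hd Ha Hv.
have hv : vanish (Qd lam mu a K) (lam K) (mu K + 0) by rewrite Nat.add_0_r; apply: h2; lia.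
have [g1 [_ [g3 _]]] := iter_divl (lam K) _ _ _ (H0 K) h1 hv.
rewrite IH /= (Op_iter_lin _ mu') //; last exact: entS_Pc.
rewrite -{1}g3 (Op_iter_lin _ mu') //; last exact: supp_Op.
set b := Nat.iter (mu K) (divl _) _ in g1 *; set d := Op (Pc _ _ _) _ _.
have Hd' : supp mu' d by apply: supp_Op.
elim: (mu K) => [|n IHn] //=; rewrite IHn (Op_Lb _ mu') //.
by elim: n {IHn} => [|n IHn] //=; apply: supp_Lb.
Qed.

Definition bigpart (lam : nat -> C) (mu : nat -> nat) (r : R) (k : nat) : R :=
  match Rle_dec (Cmod (lam k)) (2 * r) with left _ => 0 | right _ => INR (mu k) * / Cmod (lam k) end.

(** Neither norm estimate covers radii comparable with [Cmod lam], so two radii are used. The zeros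
    of modulus at most [2 * r] come first, by monotonicity, and are divided out at radius [4 * r] at
    no cost; each later zero is divided out at radius [r] and costs an exponential factor. *)
Lemma Qd_norm lam mu a r K :
  (forall n, lam n <> RtoC 0) -> (forall n m, n <> m -> lam n <> lam m) ->
  (forall n, Cmod (lam n) <= Cmod (lam (S n))) ->
  entS a -> (forall k, vanish a (lam k) (mu k)) -> 0 <= r ->
  nr (Qd lam mu a K) r <= nr a (4 * r) * exp (2 * r * Rsum K (bigpart lam mu r)) /\
  ((forall k, (k < K)%nat -> Cmod (lam k) <= 2 * r) -> nr (Qd lam mu a K) (4 * r) <= nr a (4 * r)).
Proof.
move=> H0 Hd Hm Ha Hv Hr.
have Hmm k j : (k <= j)%nat -> Cmod (lam k) <= Cmod (lam j).
  by elim=> [|i _ IH]; [lra | have := Hm i; lra].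
have Hb0 k : 0 <= bigpart lam mu r k.
  rewrite /bigpart; case: Rle_dec => _; first by lra.
  by apply: Rmult_le_pos; [apply: pos_INR | apply: Rlt_le; apply: Rinv_0_lt_compat; apply/Cmod_gt_0].
have Hna : 0 <= nr a (4 * r) by apply: nr_ge0 => //; lra.
elim: K => [|K [IH1 IH2]].
  rewrite /= Rmult_0_r exp_0; split; last by lra.
  by rewrite Rmult_1_r; apply: nr_mono => //; lra.
have [h1 h2] := Qd_facts lam mu a K H0 Hd Ha Hv.
have hv : vanish (Qd lam mu a K) (lam K) (mu K + 0) by rewrite Nat.add_0_r; apply: h2; lia.
have [g1 [_ [_ [_ [g5 g6]]]]] := iter_divl (lam K) _ _ _ (H0 K) h1 hv.
case: (Rle_dec (Cmod (lam K)) (2 * r)) => Hc.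
- have Hall : nr (Qd lam mu a (S K)) (4 * r) <= nr a (4 * r).
    apply: Rle_trans (g5 (4 * r) ltac:(lra)) _; apply: IH2 => k Hk.
    by apply: Rle_trans Hc; apply: Hmm; lia.
  split=> // .
  apply: (Rle_trans _ (nr a (4 * r))).
    by apply: Rle_trans Hall; apply: nr_mono => //; lra.
  rewrite -{1}(Rmult_1_r (nr a _)); apply: Rmult_le_compat_l => //.
  rewrite -exp_0; apply: exp_mono; apply: Rmult_le_pos; first by lra.
  exact: Rsum_ge0.
- split; last by move=> H; have := H K ltac:(lia).
  apply: Rle_trans (g6 r Hr ltac:(lra)) _.
  have e : bigpart lam mu r K = INR (mu K) * / Cmod (lam K) by rewrite /bigpart; case: Rle_dec.
  rewrite RsumS Rmult_plus_distr_l exp_plus -(Rmult_assoc (nr a _)) e; apply: Rmult_le_compat_r => //.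
  by apply: Rlt_le; apply: exp_pos.
Qed.

Definition typezero (a : nat -> C) : Prop :=
  forall eps, 0 < eps -> exists M, forall r, 0 <= r -> nr a r <= M * exp (eps * r).

(** The point is uniformity in [K]. The norm of [a] at [4 * r] puts [eps/8 * (4 * r)] into the
    exponent. The zeros beyond [2 * r] add [2 * r] times a tail, below [eps/4] as soon as [2 * r]
    exceeds the modulus [R0] of [lam N]; for smaller [r] they add at most the constant [R0 * A]. *)
Lemma Qd_typezero lam mu a eps :
  (forall n, lam n <> RtoC 0) -> (forall n m, n <> m -> lam n <> lam m) ->
  (forall n, Cmod (lam n) <= Cmod (lam (S n))) -> wsum (rL lam) mu ->
  entS a -> typezero a -> (forall k, vanish a (lam k) (mu k)) -> 0 < eps ->
  exists M, 0 <= M /\ forall r K, 0 <= r -> nr (Qd lam mu a K) r <= M * exp (eps * r).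
Proof.
move=> H0 Hd Hm Hw Ha Ht Hv He.
have Hmm k j : (k <= j)%nat -> Cmod (lam k) <= Cmod (lam j).
  by elim=> [|i _ IH]; [lra | have := Hm i; lra].
have [M HM] := Ht (eps / 8) ltac:(lra).
have [N HN] := Series_tail_small _ (eps / 4) (proj2 Hw) (wsum_term_ge0 _ _ Hw) ltac:(lra).
set A := Series (fun n => INR (mu n) * rL lam n).
have HA : 0 <= A by apply: Series_ge0; [apply: wsum_term_ge0 | case: Hw].
set R0 := Cmod (lam N).
have HR0 : 0 <= R0 := Cmod_ge_0 _.
have HM0 : 0 <= M.
  have := HM 0 (Rle_refl 0); rewrite Rmult_0_r exp_0 Rmult_1_r.
  by have := nr_ge0 a 0 (Rle_refl 0) Ha; lra.
have Hbp k r : 0 <= bigpart lam mu r k <= INR (mu k) * rL lam k.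
  rewrite /bigpart; have := wsum_term_ge0 _ _ Hw k; rewrite /rL.
  by case: Rle_dec => _; lra.
exists (M * exp (R0 * A)); split; first by apply: Rmult_le_pos => //; apply: Rlt_le; apply: exp_pos.
move=> r K Hr.
apply: Rle_trans (proj1 (Qd_norm lam mu a r K H0 Hd Hm Ha Hv Hr)) _.
have h1 := HM (4 * r) ltac:(lra).
have h2 : 2 * r * Rsum K (bigpart lam mu r) <= R0 * A + eps / 2 * r.
  have hS : Rsum K (bigpart lam mu r) <= A.
    apply: (Rle_trans _ (Rsum K (fun n => INR (mu n) * rL lam n))).
      by apply: Rsum_le => n _; have := Hbp n r; lra.
    by apply: Rsum_le_Series; [apply: wsum_term_ge0 | case: Hw].
  case: (Rle_dec (2 * r) R0) => Hc.
    have : 0 <= eps / 2 * r by apply: Rmult_le_pos; lra.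
    have : 2 * r * Rsum K (bigpart lam mu r) <= R0 * A.
      apply: Rmult_le_compat => //; [lra|apply: Rsum_ge0 => n _; exact: (proj1 (Hbp n r))].
    lra.
  have hT : Rsum K (bigpart lam mu r) <= eps / 4.
    apply: Rle_trans (Rsum_mono _ K (N + K) (fun n => proj1 (Hbp n r)) ltac:(lia)) _.
    have hz : Rsum N (bigpart lam mu r) = 0.
      rewrite (Rsum_ext _ _ (fun _ => 0 * 0)); first by rewrite Rsum_scal; ring.
      move=> n Hn; rewrite /bigpart; case: Rle_dec; first by move=> _; ring.
      by have := Hmm n N ltac:(lia); rewrite -/R0; lra.
    have hs : forall K, Rsum (N + K) (bigpart lam mu r) <= Rsum K (fun n => INR (mu (N + n)%nat) * rL lam (N + n)%nat).
      elim=> [|k IH]; first by rewrite Nat.add_0_r hz /=; lra.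
      by rewrite Nat.add_succ_r !RsumS; have := Hbp (N + k)%nat r; lra.
    apply: Rle_trans (hs K) _; apply: Rlt_le; apply: Rle_lt_trans (HN N (Nat.le_refl _)).
    apply: (Rsum_le_Series (fun n => INR (mu (N + n)%nat) * rL lam (N + n)%nat)).
      by move=> n; apply: (wsum_term_ge0 _ _ Hw).
    exact: (proj1 (ex_series_incr_n (V := R_NormedModule) (fun n => INR (mu n) * rL lam n) N) (proj2 Hw)).
  have : 0 <= R0 * A by apply: Rmult_le_pos.
  have : 2 * r * Rsum K (bigpart lam mu r) <= 2 * r * (eps / 4) by apply: Rmult_le_compat_l; lra.
  lra.
apply: (Rle_trans _ (M * exp (eps / 8 * (4 * r)) * exp (R0 * A + eps / 2 * r))).
  apply: Rmult_le_compat => //; [apply: nr_ge0 => //; lra|by apply: Rlt_le; apply: exp_pos|].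
  exact: exp_mono.
rewrite exp_plus.
have -> : eps * r = eps / 8 * (4 * r) + eps / 2 * r by field.
by rewrite exp_plus; apply: Req_le; ring.
Qed.

Definition except (mu : nat -> nat) (n k : nat) : nat := if Nat.eqb k n then 0%nat else mu k.

Definition offS (S : nat -> Prop) (mu : nat -> nat) (k : nat) : nat :=
  match excluded_middle_informative (S k) with left _ => 0%nat | right _ => mu k end.

Definition onS (S : nat -> Prop) (mu : nat -> nat) (k : nat) : nat :=
  match excluded_middle_informative (S k) with left _ => mu k | right _ => 0%nat end.

(* Interpolation of 1 on [S] and of 0 off [S], for the Taylor coefficients of the function. *)
Definition interpC (lam : nat -> C) (mu : nat -> nat) : Prop :=
  forall S : nat -> Prop, exists a, entS a /\ typezero a /\
    forall n, (S n -> forall c, supp (mu n) c -> Op a (lam n) c = c) /\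
              (~ S n -> vanish a (lam n) (mu n)).

Lemma Cmod_lF lam n : lam n <> RtoC 0 -> Cmod (lF lam n) = rL lam n.
Proof. by move=> H; rewrite /lF /rL Cmod_inv. Qed.

Lemma mu_rL_le lam mu : wsum (rL lam) mu -> forall n, INR (mu n) * rL lam n <= Series (fun n => INR (mu n) * rL lam n).
Proof.
move=> Hw n.
apply: Rle_trans (Rsum_le_Series _ (S n) (wsum_term_ge0 _ _ Hw) (proj2 Hw)).
apply: (Rsum_term_le (S n) (fun n => INR (mu n) * rL lam n)); last by lia.
by move=> k _; apply: (wsum_term_ge0 _ _ Hw).
Qed.

(** On a block with [n] in [S], [a(D)] is the identity; as [a] is [Qd] times [Pc], the quotient
    inverts [Pc(D)] there, and [Qd_typezero] bounds its norm. Since [mu n <= A * Cmod (lam n)], the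
    rate [eps / (1 + A)] compensates for the radius [Cmod (lam n) + INR (mu n)]. *)
Lemma lower_bound_offS lam mu (S : nat -> Prop) eps :
  (forall n, lam n <> RtoC 0) -> (forall n m, n <> m -> lam n <> lam m) ->
  (forall n, Cmod (lam n) <= Cmod (lam (Datatypes.S n))) -> wsum (rL lam) mu ->
  interpC lam mu -> 0 < eps ->
  exists M, 0 <= M /\ forall n K c, S n -> supp (mu n) c ->
    nb (mu n) c <= M * exp (eps * Cmod (lam n)) * nb (mu n) (Op (Pc (lF lam) (offS S mu) K) (lam n) c).
Proof.
move=> H0 Hd Hm Hw Hi He.
have [a [Ha [Ht HS]]] := Hi S.
have Hle n : (offS S mu n <= mu n)%nat.
  by rewrite /offS; case: excluded_middle_informative; lia.
have Hv k : vanish a (lam k) (offS S mu k).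
  rewrite /offS; case: excluded_middle_informative => Hk; last by apply: (proj2 (HS k)).
  by move=> c Hc j; apply: (supp_Op a 0) => //; lia.
set A := Series (fun n => INR (mu n) * rL lam n).
have HA : 0 <= A by apply: Series_ge0; [apply: wsum_term_ge0 | case: Hw].
have [M [HM0 HM]] := Qd_typezero lam (offS S mu) a (eps / (1 + A)) H0 Hd Hm
  (wsum_mono _ _ _ Hle Hw) Ha Ht Hv ltac:(apply: Rdiv_lt_0_compat; lra).
exists M; split=> // n K c Hn Hc.
have E := Qd_Op lam (offS S mu) a K (lam n) (mu n) c H0 Hd Ha Hv Hc.
rewrite (proj1 (HS n) Hn c Hc) in E.
have [hq _] := Qd_facts lam (offS S mu) a K H0 Hd Ha Hv.
have h := nb_Op _ (mu n) (lam n) _ hq (supp_Op (Pc (lF lam) (offS S mu) K) _ (lam n) _ Hc).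
rewrite -E in h; apply: Rle_trans h _; apply: Rmult_le_compat_r; first exact: nb_ge0.
apply: Rle_trans (HM _ K (rad_ge0 _ _)) _; apply: Rmult_le_compat_l => //.
apply: exp_mono.
have hp : 0 < Cmod (lam n) by apply/Cmod_gt_0.
have hmu : INR (mu n) <= A * Cmod (lam n).
  have := mu_rL_le lam mu Hw n; rewrite -/A /rL => h'.
  have -> : INR (mu n) = INR (mu n) * / Cmod (lam n) * Cmod (lam n) by field; lra.
  by apply: Rmult_le_compat_r; lra.
apply: (Rle_trans _ (eps / (1 + A) * ((1 + A) * Cmod (lam n)))).
  apply: Rmult_le_compat_l; last by lra.
  by apply: Rlt_le; apply: Rdiv_lt_0_compat; lra.
by apply: Req_le; field; lra.
Qed.

(** * Factors of the zeros in a lacunary set *)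

Lemma Op_Pc_add l m1 m2 m lam mu c K : (forall k, (m1 k + m2 k = m k)%nat) -> supp mu c ->
  Op (Pc l m K) lam c = Op (Pc l m1 K) lam (Op (Pc l m2 K) lam c).
Proof.
move=> H Hc; elim: K => [|K IH]; first by rewrite /= !Op_delta0.
have Hs n d : supp mu d -> supp mu (Nat.iter n (Lb (l K) lam) d).
  by move=> Hd; elim: n => [|n IHn] //=; apply: supp_Lb.
have H2 : supp mu (Op (Pc l m2 K) lam c) by apply: supp_Op.
rewrite /= !(Op_iter_lin _ mu) //; try exact: entS_Pc; last exact: Hs.
rewrite IH -H Nat.iter_add; congr (Nat.iter _ _ _).
elim: (m2 K) => [|n IHn] //=.
by rewrite IHn (Op_Lb _ mu) //; [apply: entS_Pc | apply: Hs].
Qed.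

Lemma nb_iter_Lb_ge n mu l lam c q : 0 <= q -> supp mu c ->
  q <= Cmod (1 - l * lam) - Cmod l * INR mu ->
  q ^ n * nb mu c <= nb mu (Nat.iter n (Lb l lam) c).
Proof.
move=> Hq Hc H; elim: n => [|n IH] /=; first by lra.
have Hs : supp mu (Nat.iter n (Lb l lam) c).
  by elim: n {IH} => [|n IHn] //=; apply: supp_Lb.
have h := nb_Lb_ge mu l lam _ Hs.
have h0 := nb_ge0 mu (Nat.iter n (Lb l lam) c).
apply: Rle_trans h; rewrite Rmult_assoc.
apply: (Rle_trans _ (q * nb mu (Nat.iter n (Lb l lam) c))); first exact: Rmult_le_compat_l.
exact: Rmult_le_compat_r.
Qed.

Lemma one_minus_ge_exp x : 0 <= x <= / 2 -> exp (- (2 * x)) <= 1 - x.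
Proof.
move=> Hx.
rewrite exp_Ropp; apply: (Rmult_le_reg_l (exp (2 * x))); first exact: exp_pos.
rewrite Rinv_r; last by apply: Rgt_not_eq; apply: exp_pos.
have := exp_ineq1_le (2 * x); nra.
Qed.

(** The factor of an index [K] in [S] is compared with [x = |lam n| / |lam K|]. By [nb_Lb_ge] and
    [mu n <= |lam n| / 2] it multiplies the norm at least by [|1 - lam n / lam K| - x/2]. This is at
    least 1 for earlier zeros, where [x >= 4], and at least [1 - 3x/2 >= exp (-3x)] for later ones,
    where [x <= 1/4]. *)
Lemma lacunary_lower lam mu (S : nat -> Prop) n K c :
  (forall n, lam n <> RtoC 0) ->
  (forall k, S k -> (k < n)%nat -> 4 * Cmod (lam k) <= Cmod (lam n)) ->
  (forall k, S k -> (n < k)%nat -> 4 * Cmod (lam n) <= Cmod (lam k)) ->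
  2 * INR (mu n) <= Cmod (lam n) -> supp (mu n) c ->
  wsum (rL lam) mu ->
  exp (- (3 * Cmod (lam n) * Series (fun k => INR (mu (n + k)%nat) * rL lam (n + k)%nat))) * nb (mu n) c <=
  nb (mu n) (Op (Pc (lF lam) (except (onS S mu) n) K) (lam n) c).
Proof.
move=> H0 Hl Hr Hmu Hc Hw.
have hp k : 0 < Cmod (lam k) by apply/Cmod_gt_0.
set m := except _ _.
(* Truncated subtraction makes this sum empty as long as [K <= n]: the earlier zeros cost
   nothing. *)
set T := fun K => Rsum (K - n) (fun k => INR (mu (n + k)%nat) * rL lam (n + k)%nat).
have HT : T K <= Series (fun k => INR (mu (n + k)%nat) * rL lam (n + k)%nat).
  apply: Rsum_le_Series; first by move=> k; apply: (wsum_term_ge0 _ _ Hw).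
  exact: (proj1 (ex_series_incr_n (V := R_NormedModule) (fun n => INR (mu n) * rL lam n) n) (proj2 Hw)).
apply: (Rle_trans _ (exp (- (3 * Cmod (lam n) * T K)) * nb (mu n) c)).
  apply: Rmult_le_compat_r; first exact: nb_ge0.
  by apply: exp_mono; have := hp n; nra.
elim: K {HT} => [|K IH].
  by rewrite /T /= Op_delta0 Rmult_0_r Ropp_0 exp_0; lra.
rewrite /= (Op_iter_lin _ (mu n)) //; last exact: entS_Pc.
set d := Op _ _ _ in IH *.
have Hd : supp (mu n) d by apply: supp_Op.
have Hd0 := nb_ge0 (mu n) d.
have e1 : Cmod (lF lam K) = / Cmod (lam K) by rewrite /lF Cmod_inv.
have hip := Rinv_0_lt_compat _ (hp K).
have hgeo : forall q, q = / Cmod (lam K) * Cmod (lam n) -> Cmod (lF lam K * lam n) = q.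
  by move=> q ->; rewrite Cmod_mult e1.
have hTS : T (Datatypes.S K) >= T K.
  apply: Rle_ge; apply: Rsum_mono; last by lia.
  by move=> k; apply: (wsum_term_ge0 _ _ Hw).
have hmono : exp (- (3 * Cmod (lam n) * T (Datatypes.S K))) * nb (mu n) c <= nb (mu n) d.
  apply: Rle_trans IH; apply: Rmult_le_compat_r; first exact: nb_ge0.
  by apply: exp_mono; have := hp n; nra.
rewrite {1}/m /except /onS; case: Nat.eqb_spec => [//|Hne].
case: excluded_middle_informative => [HS|//].
set x := / Cmod (lam K) * Cmod (lam n).
have hmx : Cmod (lF lam K) * INR (mu n) <= x / 2.
  rewrite e1 /x; apply: (Rle_trans _ (/ Cmod (lam K) * (Cmod (lam n) / 2))); last by apply: Req_le; field; have := hp K; lra.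
  by apply: Rmult_le_compat_l; lra.
have [Hlt|Hgt] : (K < n)%nat \/ (n < K)%nat by lia.
- have hx : 4 <= x.
    rewrite /x; apply: (Rle_trans _ (/ Cmod (lam K) * (4 * Cmod (lam K)))); first by apply: Req_le; field; have := hp K; lra.
    by apply: Rmult_le_compat_l; [lra | apply: Hl].
  have h1 : x - 1 <= Cmod (1 - lF lam K * lam n).
    have := Cmod_triangle (1 - lF lam K * lam n) (- (1)); rewrite Cmod_opp Cmod_1.
    replace (1 - lF lam K * lam n + - (1))%C with (- (lF lam K * lam n))%C by ring.
    by rewrite Cmod_opp (hgeo x) //; lra.
  apply: Rle_trans hmono _.
  have := nb_iter_Lb_ge (mu K) (mu n) (lF lam K) (lam n) d 1 ltac:(lra) Hd ltac:(lra).
  by rewrite pow1 Rmult_1_l.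
- have hx : 0 <= x <= / 4.
    split; first by rewrite /x; apply: Rmult_le_pos; [lra | apply: Cmod_ge_0].
    rewrite /x; apply: (Rle_trans _ (/ Cmod (lam K) * (Cmod (lam K) / 4))); last by apply: Req_le; field; have := hp K; lra.
    by apply: Rmult_le_compat_l; [lra | have := Hr K HS Hgt; lra].
  have h1 : 1 - x <= Cmod (1 - lF lam K * lam n).
    have := Cmod_triangle (1 - lF lam K * lam n) (lF lam K * lam n).
    replace (1 - lF lam K * lam n + lF lam K * lam n)%C with (RtoC 1) by ring.
    by rewrite Cmod_1 (hgeo x) //; lra.
  have h2 := one_minus_ge_exp (3 / 2 * x) ltac:(lra).
  have h3 := nb_iter_Lb_ge (mu K) (mu n) (lF lam K) (lam n) d (exp (- (2 * (3 / 2 * x))))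
     (Rlt_le _ _ (exp_pos _)) Hd ltac:(lra).
  apply: Rle_trans h3.
  have -> : T (Datatypes.S K) = T K + INR (mu K) * rL lam K.
    rewrite /T; have -> : (Datatypes.S K - n = Datatypes.S (K - n))%nat by lia.
    by rewrite RsumS; have -> : (n + (K - n) = K)%nat by lia.
  have -> : - (3 * Cmod (lam n) * (T K + INR (mu K) * rL lam K)) =
     INR (mu K) * (- (2 * (3 / 2 * x))) + - (3 * Cmod (lam n) * T K) by rewrite /x /rL; field; have := hp K; lra.
  rewrite exp_plus Rmult_assoc.
  have -> : exp (INR (mu K) * - (2 * (3 / 2 * x))) = exp (- (2 * (3 / 2 * x))) ^ mu K.
    elim: (mu K) => [|k IHk]; first by rewrite Rmult_0_l exp_0.
    by rewrite S_INR Rmult_plus_distr_r exp_plus IHk Rmult_1_l /=; ring.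
  apply: Rmult_le_compat_l; last exact: IH.
  by apply: pow_le; apply: Rlt_le; apply: exp_pos.
Qed.

Lemma except_le mu n k : (except mu n k <= mu k)%nat.
Proof. by rewrite /except; case: Nat.eqb; lia. Qed.

Lemma lF_rL lam : (forall n, lam n <> RtoC 0) -> (fun n => Cmod (lF lam n)) = rL lam.
Proof. by move=> H0; apply: functional_extensionality => n; apply: Cmod_lF. Qed.

(** The zeros other than [lam n] are split into those off [S] and the rest of [S], and each group
    may spend [eps/2]. The second costs [3 * Cmod (lam n)] times a tail, which is below [eps/6] for
    [n >= N]; for the other [n] the modulus is at most [R0], and the cost is a constant. *)
Lemma lower_bound_S lam mu (S : nat -> Prop) eps :
  (forall n, lam n <> RtoC 0) -> (forall n m, n <> m -> lam n <> lam m) ->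
  (forall n, Cmod (lam n) <= Cmod (lam (Datatypes.S n))) -> wsum (rL lam) mu ->
  interpC lam mu -> 0 < eps ->
  exists M, 0 <= M /\ forall n c, S n -> supp (mu n) c ->
    (forall k, S k -> (k < n)%nat -> 4 * Cmod (lam k) <= Cmod (lam n)) ->
    (forall k, S k -> (n < k)%nat -> 4 * Cmod (lam n) <= Cmod (lam k)) ->
    2 * INR (mu n) <= Cmod (lam n) ->
    nb (mu n) c <= M * exp (eps * Cmod (lam n)) * nb (mu n) (Op (Fi (lF lam) (except mu n)) (lam n) c).
Proof.
move=> H0 Hd Hm Hw Hi He.
have [M [HM0 HM]] := lower_bound_offS lam mu S (eps / 2) H0 Hd Hm Hw Hi ltac:(lra).
have Hterm := wsum_term_ge0 _ _ Hw.
have [N HN] := Series_tail_small _ (eps / 6) (proj2 Hw) Hterm ltac:(lra).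
set A := Series (fun n => INR (mu n) * rL lam n).
have HA : 0 <= A by apply: Series_ge0 => //; case: Hw.
set R0 := Cmod (lam N).
have HR0 : 0 <= R0 := Cmod_ge_0 _.
have Hmm k j : (k <= j)%nat -> Cmod (lam k) <= Cmod (lam j).
  by elim=> [|i _ IH]; [lra | have := Hm i; lra].
exists (M * exp (3 * R0 * A)); split.
  by apply: Rmult_le_pos => //; apply: Rlt_le; apply: exp_pos.
move=> n c Hn Hc H1 H2 H3.
have hl := Cmod_ge_0 (lam n).
set T := Series (fun k => INR (mu (n + k)%nat) * rL lam (n + k)%nat).
have hT : 3 * Cmod (lam n) * T <= 3 * R0 * A + eps / 2 * Cmod (lam n).
  have hT0 : 0 <= T.
    apply: Series_ge0 => [k|]; first exact: Hterm.
    exact: (proj1 (ex_series_incr_n (V := R_NormedModule) (fun n => INR (mu n) * rL lam n) n) (proj2 Hw)).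
  have [Hlt|Hge] : (n < N)%nat \/ (N <= n)%nat by lia.
  - have hTA : T <= A.
      have := Series_split _ n (proj2 Hw); rewrite -/T -/A.
      by have := Rsum_ge0 n _ (fun k _ => Hterm k); lra.
    have h := Hmm n N ltac:(lia); rewrite -/R0 in h.
    have : Cmod (lam n) * T <= R0 * A by apply: Rmult_le_compat.
    have : 0 <= eps / 2 * Cmod (lam n) by apply: Rmult_le_pos; lra.
    lra.
  - have h := HN n Hge; rewrite -/T in h.
    have : Cmod (lam n) * T <= Cmod (lam n) * (eps / 6) by apply: Rmult_le_compat_l; lra.
    have : 0 <= R0 * A by apply: Rmult_le_pos.
    lra.
(* The constant does not depend on [K], so the bound passes to the infinite product through
   [Op_Pc_lim]. *)
have key K : nb (mu n) c <= M * exp (3 * R0 * A) * exp (eps * Cmod (lam n)) *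
    nb (mu n) (Op (Pc (lF lam) (except mu n) K) (lam n) c).
  have h1 := HM n K c Hn Hc.
  have Hsum k : (except (onS S mu) n k + offS S mu k = except mu n k)%nat.
    rewrite /except /onS /offS; case: Nat.eqb_spec => [->|_]; case: excluded_middle_informative => // Hk; lia.
  rewrite (Op_Pc_add _ _ _ _ _ (mu n) c K Hsum) //.
  have hd : supp (mu n) (Op (Pc (lF lam) (offS S mu) K) (lam n) c) by apply: supp_Op.
  have h2 := lacunary_lower lam mu S n K _ H0 H1 H2 H3 hd Hw.
  rewrite -/T in h2.
  set x := nb (mu n) (Op (Pc (lF lam) (offS S mu) K) (lam n) c) in h1 h2 *.
  set y := nb (mu n) (Op _ _ _) in h2 *.
  have hx : x <= exp (3 * Cmod (lam n) * T) * y.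
    apply: (Rmult_le_reg_l (exp (- (3 * Cmod (lam n) * T)))); first exact: exp_pos.
    by rewrite -Rmult_assoc -exp_plus Rplus_opp_l exp_0 Rmult_1_l.
  have hy : 0 <= y := nb_ge0 _ _.
  have he : exp (3 * Cmod (lam n) * T) <= exp (3 * R0 * A) * exp (eps / 2 * Cmod (lam n)).
    by rewrite -exp_plus; apply: exp_mono.
  apply: Rle_trans h1 _.
  apply: (Rle_trans _ (M * exp (eps / 2 * Cmod (lam n)) * (exp (3 * R0 * A) * exp (eps / 2 * Cmod (lam n)) * y))).
    apply: Rmult_le_compat_l; first by apply: Rmult_le_pos => //; apply: Rlt_le; apply: exp_pos.
    by apply: Rle_trans hx _; apply: Rmult_le_compat_r.
  have -> : eps * Cmod (lam n) = eps / 2 * Cmod (lam n) + eps / 2 * Cmod (lam n) by field.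
  by rewrite exp_plus; apply: Req_le; ring.
set B := M * exp (3 * R0 * A) * exp (eps * Cmod (lam n)) in key *.
have Hw' : wsum (fun n => Cmod (lF lam n)) (except mu n).
  by rewrite lF_rL //; apply: wsum_mono Hw => k; apply: except_le.
have hl' k := Op_Pc_lim (lF lam) (except mu n) (mu n) (lam n) c k Hw' Hc.
case: (Req_dec B 0) => HB.
  by have := key 0%nat; rewrite HB !Rmult_0_l.
have HBp : 0 < B.
  have : 0 <= B.
    by apply: Rmult_le_pos; [apply: Rmult_le_pos => //|]; apply: Rlt_le; apply: exp_pos.
  by lra.
have := limC_nb_ge (mu n) _ _ (nb (mu n) c / B) hl' _.
have HBk K : nb (mu n) c / B <= nb (mu n) (Op (Pc (lF lam) (except mu n) K) (lam n) c).
  apply: (Rmult_le_reg_l B) => //; have := key K.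
  by have -> : B * (nb (mu n) c / B) = nb (mu n) c by field.
move=> /(_ HBk) h.
have -> : nb (mu n) c = B * (nb (mu n) c / B) by field.
by apply: Rmult_le_compat_l => //; lra.
Qed.

(** With [S] reduced to [n], the zeros off [S] are all zeros except [lam n]. The constant depends on
    [n]; the lemma handles the indices below [n0] in [block_lower_bound]. *)
Lemma lower_bound_single lam mu n eps :
  (forall n, lam n <> RtoC 0) -> (forall n m, n <> m -> lam n <> lam m) ->
  (forall n, Cmod (lam n) <= Cmod (lam (Datatypes.S n))) -> wsum (rL lam) mu ->
  interpC lam mu -> 0 < eps ->
  exists M, 0 <= M /\ forall c, supp (mu n) c ->
    nb (mu n) c <= M * nb (mu n) (Op (Fi (lF lam) (except mu n)) (lam n) c).
Proof.
move=> H0 Hd Hm Hw Hi He.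
have [M [HM0 HM]] := lower_bound_offS lam mu (fun k => k = n) eps H0 Hd Hm Hw Hi He.
have He0 := exp_pos (eps * Cmod (lam n)).
exists (M * exp (eps * Cmod (lam n))); split; first by apply: Rmult_le_pos; lra.
move=> c Hc.
have E : offS (fun k => k = n) mu = except mu n.
  apply: functional_extensionality => k; rewrite /offS /except.
  by case: Nat.eqb_spec; case: excluded_middle_informative.
rewrite E in HM.
set B := M * exp (eps * Cmod (lam n)) in HM *.
have Hw' : wsum (fun n => Cmod (lF lam n)) (except mu n).
  by rewrite lF_rL //; apply: wsum_mono Hw => k; apply: except_le.
have hl' k := Op_Pc_lim (lF lam) (except mu n) (mu n) (lam n) c k Hw' Hc.
have key K : nb (mu n) c <= B * nb (mu n) (Op (Pc (lF lam) (except mu n) K) (lam n) c) by apply: HM.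
have HB0 : 0 <= B by apply: Rmult_le_pos; lra.
case: (Req_dec B 0) => HB.
  by have := key 0%nat; rewrite HB !Rmult_0_l.
have HBk K : nb (mu n) c / B <= nb (mu n) (Op (Pc (lF lam) (except mu n) K) (lam n) c).
  apply: (Rmult_le_reg_l B); first by lra.
  by have -> : B * (nb (mu n) c / B) = nb (mu n) c by field.
have h := limC_nb_ge (mu n) _ _ (nb (mu n) c / B) hl' HBk.
have -> : nb (mu n) c = B * (nb (mu n) c / B) by field.
by apply: Rmult_le_compat_l => //; lra.
Qed.

Lemma mu_little_o lam mu eps : (forall n, lam n <> RtoC 0) -> wsum (rL lam) mu -> 0 < eps ->
  exists N, forall n, (N <= n)%nat -> INR (mu n) <= eps * Cmod (lam n).
Proof.
move=> H0 Hw He.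
have /is_lim_seq_spec /(_ (mkposreal _ He)) [N HN] := ex_series_lim_0 _ (proj2 Hw).
exists N => n Hn; have /= := HN n Hn; rewrite Rminus_0_r => /Rabs_def2 [h _].
have hp : 0 < Cmod (lam n) by apply/Cmod_gt_0.
have -> : INR (mu n) = INR (mu n) * rL lam n * Cmod (lam n) by rewrite /rL; field; lra.
by apply: Rmult_le_compat_r; lra.
Qed.

(* A failure of the bound would occur along a lacunary set [S] of indices, where
   [lower_bound_S] contradicts it. *)
Lemma block_lower_bound lam mu eps :
  (forall n, lam n <> RtoC 0) -> (forall n m, n <> m -> lam n <> lam m) ->
  (forall n, Cmod (lam n) <= Cmod (lam (S n))) -> is_lim_seq (fun n => Cmod (lam n)) p_infty ->
  wsum (rL lam) mu -> interpC lam mu -> 0 < eps ->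
  exists M, 0 <= M /\ forall n c, supp (mu n) c ->
    nb (mu n) c <= M * exp (eps * Cmod (lam n)) * nb (mu n) (Op (Fi (lF lam) (except mu n)) (lam n) c).
Proof.
move=> H0 Hd Hm Hinf Hw Hi He; apply: NNPP => Hno.
set F := fun n c => nb (mu n) (Op (Fi (lF lam) (except mu n)) (lam n) c).
set bad := fun (j n : nat) => exists c, supp (mu n) c /\ INR j * exp (eps * Cmod (lam n)) * F n c < nb (mu n) c.
have HF n c : 0 <= F n c := nb_ge0 _ _.
have Hexp n : 1 <= exp (eps * Cmod (lam n)).
  by rewrite -exp_0; apply: exp_mono; apply: Rmult_le_pos; [lra | apply: Cmod_ge_0].
(* If the bound held with constant [j] from [n0] on, the individual bounds for [n < n0] would
   complete it to a uniform one; the sum of their constants serves as a maximum. *)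
have Hbad : forall p : nat * nat, exists n, (fst p <= n)%nat /\ bad (snd p) n.
  move=> [n0 j] /=; apply: NNPP => Hnb; apply: Hno.
  have HC : forall n : nat, exists C : R, 0 <= C /\ forall c, supp (mu n) c -> nb (mu n) c <= C * F n c.
    by move=> n; apply: lower_bound_single Hi He.
  have [Cf HCf] : exists Cf : nat -> R, forall n, 0 <= Cf n /\ forall c, supp (mu n) c -> nb (mu n) c <= Cf n * F n c.
    exists (fun n => proj1_sig (constructive_indefinite_description _ (HC n))) => n.
    exact: (proj2_sig (constructive_indefinite_description _ (HC n))).
  exists (INR j + Rsum n0 Cf).
  have hR : 0 <= Rsum n0 Cf by apply: Rsum_ge0 => n _; apply: (proj1 (HCf n)).
  have hj := pos_INR j.
  split; first by lra.
  move=> n c Hc; rewrite -/(F n c).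
  have h1 := Hexp n; have h2 := HF n c.
  have [Hlt|Hge] : (n < n0)%nat \/ (n0 <= n)%nat by lia.
  - apply: Rle_trans (proj2 (HCf n) c Hc) _; apply: Rmult_le_compat_r => //.
    have h3 := Rsum_term_le n0 Cf n (fun k _ => proj1 (HCf k)) Hlt.
    have h4 := proj1 (HCf n); nra.
  - apply: Rnot_lt_le => Hlt; apply: Hnb; exists n; split=> //; exists c; split=> //.
    apply: Rle_lt_trans Hlt; apply: Rmult_le_compat_r => //.
    by apply: Rmult_le_compat_r; lra.
have Hthr : forall k, exists n, (k < n)%nat /\ forall m, (n <= m)%nat -> 4 * Cmod (lam k) <= Cmod (lam m).
  move=> k; move/is_lim_seq_spec: Hinf => /(_ (4 * Cmod (lam k))) [N HN].
  exists (N + S k)%nat; split; first by lia.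
  by move=> m Hm'; apply: Rlt_le; apply: HN; lia.
have [n1 Hn1] := mu_little_o lam mu (/ 2) H0 Hw ltac:(lra).
set pick := fun p => proj1_sig (constructive_indefinite_description _ (Hbad p)).
set thr := fun k => proj1_sig (constructive_indefinite_description _ (Hthr k)).
have Hpick p : (fst p <= pick p)%nat /\ bad (snd p) (pick p)
  := proj2_sig (constructive_indefinite_description _ (Hbad p)).
have Hthr' k : (k < thr k)%nat /\ forall m, (thr k <= m)%nat -> 4 * Cmod (lam k) <= Cmod (lam m)
  := proj2_sig (constructive_indefinite_description _ (Hthr k)).
(* The [j]-th index violates the bound with constant [j] and lies beyond the threshold that makes
   its modulus at least four times that of its predecessor. *)
set s := fix s (j : nat) : nat := match j with O => pick (n1, O) | S j' => pick (thr (s j'), S j') end.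
have Hs_bad j : bad j (s j) by case: j => [|j]; apply: (proj2 (Hpick _)).
have Hs_thr j : (thr (s j) <= s (S j))%nat by apply: (proj1 (Hpick (thr (s j), S j))).
have Hs_inc j : (s j < s (S j))%nat by have := Hs_thr j; have := proj1 (Hthr' (s j)); lia.
have Hs_lt i j : (i < j)%nat -> (s (S i) <= s j)%nat.
  by elim=> [|m _ IH]; [lia | have := Hs_inc m; lia].
have Hs_ge j : (n1 <= s j)%nat.
  elim: j => [|j IH]; last by have := Hs_inc j; lia.
  exact: (proj1 (Hpick (n1, O))).
have Hs_lac i j : (i < j)%nat -> (s i < s j)%nat /\ 4 * Cmod (lam (s i)) <= Cmod (lam (s j)).
  move=> Hij; have h1 := Hs_lt i j Hij; have h2 := Hs_inc i; split; first by lia.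
  by apply: (proj2 (Hthr' (s i))); have := Hs_thr i; lia.
have Hs_inv i j : (s i < s j)%nat -> (i < j)%nat.
  move=> Hij; have [//|[E|Hji]] : (i < j)%nat \/ i = j \/ (j < i)%nat by lia.
  - by rewrite E in Hij; lia.
  - by have := proj1 (Hs_lac j i Hji); lia.
(* On this set there is a single constant [M], which any [j > M] contradicts. *)
have [M [HM0 HM]] := lower_bound_S lam mu (fun n => exists j, n = s j) eps H0 Hd Hm Hw Hi He.
have [j Hj] := INR_archimed 1 M Rlt_0_1; rewrite Rmult_1_r in Hj.
have [c [Hc Hlt]] := Hs_bad j.
have h := HM (s j) c (ex_intro _ j eq_refl) Hc _ _ _.
have : nb (mu (s j)) c <= M * exp (eps * Cmod (lam (s j))) * F (s j) c.
  apply: h.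
  - by move=> k [i ->] Hk; apply: (proj2 (Hs_lac i j (Hs_inv _ _ Hk))).
  - by move=> k [i ->] Hk; apply: (proj2 (Hs_lac j i (Hs_inv _ _ Hk))).
  - by have := Hn1 (s j) (Hs_ge j); lra.
have : M * exp (eps * Cmod (lam (s j))) * F (s j) c <= INR j * exp (eps * Cmod (lam (s j))) * F (s j) c.
  apply: Rmult_le_compat_r => //; apply: Rmult_le_compat_r; last by lra.
  by have := Hexp (s j); lra.
lra.
Qed.

(** * Goursat's lemma and Cauchy's formula *)

Lemma nested_point (a b : nat -> R) :
  (forall n, a n <= a (S n)) -> (forall n, b (S n) <= b n) -> (forall n, a n <= b n) ->
  exists x, forall n, a n <= x <= b n.
Proof.
move=> Ha Hb Hab.
have Hbm n m : (n <= m)%nat -> b m <= b n.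
  by elim=> [|k _ IH]; [lra | have := Hb k; lra].
have Ham n m : (n <= m)%nat -> a n <= a m.
  by elim=> [|k _ IH]; [lra | have := Ha k; lra].
have [x Hx] : ex_finite_lim_seq a.
  apply: (ex_finite_lim_seq_incr _ (b 0%nat)) => // n.
  by have := Hab n; have := Hbm 0%nat n ltac:(lia); lra.
exists x => n; split; first by apply: (is_lim_seq_incr_compare a x Hx Ha n).
apply: (is_lim_seq_le (fun k => a (k + n)%nat) (fun _ => b n) x (b n)).
- by move=> k; have := Hab (k + n)%nat; have := Hbm n (k + n)%nat ltac:(lia); lra.
- by apply/(is_lim_seq_incr_n a).
- exact: is_lim_seq_const.
Qed.

Record rect := Rect { rs1 : R; rs2 : R; rt1 : R; rt2 : R }.

Definition rect_ok (q : rect) := rs1 q <= rs2 q /\ rt1 q <= rt2 q.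

Definition half_of (q q' : rect) :=
  rect_ok q' /\ rs1 q <= rs1 q' /\ rs2 q' <= rs2 q /\ rt1 q <= rt1 q' /\ rt2 q' <= rt2 q /\
  rs2 q' - rs1 q' = (rs2 q - rs1 q) / 2 /\ rt2 q' - rt1 q' = (rt2 q - rt1 q) / 2.

(** Stated for an additive function of rectangles, because the form to be integrated lives on
    rectangles in the coordinates [(s, t)] and not in the plane of [f]. Along repeated bisections a
    nonzero value decreases no faster than the area, against the local estimate at the common
    point. *)
Lemma goursat (m : rect -> C) (q0 : rect) :
  rect_ok q0 ->
  (forall s1 s s2 t1 t2, m (Rect s1 s2 t1 t2) = (m (Rect s1 s t1 t2) + m (Rect s s2 t1 t2))%C) ->
  (forall s1 s2 t1 t t2, m (Rect s1 s2 t1 t2) = (m (Rect s1 s2 t1 t) + m (Rect s1 s2 t t2))%C) ->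
  (forall s t, rs1 q0 <= s <= rs2 q0 -> rt1 q0 <= t <= rt2 q0 ->
    forall eps, 0 < eps -> exists d, 0 < d /\ forall q, rect_ok q ->
      rs1 q0 <= rs1 q -> rs2 q <= rs2 q0 -> rt1 q0 <= rt1 q -> rt2 q <= rt2 q0 ->
      rs1 q <= s <= rs2 q -> rt1 q <= t <= rt2 q -> rs2 q - rs1 q < d -> rt2 q - rt1 q < d ->
      Cmod (m q) <= eps * (rs2 q - rs1 q + (rt2 q - rt1 q)) ^ 2) ->
  m q0 = RtoC 0.
Proof.
move=> Hq0 Hs Ht Hloc; apply: NNPP => Hne.
have Hp : 0 < Cmod (m q0) by apply/Cmod_gt_0.
(* The hypothesis [rect_ok] sits under the existential, so that the choice function is defined on
   all rectangles. *)
have Hstep : forall q, exists q', rect_ok q -> half_of q q' /\ Cmod (m q) <= 4 * Cmod (m q').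
  move=> [s1 s2 t1 t2].
  case: (excluded_middle_informative (rect_ok (Rect s1 s2 t1 t2))) => [[/= h1 h2]|h]; last by exists (Rect s1 s2 t1 t2).
  set s := (s1 + s2) / 2; set t := (t1 + t2) / 2.
  have E := Hs s1 s s2 t1 t2; rewrite (Ht s1 s t1 t t2) (Ht s s2 t1 t t2) in E.
  apply: NNPP => Hno.
  have hq q' : half_of (Rect s1 s2 t1 t2) q' -> Cmod (m q') < Cmod (m (Rect s1 s2 t1 t2)) / 4.
    move=> Hh; apply: Rnot_le_lt => Hle; apply: Hno; exists q' => _; split=> //; lra.
  have a1 := hq (Rect s1 s t1 t); have a2 := hq (Rect s1 s t t2).
  have a3 := hq (Rect s s2 t1 t); have a4 := hq (Rect s s2 t t2).
  rewrite /half_of /rect_ok /= in a1 a2 a3 a4.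
  have b1 := a1 ltac:(rewrite /s /t; lra); have b2 := a2 ltac:(rewrite /s /t; lra).
  have b3 := a3 ltac:(rewrite /s /t; lra); have b4 := a4 ltac:(rewrite /s /t; lra).
  have := Cmod_triangle (m (Rect s1 s t1 t) + m (Rect s1 s t t2)) (m (Rect s s2 t1 t) + m (Rect s s2 t t2)).
  have := Cmod_triangle (m (Rect s1 s t1 t)) (m (Rect s1 s t t2)).
  have := Cmod_triangle (m (Rect s s2 t1 t)) (m (Rect s s2 t t2)).
  rewrite -E; lra.
set nxt := fun q => proj1_sig (constructive_indefinite_description _ (Hstep q)).
have Hnxt q : rect_ok q -> half_of q (nxt q) /\ Cmod (m q) <= 4 * Cmod (m (nxt q))
  := proj2_sig (constructive_indefinite_description _ (Hstep q)).
set Q := fun n => Nat.iter n nxt q0.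
have Hok n : rect_ok (Q n).
  by elim: n => [|n IH] //=; have [[h _] _] := Hnxt _ IH.
have HQ n := Hnxt _ (Hok n).
have [s Hs'] := nested_point (fun n => rs1 (Q n)) (fun n => rs2 (Q n))
  ltac:(move=> n; have [[_ h] _] := HQ n; rewrite /Q /=; tauto)
  ltac:(move=> n; have [[_ h] _] := HQ n; rewrite /Q /=; tauto)
  ltac:(move=> n; have [h _] := Hok n; exact h).
have [t Ht'] := nested_point (fun n => rt1 (Q n)) (fun n => rt2 (Q n))
  ltac:(move=> n; have [[_ h] _] := HQ n; rewrite /Q /=; tauto)
  ltac:(move=> n; have [[_ h] _] := HQ n; rewrite /Q /=; tauto)
  ltac:(move=> n; have [_ h] := Hok n; exact h).
have Hsub n : rs1 q0 <= rs1 (Q n) /\ rs2 (Q n) <= rs2 q0 /\ rt1 q0 <= rt1 (Q n) /\ rt2 (Q n) <= rt2 q0.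
  elim: n => [|n IH]; first by rewrite /Q /=; lra.
  by have [[_ h] _] := HQ n; rewrite /Q /= -/(Q n); lra.
set a := rs2 q0 - rs1 q0; set b := rt2 q0 - rt1 q0.
have Hsize n : rs2 (Q n) - rs1 (Q n) = a * (/ 2) ^ n /\ rt2 (Q n) - rt1 (Q n) = b * (/ 2) ^ n.
  elim: n => [|n [IH1 IH2]]; first by rewrite /Q /= /a /b; lra.
  have [[_ h] _] := HQ n; rewrite /Q /= -/(Q n).
  by move: h; rewrite IH1 IH2; set x := (/ 2) ^ n; lra.
have Hbig n : Cmod (m q0) * (/ 4) ^ n <= Cmod (m (Q n)).
  elim: n => [|n IH]; first by rewrite /Q /=; lra.
  by have [_ h] := HQ n; rewrite /Q /= -/(Q n); lra.
have [Ha Hb] : 0 <= a /\ 0 <= b by case: Hq0; rewrite /a /b; lra.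
(* Chosen so that [eps * (a + b) ^ 2 < Cmod (m q0)]; the summand 1 covers a rectangle reduced to a
   point. *)
set eps := Cmod (m q0) / (2 * ((a + b) ^ 2 + 1)).
have Hab : 0 <= (a + b) ^ 2 by apply: pow_le; lra.
have He : 0 < eps by apply: Rdiv_lt_0_compat; lra.
have [d [Hd0 Hd]] := Hloc s t (Hs' 0%nat) (Ht' 0%nat) eps He.
have [n Hn] : exists n, (a + b) * (/ 2) ^ n < d.
  have hd : 0 < d / (a + b + 1) by apply: Rdiv_lt_0_compat; lra.
  have [N HN] := pow_lt_1_zero (/ 2) ltac:(rewrite Rabs_pos_eq; lra) _ hd.
  exists N; have := HN N (Nat.le_refl _); rewrite Rabs_pos_eq; last by apply: pow_le; lra.
  have hx : 0 <= (/ 2) ^ N by apply: pow_le; lra.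
  move=> h; apply: (Rle_lt_trans _ ((a + b + 1) * (/ 2) ^ N)); first by nra.
  apply: (Rlt_le_trans _ ((a + b + 1) * (d / (a + b + 1)))); first by apply: Rmult_lt_compat_l; lra.
  by apply: Req_le; field; lra.
have [h1 [h2 [h3 h4]]] := Hsub n; have [e1 e2] := Hsize n.
have hx : 0 <= (/ 2) ^ n by apply: pow_le; lra.
have h := Hd (Q n) (Hok n) h1 h2 h3 h4 (Hs' n) (Ht' n) ltac:(rewrite e1; nra) ltac:(rewrite e2; nra).
rewrite e1 e2 in h.
have e4 : (a * (/ 2) ^ n + b * (/ 2) ^ n) ^ 2 = (a + b) ^ 2 * (/ 4) ^ n.
  have -> : (/ 4) ^ n = ((/ 2) ^ n) ^ 2 by elim: (n) => [|k IH] /=; [ring | rewrite IH /=; field].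
  ring.
rewrite e4 in h.
have hb := Hbig n.
have h4n : 0 < (/ 4) ^ n by apply: pow_lt; lra.
have : Cmod (m q0) <= eps * (a + b) ^ 2.
  by apply: (Rmult_le_reg_r ((/ 4) ^ n)) => //; lra.
have : eps * (a + b) ^ 2 < Cmod (m q0).
  apply: (Rle_lt_trans _ (eps * ((a + b) ^ 2 + 1))); first by nra.
  have -> : eps * ((a + b) ^ 2 + 1) = Cmod (m q0) / 2 by rewrite /eps; field; lra.
  lra.
lra.
Qed.

(** * Integrals of complex-valued functions of a real variable *)

Definition contR (g : R -> C) := forall t, continuous (fun t => Re (g t)) t /\ continuous (fun t => Im (g t)) t.

Definition CI (g : R -> C) (a b : R) : C :=
  (RInt (fun t => Re (g t)) a b, RInt (fun t => Im (g t)) a b).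

Lemma contR_ext g h : (forall t, g t = h t) -> contR g -> contR h.
Proof. by move=> H Hg; have <- : g = h by apply: functional_extensionality. Qed.

Lemma contR_const c : contR (fun _ => c).
Proof. by move=> t; split; apply: continuous_const. Qed.

Lemma contR_plus g h : contR g -> contR h -> contR (fun t => g t + h t)%C.
Proof.
move=> Hg Hh t; have [h1 h2] := Hg t; have [h3 h4] := Hh t.
by split; apply: (continuous_plus (V := R_NormedModule)).
Qed.

Lemma contR_mult g h : contR g -> contR h -> contR (fun t => g t * h t)%C.
Proof.
move=> Hg Hh t; have [h1 h2] := Hg t; have [h3 h4] := Hh t.
split; [apply: (continuous_minus (V := R_NormedModule)) | apply: (continuous_plus (V := R_NormedModule))];
  by apply: (continuous_mult (K := R_AbsRing)).
Qed.

Lemma Csqr_pos (z : C) : z <> RtoC 0 -> fst z ^ 2 + snd z ^ 2 <> 0.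
Proof.
case: z => x y Hz /= H; apply: Hz; congr pair.
- by apply: Rsqr_0_uniq; rewrite /Rsqr; nra.
- by apply: Rsqr_0_uniq; rewrite /Rsqr; nra.
Qed.

Lemma contR_inv g : contR g -> (forall t, g t <> RtoC 0) -> contR (fun t => / g t)%C.
Proof.
move=> Hg Hn t; have [h1 h2] := Hg t.
have hq : continuous (fun t => / (fst (g t) ^ 2 + snd (g t) ^ 2)) t.
  apply: continuous_Rinv_comp; last exact: Csqr_pos.
  apply: (continuous_plus (V := R_NormedModule)).
  - apply: (continuous_mult (K := R_AbsRing)) => //.
    by apply: (continuous_mult (K := R_AbsRing)) => //; apply: continuous_const.
  - apply: (continuous_mult (K := R_AbsRing)) => //.
    by apply: (continuous_mult (K := R_AbsRing)) => //; apply: continuous_const.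
split; apply: (continuous_mult (K := R_AbsRing)) => //.
exact: (continuous_opp (V := R_NormedModule)).
Qed.

Lemma contR_pow g n : contR g -> contR (fun t => g t ^ n)%C.
Proof. by move=> Hg; elim: n => [|n IH] /=; [apply: contR_const | apply: contR_mult]. Qed.

Lemma continuous_eps (g : R -> R) t :
  continuous g t <-> forall eps, 0 < eps -> exists d, 0 < d /\ forall t', Rabs (t' - t) < d -> Rabs (g t' - g t) < eps.
Proof.
split.
- move=> /filterlim_locally H eps He; have [d Hd] := H (mkposreal _ He).
  by exists d; split; [apply: cond_pos | move=> t' Ht'; apply: Hd].
- move=> H; apply/filterlim_locally => eps.
  have [d [Hd0 Hd]] := H eps (cond_pos eps).
  by exists (mkposreal _ Hd0) => t' Ht'; apply: Hd.
Qed.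

Lemma contR_eps g :
  contR g <-> forall t eps, 0 < eps -> exists d, 0 < d /\ forall t', Rabs (t' - t) < d -> Cmod (g t' - g t) < eps.
Proof.
split.
- move=> H t eps He; have [/continuous_eps h1 /continuous_eps h2] := H t.
  have [d1 [Hd1 H1]] := h1 (eps / 2) ltac:(lra).
  have [d2 [Hd2 H2]] := h2 (eps / 2) ltac:(lra).
  exists (Rmin d1 d2); split; first exact: Rmin_pos.
  move=> t' Ht'; have := Rmin_l d1 d2; have := Rmin_r d1 d2 => a1 a2.
  apply: Rle_lt_trans (Cmod_Rabs_le _) _.
  have := H1 t' ltac:(lra); have := H2 t' ltac:(lra).
  have -> : Re (g t' - g t) = Re (g t') - Re (g t) by [].
  by have -> : Im (g t' - g t) = Im (g t') - Im (g t) by []; lra.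
- move=> H t; split; apply/continuous_eps => eps He; have [d [Hd0 Hd]] := H t eps He; exists d; split=> // t' Ht'.
  + by apply: Rle_lt_trans (Hd t' Ht'); have := re_le_Cmod (g t' - g t).
  + by apply: Rle_lt_trans (Hd t' Ht'); have := im_le_Cmod (g t' - g t).
Qed.

Lemma CD_cont f z : (exists l, CD f z l) ->
  forall eps, 0 < eps -> exists d, 0 < d /\ forall h, Cmod h < d -> Cmod (f (z + h) - f z)%C < eps.
Proof.
move=> [l Hl] eps He; have [d [Hd0 Hd]] := Hl 1 Rlt_0_1.
have hl := Cmod_ge_0 l.
exists (Rmin d (eps / (Cmod l + 2))); split.
  by apply: Rmin_pos => //; apply: Rdiv_lt_0_compat; lra.
move=> h Hh; have := Rmin_l d (eps / (Cmod l + 2)); have := Rmin_r d (eps / (Cmod l + 2)) => a1 a2.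
have h0 := Cmod_ge_0 h.
have := Hd h ltac:(lra); have := Cmod_triangle (f (z + h)%C - f z - h * l) (h * l).
replace (f (z + h)%C - f z - h * l + h * l)%C with (f (z + h)%C - f z)%C by ring.
rewrite Cmod_mult => b1 b2.
have b3 : Cmod h * (Cmod l + 2) < eps.
  apply: (Rlt_le_trans _ (eps / (Cmod l + 2) * (Cmod l + 2))); first by apply: Rmult_lt_compat_r; lra.
  by apply: Req_le; field; lra.
nra.
Qed.

Lemma contR_comp f g : (forall z, exists l, CD f z l) -> contR g -> contR (fun t => f (g t)).
Proof.
move=> Hf /contR_eps Hg; apply/contR_eps => t eps He.
have [d [Hd0 Hd]] := CD_cont f (g t) (Hf (g t)) eps He.
have [d' [Hd0' Hd']] := Hg t d Hd0.
exists d'; split=> // t' Ht'.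
have := Hd _ (Hd' t' Ht').
by replace (g t + (g t' - g t))%C with (g t') by ring.
Qed.

Lemma ex_CI_re g a b : contR g -> ex_RInt (fun t => Re (g t)) a b.
Proof. by move=> H; apply: (ex_RInt_continuous (V := R_CompleteNormedModule)) => t _; apply: (proj1 (H t)). Qed.

Lemma ex_CI_im g a b : contR g -> ex_RInt (fun t => Im (g t)) a b.
Proof. by move=> H; apply: (ex_RInt_continuous (V := R_CompleteNormedModule)) => t _; apply: (proj2 (H t)). Qed.

Lemma CI_ext g h a b : (forall t, g t = h t) -> CI g a b = CI h a b.
Proof. by move=> H; have -> : g = h by apply: functional_extensionality. Qed.

Lemma CI_plus g h a b : contR g -> contR h -> CI (fun t => g t + h t)%C a b = (CI g a b + CI h a b)%C.
Proof.
move=> Hg Hh; rewrite /CI /Cplus /=; congr pair.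
- by rewrite -[RHS](RInt_plus (V := R_CompleteNormedModule)); [|apply: ex_CI_re|apply: ex_CI_re].
- by rewrite -[RHS](RInt_plus (V := R_CompleteNormedModule)); [|apply: ex_CI_im|apply: ex_CI_im].
Qed.

Lemma CI_scal c g a b : contR g -> CI (fun t => c * g t)%C a b = (c * CI g a b)%C.
Proof.
move=> Hg; rewrite /CI /Cmult /=; congr pair.
- have e1 := RInt_scal (V := R_CompleteNormedModule) (fun t => Re (g t)) a b (fst c) (ex_CI_re g a b Hg).
  have e2 := RInt_scal (V := R_CompleteNormedModule) (fun t => Im (g t)) a b (snd c) (ex_CI_im g a b Hg).
  rewrite /scal /= /mult /= in e1 e2; rewrite -e1 -e2.
  rewrite -[RHS](RInt_minus (V := R_CompleteNormedModule)) //.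
  + exact: (ex_RInt_scal (V := R_NormedModule)) (ex_CI_re g a b Hg).
  + exact: (ex_RInt_scal (V := R_NormedModule)) (ex_CI_im g a b Hg).
- have e1 := RInt_scal (V := R_CompleteNormedModule) (fun t => Im (g t)) a b (fst c) (ex_CI_im g a b Hg).
  have e2 := RInt_scal (V := R_CompleteNormedModule) (fun t => Re (g t)) a b (snd c) (ex_CI_re g a b Hg).
  rewrite /scal /= /mult /= in e1 e2; rewrite -e1 -e2.
  rewrite -[RHS](RInt_plus (V := R_CompleteNormedModule)) //.
  + exact: (ex_RInt_scal (V := R_NormedModule)) (ex_CI_im g a b Hg).
  + exact: (ex_RInt_scal (V := R_NormedModule)) (ex_CI_re g a b Hg).
Qed.

Lemma CI_Chasles g a b c : contR g -> CI g a c = (CI g a b + CI g b c)%C.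
Proof.
move=> Hg; rewrite /CI /Cplus /=; congr pair.
- by rewrite -[LHS](RInt_Chasles (V := R_CompleteNormedModule) _ a b c); [|apply: ex_CI_re|apply: ex_CI_re].
- by rewrite -[LHS](RInt_Chasles (V := R_CompleteNormedModule) _ a b c); [|apply: ex_CI_im|apply: ex_CI_im].
Qed.

Lemma CI_bound g a b B : a <= b -> contR g -> (forall t, a <= t <= b -> Cmod (g t) <= B) ->
  Cmod (CI g a b) <= 2 * (b - a) * B.
Proof.
move=> Hab Hg HB; apply: Rle_trans (Cmod_Rabs_le _) _; rewrite /CI /=.
have h1 := abs_RInt_le_const (fun t => Re (g t)) a b B Hab (ex_CI_re g a b Hg).
have h2 := abs_RInt_le_const (fun t => Im (g t)) a b B Hab (ex_CI_im g a b Hg).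
have := h1 (fun t Ht => Rle_trans _ _ _ (re_le_Cmod (g t)) (HB t Ht)).
have := h2 (fun t Ht => Rle_trans _ _ _ (im_le_Cmod (g t)) (HB t Ht)).
lra.
Qed.

Lemma CI_derive (G g : R -> C) a b : contR g ->
  (forall t, is_derive (fun t => Re (G t)) t (Re (g t))) ->
  (forall t, is_derive (fun t => Im (G t)) t (Im (g t))) -> CI g a b = (G b - G a)%C.
Proof.
move=> Hg H1 H2; rewrite /CI /Cminus /Cplus /Copp /=; congr pair; apply: is_RInt_unique.
- apply: (is_RInt_derive (V := R_CompleteNormedModule) (fun t => Re (G t))) => t _ //; apply: (proj1 (Hg t)).
- apply: (is_RInt_derive (V := R_CompleteNormedModule) (fun t => Im (G t))) => t _ //; apply: (proj2 (Hg t)).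
Qed.

(* Cauchy's formula for [z] inside the circle [zeta] is obtained from the annulus
   [w = z + e^s (zeta(t) - z)], whose logarithmic form [dw / (w - z)] is [ds + kern dt];
   [Mu] is the integral of [Phi dw / (w - z)] along the boundary of a rectangle in [(s, t)]. *)
Definition zeta (rho t : R) : C := (RtoC rho * (cos t, sin t))%C.
Definition izeta (rho t : R) : C := (RtoC (/ rho) * (cos t, - sin t)%R)%C.
Definition kern (rho : R) (z : C) (t : R) : C := (Ci / (1 - z * izeta rho t))%C.
Definition Wpt (rho : R) (z : C) (s t : R) : C := (z + RtoC (exp s) * (zeta rho t - z))%C.

Lemma Cmod_cis t : Cmod (cos t, sin t) = 1.
Proof.
rewrite /Cmod /= !Rmult_1_r -[RHS]sqrt_1; congr sqrt.
by have := sin2_cos2 t; rewrite /Rsqr; lra.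
Qed.

Lemma Cmod_cis_conj t : Cmod (cos t, - sin t) = 1.
Proof. by have := Cmod_conj (cos t, sin t); rewrite Cmod_cis. Qed.

Lemma Cmod_zeta rho t : 0 < rho -> Cmod (zeta rho t) = rho.
Proof. by move=> H; rewrite /zeta Cmod_mult Cmod_cis Cmod_R Rabs_pos_eq; lra. Qed.

Lemma Cmod_izeta rho t : 0 < rho -> Cmod (izeta rho t) = / rho.
Proof.
move=> H; have := Rinv_0_lt_compat _ H => H'.
by rewrite /izeta Cmod_mult Cmod_cis_conj Cmod_R Rabs_pos_eq; lra.
Qed.

Lemma zeta_izeta rho t : 0 < rho -> (zeta rho t * izeta rho t)%C = RtoC 1.
Proof.
move=> H; rewrite /zeta /izeta.
have -> : (RtoC rho * (cos t, sin t) * (RtoC (/ rho) * (cos t, - sin t)%R))%C =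
  (RtoC rho * RtoC (/ rho) * ((cos t, sin t) * (cos t, - sin t)%R))%C by ring.
have -> : ((cos t, sin t) * (cos t, - sin t)%R)%C = RtoC 1.
  by rewrite /Cmult /RtoC /=; congr pair; [have := sin2_cos2 t; rewrite /Rsqr; lra | ring].
by rewrite -RtoC_mult Rinv_r; [ring | lra].
Qed.

Lemma contR_cis : contR (fun t => (cos t, sin t)).
Proof. by move=> t; split; [apply: continuous_cos | apply: continuous_sin]. Qed.

Lemma contR_cis_conj : contR (fun t => (cos t, - sin t)).
Proof.
move=> t; split; first exact: continuous_cos.
by apply: (continuous_opp (V := R_NormedModule)); apply: continuous_sin.
Qed.

Lemma contR_zeta rho : contR (zeta rho).
Proof. by apply: contR_mult; [apply: contR_const | apply: contR_cis]. Qed.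

Lemma contR_izeta rho : contR (izeta rho).
Proof. by apply: contR_mult; [apply: contR_const | apply: contR_cis_conj]. Qed.

Lemma contR_exp : contR (fun s => RtoC (exp s)).
Proof. by move=> t; split; [apply: continuous_exp | apply: continuous_const]. Qed.

Lemma contR_W1 rho z s : contR (Wpt rho z s).
Proof.
apply: contR_plus; first exact: contR_const.
apply: contR_mult; first exact: contR_const.
by apply: contR_plus; [apply: contR_zeta | apply: contR_const].
Qed.

Lemma contR_W2 rho z t : contR (fun s => Wpt rho z s t).
Proof.
apply: contR_plus; first exact: contR_const.
by apply: contR_mult; [apply: contR_exp | apply: contR_const].
Qed.

Lemma kern_den rho z t : 0 < rho -> Cmod z < rho -> 1 - Cmod z / rho <= Cmod (1 - z * izeta rho t).
Proof.
move=> H Hz; have := Cmod_triangle (1 - z * izeta rho t) (z * izeta rho t).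
replace (1 - z * izeta rho t + z * izeta rho t)%C with (RtoC 1) by ring.
rewrite Cmod_1 Cmod_mult Cmod_izeta //; rewrite /Rdiv; lra.
Qed.

Lemma ratio_lt1 rho z : 0 < rho -> Cmod z < rho -> 0 <= Cmod z / rho < 1.
Proof.
move=> H Hz; split; first by apply: Rdiv_le_0_compat => //; apply: Cmod_ge_0.
by apply: (Rmult_lt_reg_r rho) => //; rewrite /Rdiv Rmult_assoc Rinv_l; lra.
Qed.

Lemma kern_neq0 rho z t : 0 < rho -> Cmod z < rho -> (1 - z * izeta rho t)%C <> RtoC 0.
Proof.
move=> H Hz; apply/Cmod_gt_0; have := kern_den rho z t H Hz; have := ratio_lt1 rho z H Hz; lra.
Qed.

Lemma contR_kern rho z : 0 < rho -> Cmod z < rho -> contR (kern rho z).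
Proof.
move=> H Hz; apply: contR_mult; first exact: contR_const.
apply: contR_inv; last by move=> t; apply: kern_neq0.
apply: contR_plus; first exact: contR_const.
apply: (contR_ext (fun t => (- z) * izeta rho t)%C); first by move=> t; ring.
by apply: contR_mult; [apply: contR_const | apply: contR_izeta].
Qed.

Lemma kern_bound rho z t : 0 < rho -> Cmod z < rho -> Cmod (kern rho z t) <= / (1 - Cmod z / rho).
Proof.
move=> H Hz; rewrite /kern Cmod_div; last exact: kern_neq0.
have h1 := kern_den rho z t H Hz; have h2 := ratio_lt1 rho z H Hz.
rewrite Cmod_Ci /Rdiv Rmult_1_l; apply: Rinv_le_contravar => //; lra.
Qed.

Lemma kern_geom rho z t : 0 < rho -> Cmod z < rho ->
  kern rho z t = (Ci + z * izeta rho t * kern rho z t)%C.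
Proof. by move=> H Hz; rewrite /kern; field; apply: kern_neq0. Qed.

Lemma kern_zeta rho z t : 0 < rho -> Cmod z < rho -> ((zeta rho t - z) * kern rho z t)%C = (Ci * zeta rho t)%C.
Proof.
move=> H Hz; have e := zeta_izeta rho t H.
have -> : (zeta rho t - z)%C = (zeta rho t * (1 - z * izeta rho t))%C.
  have -> : (zeta rho t * (1 - z * izeta rho t) = zeta rho t - z * (zeta rho t * izeta rho t))%C by ring.
  by rewrite e; ring.
by rewrite /kern; field; apply: kern_neq0.
Qed.

Definition Mu (rho : R) (z : C) (Phi : R -> R -> C) (q : rect) : C :=
  (CI (fun s => Phi s (rt1 q)) (rs1 q) (rs2 q) + CI (fun t => Phi (rs2 q) t * kern rho z t) (rt1 q) (rt2 q)
   - CI (fun s => Phi s (rt2 q)) (rs1 q) (rs2 q) - CI (fun t => Phi (rs1 q) t * kern rho z t) (rt1 q) (rt2 q))%C.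

(** The sides of a rectangle are parallel to the axes, so separate continuity is what the integrals
    in [Mu] require. *)
Definition sepc (Phi : R -> R -> C) := (forall s, contR (Phi s)) /\ (forall t, contR (fun s => Phi s t)).

Lemma Mu_plus rho z Phi Psi q : 0 < rho -> Cmod z < rho -> sepc Phi -> sepc Psi ->
  Mu rho z (fun s t => Phi s t + Psi s t)%C q = (Mu rho z Phi q + Mu rho z Psi q)%C.
Proof.
move=> H Hz [h1 h2] [h3 h4]; have hk := contR_kern rho z H Hz; rewrite /Mu.
rewrite !CI_plus //.
have e s : CI (fun t => (Phi s t + Psi s t) * kern rho z t)%C (rt1 q) (rt2 q) =
   (CI (fun t => Phi s t * kern rho z t) (rt1 q) (rt2 q) + CI (fun t => Psi s t * kern rho z t) (rt1 q) (rt2 q))%C.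
  rewrite -CI_plus; [|exact: contR_mult|exact: contR_mult].
  by apply: CI_ext => t; ring.
by rewrite !e; ring.
Qed.

(** For a constant, opposite sides cancel because [kern] does not depend on [s]. For the linear
    part, [kern_zeta] shows that the form is [be] times the differential of
    [exp s * (zeta t - z)]. *)
Lemma Mu_affine rho z al be q : 0 < rho -> Cmod z < rho ->
  Mu rho z (fun s t => al + be * (RtoC (exp s) * (zeta rho t - z)))%C q = RtoC 0.
Proof.
move=> H Hz; have hk := contR_kern rho z H Hz.
have Hs : sepc (fun s t => be * (RtoC (exp s) * (zeta rho t - z)))%C.
  split=> [s|t]; (apply: contR_mult; first exact: contR_const); apply: contR_mult.
  - exact: contR_const.
  - by apply: contR_plus; [apply: contR_zeta | apply: contR_const].
  - exact: contR_exp.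
  - exact: contR_const.
rewrite (Mu_plus _ _ (fun _ _ => al)) //; last by split=> ?; apply: contR_const.
rewrite {1}/Mu.
have e1 t a b : CI (fun s => be * (RtoC (exp s) * (zeta rho t - z)))%C a b =
   (be * (zeta rho t - z) * (RtoC (exp b) - RtoC (exp a)))%C.
  rewrite (CI_ext _ (fun s => (be * (zeta rho t - z)) * RtoC (exp s))%C); last by move=> s; ring.
  rewrite CI_scal; last exact: contR_exp.
  congr (_ * _)%C; apply: (CI_derive (fun s => RtoC (exp s))); first exact: contR_exp.
  - by move=> s; apply: is_derive_exp.
  - by move=> s /=; apply: (is_derive_const (V := R_NormedModule)).
have e2 s a b : CI (fun t => be * (RtoC (exp s) * (zeta rho t - z)) * kern rho z t)%C a b =
   (be * RtoC (exp s) * (zeta rho b - zeta rho a))%C.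
  rewrite (CI_ext _ (fun t => (be * RtoC (exp s)) * (Ci * zeta rho t))%C); last first.
    by move=> t; rewrite -(kern_zeta rho z t H Hz); ring.
  have hc : contR (fun t => Ci * zeta rho t)%C.
    by apply: contR_mult; [apply: contR_const | apply: contR_zeta].
  rewrite CI_scal //; congr (_ * _)%C; apply: CI_derive => // t; rewrite /zeta /Ci /Cmult /RtoC /Re /Im /=.
  - by auto_derive => //; ring.
  - by auto_derive => //; ring.
rewrite /Mu !e1 !e2; ring.
Qed.

Lemma Mu_bound rho z Phi q B : 0 < rho -> Cmod z < rho -> sepc Phi -> rect_ok q ->
  (forall s t, rs1 q <= s <= rs2 q -> rt1 q <= t <= rt2 q -> Cmod (Phi s t) <= B) ->
  Cmod (Mu rho z Phi q) <= 4 * (1 + / (1 - Cmod z / rho)) * B * (rs2 q - rs1 q + (rt2 q - rt1 q)).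
Proof.
move=> H Hz [h1 h2] [Hq1 Hq2] HB; have hk := contR_kern rho z H Hz.
set K := / (1 - Cmod z / rho).
have HK : 0 < K by apply: Rinv_0_lt_compat; have := ratio_lt1 rho z H Hz; lra.
have HB0 : 0 <= B by apply: Rle_trans (Cmod_ge_0 _) (HB (rs1 q) (rt1 q) _ _); lra.
have a1 := CI_bound _ _ _ B Hq1 (h2 (rt1 q)) (fun s Hs => HB s (rt1 q) Hs ltac:(lra)).
have a2 := CI_bound _ _ _ B Hq1 (h2 (rt2 q)) (fun s Hs => HB s (rt2 q) Hs ltac:(lra)).
have hb s t : rs1 q <= s <= rs2 q -> rt1 q <= t <= rt2 q -> Cmod (Phi s t * kern rho z t) <= B * K.
  move=> Hs Ht; rewrite Cmod_mult; apply: Rmult_le_compat; [exact: Cmod_ge_0|exact: Cmod_ge_0|exact: HB|exact: kern_bound].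
have a3 := CI_bound _ _ _ (B * K) Hq2 (contR_mult _ _ (h1 (rs1 q)) hk) (fun t Ht => hb (rs1 q) t ltac:(lra) Ht).
have a4 := CI_bound _ _ _ (B * K) Hq2 (contR_mult _ _ (h1 (rs2 q)) hk) (fun t Ht => hb (rs2 q) t ltac:(lra) Ht).
rewrite /Mu; set x1 := CI _ _ _ in a1 *; set x2 := CI _ _ _ in a2 *; set x3 := CI _ _ _ in a3 *; set x4 := CI _ _ _ in a4 *.
have t1 := Cmod_triangle (x1 + x4 - x2) (- x3); have t2 := Cmod_triangle (x1 + x4) (- x2).
have t3 := Cmod_triangle x1 x4; rewrite !Cmod_opp in t1 t2.
rewrite /Cminus in t1 t2 *.
have p1 : 0 <= (rs2 q - rs1 q) * (B * K) by apply: Rmult_le_pos; [lra | nra].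
have p2 : 0 <= (rt2 q - rt1 q) * B by apply: Rmult_le_pos; lra.
lra.
Qed.

Lemma exp_lip a b : a <= 0 -> b <= 0 -> Rabs (exp a - exp b) <= Rabs (a - b).
Proof.
have h x y : x <= y -> y <= 0 -> 0 <= exp y - exp x <= y - x.
  move=> Hxy Hy; have h1 := exp_mono _ _ Hxy.
  have h2 : exp y <= 1 by rewrite -exp_0; apply: exp_mono.
  have h3 : exp x = exp y * exp (x - y) by rewrite -exp_plus; congr exp; ring.
  have h4 := exp_ineq1_le (x - y).
  have h5 := exp_pos y.
  by split; [lra | rewrite h3; nra].
move=> Ha Hb; case: (Rle_dec a b) => Hab.
- have := h a b Hab Hb; rewrite (Rabs_left1 (a - b)); last by lra.
  by move=> ?; rewrite Rabs_left1; lra.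
- have := h b a ltac:(lra) Ha; rewrite (Rabs_pos_eq (a - b)); last by lra.
  by move=> ?; rewrite Rabs_pos_eq; lra.
Qed.

Lemma lip_of_derive (f df : R -> R) a b : (forall t, is_derive f t (df t)) -> (forall t, Rabs (df t) <= 1) ->
  Rabs (f b - f a) <= Rabs (b - a).
Proof.
move=> H Hd.
have [c [_ ->]] := MVT_gen f a b df (fun x _ => H x)
  (fun x _ => proj2 (continuity_pt_filterlim f x) (ex_derive_continuous f x (ex_intro _ _ (H x)))).
by rewrite Rabs_mult; have := Hd c; have := Rabs_pos (b - a); nra.
Qed.

Lemma zeta_lip rho a b : 0 < rho -> Cmod (zeta rho b - zeta rho a) <= 2 * rho * Rabs (b - a).
Proof.
move=> H.
have -> : (zeta rho b - zeta rho a)%C = (RtoC rho * (cos b - cos a, sin b - sin a)%R)%C.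
  by rewrite /zeta /Cmult /Cminus /Cplus /Copp /RtoC /=; congr pair; ring.
rewrite Cmod_mult Cmod_R Rabs_pos_eq; last by lra.
have h1 : Rabs (cos b - cos a) <= Rabs (b - a).
  apply: (lip_of_derive cos (fun t => - sin t)) => t; first exact: is_derive_cos.
  by rewrite Rabs_Ropp; apply: Rabs_le; have := SIN_bound t; lra.
have h2 : Rabs (sin b - sin a) <= Rabs (b - a).
  apply: (lip_of_derive sin cos) => t; first exact: is_derive_sin.
  by apply: Rabs_le; have := COS_bound t; lra.
have := Cmod_Rabs_le (cos b - cos a, sin b - sin a)%R; rewrite /=; nra.
Qed.

Lemma zeta_sub_bound rho z t : 0 < rho -> Cmod z < rho -> Cmod (zeta rho t - z) <= 2 * rho.
Proof.
move=> H Hz; have := Cmod_triangle (zeta rho t) (- z); rewrite Cmod_opp Cmod_zeta // /Cminus; lra.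
Qed.

Lemma W_lip rho z s t s' t' : 0 < rho -> Cmod z < rho -> s <= 0 -> s' <= 0 ->
  Cmod (Wpt rho z s' t' - Wpt rho z s t) <= 2 * rho * (Rabs (s' - s) + Rabs (t' - t)).
Proof.
move=> H Hz Hs Hs'.
have -> : (Wpt rho z s' t' - Wpt rho z s t)%C =
  (RtoC (exp s' - exp s) * (zeta rho t' - z) + RtoC (exp s) * (zeta rho t' - zeta rho t))%C.
  by rewrite /Wpt RtoC_minus; ring.
apply: Rle_trans (Cmod_triangle _ _) _; rewrite !Cmod_mult !Cmod_R.
have h1 := exp_lip s' s Hs' Hs; have h2 := zeta_sub_bound rho z t' H Hz; have h3 := zeta_lip rho t t' H.
have h4 : Rabs (exp s) <= 1.
  rewrite Rabs_pos_eq; last by apply: Rlt_le; apply: exp_pos.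
  by rewrite -exp_0; apply: exp_mono.
have a1 : Rabs (exp s' - exp s) * Cmod (zeta rho t' - z) <= Rabs (s' - s) * (2 * rho).
  by apply: Rmult_le_compat => //; [apply: Rabs_pos | apply: Cmod_ge_0].
have a2 : Rabs (exp s) * Cmod (zeta rho t' - zeta rho t) <= 1 * (2 * rho * Rabs (t' - t)).
  by apply: Rmult_le_compat => //; [apply: Rabs_pos | apply: Cmod_ge_0].
lra.
Qed.

Lemma sepc_fW f rho z : (forall w, exists l, CD f w l) -> sepc (fun s t => f (Wpt rho z s t)).
Proof.
move=> Hf; split=> [s|t]; apply: contR_comp => //; [exact: contR_W1 | exact: contR_W2].
Qed.

(** Near a point, [f] is affine up to [e' * |w - w0|]. The affine part contributes 0, and the error
    contributes at most a constant times the square of the half perimeter, as [goursat] requires.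
    The restriction [s0 <= 0] makes [exp], hence [Wpt], Lipschitz with a uniform constant. *)
Lemma Mu_f_zero f rho z s0 : (forall w, exists l, CD f w l) -> 0 < rho -> Cmod z < rho -> s0 <= 0 ->
  Mu rho z (fun s t => f (Wpt rho z s t)) (Rect s0 0 0 (2 * PI)) = RtoC 0.
Proof.
move=> Hf H Hz Hs0; have hk := contR_kern rho z H Hz.
have [c1 c2] := sepc_fW f rho z Hf.
apply: (goursat (Mu rho z (fun s t => f (Wpt rho z s t)))).
- by split=> //=; have := PI_RGT_0; lra.
- move=> s1 s s2 t1 t2; rewrite /Mu /= (CI_Chasles (fun s => f (Wpt rho z s t1)) s1 s s2) //.
  by rewrite (CI_Chasles (fun s => f (Wpt rho z s t2)) s1 s s2) //; ring.
- move=> s1 s2 t1 t t2; rewrite /Mu /=.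
  rewrite (CI_Chasles (fun t => f (Wpt rho z s1 t) * kern rho z t)%C t1 t t2); last exact: contR_mult.
  by rewrite (CI_Chasles (fun t => f (Wpt rho z s2 t) * kern rho z t)%C t1 t t2); [ring | exact: contR_mult].
move=> s t Hs Ht eps He /=; rewrite /= in Hs Ht.
have [l Hl] := Hf (Wpt rho z s t).
set K := 4 * (1 + / (1 - Cmod z / rho)).
have HK : 4 <= K.
  have : 0 < / (1 - Cmod z / rho) by apply: Rinv_0_lt_compat; have := ratio_lt1 rho z H Hz; lra.
  by rewrite /K; lra.
set L := 2 * rho.
set e' := eps / (K * L).
have HL : 0 < L by rewrite /L; lra.
have He' : 0 < e' by apply: Rdiv_lt_0_compat => //; apply: Rmult_lt_0_compat; lra.
have [d [Hd0 Hd]] := Hl e' He'.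
exists (d / (2 * L)); split; first by apply: Rdiv_lt_0_compat; lra.
move=> q [Hq1 Hq2] b1 b2 b3 b4 Hsq Htq Hsz1 Hsz2.
set w0 := Wpt rho z s t in Hl Hd.
set al := (f w0 - l * (w0 - z))%C.
set sg := rs2 q - rs1 q + (rt2 q - rt1 q).
have Hsg : sg < d / L.
  have -> : d / L = d / (2 * L) + d / (2 * L) by field; lra.
  by rewrite /sg; lra.
have sA : sepc (fun s t => al + l * (RtoC (exp s) * (zeta rho t - z)))%C.
  split=> [s'|t']; (apply: contR_plus; first exact: contR_const); (apply: contR_mult; first exact: contR_const); apply: contR_mult.
  - exact: contR_const.
  - by apply: contR_plus; [apply: contR_zeta | apply: contR_const].
  - exact: contR_exp.
  - exact: contR_const.
set Er := (fun s t => f (Wpt rho z s t) + - (1) * (al + l * (RtoC (exp s) * (zeta rho t - z))))%C.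
have sE : sepc Er.
  split=> [s'|t']; apply: contR_plus; try exact: c1; try exact: c2.
  - by apply: contR_mult; [apply: contR_const | apply: (proj1 sA)].
  - by apply: contR_mult; [apply: contR_const | apply: (proj2 sA)].
have -> : Mu rho z (fun s t => f (Wpt rho z s t)) q = Mu rho z Er q.
  rewrite -[RHS]Cplus_0_r -(Mu_affine rho z al l q H Hz) -Mu_plus //.
  congr (Mu rho z _ q); apply: functional_extensionality => s'; apply: functional_extensionality => t'.
  by rewrite /Er; ring.
apply: Rle_trans (Mu_bound rho z Er q (e' * (L * sg)) H Hz sE (conj Hq1 Hq2) _) _; last first.
  rewrite -/sg -/K; apply: Req_le; rewrite /e'; field; lra.
move=> s' t' Hs' Ht'.
have hw : Cmod (Wpt rho z s' t' - w0) <= L * sg.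
  apply: Rle_trans (W_lip rho z s t s' t' H Hz ltac:(lra) ltac:(lra)) _.
  apply: Rmult_le_compat_l; first by lra.
  have : Rabs (s' - s) <= rs2 q - rs1 q by apply: Rabs_le; lra.
  have : Rabs (t' - t) <= rt2 q - rt1 q by apply: Rabs_le; lra.
  by rewrite /sg; lra.
have hwd : Cmod (Wpt rho z s' t' - w0) < d.
  apply: Rle_lt_trans hw _.
  apply: (Rlt_le_trans _ (L * (d / L))); first by apply: Rmult_lt_compat_l.
  by apply: Req_le; field; lra.
have := Hd _ hwd.
replace (w0 + (Wpt rho z s' t' - w0))%C with (Wpt rho z s' t') by ring.
have -> : (f (Wpt rho z s' t') - f w0 - (Wpt rho z s' t' - w0) * l)%C = Er s' t'.
  by rewrite /Er /al /Wpt; ring.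
move=> h; apply: Rle_trans h _; apply: Rmult_le_compat_l; lra.
Qed.

Lemma zeta_2PI rho : zeta rho (2 * PI) = zeta rho 0.
Proof. by rewrite /zeta cos_2PI sin_2PI cos_0 sin_0. Qed.

Lemma W_at_0 rho z t : Wpt rho z 0 t = zeta rho t.
Proof. by rewrite /Wpt exp_0; ring. Qed.

(** The sides [t = 0] and [t = 2 * PI] cancel by periodicity, so the integral along the curve
    [Wpt rho z s] is the same for all [s <= 0]. As [s] tends to minus infinity the curve shrinks to
    [z]. *)
Lemma kern_formula f rho z : (forall w, exists l, CD f w l) -> 0 < rho -> Cmod z < rho ->
  CI (fun t => f (zeta rho t) * kern rho z t)%C 0 (2 * PI) = (f z * CI (kern rho z) 0 (2 * PI))%C.
Proof.
move=> Hf H Hz; have hk := contR_kern rho z H Hz.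
have [c1 c2] := sepc_fW f rho z Hf.
have HPI := PI_RGT_0.
set J := fun s => CI (fun t => f (Wpt rho z s t) * kern rho z t)%C 0 (2 * PI).
have HJ s : s <= 0 -> J s = J 0.
  move=> Hs; have := Mu_f_zero f rho z s Hf H Hz Hs; rewrite /Mu /= -/(J s) -/(J 0).
  have -> : CI (fun s => f (Wpt rho z s (2 * PI))) s 0 = CI (fun s => f (Wpt rho z s 0)) s 0.
    by apply: CI_ext => u; rewrite /Wpt zeta_2PI.
  set x := CI _ _ _ => E.
  have -> : J s = (J s + (x + J 0 - x - J s))%C by rewrite E; ring.
  ring.
have -> : CI (fun t => f (zeta rho t) * kern rho z t)%C 0 (2 * PI) = J 0.
  by apply: CI_ext => t; rewrite W_at_0.
set K := / (1 - Cmod z / rho).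
have HK : 0 < K by apply: Rinv_0_lt_compat; have := ratio_lt1 rho z H Hz; lra.
(* Equality by way of a constant sequence: the difference is below every [eps], with [s] depending
   on [eps]. *)
apply: (limC_unique (fun _ => J 0)); first exact: limC_const.
move=> eps He.
set e' := eps / (2 * (2 * PI) * K + 1).
have hpk : 0 < 2 * (2 * PI) * K by apply: Rmult_lt_0_compat; lra.
have He' : 0 < e' by apply: Rdiv_lt_0_compat; lra.
have [d [Hd0 Hd]] := CD_cont f z (Hf z) e' He'.
exists 0%nat => n _.
set s := Rmin 0 (ln (d / (2 * rho + 1))) - 1.
have Hs : s <= 0 by rewrite /s; have := Rmin_l 0 (ln (d / (2 * rho + 1))); lra.
have Hes : exp s * (2 * rho) < d.
  have hd : 0 < d / (2 * rho + 1) by apply: Rdiv_lt_0_compat; lra.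
  have h : exp s < d / (2 * rho + 1).
    rewrite -[X in _ < X]exp_ln //; apply: exp_increasing.
    by rewrite /s; have := Rmin_r 0 (ln (d / (2 * rho + 1))); lra.
  apply: (Rle_lt_trans _ (d / (2 * rho + 1) * (2 * rho))); first by apply: Rmult_le_compat_r; lra.
  apply: (Rlt_le_trans _ (d / (2 * rho + 1) * (2 * rho + 1))); first by apply: Rmult_lt_compat_l; lra.
  by apply: Req_le; field; lra.
rewrite -(HJ s Hs) /J.
have cE : contR (fun t => f (Wpt rho z s t) + - f z)%C by apply: contR_plus; [apply: c1 | apply: contR_const].
have -> : (CI (fun t => f (Wpt rho z s t) * kern rho z t) 0 (2 * PI) - f z * CI (kern rho z) 0 (2 * PI))%C
   = CI (fun t => (f (Wpt rho z s t) + - f z) * kern rho z t)%C 0 (2 * PI).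
  have -> : CI (fun t => (f (Wpt rho z s t) + - f z) * kern rho z t)%C 0 (2 * PI) =
     CI (fun t => f (Wpt rho z s t) * kern rho z t + (- f z) * kern rho z t)%C 0 (2 * PI).
    by apply: CI_ext => t; ring.
  rewrite CI_plus; [|by apply: contR_mult => //; apply: c1|by apply: contR_mult => //; apply: contR_const].
  by rewrite CI_scal //; ring.
apply: Rle_lt_trans (CI_bound _ 0 (2 * PI) (e' * K) ltac:(lra) (contR_mult _ _ cE hk) _) _.
  move=> t _; rewrite Cmod_mult; apply: Rmult_le_compat; [exact: Cmod_ge_0|exact: Cmod_ge_0| |exact: kern_bound].
  have := Hd (RtoC (exp s) * (zeta rho t - z))%C; rewrite /Wpt /Cminus => h; apply: Rlt_le; apply: h.
  rewrite Cmod_mult Cmod_R Rabs_pos_eq; last by apply: Rlt_le; apply: exp_pos.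
  apply: Rle_lt_trans Hes; apply: Rmult_le_compat_l; first by apply: Rlt_le; apply: exp_pos.
  exact: zeta_sub_bound.
have -> : 2 * (2 * PI - 0) * (e' * K) = (2 * (2 * PI) * K) * e' by ring.
apply: (Rlt_le_trans _ ((2 * (2 * PI) * K + 1) * e')); first by apply: Rmult_lt_compat_r; lra.
by apply: Req_le; rewrite /e'; field; lra.
Qed.

(** * Power series from the Cauchy kernel *)

Lemma kern_expand g rho z M : contR g -> 0 < rho -> Cmod z < rho ->
  CI (fun t => g t * kern rho z t)%C 0 (2 * PI) =
  (Ci * Csum M (fun m => CI (fun t => g t * izeta rho t ^ m) 0 (2 * PI) * z ^ m)
   + CI (fun t => g t * (z * izeta rho t) ^ M * kern rho z t) 0 (2 * PI))%C.
Proof.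
move=> Hg H Hz; have hk := contR_kern rho z H Hz; have hi := contR_izeta rho.
elim: M => [|M IH].
  rewrite /= Cmult_0_r Cplus_0_l; apply: CI_ext => t /=; ring.
rewrite IH.
have hzi : contR (fun t => z * izeta rho t)%C by apply: contR_mult => //; apply: contR_const.
have -> : CI (fun t => g t * (z * izeta rho t) ^ M * kern rho z t)%C 0 (2 * PI) =
   CI (fun t => (Ci * z ^ M) * (g t * izeta rho t ^ M) + g t * (z * izeta rho t) ^ S M * kern rho z t)%C 0 (2 * PI).
  apply: CI_ext => t; rewrite {1}(kern_geom rho z t H Hz).
  have -> : ((z * izeta rho t) ^ S M = z * izeta rho t * (z * izeta rho t) ^ M)%C by [].
  rewrite Cpow_mult_l; ring.
rewrite CI_plus; last 2 first.
- by apply: contR_mult; [apply: contR_const | apply: contR_mult => //; apply: contR_pow].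
- by apply: contR_mult => //; apply: contR_mult => //; apply: (contR_pow _ (S M)).
rewrite CI_scal; last by apply: contR_mult => //; apply: contR_pow.
rewrite [Csum (S M) _]/=; ring.
Qed.

Lemma kern_series g rho z B : contR g -> 0 < rho -> Cmod z < rho -> (forall t, Cmod (g t) <= B) ->
  limC (fun M => Ci * Csum M (fun m => CI (fun t => g t * izeta rho t ^ m) 0 (2 * PI) * z ^ m))%C
       (CI (fun t => g t * kern rho z t)%C 0 (2 * PI)).
Proof.
move=> Hg H Hz HB eps He; have hk := contR_kern rho z H Hz; have hi := contR_izeta rho.
have HPI := PI_RGT_0.
have hr := ratio_lt1 rho z H Hz.
set K := / (1 - Cmod z / rho).
have HK : 0 < K by apply: Rinv_0_lt_compat; lra.
have HB0 : 0 <= B by apply: Rle_trans (Cmod_ge_0 _) (HB 0).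
set D := 2 * (2 * PI) * (B * K).
have HD : 0 <= D by apply: Rmult_le_pos; [lra | apply: Rmult_le_pos; lra].
have [N HN] := pow_lt_1_zero (Cmod z / rho) ltac:(rewrite Rabs_pos_eq; lra) (eps / (D + 1))
   ltac:(apply: Rdiv_lt_0_compat; lra).
exists N => n Hn; rewrite (kern_expand g rho z n) //.
set x := (Ci * _)%C; set y := CI _ _ _.
replace (x - (x + y))%C with (- y)%C by ring.
rewrite Cmod_opp.
have hzi : contR (fun t => z * izeta rho t)%C by apply: contR_mult => //; apply: contR_const.
have hq : 0 <= (Cmod z / rho) ^ n by apply: pow_le; lra.
apply: (Rle_lt_trans _ (2 * (2 * PI - 0) * (B * (Cmod z / rho) ^ n * K))).
  apply: CI_bound; first by lra.
  - by apply: contR_mult => //; apply: contR_mult => //; apply: contR_pow.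
  - move=> t _; rewrite (Cmod_mult (g t * _)) (Cmod_mult (g t)) Cmod_pow Cmod_mult Cmod_izeta //.
    apply: Rmult_le_compat; [|exact: Cmod_ge_0| |exact: kern_bound].
    + by apply: Rmult_le_pos; [apply: Cmod_ge_0 | exact: hq].
    + by apply: Rmult_le_compat_r.
have := HN n Hn; rewrite Rabs_pos_eq // => h.
have -> : 2 * (2 * PI - 0) * (B * (Cmod z / rho) ^ n * K) = D * (Cmod z / rho) ^ n by rewrite /D; ring.
apply: (Rle_lt_trans _ ((D + 1) * (Cmod z / rho) ^ n)); first by nra.
apply: (Rlt_le_trans _ ((D + 1) * (eps / (D + 1)))); first by apply: Rmult_lt_compat_l; lra.
by apply: Req_le; field; lra.
Qed.

Definition cisc (t : R) : C := (cos t, - sin t).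

Lemma cisc_pow t m : (cisc t ^ m)%C = cisc (INR m * t).
Proof.
elim: m => [|m IH]; first by rewrite /= /cisc Rmult_0_l cos_0 sin_0 Ropp_0.
have -> : (cisc t ^ S m)%C = (cisc t * cisc t ^ m)%C by [].
by rewrite IH S_INR Rmult_plus_distr_r Rmult_1_l /cisc cos_plus sin_plus /Cmult /=; congr pair; ring.
Qed.

Lemma CI_izeta_pow rho m : 0 < rho ->
  CI (fun t => 1 * izeta rho t ^ m)%C 0 (2 * PI) = RtoC (match m with O => 2 * PI | S _ => 0 end).
Proof.
move=> H; case: m => [|m].
  rewrite (CI_ext _ (fun _ => RtoC 1)); last by move=> t /=; ring.
  rewrite /CI /= !RInt_const /scal /= /mult /= /RtoC; congr pair; ring.
set p := INR (S m).
have Hp : p <> 0 by apply: not_0_INR.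
rewrite (CI_ext _ (fun t => RtoC ((/ rho) ^ S m) * cisc (p * t))%C); last first.
  by move=> t; rewrite /izeta -/(cisc t) Cpow_mult_l cisc_pow -/p RtoC_pow; ring.
have hc : contR (fun t => cisc (p * t)).
  move=> t; split.
  - have h : ex_derive (fun t => cos (p * t)) t by auto_derive.
    exact: (ex_derive_continuous (V := R_NormedModule)) h.
  - have h : ex_derive (fun t => - sin (p * t)) t by auto_derive.
    exact: (ex_derive_continuous (V := R_NormedModule)) h.
rewrite CI_scal //.
rewrite (CI_derive (fun t => ((sin (p * t) / p, cos (p * t) / p)%R : C))) //; last 2 first.
- by move=> t; rewrite /=; auto_derive => //; field.
- by move=> t; rewrite /=; auto_derive => //; field.
have e1 : sin (p * (2 * PI)) = sin 0.
  have -> : p * (2 * PI) = 0 + 2 * INR (S m) * PI by rewrite /p; ring.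
  exact: sin_period.
have e2 : cos (p * (2 * PI)) = cos 0.
  have -> : p * (2 * PI) = 0 + 2 * INR (S m) * PI by rewrite /p; ring.
  exact: cos_period.
by rewrite e1 e2 Rmult_0_r; ring.
Qed.

(** The expansion of the kernel against the function 1: by periodicity only the constant term has a
    nonzero integral. *)
Lemma CI_kern rho z : 0 < rho -> Cmod z < rho -> CI (kern rho z) 0 (2 * PI) = (Ci * RtoC (2 * PI))%C.
Proof.
move=> H Hz.
have -> : CI (kern rho z) 0 (2 * PI) = CI (fun t => 1 * kern rho z t)%C 0 (2 * PI).
  by apply: CI_ext => t; ring.
apply: limC_unique (kern_series (fun _ => RtoC 1) rho z 1 (contR_const _) H Hz _) _.
  by move=> t; rewrite Cmod_1; lra.
apply: (limC_eventually (fun _ => Ci * RtoC (2 * PI))%C _ _ 1); last exact: limC_const.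
move=> n Hn; congr (Ci * _)%C; case: n Hn => [|n] Hn; first by lia.
rewrite Csum_incr CI_izeta_pow // [(z ^ 0)%C]/= Csum_zero; first by ring.
by move=> m _; rewrite CI_izeta_pow //; ring.
Qed.

(** The constant 2 stems from [CI_bound]. At this stage the coefficients may depend on [rho];
    [series_identity] will show that they do not. *)
Lemma local_series f rho B : (forall w, exists l, CD f w l) -> 0 < rho ->
  (forall z, Cmod z = rho -> Cmod (f z) <= B) ->
  exists a, (forall m, Cmod (a m) * rho ^ m <= 2 * B) /\
    forall z, Cmod z < rho -> limC (fun M => Csum M (fun m => a m * z ^ m)%C) (f z).
Proof.
move=> Hf H HB; have HPI := PI_RGT_0.
have Hg : contR (fun t => f (zeta rho t)) by apply: contR_comp => //; apply: contR_zeta.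
have HBg t : Cmod (f (zeta rho t)) <= B by apply: HB; apply: Cmod_zeta.
set A := fun m => CI (fun t => f (zeta rho t) * izeta rho t ^ m)%C 0 (2 * PI).
have H2 : RtoC (2 * PI) <> RtoC 0 by move=> /RtoC_inj; lra.
have Hinv : Cmod (/ RtoC (2 * PI)) = / (2 * PI) by rewrite Cmod_inv // Cmod_R Rabs_pos_eq //; lra.
exists (fun m => A m / RtoC (2 * PI))%C; split.
- move=> m; rewrite /Cdiv Cmod_mult Hinv.
  have hr : 0 < rho ^ m by apply: pow_lt.
  have : Cmod (A m) <= 2 * (2 * PI - 0) * (B * (/ rho) ^ m).
    apply: CI_bound; first by lra.
    + by apply: contR_mult => //; apply: contR_pow; apply: contR_izeta.
    + move=> t _; rewrite Cmod_mult Cmod_pow Cmod_izeta //; apply: Rmult_le_compat_r => //.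
      by apply: pow_le; apply: Rlt_le; apply: Rinv_0_lt_compat.
  move=> h; apply: (Rle_trans _ (2 * (2 * PI - 0) * (B * (/ rho) ^ m) * / (2 * PI) * rho ^ m)).
    apply: Rmult_le_compat_r; first by lra.
    by apply: Rmult_le_compat_r => //; apply: Rlt_le; apply: Rinv_0_lt_compat; lra.
  by rewrite pow_inv; apply: Req_le; field; split; lra.
- move=> z Hz.
  have h := kern_series _ rho z B Hg H Hz HBg.
  rewrite kern_formula // CI_kern // in h.
  have hCi : Ci <> RtoC 0 by apply/Cmod_gt_0; rewrite Cmod_Ci; lra.
  have := limC_scal (/ (Ci * RtoC (2 * PI)))%C _ _ h.
  have -> : (/ (Ci * RtoC (2 * PI)) * (f z * (Ci * RtoC (2 * PI))))%C = f z by field.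
  apply: limC_ext => n.
  have -> : (/ (Ci * RtoC (2 * PI)) * (Ci * Csum n (fun m => A m * z ^ m)))%C = (/ RtoC (2 * PI) * Csum n (fun m => A m * z ^ m))%C by field.
  by rewrite -Csum_scal; apply: Csum_ext => m _; rewrite /Cdiv; ring.
Qed.

(** At a small positive [t], the first nonzero term would have the same modulus as the tail after
    it, which is at most [2 * B * t ^ S n]. *)
Lemma series_identity (d : nat -> C) B : (forall m, Cmod (d m) <= B) ->
  (forall z, Cmod z < 1 -> limC (fun M => Csum M (fun m => d m * z ^ m)%C) (RtoC 0)) ->
  forall m, d m = RtoC 0.
Proof.
move=> HB Hz.
have HB0 : 0 <= B by apply: Rle_trans (Cmod_ge_0 _) (HB 0%nat).
have key : forall n m, (m < n)%nat -> d m = RtoC 0.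
  elim=> [|n IH] m Hm; first by lia.
  have [Hlt|->] : (m < n)%nat \/ m = n by lia.
    exact: IH.
  apply: NNPP => Hne.
  have hp : 0 < Cmod (d n) by apply/Cmod_gt_0.
  (* The first bound makes the geometric tail at most twice its leading term; the second gives
     [2 * B * t < Cmod (d n)]. *)
  set t := Rmin (/ 2) (Cmod (d n) / (4 * (B + 1))).
  have ht0 : 0 < t by apply: Rmin_pos; [lra | apply: Rdiv_lt_0_compat; lra].
  have ht1 : t <= / 2 by apply: Rmin_l.
  have ht2 : t * (4 * (B + 1)) <= Cmod (d n).
    apply: (Rle_trans _ (Cmod (d n) / (4 * (B + 1)) * (4 * (B + 1)))).
      by apply: Rmult_le_compat_r; [lra | apply: Rmin_r].
    by apply: Req_le; field; lra.
  have hCt : Cmod (RtoC t) = t by rewrite Cmod_R Rabs_pos_eq; lra.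
  have hgeo : ex_series (fun k => t ^ k) by apply: ex_series_geom; rewrite Rabs_pos_eq; lra.
  have hb k : Cmod (d k * RtoC t ^ k)%C <= B * t ^ k.
    rewrite Cmod_mult Cmod_pow hCt; apply: Rmult_le_compat_r => //; apply: pow_le; lra.
  have hs : summ (fun k => d k * RtoC t ^ k)%C.
    by apply: summ_le hb _; apply: (ex_series_scal_l (V := R_NormedModule)).
  have E := limC_unique _ _ _ (CS_lim _ hs) (Hz (RtoC t) ltac:(rewrite hCt; lra)).
  rewrite (CS_split _ (S n) hs) [Csum (S n) _]/= Csum_zero in E; last by move=> k Hk; rewrite IH //; ring.
  set T := CS _ in E.
  have hT : Cmod T <= 2 * B * t ^ S n.
    apply: (Rle_trans _ (Series (fun k => B * t ^ S n * t ^ k))).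
      apply: CS_bound; last by apply: (ex_series_scal_l (V := R_NormedModule)).
      by move=> k; apply: Rle_trans (hb _) _; rewrite pow_add; apply: Req_le; ring.
    rewrite Series_scal_l Series_geom; last by rewrite Rabs_pos_eq; lra.
    have h1 : / (1 - t) <= 2.
      by rewrite -[2]Rinv_inv; apply: Rinv_le_contravar; lra.
    have h2 : 0 <= B * t ^ S n by apply: Rmult_le_pos => //; apply: pow_le; lra.
    nra.
  have e2 : Cmod (d n) * t ^ n = Cmod T.
    have -> : T = (- (d n * RtoC t ^ n))%C.
      have -> : T = (0 + d n * RtoC t ^ n + T - d n * RtoC t ^ n)%C by ring.
      by rewrite E; ring.
    by rewrite Cmod_opp Cmod_mult Cmod_pow hCt.
  have htn : 0 < t ^ n by apply: pow_lt.
  have : Cmod (d n) * t ^ n <= (2 * B * t) * t ^ n by rewrite e2; move: hT; rewrite /=; lra.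
  move=> /(Rmult_le_reg_r _ _ _ htn); nra.
by move=> m; apply: (key (S m)); lia.
Qed.

Lemma limC_minus u v l l' : limC u l -> limC v l' -> limC (fun n => u n - v n)%C (l - l')%C.
Proof.
move=> Hu Hv; rewrite /Cminus; apply: limC_plus => //.
apply: (limC_ext (fun n => (- (1)) * v n)%C); first by move=> n; ring.
have -> : (- l')%C = (- (1) * l')%C by ring.
exact: limC_scal.
Qed.

(** The coefficients found at radius 1 serve every larger radius. Cauchy's estimate at radius
    [2 * r + 1] makes the terms at radius [r] decay like [(/ 2) ^ m], and growth at rate [eps / 2]
    there becomes growth at rate [eps] in [r]. *)
Lemma A0_coefs f : A0 f -> exists a, entS a /\ typezero a /\ forall z, f z = PS a z.
Proof.
move=> [Hent Hgr].
have Hf w : exists l, CD f w l by have [l /CD_is_derive Hl] := Hent w; exists l.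
have Hloc eps rho : 0 < eps -> 0 < rho -> exists a, (exists M, forall z, Cmod (f z) <= M * exp (eps * Cmod z)) /\ forall z, Cmod z < rho -> limC (fun M => Csum M (fun m => a m * z ^ m)%C) (f z).
  move=> He Hr; have [M HM] := Hgr eps He.
  have [a [_ Ha]] := local_series f rho (M * exp (eps * rho)) Hf Hr
     ltac:(move=> z <-; exact: HM).
  by exists a; split=> //; exists M.
have [M1 HM1] := Hgr 1 Rlt_0_1.
have [a [Ha Hz]] := local_series f 1 (M1 * exp (1 * 1)) Hf Rlt_0_1
   ltac:(move=> z Hz; rewrite -{2}Hz; exact: HM1).
have Hbig rho B : 1 <= rho -> (forall z, Cmod z = rho -> Cmod (f z) <= B) ->
   (forall m, Cmod (a m) * rho ^ m <= 2 * B) /\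
   forall z, Cmod z < rho -> limC (fun M => Csum M (fun m => a m * z ^ m)%C) (f z).
  move=> Hrho HB.
  have [b [Hb Hbz]] := local_series f rho B Hf ltac:(lra) HB.
  have -> : a = b; last by split.
  apply: functional_extensionality => m.
  have h : forall m, (a m - b m)%C = RtoC 0.
    apply: (series_identity (fun m => a m - b m)%C (2 * (M1 * exp (1 * 1)) + 2 * B)).
    - move=> k; have := Ha k; rewrite pow1 Rmult_1_r => h1.
      have h2 : Cmod (b k) <= 2 * B.
        apply: Rle_trans (Hb k); have := pow_R1_Rle rho k Hrho; have := Cmod_ge_0 (b k); nra.
      have := Cmod_triangle (a k) (- b k); rewrite Cmod_opp /Cminus; lra.
    - move=> z Hz1.
      have -> : RtoC 0 = (f z - f z)%C by ring.
      apply: (limC_ext (fun M => Csum M (fun m => a m * z ^ m) - Csum M (fun m => b m * z ^ m))%C).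
        move=> n; elim: n => [|n IHn] /=; first by ring.
        by rewrite -IHn; ring.
      by apply: limC_minus; [apply: Hz | apply: Hbz; lra].
  have -> : a m = ((a m - b m) + b m)%C by ring.
  by rewrite h; ring.
have Hco eps M : 0 < eps -> (forall z, Cmod (f z) <= M * exp (eps * Cmod z)) ->
  forall rho, 1 <= rho -> forall m, Cmod (a m) * rho ^ m <= 2 * (M * exp (eps * rho)).
  by move=> He HM rho Hrho; apply: (proj1 (Hbig rho (M * exp (eps * rho)) Hrho _)) => z <-.
have Hhalf : ex_series (fun m => (/ 2) ^ m) by apply: ex_series_geom; rewrite Rabs_pos_eq; lra.
have Hterm eps M r : 0 < eps -> (forall z, Cmod (f z) <= M * exp (eps * Cmod z)) -> 0 <= r ->
   forall m, Cmod (a m) * r ^ m <= 2 * (M * exp (eps * (2 * r + 1))) * (/ 2) ^ m.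
  move=> He HM Hr m.
  have h := Hco eps M He HM (2 * r + 1) ltac:(lra) m.
  have h2 : 0 <= (/ 2) ^ m by apply: pow_le; lra.
  apply: (Rle_trans _ (Cmod (a m) * (2 * r + 1) ^ m * (/ 2) ^ m)); last by apply: Rmult_le_compat_r.
  rewrite Rmult_assoc; apply: Rmult_le_compat_l; first exact: Cmod_ge_0.
  by rewrite -Rpow_mult_distr; apply: pow_incr; lra.
have HaS : entS a.
  move=> r Hr; apply: (ex_series_le0 _ (fun m => 2 * (M1 * exp (1 * (2 * r + 1))) * (/ 2) ^ m)).
    by move=> m; split; [apply: nr_term_ge0 | apply: Hterm => //; lra].
  exact: (ex_series_scal_l (V := R_NormedModule)).
exists a; split=> //; split.
- move=> eps He; have [M HM] := Hgr (eps / 2) ltac:(lra).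
  exists (4 * M * exp (eps / 2)) => r Hr.
  apply: (Rle_trans _ (Series (fun m => 2 * (M * exp (eps / 2 * (2 * r + 1))) * (/ 2) ^ m))).
    apply: Series_le; last exact: (ex_series_scal_l (V := R_NormedModule)).
    by move=> m; split; [apply: nr_term_ge0 | apply: Hterm => //; lra].
  rewrite Series_scal_l Series_geom; last by rewrite Rabs_pos_eq; lra.
  have -> : eps / 2 * (2 * r + 1) = eps / 2 + eps * r by field.
  by rewrite exp_plus; apply: Req_le; field.
- move=> z; apply: limC_unique (CS_lim _ (entS_summ a z HaS)).
  have hz := Cmod_ge_0 z.
  have h := proj2 (Hbig (Cmod z + 1) (M1 * exp (1 * (Cmod z + 1))) ltac:(lra) ltac:(move=> w <-; exact: HM1)).
  by apply: h; lra.
Qed.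

(** The data are bounded by 1, hence admissible for every [S]. The jet [(1, 0, ..., 0)] at [lam n]
    says that [a - 1] vanishes there to order [mu n], so that [a(D)] is the identity on the
    block. *)
Lemma interpolating_interpC lam mu : (forall n, (0 < mu n)%nat) -> interpolating_A0 lam mu -> interpC lam mu.
Proof.
move=> Hmu Hi S.
set dat := fun n k : nat => match k with
  | O => match excluded_middle_informative (S n) with left _ => RtoC 1 | right _ => RtoC 0 end
  | _ => RtoC 0 end.
have [|f [Hf Hj]] := Hi dat.
  move=> eps He; exists 1 => n.
  have h1 : sum_f_R0 (fun k => Cmod (dat n k)) (Init.Nat.pred (mu n)) <= 1.
    have h0 : Cmod (dat n 0%nat) <= 1.
      by rewrite /dat; case: excluded_middle_informative => _; rewrite ?Cmod_1 ?Cmod_0; lra.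
    elim: (Init.Nat.pred (mu n)) => [|k IH] //=.
    by rewrite Cmod_0; lra.
  have h2 : exp (- eps * Cmod (lam n)) <= 1.
    by rewrite -exp_0; apply: exp_mono; have := Cmod_ge_0 (lam n); nra.
  have h3 := exp_pos (- eps * Cmod (lam n)).
  nra.
have [a [Ha [Hta Hfa]]] := A0_coefs f Hf.
have Ef : f = PS a by apply: functional_extensionality.
rewrite Ef (Cder_n_tower _ _ (PS_tower a Ha)) in Hj.
have Hfact k : RtoC (INR (fact k)) <> RtoC 0 by move=> /RtoC_inj /INR_fact_neq_0.
have Hj' n k : (k < mu n)%nat -> PS (Nat.iter k dS a) (lam n) = (dat n k * RtoC (INR (fact k)))%C.
  by move=> Hk; rewrite -(Hj n k Hk); field.
exists a; split=> //; split=> // n; split=> Hn.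
- have Hd := entS_delta0.
  set b := fun m => (a m - RtoC (delta0 m))%C.
  have Hb : entS b.
    move=> r Hr; apply: (ex_series_le0 _ (fun m => Cmod (a m) * r ^ m + Cmod (RtoC (delta0 m)) * r ^ m)).
      move=> m; split; first exact: nr_term_ge0.
      rewrite -Rmult_plus_distr_r; apply: Rmult_le_compat_r; first exact: pow_le.
      by have := Cmod_triangle (a m) (- RtoC (delta0 m)); rewrite Cmod_opp.
    by apply: (ex_series_plus (V := R_NormedModule)); [apply: Ha | apply: Hd].
  have hv : vanish b (lam n) (mu n).
    apply: vanish_of_jets => // j Hjn.
    case: j Hjn => [|j] Hjn.
    + rewrite [Nat.iter 0 _ _]/=.
      have -> : PS b (lam n) = (PS a (lam n) - PS (fun m => RtoC (delta0 m)) (lam n))%C.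
        rewrite /PS -CS_minus; [|exact: entS_summ|exact: entS_summ].
        by apply: CS_ext => m; rewrite /b; ring.
      have := Hj' n 0%nat Hjn; rewrite [Nat.iter 0 _ _]/= => ->.
      rewrite -(Cprod_PS (fun _ => RtoC 0) (fun _ => 0%nat) 0) /dat.
      by case: excluded_middle_informative => // _ /=; ring.
    + have -> : Nat.iter (Datatypes.S j) dS b = Nat.iter (Datatypes.S j) dS a.
        have E : dS b = dS a by apply: functional_extensionality => m; rewrite /dS /b /=; ring.
        by rewrite !Nat.iter_succ_r E.
      by rewrite Hj' // /dat; ring.
  move=> c Hc; apply: functional_extensionality => k.
  have -> : Op a (lam n) c k = (Op b (lam n) c k + Op (fun m => RtoC (delta0 m)) (lam n) c k)%C.
    rewrite /Op -CS_plus; [|exact: Op_summ Hb Hc|exact: Op_summ Hd Hc].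
    by apply: CS_ext => m; rewrite /b; ring.
  by rewrite hv // Op_delta0; ring.
- apply: vanish_of_jets => // j Hjn; rewrite Hj' // /dat.
  case: j Hjn => [|j] Hjn; last by ring.
  by case: excluded_middle_informative => // _; ring.
Qed.

(** * Calculus of exponential polynomials *)

(** The componentwise form gives access to the mean value theorem, which is available for each real
    component only; this is where the factor 2 in [RD_lip] comes from. *)
Definition RD (f : R -> C) (x : R) (l : C) : Prop :=
  is_derive (fun x => Re (f x)) x (Re l) /\ is_derive (fun x => Im (f x)) x (Im l).

Lemma is_derive_eps (V : NormedModule R_AbsRing) (f : R -> V) (x : R) (l : V) :
  is_derive f x l <-> forall eps, 0 < eps -> exists d, 0 < d /\
    forall y, Rabs (y - x) < d -> norm (minus (minus (f y) (f x)) (scal (y - x) l)) <= eps * Rabs (y - x).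
Proof.
split.
- move=> [_ H] eps He.
  have [d Hd] := H x (fun P HP => HP) (mkposreal eps He).
  by exists d; split; [exact: cond_pos | move=> y Hy; apply: (Hd y Hy)].
- move=> H; split; first exact: is_linear_scal_l.
  move=> x' /is_filter_lim_locally_unique <- eps.
  have [d [Hd0 Hd]] := H eps (cond_pos eps).
  by exists (mkposreal d Hd0) => y Hy; apply: Hd.
Qed.

Lemma RD_is_derive f x l : is_derive (K := R_AbsRing) (V := C_R_NormedModule) f x l <-> RD f x l.
Proof.
rewrite is_derive_eps /RD !is_derive_eps; split.
- move=> H; split=> eps He; have [d [Hd0 Hd]] := H eps He; exists d; split=> // y Hy; apply: Rle_trans (Hd y Hy);
  rewrite -Cmod_norm.
  + exact: (re_le_Cmod (minus (minus (f y) (f x)) (scal (y - x) l))).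
  + exact: (im_le_Cmod (minus (minus (f y) (f x)) (scal (y - x) l))).
- move=> [H1 H2] eps He.
  have [d1 [Hd1 h1]] := H1 (eps / 2) ltac:(lra); have [d2 [Hd2 h2]] := H2 (eps / 2) ltac:(lra).
  exists (Rmin d1 d2); split; first exact: Rmin_pos.
  move=> y Hy; have a1 := Rmin_l d1 d2; have a2 := Rmin_r d1 d2.
  rewrite -Cmod_norm; apply: Rle_trans (Cmod_Rabs_le _) _.
  have b1 := h1 y ltac:(lra); have b2 := h2 y ltac:(lra).
  have -> : eps * Rabs (y - x) = eps / 2 * Rabs (y - x) + eps / 2 * Rabs (y - x) by field.
  exact: Rplus_le_compat b1 b2.
Qed.

Lemma RD_ext_loc f g x l a b : a < x < b -> (forall y, a < y < b -> f y = g y) -> RD f x l -> RD g x l.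
Proof.
move=> Hx H [h1 h2].
have hd : 0 < Rmin (x - a) (b - x) by apply: Rmin_pos; lra.
have hin y : ball x (mkposreal _ hd) y -> a < y < b.
  rewrite /ball /= /AbsRing_ball /abs /minus /plus /opp /= => /Rabs_def2.
  have := Rmin_l (x - a) (b - x); have := Rmin_r (x - a) (b - x); lra.
split.
- by apply: is_derive_ext_loc h1; exists (mkposreal _ hd) => y /hin Hy; rewrite H.
- by apply: is_derive_ext_loc h2; exists (mkposreal _ hd) => y /hin Hy; rewrite H.
Qed.

Lemma RD_eq f x l l' : l = l' -> RD f x l -> RD f x l'.
Proof. by move=> ->. Qed.

Lemma RD_const c x : RD (fun _ => c) x (RtoC 0).
Proof. by split; apply: (is_derive_const (V := R_NormedModule)). Qed.

Lemma RD_plus f g x l k : RD f x l -> RD g x k -> RD (fun x => f x + g x)%C x (l + k)%C.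
Proof. by move=> [h1 h2] [h3 h4]; split; apply: (is_derive_plus (V := R_NormedModule)). Qed.

Lemma is_derive_eq (f : R -> R) x l l' : l = l' -> is_derive f x l -> is_derive f x l'.
Proof. by move=> ->. Qed.

Lemma RD_mult f g x l k : RD f x l -> RD g x k -> RD (fun x => f x * g x)%C x (l * g x + f x * k)%C.
Proof.
move=> [h1 h2] [h3 h4]; split.
- have e1 := is_derive_mult _ _ x _ _ h1 h3 Rmult_comm.
  have e2 := is_derive_mult _ _ x _ _ h2 h4 Rmult_comm.
  have e := is_derive_minus (V := R_NormedModule) _ _ x _ _ e1 e2.
  apply: is_derive_eq e; rewrite /minus /plus /opp /mult /= /Re /Im; ring.
- have e1 := is_derive_mult _ _ x _ _ h1 h4 Rmult_comm.
  have e2 := is_derive_mult _ _ x _ _ h2 h3 Rmult_comm.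
  have e := is_derive_plus (V := R_NormedModule) _ _ x _ _ e1 e2.
  apply: is_derive_eq e; rewrite /plus /mult /= /Re /Im; ring.
Qed.

Lemma RD_scal c f x l : RD f x l -> RD (fun x => c * f x)%C x (c * l)%C.
Proof. by move=> H; apply: RD_eq (RD_mult _ _ x _ _ (RD_const c x) H); ring. Qed.

Lemma RD_minus f g x l k : RD f x l -> RD g x k -> RD (fun x => f x - g x)%C x (l - k)%C.
Proof. by move=> [h1 h2] [h3 h4]; split; apply: (is_derive_minus (V := R_NormedModule)). Qed.

Lemma RD_Csum N (f : nat -> R -> C) x (l : nat -> C) :
  (forall n, (n < N)%nat -> RD (f n) x (l n)) -> RD (fun x => Csum N (fun n => f n x)) x (Csum N l).
Proof.
elim: N => [|N IH] H /=; first exact: RD_const.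
by apply: RD_plus; [apply: IH => n Hn; apply: H; lia | apply: H; lia].
Qed.

Lemma RD_pow k x : RD (fun x => RtoC (x ^ k)) x (RtoC (INR k * x ^ Init.Nat.pred k)).
Proof.
split => /=; last exact: (is_derive_const (V := R_NormedModule)).
by auto_derive => //; ring.
Qed.

Lemma RD_cexp lam x : RD (fun x => cexp (lam * RtoC x)) x (lam * cexp (lam * RtoC x))%C.
Proof.
case: lam => a b.
have E t : cexp ((a, b) * RtoC t) = (exp (a * t) * cos (b * t), exp (a * t) * sin (b * t)).
  by rewrite /cexp /=; congr (exp _ * cos _, exp _ * sin _); ring.
have -> : (fun t => cexp ((a, b) * RtoC t)) = (fun t => (exp (a * t) * cos (b * t), exp (a * t) * sin (b * t))).
  by apply: functional_extensionality.
rewrite E; split; rewrite /=; auto_derive => //; ring.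
Qed.

Lemma Cmod_cexp z : Cmod (cexp z) = exp (Re z).
Proof.
have -> : cexp z = (RtoC (exp (Re z)) * (cos (Im z), sin (Im z)))%C.
  by rewrite /cexp /Cmult /RtoC /=; congr pair; ring.
by rewrite Cmod_mult Cmod_cis Cmod_R Rabs_pos_eq; [ring | apply: Rlt_le; apply: exp_pos].
Qed.

Lemma cexp_plus z w : cexp (z + w) = (cexp z * cexp w)%C.
Proof.
case: z => a b; case: w => c d.
by rewrite /cexp /Cplus /Cmult /= exp_plus cos_plus sin_plus; congr pair; ring.
Qed.

Lemma cexp_0 : cexp (RtoC 0) = RtoC 1.
Proof. by rewrite /cexp /= exp_0 cos_0 sin_0 /RtoC; congr pair; ring. Qed.

Lemma RD_lip f f' a b B x y : (forall t, a < t < b -> RD f t (f' t)) ->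
  (forall t, a < t < b -> Cmod (f' t) <= B) -> a < x < b -> a < y < b ->
  Cmod (f y - f x) <= 2 * B * Rabs (y - x).
Proof.
move=> H HB Hx Hy.
have hin t : Rmin x y <= t <= Rmax x y -> a < t < b.
  by rewrite /Rmin /Rmax; case: Rle_dec => _; lra.
have h1 : Rabs (Re (f y) - Re (f x)) <= B * Rabs (y - x).
  have [c [Hc ->]] := MVT_gen (fun t => Re (f t)) x y (fun t => Re (f' t))
    (fun t Ht => proj1 (H t (hin t ltac:(lra))))
    (fun t Ht => proj2 (continuity_pt_filterlim _ t) (ex_derive_continuous _ t (ex_intro _ _ (proj1 (H t (hin t Ht)))))).
  rewrite Rabs_mult; apply: Rmult_le_compat_r; first exact: Rabs_pos.
  by apply: Rle_trans (re_le_Cmod _) _; apply: HB; apply: hin.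
have h2 : Rabs (Im (f y) - Im (f x)) <= B * Rabs (y - x).
  have [c [Hc ->]] := MVT_gen (fun t => Im (f t)) x y (fun t => Im (f' t))
    (fun t Ht => proj2 (H t (hin t ltac:(lra))))
    (fun t Ht => proj2 (continuity_pt_filterlim _ t) (ex_derive_continuous _ t (ex_intro _ _ (proj2 (H t (hin t Ht)))))).
  rewrite Rabs_mult; apply: Rmult_le_compat_r; first exact: Rabs_pos.
  by apply: Rle_trans (im_le_Cmod _) _; apply: HB; apply: hin.
apply: Rle_trans (Cmod_Rabs_le _) _.
have -> : Re (f y - f x) = Re (f y) - Re (f x) by [].
have -> : Im (f y - f x) = Im (f y) - Im (f x) by [].
lra.
Qed.

Lemma RD_zero_const f a b x y : (forall t, a < t < b -> RD f t (RtoC 0)) -> a < x < b -> a < y < b -> f y = f x.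
Proof.
move=> H Hx Hy.
have h := RD_lip f (fun _ => RtoC 0) a b 0 x y H (fun t _ => Req_le _ _ Cmod_0) Hx Hy.
have e : (f y - f x)%C = RtoC 0 by apply: Cmod_eq_0; have := Cmod_ge_0 (f y - f x); lra.
have -> : f y = ((f y - f x) + f x)%C by ring.
by rewrite e; ring.
Qed.

Lemma RD_zero f a b x l : a < x < b -> (forall t, a < t < b -> f t = RtoC 0) -> RD f x l -> l = RtoC 0.
Proof.
move=> Hx H /(RD_ext_loc _ (fun _ => RtoC 0) _ _ _ _ Hx H) [h1 h2].
have [k1 k2] := RD_const (RtoC 0) x.
have e1 := is_derive_unique _ _ _ h1; have e2 := is_derive_unique _ _ _ h2.
rewrite (is_derive_unique _ _ _ k1) in e1; rewrite (is_derive_unique _ _ _ k2) in e2.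
by case: l e1 e2 {h1 h2} => u v /= <- <-.
Qed.

(** * Exponential polynomials and the equations they solve *)

Definition pv (mu : nat) (c : nat -> C) (x : R) : C := Csum mu (fun k => c k * RtoC (x ^ k))%C.

Definition fb (mu : nat) (lam : C) (c : nat -> C) (x : R) : C := (pv mu c x * cexp (lam * RtoC x))%C.

Lemma CsumS N a : Csum (S N) a = (Csum N a + a N)%C.
Proof. by []. Qed.

Lemma pv_mono mu mu' c x : (mu <= mu')%nat -> supp mu c -> pv mu' c x = pv mu c x.
Proof.
move=> H Hs; elim: H => [|m Hm IH] //.
by rewrite {1}/pv CsumS -/(pv m c x) IH Hs; [ring | lia].
Qed.

Lemma fb_mono mu mu' lam c x : (mu <= mu')%nat -> supp mu c -> fb mu' lam c x = fb mu lam c x.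
Proof. by move=> H Hs; rewrite /fb (pv_mono mu). Qed.

Lemma pv_lin mu p c q d x : pv mu (fun k => p * c k + q * d k)%C x = (p * pv mu c x + q * pv mu d x)%C.
Proof. by rewrite /pv -!Csum_scal -Csum_plus; apply: Csum_ext => k _; ring. Qed.

Lemma fb_lin mu lam p c q d x : fb mu lam (fun k => p * c k + q * d k)%C x = (p * fb mu lam c x + q * fb mu lam d x)%C.
Proof. by rewrite /fb pv_lin; ring. Qed.

Definition dp (c : nat -> C) (k : nat) : C := (RtoC (INR (S k)) * c (S k))%C.

Lemma RD_pv mu c x : supp mu c -> RD (pv mu c) x (pv mu (dp c) x).
Proof.
move=> Hs.
have H := RD_Csum mu (fun k x => c k * RtoC (x ^ k))%C x
   (fun k => c k * RtoC (INR k * x ^ Init.Nat.pred k))%C (fun k _ => RD_scal (c k) _ x _ (RD_pow k x)).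
apply: RD_eq H.
have e1 := Csum_incr mu (fun k => c k * RtoC (INR k * x ^ Init.Nat.pred k))%C.
have e2 : Csum (S mu) (fun k => c k * RtoC (INR k * x ^ Init.Nat.pred k))%C =
  Csum mu (fun k => c k * RtoC (INR k * x ^ Init.Nat.pred k))%C.
  by rewrite CsumS Hs //; ring.
rewrite -e2 e1 Rmult_0_l Cmult_0_r Cplus_0_l; apply: Csum_ext => k _.
by rewrite /dp RtoC_mult; ring_simplify; rewrite [Init.Nat.pred _]/=; ring.
Qed.

Lemma RD_fb mu lam c x : supp mu c -> RD (fb mu lam c) x (fb mu lam (Db lam c) x).
Proof.
move=> Hs; apply: RD_eq (RD_mult _ _ x _ _ (RD_pv mu c x Hs) (RD_cexp lam x)).
have -> : Db lam c = (fun k => lam * c k + 1 * dp c k)%C.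
  by apply: functional_extensionality => k; rewrite DbE /dp; ring.
by rewrite /fb pv_lin; ring.
Qed.

Lemma pv_bound mu c x X : 1 <= X -> Rabs x <= X -> Cmod (pv mu c x) <= X ^ mu * nb mu c.
Proof.
move=> HX Hx; apply: Rle_trans (Csum_Cmod _ _) _; rewrite /nb -Rsum_scal; apply: Rsum_le => k Hk.
rewrite Cmod_mult Cmod_R -RPow_abs Rmult_comm; apply: Rmult_le_compat_r; first exact: Cmod_ge_0.
apply: (Rle_trans _ (X ^ k)); first by apply: pow_incr; split; [apply: Rabs_pos |].
by apply: Rle_pow => //; lia.
Qed.

Lemma Re_lam_x lam x : Re (lam * RtoC x)%C = Re lam * x.
Proof. by case: lam => a b; rewrite /=; ring. Qed.

Lemma fb_bound mu lam c x X : 1 <= X -> Rabs x <= X ->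
  Cmod (fb mu lam c x) <= X ^ mu * nb mu c * exp (Re lam * x).
Proof.
move=> HX Hx; rewrite /fb Cmod_mult Cmod_cexp Re_lam_x; apply: Rmult_le_compat_r; first by apply: Rlt_le; apply: exp_pos.
exact: pv_bound.
Qed.

Lemma ode_hom (W : R -> C) lam a b : a < b -> (forall x, a < x < b -> RD W x (lam * W x)%C) ->
  exists K, forall x, a < x < b -> W x = (K * cexp (lam * RtoC x))%C.
Proof.
move=> Hab H.
set Z := fun x => (W x * cexp (- lam * RtoC x))%C.
have HZ x : a < x < b -> RD Z x (RtoC 0).
  move=> Hx; apply: RD_eq (RD_mult _ _ x _ _ (H x Hx) (RD_cexp (- lam) x)).
  by ring.
have he x : (cexp (- lam * RtoC x) * cexp (lam * RtoC x))%C = RtoC 1.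
  by rewrite -cexp_plus -cexp_0; congr cexp; ring.
exists (Z ((a + b) / 2)) => x Hx.
rewrite (RD_zero_const Z a b x _ HZ Hx); last by lra.
have -> : (Z x * cexp (lam * RtoC x) = W x * (cexp (- lam * RtoC x) * cexp (lam * RtoC x)))%C by rewrite /Z; ring.
by rewrite he; ring.
Qed.

(** The equation says that [(1 - D / lam) W] is the block [c]. Integrating the polynomial, which
    raises the degree by one, gives a particular solution; the homogeneous solution [K exp (lam x)]
    only changes the coefficient of index 0. *)
Lemma ode_block (W : R -> C) lam mu c a b : a < b -> supp mu c ->
  (forall x, a < x < b -> RD W x (lam * (W x - fb mu lam c x))%C) ->
  exists d, supp (S mu) d /\ forall x, a < x < b -> W x = fb (S mu) lam d x.
Proof.
move=> Hab Hc H.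
set d := fun k : nat => match k with O => RtoC 0 | S j => (- lam * c j / RtoC (INR (S j)))%C end.
have Hd : supp (S mu) d.
  by move=> [|j] Hj //=; rewrite Hc; [rewrite /Cdiv; ring | lia].
have Hn j : RtoC (INR (S j)) <> RtoC 0 by move=> h; apply: (not_0_INR (S j)) => //; exact: (RtoC_inj _ _ h).
have E : Db lam d = (fun k => lam * d k + (- lam) * c k)%C.
  apply: functional_extensionality => j; rewrite DbE.
  have -> : d (S j) = (- lam * c j / RtoC (INR (S j)))%C by [].
  by move: (RtoC (INR (S j))) (Hn j) (d j) => q Hq y; field.
have [K HK] := ode_hom (fun x => W x - fb (S mu) lam d x)%C lam a b Hab
  ltac:(move=> x Hx; apply: RD_eq (RD_minus _ _ x _ _ (H x Hx) (RD_fb (S mu) lam d x Hd));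
        rewrite E fb_lin (fb_mono mu (S mu) lam c x ltac:(lia) Hc); ring).
have He : supp 1 (edelta 0) by move=> [|k] Hk //; lia.
exists (fun k => 1 * d k + K * edelta 0 k)%C; split.
  by move=> k Hk; rewrite Hd // He; [ring | lia].
move=> x Hx; rewrite fb_lin (fb_mono 1 (S mu) lam (edelta 0) x ltac:(lia) He).
have -> : fb 1 lam (edelta 0) x = cexp (lam * RtoC x).
  by rewrite /fb /pv /edelta /=; ring.
have -> : W x = ((W x - fb (S mu) lam d x) + fb (S mu) lam d x)%C by ring.
by rewrite HK //; ring.
Qed.

(** The first [N] terms are differentiated as a finite sum. For the others, [RD_lip] turns uniformly
    small derivatives into small difference quotients. The three errors take the shares 1/2, 1/4 and
    1/8 of [eps]. *)
Lemma RD_CS (u u' : nat -> R -> C) a b x :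
  (forall n t, a < t < b -> RD (u n) t (u' n t)) ->
  (forall t, a < t < b -> summ (fun n => u n t)) ->
  (forall t, a < t < b -> summ (fun n => u' n t)) ->
  (forall d, 0 < d -> exists N, forall t, a < t < b -> Series (fun n => Cmod (u' (N + n)%nat t)) <= d) ->
  a < x < b -> RD (fun t => CS (fun n => u n t)) x (CS (fun n => u' n x)).
Proof.
move=> Hd Hs Hs' Hu Hx; apply/RD_is_derive/is_derive_eps => eps He.
have [N HN] := Hu (eps / 8) ltac:(lra).
have /RD_is_derive /is_derive_eps h := RD_Csum N u x (fun n => u' n x) (fun n _ => Hd n x Hx).
have [d [Hd0 Hd1]] := h (eps / 2) ltac:(lra).
exists (Rmin d (Rmin (x - a) (b - x))); split.
  by apply: Rmin_pos => //; apply: Rmin_pos; lra.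
move=> y Hy.
have a1 := Rmin_l d (Rmin (x - a) (b - x)); have a2 := Rmin_r d (Rmin (x - a) (b - x)).
have a3 := Rmin_l (x - a) (b - x); have a4 := Rmin_r (x - a) (b - x).
have Hyab : a < y < b by move/Rabs_def2: (Hy); lra.
have b1 := Hd1 y ltac:(lra).
rewrite -Cmod_norm in b1; rewrite -Cmod_norm.
set A := (Csum N (fun n => u n y) - Csum N (fun n => u n x) - RtoC (y - x) * Csum N (fun n => u' n x))%C.
have b2 : Cmod A <= eps / 2 * Rabs (y - x).
  apply: Rle_trans b1; apply: Req_le; congr Cmod.
  rewrite /A /minus /plus /opp /scal /= /prod_plus /prod_opp /prod_scal /Cminus /Cplus /Copp /Cmult /RtoC /=.
  by congr pair; rewrite /plus /opp /scal /= /mult /=; ring.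
set T := (CS (fun n => u (N + n)%nat y) - CS (fun n => u (N + n)%nat x))%C.
set T' := (RtoC (y - x) * CS (fun n => u' (N + n)%nat x))%C.
have E : (minus (minus (CS (fun n => u n y) : C_R_NormedModule) (CS (fun n => u n x))) (scal (y - x) (CS (fun n => u' n x) : C_R_NormedModule)) : C)
  = (A + T - T')%C.
  rewrite (CS_split _ N (Hs y Hyab)) (CS_split _ N (Hs x Hx)) (CS_split _ N (Hs' x Hx)) /A /T /T'.
  set A1 := Csum _ _; set A2 := CS _; set A3 := Csum _ _; set A4 := CS _; set A5 := Csum _ _; set A6 := CS _.
  rewrite /minus /plus /opp /scal /= /prod_plus /prod_opp /prod_scal /Cminus /Cplus /Copp /Cmult /RtoC /=.
  by congr pair; rewrite /plus /opp /scal /= /mult /=; ring.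
rewrite E.
have hT : Cmod T <= eps / 4 * Rabs (y - x).
  rewrite /T -CS_minus; [|exact: (summ_shift (fun n => u n y) N (Hs y Hyab))|exact: (summ_shift (fun n => u n x) N (Hs x Hx))].
  have hs : summ (fun n => u (N + n)%nat y - u (N + n)%nat x)%C.
    by apply: summ_minus; [exact: (summ_shift (fun n => u n y) N (Hs y Hyab)) | exact: (summ_shift (fun n => u n x) N (Hs x Hx))].
  apply: limC_le (CS_lim _ hs) _ => M.
  have -> : Csum M (fun n => u (N + n)%nat y - u (N + n)%nat x)%C =
     (Csum M (fun n => u (N + n)%nat y) - Csum M (fun n => u (N + n)%nat x))%C.
    by elim: M => [|M IH] /=; [ring | rewrite IH; ring].
  apply: Rle_trans (RD_lip (fun t => Csum M (fun n => u (N + n)%nat t)) (fun t => Csum M (fun n => u' (N + n)%nat t)) a b (eps / 8) x y _ _ Hx Hyab) _.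
  - by move=> t Ht; apply: (RD_Csum M (fun n => u (N + n)%nat)) => n _; apply: Hd.
  - move=> t Ht; apply: Rle_trans (Csum_Cmod _ _) _; apply: Rle_trans (HN t Ht).
    apply: Rsum_le_Series; first by move=> n; apply: Cmod_ge_0.
    exact: (summ_shift (fun n => u' n t) N (Hs' t Ht)).
  - by apply: Req_le; field.
have hT' : Cmod T' <= eps / 8 * Rabs (y - x).
  rewrite /T' Cmod_mult Cmod_R Rmult_comm; apply: Rmult_le_compat_r; first exact: Rabs_pos.
  apply: Rle_trans (HN x Hx).
  exact: (CS_Cmod_le _ (summ_shift (fun n => u' n x) N (Hs' x Hx))).
have t1 := Cmod_triangle (A + T) (- T'); have t2 := Cmod_triangle A T.
rewrite Cmod_opp in t1; rewrite /Cminus.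
have : 0 <= eps * Rabs (y - x) by apply: Rmult_le_pos; [lra | apply: Rabs_pos].
lra.
Qed.

(** An argument bounded by [th < PI/2] gives [|Im| <= tan th * Re], whence
    [kap = 1 / (1 + tan th)]. *)
Lemma condB_kappa lam : (forall n, lam n <> RtoC 0) -> condB lam ->
  exists kap, 0 < kap /\ forall n, kap * Cmod (lam n) <= Re (lam n).
Proof.
move=> H0 [th [Hth Harg]].
have HPI := PI_RGT_0.
have Hth0 : 0 <= th by apply: Rle_trans (Rabs_pos _) (Harg 0%nat).
have Hcase n : 0 < Re (lam n) /\ Rabs (Im (lam n)) <= tan th * Re (lam n).
  have := Harg n; rewrite /Carg.
  have bnd x : - (PI / 2) < atan x < PI / 2 by have := atan_bound x; lra.
  case: Rlt_dec => [Hre|Hre].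
    move=> /Rabs_le_between [h1 h2]; split=> //.
    have hinc x : atan x <= th -> x <= tan th.
      move=> h; apply: Rnot_lt_le => hlt.
      have := atan_increasing _ _ hlt; rewrite atan_tan; [lra|split; lra].
    have hx : Im (lam n) / Re (lam n) <= tan th by apply: hinc.
    have hx' : - (Im (lam n) / Re (lam n)) <= tan th by apply: hinc; rewrite atan_opp; lra.
    have e : Im (lam n) = Im (lam n) / Re (lam n) * Re (lam n) by field; lra.
    by apply: Rabs_le; rewrite e; nra.
  (* In the remaining branches of [Carg] the argument has modulus at least [PI/2], or [lam n] is
     0. *)
  case: Rlt_dec => [Hre'|Hre'].
    have := bnd (Im (lam n) / Re (lam n)); case: Rle_dec => _ hb.
      by rewrite Rabs_pos_eq; lra.
    by rewrite Rabs_left1; lra.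
  have hz : Re (lam n) = 0 by lra.
  case: Rlt_dec => Him; first by rewrite Rabs_pos_eq; lra.
  case: Rlt_dec => Him'; first by rewrite Rabs_left1; lra.
  have hi : Im (lam n) = 0 by lra.
  by case: (H0 n); move: hz hi; case: (lam n) => u v /= -> ->.
have HT : 0 <= tan th.
  have [h1 h2] := Hcase 0%nat; have := Rabs_pos (Im (lam 0%nat)); nra.
exists (/ (1 + tan th)); split; first by apply: Rinv_0_lt_compat; lra.
move=> n; have [h1 h2] := Hcase n.
apply: (Rmult_le_reg_l (1 + tan th)); first by lra.
rewrite -Rmult_assoc Rinv_r ?Rmult_1_l; last by lra.
apply: Rle_trans (Cmod_Rabs_le _) _; rewrite (Rabs_pos_eq (Re _)); lra.
Qed.

(** * Absolutely summable expansions *)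

Record good (lam : nat -> C) (mu : nat -> nat) (kap : R) : Prop := Good {
  good_ne : forall n, lam n <> RtoC 0;
  good_inj : forall n m, n <> m -> lam n <> lam m;
  good_mono : forall n, Cmod (lam n) <= Cmod (lam (S n));
  good_lim : is_lim_seq (fun n => Cmod (lam n)) p_infty;
  good_mu : forall n, (0 < mu n)%nat;
  good_sum : wsum (rL lam) mu;
  good_kap : 0 < kap;
  good_re : forall n, kap * Cmod (lam n) <= Re (lam n)
}.

Definition rad (lam : nat -> C) (mu : nat -> nat) (n : nat) : R := Cmod (lam n) + INR (mu n).

(** The growth of coefficients under which the blocks and all their derivatives are summable at
    every [x < beta]. No left endpoint enters, so expansions extend to the left of the interval. *)
Definition CB (lam : nat -> C) (mu : nat -> nat) (beta : R) (c : nat -> nat -> C) : Prop :=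
  (forall n, supp (mu n) (c n)) /\
  forall eta, 0 < eta -> exists M, 0 <= M /\
    forall n, nb (mu n) (c n) <= M * exp (- (beta - eta) * Re (lam n)).

(** Majorant of the block [n] for [Rabs x <= X] and [x <= y]. *)
Definition wt (lam : nat -> C) (mu : nat -> nat) (c : nat -> nat -> C) (X y : R) (n : nat) : R :=
  X ^ mu n * nb (mu n) (c n) * exp (Re (lam n) * y).

(** A weight covering both uses of [wt_summable]: powers, for the derivatives of blocks, and the
    majorant [G], for the action of [F(D)]. *)
Definition subexp (g : R -> R) : Prop :=
  (forall r, 0 <= r -> 0 <= g r) /\
  forall eps, 0 < eps -> exists M, 0 <= M /\ forall r, 0 <= r -> g r <= M * exp (eps * r).

Lemma good_pos lam mu kap n : good lam mu kap -> 0 < Cmod (lam n).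
Proof. by move=> Hg; apply/Cmod_gt_0; apply: good_ne Hg n. Qed.

(** [mu n = o(|lam n|)], because the terms of the convergent series of [mu n / |lam n|] tend to
    0. *)
Lemma pow_mu_subexp lam mu kap X del : good lam mu kap -> 1 <= X -> 0 < del ->
  exists M, 0 <= M /\ forall n, X ^ mu n <= M * exp (del * Cmod (lam n)).
Proof.
move=> Hg HX Hd.
have hl : 0 <= ln X by rewrite -ln_1; case: HX => [h|<-]; [apply: Rlt_le; apply: ln_increasing; lra | lra].
have [N HN] := mu_little_o lam mu (del / (ln X + 1)) (good_ne _ _ _ Hg) (good_sum _ _ _ Hg) ltac:(apply: Rdiv_lt_0_compat; lra).
have h0 k : 0 <= X ^ mu k by apply: pow_le; lra.
have hR : 0 <= Rsum N (fun k => X ^ mu k) by apply: Rsum_ge0.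
exists (1 + Rsum N (fun k => X ^ mu k)); split; first by lra.
move=> n.
have he : 1 <= exp (del * Cmod (lam n)).
  by rewrite -exp_0; apply: exp_mono; have := good_pos _ _ _ n Hg; nra.
have [Hlt|Hge] : (n < N)%nat \/ (N <= n)%nat by lia.
- have := Rsum_term_le N (fun k => X ^ mu k) n (fun k _ => h0 k) Hlt; nra.
- have h := HN n Hge.
  have e : X ^ mu n <= exp (del * Cmod (lam n)).
    have -> : X ^ mu n = exp (INR (mu n) * ln X) by rewrite -Rpower_pow; [|lra].
    apply: exp_mono.
    apply: (Rle_trans _ (del / (ln X + 1) * Cmod (lam n) * ln X)); first by apply: Rmult_le_compat_r.
    have -> : del * Cmod (lam n) = del / (ln X + 1) * Cmod (lam n) * (ln X + 1) by field; lra.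
    apply: Rmult_le_compat_l; last by lra.
    apply: Rmult_le_pos; first by apply: Rlt_le; apply: Rdiv_lt_0_compat; lra.
    by apply: Cmod_ge_0.
  nra.
Qed.

Lemma rad_le lam mu kap : good lam mu kap -> exists A, 1 <= A /\ forall n, 0 <= rad lam mu n <= A * Cmod (lam n).
Proof.
move=> Hg; have Hw := good_sum _ _ _ Hg.
set A := Series (fun n => INR (mu n) * rL lam n).
have HA : 0 <= A by apply: Series_ge0; [apply: wsum_term_ge0 | case: Hw].
exists (1 + A); split; first by lra.
move=> n; split; first exact: rad_ge0.
have hp := good_pos _ _ _ n Hg.
have := mu_rL_le lam mu Hw n; rewrite -/A /rL => h'.
have : INR (mu n) <= A * Cmod (lam n).
  have -> : INR (mu n) = INR (mu n) * / Cmod (lam n) * Cmod (lam n) by field; lra.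
  by apply: Rmult_le_compat_r; lra.
by rewrite /rad; lra.
Qed.

Lemma wt_ge0 lam mu c X y n : 1 <= X -> 0 <= wt lam mu c X y n.
Proof.
move=> HX; apply: Rmult_le_pos; last by apply: Rlt_le; apply: exp_pos.
by apply: Rmult_le_pos; [apply: pow_le; lra | apply: nb_ge0].
Qed.

(** With [eta] half the distance from [y] to [beta], a factor [exp (- q |lam n|)] is gained, where
    [q = eta * kap]. The powers of [X] and the weight [g] use up [q/4] each; what remains is below
    [2 / (q |lam n|)], hence summable because [mu n >= 1] and the series of [mu n / |lam n|]
    converges. *)
Lemma wt_summable lam mu kap beta c X y g : good lam mu kap -> CB lam mu beta c ->
  1 <= X -> y < beta -> subexp g -> ex_series (fun n => wt lam mu c X y n * g (rad lam mu n)).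
Proof.
move=> Hg [_ Hc] HX Hy [Hg0 Hge].
have hk := good_kap _ _ _ Hg.
set eta := (beta - y) / 2; have heta : 0 < eta by rewrite /eta; lra.
have [M [HM0 HM]] := Hc eta heta.
set q := eta * kap; have hq : 0 < q by apply: Rmult_lt_0_compat.
have [M1 [HM1 H1]] := pow_mu_subexp lam mu kap X (q / 4) Hg HX ltac:(lra).
have [A [HA Hrad]] := rad_le _ _ _ Hg.
have [M2 [HM2 H2]] := Hge (q / 4 / A) ltac:(apply: Rdiv_lt_0_compat; lra).
have hK : 0 <= M1 * M * M2 * (2 / q).
  apply: Rmult_le_pos; last by apply: Rlt_le; apply: Rdiv_lt_0_compat; lra.
  by apply: Rmult_le_pos => //; apply: Rmult_le_pos.
apply: (ex_series_le0 _ (fun n => M1 * M * M2 * (2 / q) * (INR (mu n) * rL lam n))); last first.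
  by apply: (ex_series_scal_l (V := R_NormedModule)); apply: (proj2 (good_sum _ _ _ Hg)).
move=> n; have [r0 r1] := Hrad n; have hp := good_pos _ _ _ n Hg.
set L := Cmod (lam n) in r1 hp *.
split; first by apply: Rmult_le_pos; [apply: wt_ge0 | apply: Hg0].
have a1 := H1 n; rewrite -/L in a1.
have a2 : nb (mu n) (c n) * exp (Re (lam n) * y) <= M * exp (- q * L).
  apply: (Rle_trans _ (M * exp (- (beta - eta) * Re (lam n)) * exp (Re (lam n) * y))).
    by apply: Rmult_le_compat_r; [apply: Rlt_le; apply: exp_pos | apply: HM].
  rewrite Rmult_assoc -exp_plus; apply: Rmult_le_compat_l => //; apply: exp_mono.
  have hr := good_re _ _ _ Hg n; rewrite -/L in hr.
  have : eta * (kap * L) <= eta * Re (lam n) by apply: Rmult_le_compat_l; lra.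
  have -> : - (beta - eta) * Re (lam n) + Re (lam n) * y = - eta * Re (lam n) by rewrite /eta; field.
  by rewrite /q; lra.
have a3 : g (rad lam mu n) <= M2 * exp (q / 4 * L).
  apply: Rle_trans (H2 _ r0) _; apply: Rmult_le_compat_l => //; apply: exp_mono.
  apply: (Rle_trans _ (q / 4 / A * (A * L))).
    by apply: Rmult_le_compat_l => //; apply: Rlt_le; apply: Rdiv_lt_0_compat; lra.
  by apply: Req_le; field; lra.
have hx0 : 0 <= X ^ mu n by apply: pow_le; lra.
have hn0 := nb_ge0 (mu n) (c n).
have he0 := exp_pos (Re (lam n) * y).
have b1 : wt lam mu c X y n <= M1 * exp (q / 4 * L) * (M * exp (- q * L)).
  rewrite /wt Rmult_assoc; apply: Rmult_le_compat => //.
  by apply: Rmult_le_pos; lra.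
apply: (Rle_trans _ (M1 * exp (q / 4 * L) * (M * exp (- q * L)) * (M2 * exp (q / 4 * L)))).
  apply: Rmult_le_compat => //; [exact: wt_ge0|exact: Hg0].
have -> : M1 * exp (q / 4 * L) * (M * exp (- q * L)) * (M2 * exp (q / 4 * L)) =
   M1 * M * M2 * exp (- (q / 2 * L)).
  have -> : - (q / 2 * L) = q / 4 * L + (- q * L + q / 4 * L) by field.
  by rewrite !exp_plus; ring.
rewrite !(Rmult_assoc (M1 * M * M2)); apply: Rmult_le_compat_l.
  by apply: Rmult_le_pos => //; apply: Rmult_le_pos.
have hmu : 1 <= INR (mu n) by apply: (le_INR 1); have := good_mu _ _ _ Hg n; lia.
have ht : 0 < q / 2 * L by apply: Rmult_lt_0_compat; lra.
apply: (Rle_trans _ (/ (q / 2 * L))).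
  rewrite exp_Ropp; apply: Rinv_le_contravar => //.
  by have := exp_ineq1_le (q / 2 * L); lra.
have -> : / (q / 2 * L) = 2 / q * (1 * rL lam n) by rewrite /rL -/L; field; lra.
apply: Rmult_le_compat_l; first by apply: Rlt_le; apply: Rdiv_lt_0_compat; lra.
apply: Rmult_le_compat_r => //; first by apply: (proj1 (good_sum _ _ _ Hg)).
Qed.

Lemma subexp_G r mu : wsum r mu -> subexp (fun x => Series (fun m => Gi r mu m * x ^ m)).
Proof.
move=> Hw; split; last by move=> eps He; apply: Gi_subexp.
by move=> x Hx; apply: Series_ge0 => [m|]; [apply: Gi_term_ge0 | apply: ex_series_Gi].
Qed.

Lemma subexp_pow m : subexp (fun x => x ^ m).
Proof.
split; first by move=> r Hr; apply: pow_le.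
move=> eps He; have [M [HM0 HM]] := one_plus_pow_subexp 1 m eps ltac:(lra) He.
exists M; split=> // r Hr; apply: Rle_trans (HM r Hr).
by apply: pow_incr; lra.
Qed.

Definition dblk (lam : nat -> C) (mu : nat -> nat) (c : nat -> nat -> C) (m n : nat) (x : R) : C :=
  fb (mu n) (lam n) (Nat.iter m (Db (lam n)) (c n)) x.

Definition gsum lam mu c (m : nat) (x : R) : C := CS (fun n => dblk lam mu c m n x).

Lemma dblk_bound lam mu kap c X y m n x : good lam mu kap -> supp (mu n) (c n) ->
  1 <= X -> Rabs x <= X -> x <= y ->
  Cmod (dblk lam mu c m n x) <= wt lam mu c X y n * rad lam mu n ^ m.
Proof.
move=> Hg Hs HX Hx Hy.
apply: Rle_trans (fb_bound _ _ _ x X HX Hx) _.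
have hr : 0 <= Re (lam n).
  have := good_re _ _ _ Hg n; have := good_kap _ _ _ Hg; have := Cmod_ge_0 (lam n); nra.
have h1 := nb_iter_Db (mu n) (lam n) (c n) m Hs.
have h2 : exp (Re (lam n) * x) <= exp (Re (lam n) * y) by apply: exp_mono; apply: Rmult_le_compat_l.
have hX : 0 <= X ^ mu n by apply: pow_le; lra.
have -> : wt lam mu c X y n * rad lam mu n ^ m = X ^ mu n * (rad lam mu n ^ m * nb (mu n) (c n)) * exp (Re (lam n) * y).
  by rewrite /wt; ring.
apply: Rmult_le_compat => //.
- by apply: Rmult_le_pos => //; apply: nb_ge0.
- by apply: Rlt_le; apply: exp_pos.
- exact: Rmult_le_compat_l.
Qed.

Lemma RD_dblk lam mu c m n x : supp (mu n) (c n) ->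
  RD (dblk lam mu c m n) x (dblk lam mu c (S m) n x).
Proof. by move=> Hs; apply: RD_fb; apply: supp_iter_Db. Qed.

Lemma dblk_summ lam mu kap beta c m x : good lam mu kap -> CB lam mu beta c -> x < beta ->
  summ (fun n => dblk lam mu c m n x).
Proof.
move=> Hg Hc Hx.
have := wt_summable lam mu kap beta c (Rabs x + 1) x (fun r => r ^ m) Hg Hc ltac:(have := Rabs_pos x; lra) Hx (subexp_pow m).
apply: summ_le => n; apply: (dblk_bound _ _ kap) => //; [exact: (proj1 Hc)|have := Rabs_pos x; lra|lra|lra].
Qed.

Lemma RD_gsum lam mu kap beta c m x : good lam mu kap -> CB lam mu beta c -> x < beta ->
  RD (gsum lam mu c m) x (gsum lam mu c (S m) x).
Proof.
move=> Hg Hc Hx.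
set y := (x + beta) / 2; set X := Rabs x + Rabs y + 1.
have hX : 1 <= X by rewrite /X; have := Rabs_pos x; have := Rabs_pos y; lra.
have hs := wt_summable lam mu kap beta c X y (fun r => r ^ S m) Hg Hc hX ltac:(rewrite /y; lra) (subexp_pow (S m)).
have hin t : x - 1 < t < y -> Rabs t <= X.
  move=> Ht; apply: Rabs_le; rewrite /X.
  have := Rle_abs x; have := Rle_abs (- x); have := Rle_abs y; rewrite Rabs_Ropp; have := Rabs_pos y; have := Rabs_pos x; lra.
have h0 n : 0 <= wt lam mu c X y n * rad lam mu n ^ S m.
  by apply: Rmult_le_pos; [apply: wt_ge0 | apply: pow_le; apply: rad_ge0].
apply: (RD_CS (fun n => dblk lam mu c m n) (fun n => dblk lam mu c (S m) n) (x - 1) y).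
- by move=> n t _; apply: RD_dblk; apply: (proj1 Hc).
- by move=> t Ht; apply: (dblk_summ _ _ kap beta) => //; rewrite /y in Ht; lra.
- by move=> t Ht; apply: (dblk_summ _ _ kap beta) => //; rewrite /y in Ht; lra.
- move=> d Hd; have [N HN] := Series_tail_small _ d hs h0 Hd.
  exists N => t Ht; apply: Rle_trans; last by apply: Rlt_le; apply: (HN N (Nat.le_refl _)).
  apply: Series_le => [n|]; last exact: (proj1 (ex_series_incr_n (V := R_NormedModule) _ N) hs).
  split; first exact: Cmod_ge_0.
  apply: (dblk_bound _ _ kap) => //; [exact: (proj1 Hc)|exact: hin|lra].
- by rewrite /y; lra.
Qed.

(** Summing first over the order [m] of the derivative gives the value of the majorant [G] at [rad],
    which is a subexponential weight; [tonelli] then reverses the order. *)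
Lemma double_wt lam mu kap beta c X y : good lam mu kap -> CB lam mu beta c -> 1 <= X -> y < beta ->
  (forall m, ex_series (fun n => Gi (rL lam) mu m * (wt lam mu c X y n * rad lam mu n ^ m))) /\
  ex_series (fun m => Series (fun n => Gi (rL lam) mu m * (wt lam mu c X y n * rad lam mu n ^ m))).
Proof.
move=> Hg Hc HX Hy; have Hw := good_sum _ _ _ Hg.
apply: (tonelli (fun n m => Gi (rL lam) mu m * (wt lam mu c X y n * rad lam mu n ^ m))).
- move=> n m; apply: Rmult_le_pos; first exact: Gi_ge0.
  by apply: Rmult_le_pos; [apply: wt_ge0 | apply: pow_le; apply: rad_ge0].
- move=> n.
  have e m : wt lam mu c X y n * (Gi (rL lam) mu m * rad lam mu n ^ m) =
     Gi (rL lam) mu m * (wt lam mu c X y n * rad lam mu n ^ m) by ring.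
  apply: ex_series_ext e _.
  by apply: (ex_series_scal_l (V := R_NormedModule)); apply: ex_series_Gi => //; apply: rad_ge0.
- apply: ex_series_ext (wt_summable lam mu kap beta c X y _ Hg Hc HX Hy (subexp_G _ _ Hw)) => n.
  rewrite -Series_scal_l; apply: Series_ext => m; ring.
Qed.

Lemma fubini_blocks lam mu kap beta c a x : good lam mu kap -> CB lam mu beta c -> x < beta ->
  (forall m, Cmod (a m) <= Gi (rL lam) mu m) ->
  CS (fun m => a m * gsum lam mu c m x)%C = CS (fun n => CS (fun m => a m * dblk lam mu c m n x))%C.
Proof.
move=> Hg Hc Hx Ha; have Hw := good_sum _ _ _ Hg.
set X := Rabs x + 1.
have hX : 1 <= X by rewrite /X; have := Rabs_pos x; lra.
have hb n m : Cmod (a m * dblk lam mu c m n x)%C <= Gi (rL lam) mu m * (wt lam mu c X x n * rad lam mu n ^ m).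
  rewrite Cmod_mult; apply: Rmult_le_compat => //; try exact: Cmod_ge_0.
  apply: (dblk_bound _ _ kap) => //; [exact: (proj1 Hc)|rewrite /X; lra|lra].
have [d1 d2] := double_wt lam mu kap beta c X x Hg Hc hX Hx.
have [_ [_ [_ E]]] := fubini (fun m n => a m * dblk lam mu c m n x)%C
   (fun m => summ_le _ _ (fun n => hb n m) (d1 m))
   ltac:(apply: ex_series_le0 d2 => m; split;
      [apply: Series_ge0 => [n|]; [exact: Cmod_ge_0 | exact: summ_le _ _ (fun n => hb n m) (d1 m)]
      |apply: Series_le (d1 m) => n; split; [exact: Cmod_ge_0 | exact: hb]]).
rewrite -E; apply: CS_ext => m; rewrite /gsum -CS_scal //.
exact: (dblk_summ _ _ kap beta).
Qed.

Lemma fb_Op a mu lam c x : entS a -> supp mu c ->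
  summ (fun m => a m * fb mu lam (Nat.iter m (Db lam) c) x)%C /\
  CS (fun m => a m * fb mu lam (Nat.iter m (Db lam) c) x)%C = fb mu lam (Op a lam c) x.
Proof.
move=> Ha Hs.
have [h1 h2] := CS_Csum mu (fun k m => (RtoC (x ^ k) * cexp (lam * RtoC x)) * (a m * Nat.iter m (Db lam) c k))%C
   (fun k _ => summ_scal _ _ (Op_summ a mu lam c k Ha Hs)).
have E m : Csum mu (fun k => (RtoC (x ^ k) * cexp (lam * RtoC x)) * (a m * Nat.iter m (Db lam) c k))%C =
   (a m * fb mu lam (Nat.iter m (Db lam) c) x)%C.
  have -> : (a m * fb mu lam (Nat.iter m (Db lam) c) x = (a m * cexp (lam * RtoC x)) * pv mu (Nat.iter m (Db lam) c) x)%C.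
    by rewrite /fb; ring.
  by rewrite /pv -Csum_scal; apply: Csum_ext => k _; ring.
split; first by apply: summ_ext h1 => m; exact: E.
rewrite -(CS_ext _ _ E) h2.
have -> : (fb mu lam (Op a lam c) x = cexp (lam * RtoC x) * pv mu (Op a lam c) x)%C by rewrite /fb; ring.
rewrite /pv -Csum_scal; apply: Csum_ext => k _; rewrite CS_scal; last exact: Op_summ Ha Hs.
by rewrite -/(Op a lam c k); ring.
Qed.

(** * Adding and removing zeros *)

Definition addmu (mu : nat -> nat) (k j n : nat) : nat := if Nat.eqb n k then (mu n + j)%nat else mu n.

Lemma bump_addmu mu k j : bump (addmu mu k j) k = addmu mu k (S j).
Proof.
by apply: functional_extensionality => n; rewrite /bump /addmu; case: Nat.eqb => //; lia.
Qed.

Lemma addmu_0 mu k : addmu mu k 0 = mu.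
Proof. by apply: functional_extensionality => n; rewrite /addmu; case: Nat.eqb => //; lia. Qed.

Lemma addmu_except mu k : addmu (except mu k) k (mu k) = mu.
Proof.
by apply: functional_extensionality => n; rewrite /addmu /except; case: Nat.eqb_spec => [->|].
Qed.

Lemma addmu_wsum r mu k j : wsum r mu -> wsum r (addmu mu k j).
Proof.
move=> Hw; elim: j => [|j IH]; first by rewrite addmu_0.
by rewrite -bump_addmu; apply: bump_wsum.
Qed.

Lemma Fi_addmu l mu k j : wsum (fun n => Cmod (l n)) mu ->
  Fi l (addmu mu k j) = Nat.iter j (lin (l k)) (Fi l mu).
Proof.
move=> Hw; elim: j => [|j IH]; first by rewrite addmu_0.
rewrite -bump_addmu /= -IH; apply: functional_extensionality => m.
by apply: Fi_bump; apply: addmu_wsum.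
Qed.

(** The factor of [lam k] occurs [mu k] times in the product, and each occurrence lowers the degree
    by one ([Lb_own]). *)
Lemma Op_Fi_zero lam mu k c : (forall n, lam n <> RtoC 0) -> wsum (rL lam) mu -> supp (mu k) c ->
  Op (Fi (lF lam) mu) (lam k) c = (fun _ => RtoC 0).
Proof.
move=> H0 Hw Hc.
have Hw' : wsum (fun n => Cmod (lF lam n)) (except mu k).
  by rewrite lF_rL //; apply: wsum_mono Hw => n; apply: except_le.
apply: functional_extensionality => j.
rewrite -{1}(addmu_except mu k) Fi_addmu // (Op_iter_lin _ (mu k)) //; last exact: entS_Fi.
apply: (supp_iter_Lb_own (mu k) 0 (lam k)) => //; last by lia.
by rewrite Nat.add_0_r; apply: supp_Op.
Qed.

Lemma Fi_le_G lam mu mu' m : (forall n, lam n <> RtoC 0) -> wsum (rL lam) mu -> (forall n, (mu' n <= mu n)%nat) ->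
  Cmod (Fi (lF lam) mu' m) <= Gi (rL lam) mu m.
Proof.
move=> H0 Hw Hm; apply: Rle_trans (Gi_mono _ _ _ m Hw Hm).
rewrite -(lF_rL lam H0); apply: Fi_le_Gi; rewrite lF_rL //.
exact: wsum_mono Hm Hw.
Qed.

Lemma entS_FiL lam mu mu' : (forall n, lam n <> RtoC 0) -> wsum (rL lam) mu -> (forall n, (mu' n <= mu n)%nat) ->
  entS (Fi (lF lam) mu').
Proof. by move=> H0 Hw Hm; apply: entS_Fi; rewrite lF_rL //; apply: wsum_mono Hm Hw. Qed.

(* The function [F_mu(D) g_0], for a tower [g] of derivatives. *)
Definition WW (lam : nat -> C) (mu : nat -> nat) (g : nat -> R -> C) (x : R) : C :=
  CS (fun m => Fi (lF lam) mu m * g m x)%C.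

Lemma WW_gsum lam mu kap beta c mu' x : good lam mu kap -> CB lam mu beta c -> x < beta ->
  (forall n, (mu' n <= mu n)%nat) ->
  WW lam mu' (gsum lam mu c) x = CS (fun n => fb (mu n) (lam n) (Op (Fi (lF lam) mu') (lam n) (c n)) x).
Proof.
move=> Hg Hc Hx Hm.
have H0 := good_ne _ _ _ Hg; have Hw := good_sum _ _ _ Hg.
rewrite /WW (fubini_blocks lam mu kap beta) //; last by move=> m; apply: Fi_le_G.
apply: CS_ext => n; apply: (proj2 (fb_Op _ _ _ _ _ _ _)); last exact: (proj1 Hc).
exact: entS_FiL Hm.
Qed.

Lemma fb_zero mu lam x : fb mu lam (fun _ => RtoC 0) x = RtoC 0.
Proof. by rewrite /fb /pv Csum_zero; [ring | move=> n _; ring]. Qed.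

(** [classC] with the real coefficients [Gi], and with uniform convergence expressed by the tails of
    a series of nonnegative terms. [V_classG] and [classG_V] relate it to the original classes. *)
Definition classG (lam : nat -> C) (mu : nat -> nat) (a b : R) (g : nat -> R -> C) : Prop :=
  (forall m x, a < x < b -> RD (g m) x (g (S m) x)) /\
  (forall x, a < x < b -> ex_series (fun m => Gi (rL lam) mu m * Cmod (g m x))) /\
  (forall eps d, 0 < eps -> 0 < d -> exists N, forall x, a + eps < x < b - eps ->
     Series (fun m => Gi (rL lam) mu (N + m)%nat * Cmod (g (N + m)%nat x)) <= d).

Lemma gsum_classG lam mu kap a b c : good lam mu kap -> CB lam mu b c -> classG lam mu a b (gsum lam mu c).
Proof.
move=> Hg Hc; have Hw := good_sum _ _ _ Hg; split; last split.
- by move=> m x Hx; apply: (RD_gsum _ _ kap b) => //; lra.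
- move=> x Hx; set X := Rabs x + 1.
  have hX : 1 <= X by rewrite /X; have := Rabs_pos x; lra.
  have [d1 d2] := double_wt lam mu kap b c X x Hg Hc hX ltac:(lra).
  apply: ex_series_le0 d2 => m; split; first by apply: Rmult_le_pos; [apply: Gi_ge0 | apply: Cmod_ge_0].
  rewrite Series_scal_l; apply: Rmult_le_compat_l; first exact: Gi_ge0.
  apply: CS_bound; last exact: (wt_summable lam mu kap b c X x _ Hg Hc hX (proj2 Hx) (subexp_pow m)).
  move=> n; apply: (dblk_bound _ _ kap) => //; [exact: (proj1 Hc)|rewrite /X; lra|lra].
- move=> eps d He Hd; set X := Rabs a + Rabs b + 1; set y := b - eps.
  have hX : 1 <= X by rewrite /X; have := Rabs_pos a; have := Rabs_pos b; lra.
  have [d1 d2] := double_wt lam mu kap b c X y Hg Hc hX ltac:(rewrite /y; lra).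
  have h0 m n : 0 <= Gi (rL lam) mu m * (wt lam mu c X y n * rad lam mu n ^ m).
    apply: Rmult_le_pos; first exact: Gi_ge0.
    by apply: Rmult_le_pos; [apply: wt_ge0 | apply: pow_le; apply: rad_ge0].
  have [N HN] := Series_tail_small _ d d2 (fun m => Series_ge0 _ (h0 m) (d1 m)) Hd.
  exists N => x Hx; apply: Rle_trans; last by apply: Rlt_le; apply: (HN N (Nat.le_refl _)).
  apply: Series_le => [m|]; last exact: (proj1 (ex_series_incr_n (V := R_NormedModule) _ N) d2).
  split; first by apply: Rmult_le_pos; [apply: Gi_ge0 | apply: Cmod_ge_0].
  rewrite Series_scal_l; apply: Rmult_le_compat_l; first exact: Gi_ge0.
  apply: CS_bound; last exact: (wt_summable lam mu kap b c X y _ Hg Hc hX ltac:(rewrite /y; lra) (subexp_pow _)).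
  rewrite /y in Hx; move=> n; apply: (dblk_bound _ _ kap) => //; [exact: (proj1 Hc)| |rewrite /y; lra].
  apply: Rabs_le; rewrite /X.
  have := Rle_abs a; have := Rle_abs (- a); have := Rle_abs b; have := Rle_abs (- b); rewrite !Rabs_Ropp.
  have := Rabs_pos a; have := Rabs_pos b; lra.
Qed.

(** * Polynomials at equispaced nodes, Baire category *)

Lemma pv_shift n c x : pv (S n) c x = (c 0%nat + RtoC x * pv n (fun k => c (S k)) x)%C.
Proof.
rewrite /pv Csum_incr -Csum_scal pow_O; congr (_ + _)%C; first by ring.
by apply: Csum_ext => k _; rewrite -tech_pow_Rmult RtoC_mult; ring.
Qed.

Lemma pv_Xb n c x : pv (S n) (Xb c) x = (RtoC x * pv n c x)%C.
Proof. by rewrite pv_shift Cplus_0_l. Qed.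

Lemma supp_Xb n c : supp n c -> supp (S n) (Xb c).
Proof. by move=> H [|k] Hk //=; apply: H; lia. Qed.

(** For a polynomial [c 0 + x c'(x)] the difference is [x] times that of [c'] plus [h c'(x + h)].
    Besides leading coefficients, the lemma provides the coefficients of translates in
    [fb_translate]. *)
Lemma difference_coef (h : R) n c : supp n c -> exists e, supp (Init.Nat.pred n) e /\
  (forall x, (pv n c (x + h) - pv n c x)%C = pv n e x) /\
  (forall k, n = S (S k) -> e k = (RtoC (INR (S k) * h) * c (S k))%C).
Proof.
elim: n c => [|n IH] c Hc.
  exists (fun _ => RtoC 0); split; first by [].
  by split; [move=> x; rewrite /pv /=; ring | move=> k].
set c' := fun k => c (S k).
have Hc' : supp n c' by move=> k Hk; apply: Hc; lia.
have [d [Hd [Hd1 Hd2]]] := IH c' Hc'.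
set e := fun k => (1 * Xb d k + 1 * (RtoC h * c' k + RtoC h * d k))%C.
have HXd : supp n (Xb d).
  by case: n {IH Hc Hc' Hd1 Hd2} Hd => [|n] Hd; move=> [|k] Hk //=; apply: Hd => /=; lia.
have Hdn : supp n d by apply: supp_mono Hd; lia.
have He : supp n e.
  by move=> k Hk; rewrite /e HXd // Hc' // Hdn //; ring.
exists e; split; first by [].
split.
- move=> x; rewrite (pv_mono n (S n) e x ltac:(lia) He) !pv_shift -/c'.
  rewrite /e !pv_lin.
  have -> : pv n (Xb d) x = (RtoC x * pv n d x)%C.
    by rewrite -pv_Xb; symmetry; apply: pv_mono HXd; lia.
  have E := Hd1 x; have -> : pv n c' (x + h) = (pv n d x + pv n c' x)%C by rewrite -E; ring.
  by rewrite RtoC_plus; ring.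
- move=> k [Hn]; rewrite /e /c'; case: k Hn => [|k] Hn.
  + have -> : d 0%nat = RtoC 0 by apply: Hd; rewrite Hn /=; lia.
    by rewrite /= Rmult_1_l; ring.
  + rewrite XbS Hd2 // (_ : d (S k) = RtoC 0); last by apply: Hd; rewrite Hn /=; lia.
    by rewrite (S_INR (S k)) Rmult_plus_distr_r Rmult_1_l RtoC_plus /c'; ring.
Qed.

Definition dl (h : R) (f : R -> C) (x : R) : C := (f (x + h)%R - f x)%C.

Lemma iter_dl_lead h j c x : supp (S j) c ->
  Nat.iter j (dl h) (pv (S j) c) x = (RtoC (h ^ j * INR (fact j)) * c j)%C.
Proof.
elim: j c x => [|j IH] c x Hc.
  by rewrite /= /pv /= Rmult_1_l; ring.
have [e [He [He1 He2]]] := difference_coef h (S (S j)) c Hc.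
rewrite Nat.iter_succ_r.
have -> : dl h (pv (S (S j)) c) = pv (S j) e.
  by apply: functional_extensionality => y; rewrite /dl He1; apply: pv_mono => //; lia.
rewrite IH // (He2 j) // -tech_pow_Rmult fact_simpl mult_INR !RtoC_mult; ring.
Qed.

Lemma iter_dl_bound h j f B p k :
  (forall i, (i <= k + j)%nat -> Cmod (f (p + INR i * h)) <= B) ->
  Cmod (Nat.iter j (dl h) f (p + INR k * h)) <= 2 ^ j * B.
Proof.
elim: j k => [|j IH] k H.
  by rewrite /= Rmult_1_l; apply: H; lia.
rewrite /= {1}/dl.
have -> : p + INR k * h + h = p + INR (S k) * h by rewrite S_INR; ring.
have h1 := IH (S k) (fun i Hi => H i ltac:(lia)); have h2 := IH k (fun i Hi => H i ltac:(lia)).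
have := Cmod_triangle (Nat.iter j (dl h) f (p + INR (S k) * h)) (- Nat.iter j (dl h) f (p + INR k * h)).
rewrite Cmod_opp /Cminus; lra.
Qed.

(* Newton's basis polynomials [prod_(i<j) (x - p - i h)]. *)
Fixpoint omega (p h : R) (j : nat) : nat -> C :=
  match j with
  | O => edelta 0
  | S j => fun k => (1 * Xb (omega p h j) k + (- RtoC (p + INR j * h)) * omega p h j k)%C
  end.

Lemma omega_supp p h j : supp (S j) (omega p h j).
Proof.
elim: j => [|j IH]; first by move=> [|k] Hk //; lia.
move=> k Hk; rewrite /= (supp_Xb _ _ IH) // IH; [ring | lia].
Qed.

Lemma omega_lead p h j : omega p h j j = RtoC 1.
Proof.
elim: j => [|j IH] //=; rewrite IH (omega_supp p h j (S j)); [ring | lia].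
Qed.

Lemma omega_node p h j i : (i < j)%nat -> pv (S j) (omega p h j) (p + INR i * h) = RtoC 0.
Proof.
elim: j => [|j IH] Hi; first by lia.
rewrite [omega _ _ _]/= pv_lin pv_Xb (pv_mono (S j) (S (S j)) _ _ ltac:(lia) (omega_supp p h j)).
have [->|Hlt] : i = j \/ (i < j)%nat by lia.
- by ring.
- by rewrite IH //; ring.
Qed.

Lemma nb_Xb n c : nb (S n) (Xb c) = nb n c.
Proof. by rewrite /nb Rsum_incr /= Cmod_0 Rplus_0_l. Qed.

Lemma nb_lin n p c q d : nb n (fun k => p * c k + q * d k)%C <= Cmod p * nb n c + Cmod q * nb n d.
Proof.
rewrite /nb -!Rsum_scal -Rsum_plus; apply: Rsum_le => k _.
by apply: Rle_trans (Cmod_triangle _ _) _; rewrite !Cmod_mult; lra.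
Qed.

Lemma nb_mono_supp n m c : (n <= m)%nat -> supp n c -> nb m c = nb n c.
Proof.
move=> H Hs; elim: H => [|k Hk IH] //.
by rewrite {1}/nb RsumS -/(nb k c) IH Hs ?Cmod_0 //; lra.
Qed.

Lemma nb_omega p h j A : (forall i, (i < j)%nat -> 1 + Rabs (p + INR i * h) <= A) -> 1 <= A ->
  nb (S j) (omega p h j) <= A ^ j.
Proof.
move=> H HA; elim: j H => [|j IH] H.
  by rewrite /nb /edelta /= Cmod_1; lra.
have h1 := IH (fun i Hi => H i ltac:(lia)); have h2 := H j ltac:(lia).
rewrite [omega _ _ _]/=; apply: Rle_trans (nb_lin _ _ _ _ _) _.
rewrite nb_Xb (nb_mono_supp (S j)); [|lia|exact: omega_supp].
rewrite Cmod_1 Cmod_opp Cmod_R /=.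
have h3 := nb_ge0 (S j) (omega p h j); have h4 := Rabs_pos (p + INR j * h).
have : 0 <= A ^ j by apply: pow_le; lra.
nra.
Qed.

(** The [j]-th difference over the nodes bounds the top coefficient [t]. Subtracting [t * omega]
    lowers the degree without changing the values at the earlier nodes, where [omega] vanishes, and
    the induction continues. *)
Lemma newton_bound p h A B n j c : 0 < h -> 1 <= A -> 0 <= B ->
  (forall i, (i < n)%nat -> 1 + Rabs (p + INR i * h) <= A) -> (j <= n)%nat -> supp j c ->
  (forall i, (i < j)%nat -> Cmod (pv j c (p + INR i * h)) <= B) ->
  nb j c <= B * Rsum j (fun i => (2 * A / h) ^ i / INR (fact i)).
Proof.
move=> Hh HA HB HAi; elim: j c => [|j IH] c Hj Hc Hb; first by rewrite /nb /=; lra.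
set t := c j.
have Hf : 0 < INR (fact j) by apply: INR_fact_lt_0.
have Hhj : 0 < h ^ j by apply: pow_lt.
have Ht : Cmod t <= 2 ^ j * B / (h ^ j * INR (fact j)).
  have h1 := iter_dl_bound h j (pv (S j) c) B p 0 (fun i Hi => Hb i ltac:(lia)).
  rewrite iter_dl_lead // Cmod_mult Cmod_R Rabs_pos_eq in h1; last by apply: Rlt_le; apply: Rmult_lt_0_compat.
  apply: (Rmult_le_reg_l (h ^ j * INR (fact j))); first exact: Rmult_lt_0_compat.
  apply: Rle_trans h1 _; apply: Req_le; field; lra.
set r := fun k => (1 * c k + (- t) * omega p h j k)%C.
have Hr : supp j r.
  move=> k Hk; rewrite /r; have [->|Hlt] : k = j \/ (S j <= k)%nat by lia.
  - by rewrite omega_lead /t; ring.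
  - by rewrite Hc // (omega_supp p h j k) //; ring.
have hr := IH r ltac:(lia) Hr _.
have {}hr : nb j r <= B * Rsum j (fun i => (2 * A / h) ^ i / INR (fact i)).
  apply: hr => i Hi.
  rewrite -(pv_mono j (S j) r) //; last by lia.
  rewrite /r pv_lin omega_node //.
  have -> : (1 * pv (S j) c (p + INR i * h) + - t * 0)%C = pv (S j) c (p + INR i * h) by ring.
  by apply: Hb; lia.
have ho := nb_omega p h j A (fun i Hi => HAi i ltac:(lia)) HA.
have hc : nb (S j) c <= nb j r + Cmod t * A ^ j.
  have -> : c = (fun k => 1 * r k + t * omega p h j k)%C.
    by apply: functional_extensionality => k; rewrite /r; ring.
  apply: Rle_trans (nb_lin _ _ _ _ _) _.
  rewrite (nb_mono_supp j (S j) r) //; last by lia.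
  rewrite Cmod_1 Rmult_1_l; apply: Rplus_le_compat_l; apply: Rmult_le_compat_l => //.
  exact: Cmod_ge_0.
rewrite RsumS Rmult_plus_distr_l; apply: Rle_trans hc _; apply: Rplus_le_compat => //.
have hA : 0 <= A ^ j by apply: pow_le; lra.
apply: (Rle_trans _ (2 ^ j * B / (h ^ j * INR (fact j)) * A ^ j)); first exact: Rmult_le_compat_r.
apply: Req_le; rewrite /Rdiv !Rpow_mult_distr pow_inv; field; lra.
Qed.

Lemma exp_partial x n : 0 <= x -> Rsum n (fun i => x ^ i / INR (fact i)) <= exp x.
Proof.
move=> Hx; have H := is_exp_Reals x.
have Hs : is_series (fun i => x ^ i / INR (fact i)) (exp x).
  apply: is_series_ext H => k; rewrite /scal /= /mult /= pow_n_pow /Rdiv; ring.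
rewrite -(is_series_unique _ _ Hs); apply: Rsum_le_Series; last by exists (exp x).
move=> k; apply: Rmult_le_pos; first exact: pow_le.
by apply: Rlt_le; apply: Rinv_0_lt_compat; apply: INR_fact_lt_0.
Qed.

(** With as many nodes as coefficients, at distance [h = (q - p) / mu], the sum in [newton_bound] is
    at most [D ^ mu] times a partial sum of [exp mu]. A bound geometric in [mu] is what matters,
    since [K ^ mu n] is subexponential in [Cmod (lam n)]. *)
Lemma poly_coef_bound p q : p < q -> exists K, 1 <= K /\ forall mu c B, supp mu c ->
  (forall x, p <= x <= q -> Cmod (pv mu c x) <= B) -> nb mu c <= K ^ mu * B.
Proof.
move=> Hpq; set A := 1 + Rabs p + Rabs q; set D := 1 + 2 * A / (q - p).
have HA : 1 <= A by rewrite /A; have := Rabs_pos p; have := Rabs_pos q; lra.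
have HD0 : 0 < 2 * A / (q - p) by apply: Rdiv_lt_0_compat; lra.
have HD : 1 <= D by rewrite /D; lra.
have He : 1 <= exp 1 by have := exp_ineq1_le 1; lra.
exists (D * exp 1); split; first by nra.
move=> [|n] c B Hc HB.
  by rewrite /nb /=; have := HB p ltac:(lra); have := Cmod_ge_0 (pv 0 c p); lra.
set mu := S n in Hc HB *.
have Hmu : 0 < INR mu by apply: lt_0_INR; rewrite /mu; lia.
have HB0 : 0 <= B by have := HB p ltac:(lra); have := Cmod_ge_0 (pv mu c p); lra.
set h := (q - p) / INR mu.
have Hh : 0 < h by apply: Rdiv_lt_0_compat; lra.
have hin i : (i < mu)%nat -> p <= p + INR i * h <= q.
  move=> Hi; have h1 : INR i <= INR mu by apply: le_INR; lia.
  have h2 := pos_INR i.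
  have h3 : INR mu * h = q - p by rewrite /h; field; lra.
  by split; nra.
have H := newton_bound p h A B mu mu c Hh HA HB0 _ (Nat.le_refl _) Hc _.
apply: Rle_trans (H _ _) _.
- move=> i Hi; have := hin i Hi; rewrite /A => h1.
  have : Rabs (p + INR i * h) <= Rabs p + Rabs q.
    apply: Rabs_le; have := Rle_abs q; have := Rle_abs (- p); rewrite Rabs_Ropp.
    have := Rabs_pos p; have := Rabs_pos q; lra.
  lra.
- by move=> i Hi; apply: HB; apply: hin.
rewrite Rmult_comm; apply: Rmult_le_compat_r => //.
apply: (Rle_trans _ (Rsum mu (fun i => D ^ mu * (INR mu ^ i / INR (fact i))))).
  apply: Rsum_le => i Hi.
  have -> : 2 * A / h = 2 * A / (q - p) * INR mu by rewrite /h; field; lra.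
  rewrite Rpow_mult_distr /Rdiv Rmult_assoc; apply: Rmult_le_compat_r.
    apply: Rmult_le_pos; first by apply: pow_le; lra.
    by apply: Rlt_le; apply: Rinv_0_lt_compat; apply: INR_fact_lt_0.
  apply: (Rle_trans _ (D ^ i)); first by apply: pow_incr; rewrite /D; rewrite /Rdiv in HD0 *; lra.
  by apply: Rle_pow => //; lia.
rewrite Rsum_scal Rpow_mult_distr; apply: Rmult_le_compat_l; first by apply: pow_le; lra.
apply: Rle_trans (exp_partial (INR mu) mu _) _; first by lra.
apply: Req_le; elim: (mu) => [|k IH]; first by rewrite exp_0.
by rewrite S_INR exp_plus IH /=; ring.
Qed.

(* Baire category argument, by nested intervals. *)
Lemma baire_bound (u : nat -> R -> C) p q : p < q ->
  (forall n, contR (u n)) ->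
  (forall x, p < x < q -> exists M, forall n, Cmod (u n x) <= M) ->
  exists p' q' M, p < p' /\ p' < q' /\ q' < q /\ forall n x, p' <= x <= q' -> Cmod (u n x) <= M.
Proof.
move=> Hpq Hu Hb; apply: NNPP => Hno.
have Hstep : forall s : nat * (R * R), exists t : R * R, p < fst (snd s) < snd (snd s) -> snd (snd s) < q ->
   fst (snd s) <= fst t /\ fst t < snd t /\ snd t <= snd (snd s) /\
   exists n, forall x, fst t <= x <= snd t -> INR (fst s) <= Cmod (u n x).
  move=> [k [a b]] /=.
  case: (excluded_middle_informative (p < a < b /\ b < q)) => [[Hab Hbq]|h]; last first.
    by exists (a, b) => h1 h2; case: h.
  (* Otherwise all [u n] would be bounded by [k] on the middle half of the interval, which [Hno]
     excludes. *)
  have [n [x [Hx Hnx]]] : exists n x, (a + (b - a) / 4 <= x <= b - (b - a) / 4) /\ INR k < Cmod (u n x).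
    apply: NNPP => Hn; apply: Hno.
    exists (a + (b - a) / 4), (b - (b - a) / 4), (INR k); split; first by lra.
    split; first by lra.
    split; first by lra.
    move=> n x Hx; apply: Rnot_lt_le => Hlt; apply: Hn; by exists n, x.
  have [d [Hd0 Hd]] := proj1 (contR_eps (u n)) (Hu n) x (Cmod (u n x) - INR k) ltac:(lra).
  set d' := Rmin (d / 2) ((b - a) / 4).
  have h1 := Rmin_l (d / 2) ((b - a) / 4); have h2 := Rmin_r (d / 2) ((b - a) / 4).
  have h3 : 0 < d' by apply: Rmin_pos; lra.
  rewrite -/d' in h1 h2.
  exists (x - d', x + d') => _ _ /=; split; first by lra.
  split; first by lra.
  split; first by lra.
  exists n => y Hy.
  have := Hd y ltac:(apply: Rabs_def1; lra).
  have := Cmod_triangle (u n y) (- (u n y - u n x)); rewrite Cmod_opp.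
  replace (u n y + - (u n y - u n x))%C with (u n x) by ring.
  lra.
set F := fun s => proj1_sig (constructive_indefinite_description _ (Hstep s)).
have HF s := proj2_sig (constructive_indefinite_description _ (Hstep s)).
(* Starting from the middle third keeps the common point inside [(p, q)], where the pointwise bound
   is available. *)
set I := fix I (k : nat) : R * R := match k with
   | O => (p + (q - p) / 3, q - (q - p) / 3) | S k => F (k, I k) end.
have HI k : p < fst (I k) < snd (I k) /\ snd (I k) < q.
  elim: k => [|k [IH1 IH2]]; first by rewrite /=; lra.
  have := HF (k, I k) IH1 IH2; rewrite -/(F (k, I k)) => -[h1 [h2 [h3 _]]].
  by rewrite [I (S k)]/= ; move: h1 h2 h3; rewrite /=; lra.
have HI' k := HF (k, I k) (proj1 (HI k)) (proj2 (HI k)).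
have [x Hx] := nested_point (fun k => fst (I k)) (fun k => snd (I k))
  ltac:(move=> k; have [h _] := HI' k; exact h)
  ltac:(move=> k; have [_ [_ [h _]]] := HI' k; exact h)
  ltac:(move=> k; have := HI k; lra).
have [M HM] := Hb x ltac:(have := Hx 0%nat; rewrite /=; lra).
have [k Hk] := INR_archimed 1 M Rlt_0_1; rewrite Rmult_1_r in Hk.
have [_ [_ [_ [n Hn]]]] := HI' k.
have := Hn x (Hx (S k)); have := HM n; rewrite /=; lra.
Qed.

(** * Solutions of F(D) f = 0 and convergent expansions *)

(** Dividing by the exponential bounds the polynomial on [[p, q]] by [M * exp (- Re (lam n) * p)]
    with [p >= b - eta/2]. Passing to the coefficients costs [K ^ mu n], at most a constant times
    [exp (eta/2 * Re (lam n))]. *)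
Lemma CB_of_bound lam mu kap b c : good lam mu kap -> (forall n, supp (mu n) (c n)) ->
  (forall eta, 0 < eta -> exists p q M, b - eta <= p /\ p < q /\
     forall n x, p <= x <= q -> Cmod (fb (mu n) (lam n) (c n) x) <= M) ->
  CB lam mu b c.
Proof.
move=> Hg Hs H; split=> // eta He.
have hk := good_kap _ _ _ Hg.
have [p [q [M [Hp [Hpq HM]]]]] := H (eta / 2) ltac:(lra).
have [K [HK1 HK]] := poly_coef_bound p q Hpq.
have [M1 [HM1 H1]] := pow_mu_subexp lam mu kap K (eta / 2 * kap) Hg HK1 ltac:(apply: Rmult_lt_0_compat; lra).
have HM0 : 0 <= M by have := HM 0%nat p ltac:(lra); have := Cmod_ge_0 (fb (mu 0%nat) (lam 0%nat) (c 0%nat) p); lra.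
exists (M1 * M); split; first exact: Rmult_le_pos.
move=> n; have hr := good_re _ _ _ Hg n.
have hr0 : 0 <= Re (lam n) by have := Cmod_ge_0 (lam n); nra.
have h1 : nb (mu n) (c n) <= K ^ mu n * (M * exp (- Re (lam n) * p)).
  apply: HK => // x Hx.
  have -> : pv (mu n) (c n) x = (fb (mu n) (lam n) (c n) x * cexp (- lam n * RtoC x))%C.
    rewrite /fb -Cmult_assoc -cexp_plus.
    have -> : (lam n * RtoC x + - lam n * RtoC x)%C = RtoC 0 by ring.
    by rewrite cexp_0; ring.
  rewrite Cmod_mult Cmod_cexp Re_lam_x; apply: Rmult_le_compat; [exact: Cmod_ge_0| |exact: HM|].
    by apply: Rlt_le; apply: exp_pos.
  apply: exp_mono.
  have -> : Re (- lam n) = - Re (lam n) by [].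
  nra.
apply: Rle_trans h1 _.
have he : exp (eta / 2 * kap * Cmod (lam n)) * exp (- Re (lam n) * p) <= exp (- (b - eta) * Re (lam n)).
  rewrite -exp_plus; apply: exp_mono.
  have : eta / 2 * (kap * Cmod (lam n)) <= eta / 2 * Re (lam n) by apply: Rmult_le_compat_l; lra.
  nra.
have h2 := H1 n.
apply: (Rle_trans _ (M1 * exp (eta / 2 * kap * Cmod (lam n)) * (M * exp (- Re (lam n) * p)))).
  apply: Rmult_le_compat_r => //; apply: Rmult_le_pos => //; apply: Rlt_le; exact: exp_pos.
have -> : M1 * exp (eta / 2 * kap * Cmod (lam n)) * (M * exp (- Re (lam n) * p)) =
  M1 * M * (exp (eta / 2 * kap * Cmod (lam n)) * exp (- Re (lam n) * p)) by ring.
by apply: Rmult_le_compat_l => //; apply: Rmult_le_pos.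
Qed.

Lemma RD_contR (f f' : R -> C) : (forall x, RD f x (f' x)) -> contR f.
Proof.
move=> H t; have [h1 h2] := H t; split.
- by apply: ex_derive_continuous; exists (Re (f' t)).
- by apply: ex_derive_continuous; exists (Im (f' t)).
Qed.

Lemma limC_terms_bounded (a : nat -> C) l : limC (fun N => Csum N a) l -> exists M, forall n, Cmod (a n) <= M.
Proof.
move=> H; have [B HB] := limC_bounded _ _ H; exists (2 * B) => n.
have h1 := HB n; have h2 := HB (S n).
have := Cmod_triangle (Csum (S n) a) (- Csum n a); rewrite Cmod_opp CsumS.
replace (Csum n a + a n + - Csum n a)%C with (a n) by ring.
by move: h2; rewrite CsumS; lra.
Qed.

(** [Wclass] does not constrain [c n k] for [k >= mu n], whereas the operators on sequences require
    these entries to be 0. *)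
Definition trunc (mu : nat -> nat) (c : nat -> nat -> C) (n k : nat) : C :=
  if Nat.ltb k (mu n) then c n k else RtoC 0.

Lemma trunc_supp mu c n : supp (mu n) (trunc mu c n).
Proof. by move=> k Hk; rewrite /trunc; have /Nat.ltb_ge -> := Hk. Qed.

Lemma Eblock_trunc lam mu c n x : Eblock lam mu c n x = fb (mu n) (lam n) (trunc mu c n) x.
Proof.
rewrite /Eblock /fb /pv; congr (_ * _)%C; apply: Csum_ext => k Hk.
by rewrite /trunc; have /Nat.ltb_lt -> := Hk.
Qed.

(** At each point the terms of the series are bounded. For every [eta], [baire_bound] is applied
    between the larger of [a] and [b - eta] and the endpoint [b], which places the interval of
    uniform boundedness as close to [b] as [CB_of_bound] asks. *)
Lemma W_CB lam mu kap a b f c : good lam mu kap -> a < b ->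
  (forall x, a < x < b -> is_series (K := C_AbsRing) (V := C_NormedModule) (fun n => Eblock lam mu c n x) (f x)) ->
  CB lam mu b (trunc mu c) /\ forall x, a < x < b -> f x = gsum lam mu (trunc mu c) 0 x.
Proof.
move=> Hg Hab H.
have Hs n := trunc_supp mu c n.
have Hl x : a < x < b -> limC (fun N => Csum N (fun n => fb (mu n) (lam n) (trunc mu c n) x)) (f x).
  move=> Hx; have /is_series_limC := H x Hx.
  by apply: limC_ext => N; apply: Csum_ext => n _; apply: Eblock_trunc.
have Hc : CB lam mu b (trunc mu c).
  apply: (CB_of_bound _ _ kap) => // eta He.
  set p := Rmax a (b - eta).
  have hp : p < b by apply: Rmax_lub_lt; lra.
  have hp1 : a <= p := Rmax_l _ _; have hp2 : b - eta <= p := Rmax_r _ _.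
  have [p' [q' [M [h1 [h2 [h3 h4]]]]]] := baire_bound (fun n => fb (mu n) (lam n) (trunc mu c n)) p b hp
    (fun n => RD_contR _ _ (fun x => RD_fb _ (lam n) _ x (Hs n)))
    (fun x Hx => limC_terms_bounded _ _ (Hl x ltac:(lra))).
  by exists p', q', M; split; [lra | split].
split=> // x Hx; apply: limC_unique (Hl x Hx) _.
by apply: CS_lim; apply: (dblk_summ _ _ kap b _ 0); [| |lra].
Qed.

Lemma Csum_RtoC N (a : nat -> R) : Csum N (fun n => RtoC (a n)) = RtoC (Rsum N a).
Proof. by elim: N => [|N IH] //=; rewrite IH RtoC_plus. Qed.

Lemma Csum_G lam mu N g (x : R) : (forall n, lam n <> RtoC 0) -> wsum (rL lam) mu ->
  Csum N (fun n => taylor_coef (Gprod lam mu) n * RtoC (Cmod (g n x)))%C =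
  RtoC (Rsum N (fun n => Gi (rL lam) mu n * Cmod (g n x : C))).
Proof.
move=> H0 Hw; rewrite -Csum_RtoC; apply: Csum_ext => n _.
by rewrite taylor_G // RtoC_mult.
Qed.

Lemma classG_V lam mu kap a b g f : good lam mu kap -> classG lam mu a b g ->
  (forall x, a < x < b -> g 0%nat x = f x) -> (forall x, a < x < b -> WW lam mu g x = RtoC 0) ->
  Vclass lam mu a b f.
Proof.
move=> Hg [G1 [G2 G3]] Hf HW.
have H0 := good_ne _ _ _ Hg; have Hw := good_sum _ _ _ Hg.
exists g; split; first split.
- by split=> // k x Hx; apply/RD_is_derive; apply: G1.
- move=> eps He; exists (fun x => RtoC (Series (fun m => Gi (rL lam) mu m * Cmod (g m x)))) => d Hd.
  have [N HN] := G3 eps (d / 2) He ltac:(lra).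
  exists N => M HM x Hx; rewrite Csum_G //.
  have Hx' : a < x < b by lra.
  rewrite -RtoC_minus Cmod_R (Series_split _ N (G2 x Hx')).
  have h0 m : 0 <= Gi (rL lam) mu m * Cmod (g m x) by apply: Rmult_le_pos; [apply: Gi_ge0 | apply: Cmod_ge_0].
  have h1 := Rsum_le_Series _ M h0 (G2 x Hx'); rewrite (Series_split _ N (G2 x Hx')) in h1.
  have h2 := Rsum_mono _ N M h0 HM; have h3 := HN x Hx.
  by rewrite Rabs_left1; lra.
- move=> x Hx; apply/is_series_limC; rewrite -(HW x Hx).
  apply: (limC_ext (fun N => Csum N (fun m => Fi (lF lam) mu m * g m x)%C)).
    by move=> N; apply: Csum_ext => m _; rewrite taylor_F // lF_rL.
  apply: CS_lim; apply: summ_le (G2 x Hx) => m; rewrite Cmod_mult.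
  apply: Rmult_le_compat_r; first exact: Cmod_ge_0.
  exact: Fi_le_G.
Qed.

Lemma V_classG lam mu kap a b f g : good lam mu kap -> classC lam mu a b f g -> classG lam mu a b g.
Proof.
move=> Hg [[_ T] U].
have H0 := good_ne _ _ _ Hg; have Hw := good_sum _ _ _ Hg.
have h0 m x : 0 <= Gi (rL lam) mu m * Cmod (g m x) by apply: Rmult_le_pos; [apply: Gi_ge0 | apply: Cmod_ge_0].
(* Cauchy criterion: in differences of partial sums the limit function [S] cancels. *)
have key eps d : 0 < eps -> 0 < d -> exists N, forall x, a + eps < x < b - eps -> forall M,
   Rsum M (fun m => Gi (rL lam) mu m * Cmod (g m x)) <= Rsum N (fun m => Gi (rL lam) mu m * Cmod (g m x)) + d.
  move=> He Hd; have [S HS] := U eps He; have [N HN] := HS (d / 2) ltac:(lra).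
  exists N => x Hx M.
  have h1 := HN N (Nat.le_refl _) x Hx; have h2 := HN (N + M)%nat ltac:(lia) x Hx.
  rewrite !Csum_G // in h1 h2.
  set A := Rsum N _ in h1 *; set B := Rsum (N + M) _ in h2.
  have h3 : Rsum M (fun m => Gi (rL lam) mu m * Cmod (g m x)) <= B by apply: Rsum_mono => //; lia.
  have := Cmod_triangle (RtoC B - S x) (- (RtoC A - S x)); rewrite Cmod_opp.
  replace (RtoC B - S x + - (RtoC A - S x))%C with (RtoC B - RtoC A)%C by ring.
  rewrite -RtoC_minus Cmod_R; have := Rle_abs (B - A); lra.
have ex x : a < x < b -> ex_series (fun m => Gi (rL lam) mu m * Cmod (g m x)).
  move=> Hx; set eps := Rmin (x - a) (b - x) / 2.
  have e1 := Rmin_l (x - a) (b - x); have e2 := Rmin_r (x - a) (b - x).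
  have e3 : 0 < Rmin (x - a) (b - x) by apply: Rmin_pos; lra.
  have [N HN] := key eps 1 ltac:(rewrite /eps; lra) Rlt_0_1.
  by apply: (ex_series_bound _ _ (fun m => h0 m x)) => M; apply: HN; rewrite /eps; lra.
split; last split => //.
- by move=> m x Hx; apply/RD_is_derive; apply: T.
- move=> eps d He Hd; have [N HN] := key eps d He Hd.
  exists N => x Hx.
  have Hx' : a < x < b by lra.
  have := Series_le_bound _ _ (HN x Hx) (ex x Hx').
  rewrite (Series_split _ N (ex x Hx')); lra.
Qed.

Lemma classG_tail_dom lam mu a b g : wsum (rL lam) mu -> classG lam mu a b g -> forall k eps d, 0 < eps -> 0 < d ->
  exists N, forall x, a + eps < x < b - eps ->
     Series (fun m => Gi (rL lam) mu (N + m + k)%nat * Cmod (g (N + m + k)%nat x)) <= d.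
Proof.
move=> Hw [_ [G2 G3]] k eps d He Hd; have [N HN] := G3 eps d He Hd.
exists N => x Hx; apply: Rle_trans (HN x Hx).
have h0 m : 0 <= Gi (rL lam) mu m * Cmod (g m x) by apply: Rmult_le_pos; [apply: Gi_ge0 | apply: Cmod_ge_0].
have hN : ex_series (fun m => Gi (rL lam) mu (N + m)%nat * Cmod (g (N + m)%nat x)).
  exact: (proj1 (ex_series_incr_n (V := R_NormedModule) (fun m => Gi (rL lam) mu m * Cmod (g m x)) N) (G2 x ltac:(lra))).
rewrite (Series_split _ k hN).
have := Rsum_ge0 k (fun m => Gi (rL lam) mu (N + m)%nat * Cmod (g (N + m)%nat x)) (fun m _ => h0 (N + m)%nat).
have -> : Series (fun m => Gi (rL lam) mu (N + m + k)%nat * Cmod (g (N + m + k)%nat x)) =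
   Series (fun m => Gi (rL lam) mu (N + (k + m))%nat * Cmod (g (N + (k + m))%nat x)).
  by apply: Series_ext => m; have -> : (N + m + k = N + (k + m))%nat by lia.
lra.
Qed.

Lemma WW_summ lam mu kap a b g mu' x : good lam mu kap -> classG lam mu a b g -> a < x < b ->
  (forall n, (mu' n <= mu n)%nat) -> summ (fun m => Fi (lF lam) mu' m * g m x)%C.
Proof.
move=> Hg [_ [G2 _]] Hx Hm.
have H0 := good_ne _ _ _ Hg; have Hw := good_sum _ _ _ Hg.
apply: summ_le (G2 x Hx) => m; rewrite Cmod_mult.
by apply: Rmult_le_compat_r; [apply: Cmod_ge_0 | apply: Fi_le_G].
Qed.

(** Formally, [WW] for [bump mu' k] is [(1 - D / lam k)] applied to [WW] for [mu']. In the
    derivative, coefficients of index [m] meet [g (S m)]; [Gi_bump_ge] bounds them by [Cmod (lam k)]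
    times the majorant of index [m+1], provided that [mu] leaves room for one more zero at
    [lam k]. *)
Lemma RD_WW lam mu kap a b g mu' k x : good lam mu kap -> classG lam mu a b g -> a < x < b ->
  (forall n, (bump mu' k n <= mu n)%nat) ->
  RD (WW lam mu' g) x (lam k * (WW lam mu' g x - WW lam (bump mu' k) g x))%C.
Proof.
move=> Hg HG Hx Hm; have [G1 [G2 _]] := HG.
have H0 := good_ne _ _ _ Hg; have Hw := good_sum _ _ _ Hg.
have Hm' n : (mu' n <= mu n)%nat.
  by have := Hm n; rewrite /bump; case: Nat.eqb; lia.
have hlk := good_pos _ _ _ k Hg.
have hw' : wsum (rL lam) mu' by apply: wsum_mono Hw.
have hwF : wsum (fun n => Cmod (lF lam n)) mu' by rewrite lF_rL.
have hb m y : Cmod (Fi (lF lam) mu' m * g (S m) y)%C <= Cmod (lam k) * (Gi (rL lam) mu (S m) * Cmod (g (S m) y)).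
  rewrite Cmod_mult -Rmult_assoc; apply: Rmult_le_compat_r; first exact: Cmod_ge_0.
  apply: Rle_trans (Fi_le_Gi _ _ m hwF) _; rewrite lF_rL //.
  have h1 := Gi_bump_ge (rL lam) mu' k m hw'; have h2 := Gi_mono _ _ _ (S m) Hw Hm.
  have -> : Gi (rL lam) mu' m = Cmod (lam k) * (rL lam k * Gi (rL lam) mu' m) by rewrite /rL; field; lra.
  by apply: Rmult_le_compat_l; lra.
have hs' y : a < y < b -> ex_series (fun m => Cmod (lam k) * (Gi (rL lam) mu (S m) * Cmod (g (S m) y))).
  move=> Hy; apply: (ex_series_scal_l (V := R_NormedModule)).
  exact: (proj1 (ex_series_incr_1 (V := R_NormedModule) (fun m => Gi (rL lam) mu m * Cmod (g m y))) (G2 y Hy)).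
have hS y : a < y < b -> summ (fun m => Fi (lF lam) mu' m * g (S m) y)%C.
  by move=> Hy; apply: summ_le (fun m => hb m y) (hs' y Hy).
have hS0 y : a < y < b -> summ (fun m => Fi (lF lam) mu' m * g m y)%C.
  by move=> Hy; apply: (WW_summ lam mu kap a b).
have E : (lam k * (WW lam mu' g x - WW lam (bump mu' k) g x))%C = CS (fun m => Fi (lF lam) mu' m * g (S m) x)%C.
  have hB : summ (fun m => Fi (lF lam) (bump mu' k) m * g m x)%C by apply: (WW_summ lam mu kap a b).
  rewrite /WW (CS_incr _ (hS0 x Hx)) (CS_incr _ hB) Fi_bump //.
  rewrite (CS_ext (fun n => Fi (lF lam) (bump mu' k) (S n) * g (S n) x)%C
    (fun n => Fi (lF lam) mu' (S n) * g (S n) x - lF lam k * (Fi (lF lam) mu' n * g (S n) x))%C); last first.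
    by move=> n; rewrite Fi_bump //=; ring.
  rewrite CS_minus; [|exact: (proj1 (summ_incr _) (hS0 x Hx))|apply: summ_scal; exact: hS].
  rewrite CS_scal; last exact: hS.
  rewrite [lin _ _ 0%nat]/= /lF.
  set A := CS _; set B := CS _; field; exact: H0.
rewrite E.
set eps := Rmin (x - a) (b - x) / 2.
have e1 := Rmin_l (x - a) (b - x); have e2 := Rmin_r (x - a) (b - x).
have e3 : 0 < Rmin (x - a) (b - x) by apply: Rmin_pos; lra.
have hin y : a + eps < y < b - eps -> a < y < b by rewrite /eps; lra.
apply: (RD_CS (fun m y => Fi (lF lam) mu' m * g m y)%C (fun m y => Fi (lF lam) mu' m * g (S m) y)%C (a + eps) (b - eps)).
- by move=> n t Ht; apply: RD_scal; apply: G1; apply: hin.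
- by move=> t Ht; apply: hS0; apply: hin.
- by move=> t Ht; apply: hS; apply: hin.
- move=> d Hd.
  have [N HN] := classG_tail_dom lam mu a b g Hw HG 1 eps (d / Cmod (lam k)) ltac:(rewrite /eps; lra) ltac:(apply: Rdiv_lt_0_compat; lra).
  exists N => t Ht.
  apply: (Rle_trans _ (Series (fun m => Cmod (lam k) * (Gi (rL lam) mu (N + m + 1)%nat * Cmod (g (N + m + 1)%nat t))))).
    apply: Series_le => [m|].
      split; first exact: Cmod_ge_0.
      by have := hb (N + m)%nat t; have -> : (S (N + m) = N + m + 1)%nat by lia.
    have := proj1 (ex_series_incr_n (V := R_NormedModule) _ N) (hs' t (hin t Ht)).
    by apply: ex_series_ext => m; have -> : (S (N + m) = N + m + 1)%nat by lia.
  rewrite Series_scal_l.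
  have := Rmult_le_compat_l _ _ _ (Rlt_le _ _ hlk) (HN t Ht).
  have -> : Cmod (lam k) * (d / Cmod (lam k)) = d by field; lra.
  exact.
- by rewrite /eps; lra.
Qed.

(** The copies of [lam n] are removed one at a time, starting from [WW lam mu g = 0]; each removal
    is an instance of [ode_block] and raises the degree by one. *)
Lemma V_block lam mu kap a b g n : good lam mu kap -> a < b -> classG lam mu a b g ->
  (forall x, a < x < b -> WW lam mu g x = RtoC 0) ->
  exists v, supp (mu n) v /\ forall x, a < x < b -> WW lam (except mu n) g x = fb (mu n) (lam n) v x.
Proof.
move=> Hg Hab HG HW.
have key j : (j <= mu n)%nat -> exists v, supp j v /\
   forall x, a < x < b -> WW lam (addmu (except mu n) n (mu n - j)) g x = fb j (lam n) v x.
  elim: j => [|j IH] Hj.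
    exists (fun _ => RtoC 0); split=> // x Hx.
    by rewrite Nat.sub_0_r addmu_except HW // fb_zero.
  have [v [Hv Ev]] := IH ltac:(lia).
  apply: (ode_block _ (lam n) j v a b Hab Hv) => x Hx.
  have e : bump (addmu (except mu n) n (mu n - S j)) n = addmu (except mu n) n (mu n - j).
    by rewrite bump_addmu; congr addmu; lia.
  rewrite -Ev // -e; apply: (RD_WW lam mu kap a b) => // m.
  rewrite e /addmu /except; case: Nat.eqb_spec => [->|] //; lia.
have [v [Hv Ev]] := key (mu n) (Nat.le_refl _).
by exists v; split=> // x Hx; rewrite -Ev // Nat.sub_diag addmu_0.
Qed.

Lemma WW_bound lam mu kap a b g mu' x : good lam mu kap -> classG lam mu a b g -> a < x < b ->
  (forall n, (mu' n <= mu n)%nat) ->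
  Cmod (WW lam mu' g x) <= Series (fun m => Gi (rL lam) mu m * Cmod (g m x)).
Proof.
move=> Hg [_ [G2 _]] Hx Hm.
have H0 := good_ne _ _ _ Hg; have Hw := good_sum _ _ _ Hg.
apply: CS_bound (G2 x Hx) => m; rewrite Cmod_mult.
by apply: Rmult_le_compat_r; [apply: Cmod_ge_0 | apply: Fi_le_G].
Qed.

(** Near [x0] finitely many terms are bounded by continuity, and the tail by 1. With [WW_bound] this
    gives a single bound for all the functions [F_{mu'}(D) g]. *)
Lemma classG_local_bound lam mu kap a b g x0 : good lam mu kap -> classG lam mu a b g -> a < x0 < b ->
  exists d M, 0 < d /\ forall x, x0 <= x <= x0 + d ->
    a < x < b /\ Series (fun m => Gi (rL lam) mu m * Cmod (g m x)) <= M.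
Proof.
move=> Hg [G1 [G2 G3]] Hx0.
set eps := Rmin (x0 - a) (b - x0) / 2.
have e1 := Rmin_l (x0 - a) (b - x0); have e2 := Rmin_r (x0 - a) (b - x0).
have e3 : 0 < Rmin (x0 - a) (b - x0) by apply: Rmin_pos; lra.
have [N HN] := G3 eps 1 ltac:(rewrite /eps; lra) Rlt_0_1.
have hloc : forall m, exists d, 0 < d /\ forall x, x0 <= x <= x0 + d -> Cmod (g m x) <= Cmod (g m x0) + 1.
  move=> m; have [h1 h2] := G1 m x0 Hx0.
  have /continuous_eps c1 := ex_derive_continuous _ x0 (ex_intro _ _ h1).
  have /continuous_eps c2 := ex_derive_continuous _ x0 (ex_intro _ _ h2).
  have [d1 [Hd1 D1]] := c1 (/ 2) ltac:(lra); have [d2 [Hd2 D2]] := c2 (/ 2) ltac:(lra).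
  exists (Rmin d1 d2 / 2); have m1 := Rmin_l d1 d2; have m2 := Rmin_r d1 d2.
  have m3 : 0 < Rmin d1 d2 by apply: Rmin_pos.
  split; first by lra.
  move=> x Hx.
  have a1 := D1 x ltac:(apply: Rabs_def1; lra); have a2 := D2 x ltac:(apply: Rabs_def1; lra).
  have := Cmod_triangle (g m x - g m x0) (g m x0); have := Cmod_Rabs_le (g m x - g m x0).
  have -> : Re (g m x - g m x0) = Re (g m x) - Re (g m x0) by [].
  have -> : Im (g m x - g m x0) = Im (g m x) - Im (g m x0) by [].
  replace (g m x - g m x0 + g m x0)%C with (g m x) by ring.
  lra.
have hfin : forall K, exists d, 0 < d /\ forall x, x0 <= x <= x0 + d ->
   Rsum K (fun m => Gi (rL lam) mu m * Cmod (g m x)) <= Rsum K (fun m => Gi (rL lam) mu m * (Cmod (g m x0) + 1)).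
  elim=> [|K [d [Hd H]]]; first by exists 1; split; [lra | move=> x _ /=; lra].
  have [d' [Hd' H']] := hloc K.
  exists (Rmin d d'); have m1 := Rmin_l d d'; have m2 := Rmin_r d d'.
  split; first exact: Rmin_pos.
  move=> x Hx; rewrite !RsumS; apply: Rplus_le_compat; first by apply: H; lra.
  apply: Rmult_le_compat_l; first by apply: Gi_ge0; apply: good_sum Hg.
  by apply: H'; lra.
have [d [Hd H]] := hfin N.
exists (Rmin d (eps / 2)), (Rsum N (fun m => Gi (rL lam) mu m * (Cmod (g m x0) + 1)) + 1).
have m1 := Rmin_l d (eps / 2); have m2 := Rmin_r d (eps / 2).
split; first by apply: Rmin_pos => //; rewrite /eps; lra.
move=> x Hx; rewrite /eps in Hx m1 m2 HN.
have Hxab : a < x < b by lra.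
split=> //; rewrite (Series_split _ N (G2 x Hxab)).
by have := H x ltac:(lra); have := HN x ltac:(lra); lra.
Qed.

Lemma classG_minus lam mu kap a b g h : good lam mu kap -> classG lam mu a b g -> classG lam mu a b h ->
  classG lam mu a b (fun m x => g m x - h m x)%C.
Proof.
move=> Hg [G1 [G2 G3]] [H1 [H2 H3]]; have Hw := good_sum _ _ _ Hg.
have hle m x : 0 <= Gi (rL lam) mu m * Cmod (g m x - h m x) <=
   Gi (rL lam) mu m * Cmod (g m x) + Gi (rL lam) mu m * Cmod (h m x).
  have g0 := Gi_ge0 (rL lam) mu m Hw.
  split; first by apply: Rmult_le_pos => //; apply: Cmod_ge_0.
  rewrite -Rmult_plus_distr_l; apply: Rmult_le_compat_l => //.
  by have := Cmod_triangle (g m x) (- h m x); rewrite Cmod_opp.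
split; last split.
- by move=> m x Hx; apply: RD_minus; [apply: G1 | apply: H1].
- move=> x Hx; apply: ex_series_le0 (fun m => hle m x) _.
  by apply: (ex_series_plus (V := R_NormedModule)); [apply: G2 | apply: H2].
- move=> eps d He Hd.
  have c1 := G3 eps (d / 2) He ltac:(lra); have c2 := H3 eps (d / 2) He ltac:(lra).
  have [N1 HN1] := c1; have [N2 HN2] := c2.
  exists (N1 + N2)%nat => x Hx; have Hx' : a < x < b by lra.
  have e1 := proj1 (ex_series_incr_n (V := R_NormedModule) _ (N1 + N2)) (G2 x Hx').
  have e2 := proj1 (ex_series_incr_n (V := R_NormedModule) _ (N1 + N2)) (H2 x Hx').
  apply: Rle_trans (Series_le _ _ (fun m => hle (N1 + N2 + m)%nat x) (ex_series_plus (V := R_NormedModule) _ _ e1 e2)) _.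
  have tailmono (u : nat -> R) P Q : (forall m, 0 <= u m) -> ex_series u -> (P <= Q)%nat ->
     Series (fun m => u (Q + m)%nat) <= Series (fun m => u (P + m)%nat).
    move=> hu hs hPQ; have := Series_split u P hs; have := Series_split u Q hs; have := Rsum_mono u P Q hu hPQ; lra.
  rewrite Series_plus //.
  have p1 := tailmono _ N1 (N1 + N2)%nat (fun m => Rmult_le_pos _ _ (Gi_ge0 (rL lam) mu m Hw) (Cmod_ge_0 (g m x))) (G2 x Hx') ltac:(lia).
  have p2 := tailmono _ N2 (N1 + N2)%nat (fun m => Rmult_le_pos _ _ (Gi_ge0 (rL lam) mu m Hw) (Cmod_ge_0 (h m x))) (H2 x Hx') ltac:(lia).
  by have := HN1 x Hx; have := HN2 x Hx; lra.
Qed.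

Lemma W_sub_V lam mu kap a b f : good lam mu kap -> a < b -> Wclass lam mu a b f -> Vclass lam mu a b f.
Proof.
move=> Hg Hab [c Hc].
have [HCB Hf] := W_CB lam mu kap a b f c Hg Hab Hc.
have H0 := good_ne _ _ _ Hg; have Hw := good_sum _ _ _ Hg.
apply: (classG_V lam mu kap a b (gsum lam mu (trunc mu c))) => //.
- exact: (gsum_classG _ _ kap).
- by move=> x Hx; rewrite Hf.
- move=> x Hx; rewrite (WW_gsum lam mu kap b) //; last by lra.
  rewrite (CS_ext _ (fun _ => RtoC 0)).
    by rewrite (proj2 (CS_eq_fin _ 0 (fun _ _ => eq_refl))).
  by move=> n; rewrite Op_Fi_zero ?fb_zero //; apply: trunc_supp.
Qed.

(** * Recovering the blocks from the function *)

Lemma edelta_supp : supp 1 (edelta 0).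
Proof. by move=> [|k] Hk //; lia. Qed.

(** If the value were 0, the operator would kill the constant block [edelta 0], against the lower
    bound. *)
Lemma except_PS_neq0 lam mu n M : (forall k, lam k <> RtoC 0) -> wsum (rL lam) mu -> (0 < mu n)%nat ->
  (forall c, supp (mu n) c -> nb (mu n) c <= M * nb (mu n) (Op (Fi (lF lam) (except mu n)) (lam n) c)) ->
  PS (Fi (lF lam) (except mu n)) (lam n) <> RtoC 0.
Proof.
move=> H0 Hw Hmu HM E.
have He := edelta_supp.
have Hs : supp (mu n) (edelta 0) by apply: supp_mono He.
have Ha := entS_FiL lam mu _ H0 Hw (except_le mu n).
have hz : nb (mu n) (Op (Fi (lF lam) (except mu n)) (lam n) (edelta 0)) = 0.
  rewrite /nb (Rsum_ext _ _ (fun _ => 0 * 0)); first by rewrite Rsum_scal; ring.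
  move=> k _; case: k => [|k].
  - by rewrite Op_top // E Cmult_0_l Cmod_0; ring.
  - by rewrite (supp_Op _ 1) ?Cmod_0 //; [ring | lia].
have := HM _ Hs; rewrite hz Rmult_0_r.
have : 1 <= nb (mu n) (edelta 0).
  have := Cmod_le_nb (mu n) (edelta 0) 0 Hs; by rewrite /edelta /= Cmod_1.
lra.
Qed.

Definition cut (N : nat) (c : nat -> nat -> C) (n : nat) : nat -> C :=
  if Nat.ltb n N then c n else fun _ => RtoC 0.

Lemma cut_CB lam mu b c N : CB lam mu b c -> CB lam mu b (cut N c).
Proof.
move=> [H1 H2]; split.
- by move=> n; rewrite /cut; case: Nat.ltb.
- move=> eta He; have [M [HM0 HM]] := H2 eta He; exists M; split=> // n.
  rewrite /cut; case: Nat.ltb => //.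
  rewrite /nb (Rsum_ext _ _ (fun _ => 0 * 0)); last by move=> k _; rewrite Cmod_0; ring.
  rewrite Rsum_scal; have := exp_pos (- (b - eta) * Re (lam n)); nra.
Qed.

Lemma cut_lt N c n : (n < N)%nat -> cut N c n = c n.
Proof. by move=> /Nat.ltb_lt H; rewrite /cut H. Qed.

Lemma cut_ge N c n : (N <= n)%nat -> cut N c n = fun _ => RtoC 0.
Proof. by move=> /Nat.ltb_ge H; rewrite /cut H. Qed.

Lemma WW_minus lam mu kap a b g h mu' x : good lam mu kap -> classG lam mu a b g -> classG lam mu a b h ->
  a < x < b -> (forall n, (mu' n <= mu n)%nat) ->
  WW lam mu' (fun m x => g m x - h m x)%C x = (WW lam mu' g x - WW lam mu' h x)%C.
Proof.
move=> Hg Gg Gh Hx Hm; rewrite /WW -CS_minus; last 2 first.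
- exact: (WW_summ lam mu kap a b).
- exact: (WW_summ lam mu kap a b).
by apply: CS_ext => m; ring.
Qed.

Lemma bump_le mu mu' k : (forall n, (mu' n <= mu n)%nat) -> (mu' k < mu k)%nat ->
  forall n, (bump mu' k n <= mu n)%nat.
Proof. by move=> H Hk n; rewrite /bump; case: Nat.eqb_spec => [->|]. Qed.

Fixpoint nsum (N : nat) (f : nat -> nat) : nat :=
  match N with O => O | S N => (nsum N f + f N)%nat end.

Lemma nsum_term N f k : (k < N)%nat -> (f k <= nsum N f)%nat.
Proof.
elim: N => [|N IH] Hk /=; first by lia.
have [->|Hlt] : k = N \/ (k < N)%nat by lia.
- by lia.
- by have := IH Hlt; lia.
Qed.

Lemma nsum_le N f f' : (forall n, (f n <= f' n)%nat) -> (nsum N f <= nsum N f')%nat.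
Proof. by move=> H; elim: N => [|N IH] //=; have := H N; lia. Qed.

Lemma nsum_lt N f f' k : (k < N)%nat -> (forall n, (f n <= f' n)%nat) -> (f k < f' k)%nat ->
  (nsum N f < nsum N f')%nat.
Proof.
move=> Hk H Hlt; elim: N Hk => [|N IH] Hk /=; first by lia.
have [E|Hlt'] : k = N \/ (k < N)%nat by lia.
- by have := nsum_le N f f' H; rewrite -E; lia.
- by have := IH Hlt'; have := H N; lia.
Qed.

(* If two zeros are missing from [mu'], then by induction [w = WW mu' h] solves both
   [w' = lam_i w] and [w' = lam_j w]; if only one is missing, [w] is a derivative
   of [WW (except mu n) h = 0]. *)
Lemma WW_vanish lam mu kap a b h N : good lam mu kap -> classG lam mu a b h ->
  (forall x, a < x < b -> WW lam mu h x = RtoC 0) ->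
  (forall n x, (n < N)%nat -> a < x < b -> WW lam (except mu n) h x = RtoC 0) ->
  forall mu', (forall n, (mu' n <= mu n)%nat) -> (forall n, (N <= n)%nat -> mu' n = mu n) ->
  forall x, a < x < b -> WW lam mu' h x = RtoC 0.
Proof.
move=> Hg HG HF He.
have H0 := good_ne _ _ _ Hg; have Hw := good_sum _ _ _ Hg.
have Hstep mu' k : (forall n, (bump mu' k n <= mu n)%nat) ->
   (forall x, a < x < b -> WW lam mu' h x = RtoC 0) -> forall x, a < x < b -> WW lam (bump mu' k) h x = RtoC 0.
  move=> Hm Hz x Hx.
  have := RD_zero _ a b x _ Hx Hz (RD_WW lam mu kap a b h mu' k x Hg HG Hx Hm).
  rewrite (Hz x Hx) => E.
  have -> : WW lam (bump mu' k) h x = (- (/ lam k) * (lam k * (0 - WW lam (bump mu' k) h x)))%C by field; exact: H0.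
  by rewrite E; ring.
(* The derivative of the zero function is zero, so each restored copy of [lam n] preserves
   vanishing. *)
have Hone n j : (n < N)%nat -> (j <= mu n)%nat -> forall x, a < x < b -> WW lam (addmu (except mu n) n j) h x = RtoC 0.
  move=> Hn; elim: j => [|j IH] Hj; first by rewrite addmu_0 => x Hx; apply: He.
  rewrite -bump_addmu; apply: Hstep; last by apply: IH; lia.
  move=> m; rewrite bump_addmu /addmu /except; case: Nat.eqb_spec => [->|] //.
(* Induction on the number of missing zeros, counted with multiplicity; all of them have index below
   [N]. *)
have key : forall D mu', (forall n, (mu' n <= mu n)%nat) -> (forall n, (N <= n)%nat -> mu' n = mu n) ->
   (nsum N (fun k => mu k - mu' k) <= D)%nat ->
   forall x, a < x < b -> WW lam mu' h x = RtoC 0.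
  elim=> [|D IH] mu' Hle Htail HD x Hx.
    suff -> : mu' = mu by apply: HF.
    apply: functional_extensionality => n.
    have [Hn|Hn] : (n < N)%nat \/ (N <= n)%nat by lia.
    - by have := nsum_term N (fun k => mu k - mu' k)%nat n Hn; have := Hle n; lia.
    - exact: Htail.
  have Hlt k : (mu' k < mu k)%nat -> (k < N)%nat.
    by move=> Hk; case: (Nat.lt_ge_cases k N) => [//|Hn]; have := Htail k Hn; lia.
  case: (excluded_middle_informative (exists i j, i <> j /\ (mu' i < mu i)%nat /\ (mu' j < mu j)%nat)).
  - move=> [i [j [Hij [Hi Hj]]]].
    have Hb k : (mu' k < mu k)%nat -> forall y, a < y < b -> WW lam (bump mu' k) h y = RtoC 0.
      move=> Hk; apply: IH.
      + exact: bump_le.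
      + move=> n Hn; rewrite /bump; case: Nat.eqb_spec => [E|_]; last exact: Htail.
        by have := Hlt k Hk; lia.
      + have : (nsum N (fun j => mu j - bump mu' k j) < nsum N (fun j => mu j - mu' j))%nat.
          apply: (nsum_lt N _ _ k (Hlt k Hk)).
          + by move=> n; rewrite /bump; case: Nat.eqb; lia.
          + by rewrite /bump Nat.eqb_refl; lia.
        by lia.
    have d1 := RD_WW lam mu kap a b h mu' i x Hg HG Hx (bump_le _ _ _ Hle Hi).
    have d2 := RD_WW lam mu kap a b h mu' j x Hg HG Hx (bump_le _ _ _ Hle Hj).
    rewrite (Hb i Hi x Hx) in d1; rewrite (Hb j Hj x Hx) in d2.
    have E : (lam i * (WW lam mu' h x - 0))%C = (lam j * (WW lam mu' h x - 0))%C.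
      case: d1 => a1 a2; case: d2 => b1 b2.
      have e1 := is_derive_unique _ _ _ a1; have e2 := is_derive_unique _ _ _ a2.
      rewrite (is_derive_unique _ _ _ b1) in e1; rewrite (is_derive_unique _ _ _ b2) in e2.
      by move: e1 e2; case: (lam i * _)%C => u v; case: (lam j * _)%C => u' v' /= -> ->.
    have Hne : (lam i - lam j)%C <> RtoC 0.
      by move=> Z; apply: (good_inj _ _ _ Hg i j Hij); rewrite -(Cplus_0_r (lam j)) -Z; ring.
    have -> : WW lam mu' h x = (/ (lam i - lam j) * (lam i * (WW lam mu' h x - 0) - lam j * (WW lam mu' h x - 0)))%C by field.
    by rewrite E; ring.
  - move=> Hno.
    case: (excluded_middle_informative (exists n, (mu' n < mu n)%nat)) => [[n Hn]|Hn].
    + have -> : mu' = addmu (except mu n) n (mu' n).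
        apply: functional_extensionality => k; rewrite /addmu /except; case: Nat.eqb_spec => [->|Hk] //.
        have := Hle k; have [//|Hlt'] : (mu' k = mu k \/ mu' k < mu k)%nat by have := Hle k; lia.
        by case: Hno; exists n, k; split; [move=> E; apply: Hk | split].
      exact: (Hone n (mu' n) (Hlt n Hn) (Hle n) x Hx).
    + have -> : mu' = mu; last exact: HF.
      apply: functional_extensionality => k; have := Hle k.
      have [//|Hlt'] : (mu' k = mu k \/ mu' k < mu k)%nat by have := Hle k; lia.
      by case: Hn; exists k.
by move=> mu' Hle Htail x Hx; apply: (key _ mu' Hle Htail (Nat.le_refl _)).
Qed.

Lemma good_lower lam mu kap eps : good lam mu kap -> interpC lam mu -> 0 < eps ->
  exists M, 0 <= M /\ forall n c, supp (mu n) c ->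
    nb (mu n) c <= M * exp (eps * Cmod (lam n)) * nb (mu n) (Op (Fi (lF lam) (except mu n)) (lam n) c).
Proof. by move=> [H1 H2 H3 H4 H5 H6 H7 H8]; apply: block_lower_bound. Qed.

(* The blocks [c n] of [g]: [F_n(D)] maps the block [c n] to [F_n(D) g], where [F_n] is
   the product [F] without its zero [lam n]. *)
Lemma V_coefs lam mu kap a b g : good lam mu kap -> interpC lam mu -> a < b -> classG lam mu a b g ->
  (forall x, a < x < b -> WW lam mu g x = RtoC 0) ->
  exists c, CB lam mu b c /\ forall n x, a < x < b ->
    WW lam (except mu n) g x = fb (mu n) (lam n) (Op (Fi (lF lam) (except mu n)) (lam n) (c n)) x.
Proof.
move=> Hg Hi Hab HG HF.
have H0 := good_ne _ _ _ Hg; have Hw := good_sum _ _ _ Hg; have hk := good_kap _ _ _ Hg.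
have Hex : forall n, exists c, supp (mu n) c /\ forall x, a < x < b ->
    WW lam (except mu n) g x = fb (mu n) (lam n) (Op (Fi (lF lam) (except mu n)) (lam n) c) x.
  move=> n; have [v [Hv Ev]] := V_block lam mu kap a b g n Hg Hab HG HF.
  have [M [HM0 HM]] := good_lower lam mu kap 1 Hg Hi Rlt_0_1.
  have hne := except_PS_neq0 lam mu n (M * exp (1 * Cmod (lam n))) H0 Hw (good_mu _ _ _ Hg n) (HM n).
  have [u [Hu Eu]] := Op_solve _ (mu n) (lam n) v (entS_FiL lam mu _ H0 Hw (except_le mu n)) hne Hv.
  by exists u; split=> // x Hx; rewrite Eu Ev.
have [c Hc] : exists c : nat -> nat -> C, forall n, supp (mu n) (c n) /\ forall x, a < x < b ->
    WW lam (except mu n) g x = fb (mu n) (lam n) (Op (Fi (lF lam) (except mu n)) (lam n) (c n)) x.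
  exists (fun n => proj1_sig (constructive_indefinite_description _ (Hex n))) => n.
  exact: (proj2_sig (constructive_indefinite_description _ (Hex n))).
exists c; split; last by move=> n; apply: (proj2 (Hc n)).
have Hs n := proj1 (Hc n).
set v := fun n => Op (Fi (lF lam) (except mu n)) (lam n) (c n).
(* The same majorant of [g] bounds all blocks [v n] on an interval close to [b], so [CB_of_bound]
   applies. *)
have Hv : CB lam mu b v.
  apply: (CB_of_bound _ _ kap) => //; first by move=> n; apply: supp_Op.
  move=> eta He; set x0 := Rmax (b - eta) ((a + b) / 2).
  have m1 : b - eta <= x0 := Rmax_l _ _; have m2 : (a + b) / 2 <= x0 := Rmax_r _ _.
  have m3 : x0 < b by apply: Rmax_lub_lt; lra.
  have [d [M [Hd HM]]] := classG_local_bound lam mu kap a b g x0 Hg HG ltac:(lra).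
  exists x0, (x0 + d), M; split; first by []; split; first by lra.
  move=> n x Hx; have [Hxab h] := HM x Hx.
  rewrite /v -(proj2 (Hc n) x Hxab); apply: Rle_trans h.
  by apply: (WW_bound lam mu kap a b) => // k; apply: except_le.
(* Half of [eta] is spent on the decay of [v n], the other half on the lower bound, taken at rate
   [eta/2 * kap] because [kap * Cmod (lam n) <= Re (lam n)]. *)
split=> // eta He.
have [M1 [HM1 H1]] := proj2 Hv (eta / 2) ltac:(lra).
have [M2 [HM2 H2]] := good_lower lam mu kap (eta / 2 * kap) Hg Hi ltac:(apply: Rmult_lt_0_compat; lra).
exists (M2 * M1); split; first exact: Rmult_le_pos.
move=> n; apply: Rle_trans (H2 n (c n) (Hs n)) _.
have h1 := H1 n; rewrite /v in h1.
have hr := good_re _ _ _ Hg n.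
have he0 := exp_pos (eta / 2 * kap * Cmod (lam n)).
apply: (Rle_trans _ (M2 * exp (eta / 2 * kap * Cmod (lam n)) * (M1 * exp (- (b - eta / 2) * Re (lam n))))).
  by apply: Rmult_le_compat_l => //; apply: Rmult_le_pos => //; lra.
have -> : M2 * exp (eta / 2 * kap * Cmod (lam n)) * (M1 * exp (- (b - eta / 2) * Re (lam n))) =
  M2 * M1 * exp (eta / 2 * kap * Cmod (lam n) + - (b - eta / 2) * Re (lam n)) by rewrite exp_plus; ring.
apply: Rmult_le_compat_l; first exact: Rmult_le_pos.
apply: exp_mono.
have : eta / 2 * (kap * Cmod (lam n)) <= eta / 2 * Re (lam n) by apply: Rmult_le_compat_l; lra.
lra.
Qed.

Lemma V_expansion lam mu kap a b g : good lam mu kap -> interpC lam mu -> a < b -> classG lam mu a b g ->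
  (forall x, a < x < b -> WW lam mu g x = RtoC 0) ->
  exists c, CB lam mu b c /\ forall x, a < x < b -> g 0%nat x = gsum lam mu c 0 x.
Proof.
move=> Hg Hi Hab HG HF.
have H0 := good_ne _ _ _ Hg; have Hw := good_sum _ _ _ Hg.
have [c [Hc Ec]] := V_coefs lam mu kap a b g Hg Hi Hab HG HF.
exists c; split=> // x Hx.
have Hcut N := cut_CB lam mu b c N Hc.
have HGc N := gsum_classG lam mu kap a b (cut N c) Hg (Hcut N).
have Hfin N : WW lam (tailmu mu N) g x =
   CS (fun n => fb (mu n) (lam n) (Op (Fi (lF lam) (tailmu mu N)) (lam n) (cut N c n)) x).
  rewrite -(WW_gsum lam mu kap b) //; [|lra|exact: tailmu_le].
  (* [h] is [g] minus its first [N] blocks. It is annihilated by [F(D)] and, for [n < N], by the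
     product without the zero [lam n], as [WW_vanish] requires. *)
  set h := fun m x => (g m x - gsum lam mu (cut N c) m x)%C.
  have Hh : classG lam mu a b h by apply: (classG_minus lam mu kap).
  have Eh mu' y : a < y < b -> (forall n, (mu' n <= mu n)%nat) ->
     WW lam mu' h y = (WW lam mu' g y - CS (fun n => fb (mu n) (lam n) (Op (Fi (lF lam) mu') (lam n) (cut N c n)) y))%C.
    move=> Hy Hm; rewrite (WW_minus lam mu kap a b) // (WW_gsum lam mu kap b) //; lra.
  have Hz : forall mu', (forall n, (mu' n <= mu n)%nat) -> (forall n, (N <= n)%nat -> mu' n = mu n) ->
     forall y, a < y < b -> WW lam mu' h y = RtoC 0.
    apply: (WW_vanish lam mu kap a b h N) => //.
    - move=> y Hy; rewrite Eh // HF // (CS_ext _ (fun _ => RtoC 0)).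
        by rewrite (proj2 (CS_eq_fin _ 0 (fun _ _ => eq_refl))) /=; ring.
      by move=> n; rewrite Op_Fi_zero ?fb_zero //; apply: (proj1 (Hcut N)).
    - move=> n y Hn Hy; rewrite Eh //; last exact: except_le.
      rewrite Ec //.
      (* The product without [lam n] still contains the zeros of every other block and kills it;
         only the block [n] survives, and it is the one given by [Ec]. *)
      have hk k : (S n <= k)%nat \/ (k < n)%nat ->
         fb (mu k) (lam k) (Op (Fi (lF lam) (except mu n)) (lam k) (cut N c k)) y = RtoC 0.
        move=> Hkn; rewrite Op_Fi_zero ?fb_zero //; first by apply: wsum_mono Hw => j; apply: except_le.
        have -> : except mu n k = mu k by rewrite /except; case: Nat.eqb_spec => //; lia.
        exact: (proj1 (Hcut N)).
      rewrite (proj2 (CS_eq_fin _ (S n) (fun k Hk => hk k (or_introl Hk)))) CsumS Csum_zero; last by move=> k Hk; apply: hk; right.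
      by rewrite cut_lt //; ring.
  have := Hz (tailmu mu N) (tailmu_le mu N) _ x Hx.
  rewrite /h (WW_minus lam mu kap a b) //; last exact: tailmu_le.
  move=> E.
  have {}E := E ltac:(by move=> n Hn; rewrite /tailmu; have /Nat.ltb_ge -> := Hn).
  have -> : WW lam (tailmu mu N) g x = ((WW lam (tailmu mu N) g x - WW lam (tailmu mu N) (gsum lam mu (cut N c)) x) + WW lam (tailmu mu N) (gsum lam mu (cut N c)) x)%C by ring.
  by rewrite E; ring.
have HwF : wsum (fun n => Cmod (lF lam n)) mu by rewrite lF_rL.
have delta_CS (u : nat -> C) : CS (fun m => RtoC (delta0 m) * u m)%C = u 0%nat.
  have H n : (1 <= n)%nat -> (RtoC (delta0 n) * u n)%C = RtoC 0.
    by case: n => [|n] Hn; [lia | rewrite /=; ring].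
  by rewrite (proj2 (CS_eq_fin _ 1 H)) /=; ring.
have L1 : limC (fun N => WW lam (tailmu mu N) g x) (g 0%nat x).
  rewrite -(delta_CS (fun m => g m x)).
  apply: (tannery _ _ _ (proj1 (proj2 HG) x Hx)).
  - move=> N m; rewrite Cmod_mult; apply: Rmult_le_compat_r; first exact: Cmod_ge_0.
    by apply: Fi_le_G => // n; apply: tailmu_le.
  - move=> m; apply: (limC_ext (fun N => g m x * Fi (lF lam) (tailmu mu N) m)%C); first by move=> n; ring.
    rewrite (Cmult_comm (RtoC _)); apply: limC_scal; exact: Fi_tail_lim.
apply: limC_unique L1 _.
apply: (limC_ext (fun N => CS (fun n => fb (mu n) (lam n) (Op (Fi (lF lam) (tailmu mu N)) (lam n) (cut N c n)) x))).
  by move=> N; rewrite Hfin.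
set X := Rabs x + 1.
have hX : 1 <= X by rewrite /X; have := Rabs_pos x; lra.
have hsum := wt_summable lam mu kap b c X x _ Hg Hc hX (proj2 Hx) (subexp_G _ _ Hw).
have hblk n m : Cmod (dblk lam mu c m n x) <= wt lam mu c X x n * rad lam mu n ^ m.
  by apply: (dblk_bound _ _ kap) => //; [apply: (proj1 Hc) | rewrite /X; lra | lra].
have hGr n : ex_series (fun m => wt lam mu c X x n * (Gi (rL lam) mu m * rad lam mu n ^ m)).
  by apply: (ex_series_scal_l (V := R_NormedModule)); apply: ex_series_Gi => //; apply: rad_ge0.
have hterm n N m : Cmod (Fi (lF lam) (tailmu mu N) m * dblk lam mu c m n x)%C <= wt lam mu c X x n * (Gi (rL lam) mu m * rad lam mu n ^ m).
  rewrite Cmod_mult.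
  have -> : wt lam mu c X x n * (Gi (rL lam) mu m * rad lam mu n ^ m) = Gi (rL lam) mu m * (wt lam mu c X x n * rad lam mu n ^ m) by ring.
  apply: Rmult_le_compat; [exact: Cmod_ge_0|exact: Cmod_ge_0| |exact: hblk].
  by apply: Fi_le_G => // k; apply: tailmu_le.
have hOp n N : fb (mu n) (lam n) (Op (Fi (lF lam) (tailmu mu N)) (lam n) (c n)) x =
   CS (fun m => Fi (lF lam) (tailmu mu N) m * dblk lam mu c m n x)%C.
  rewrite -(proj2 (fb_Op _ _ _ _ x (entS_FiL lam mu _ H0 Hw (tailmu_le mu N)) (proj1 Hc n))) //.
(* Dominated convergence in [n] and, for fixed [n], once more in [m]: the coefficients of the tail
   product tend to those of the constant 1. *)
apply: (tannery _ _ _ hsum).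
- move=> N n; case: (Nat.lt_ge_cases n N) => [Hlt|Hge].
  + by rewrite cut_lt // hOp -Series_scal_l; apply: CS_bound.
  + rewrite cut_ge // (_ : Op _ _ _ = fun _ => RtoC 0).
      rewrite fb_zero Cmod_0; apply: Rmult_le_pos; first exact: wt_ge0.
      by apply: (proj1 (subexp_G _ _ Hw)); apply: rad_ge0.
    by apply: functional_extensionality => k; apply: (supp_Op _ 0) => //; lia.
- move=> n.
  apply: (limC_eventually (fun N => CS (fun m => Fi (lF lam) (tailmu mu N) m * dblk lam mu c m n x)%C) _ _ (S n)).
    by move=> N HN; rewrite cut_lt // hOp.
  rewrite -(delta_CS (fun m => dblk lam mu c m n x)).
  apply: (tannery _ _ _ (hGr n)); first by move=> N m; apply: hterm.
  move=> m; apply: (limC_ext (fun N => dblk lam mu c m n x * Fi (lF lam) (tailmu mu N) m)%C); first by move=> k; ring.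
  rewrite (Cmult_comm (RtoC _)); apply: limC_scal; exact: Fi_tail_lim.
Qed.

Lemma V_sub_W lam mu kap a b f : good lam mu kap -> interpC lam mu -> a < b -> Vclass lam mu a b f -> Wclass lam mu a b f.
Proof.
move=> Hg Hi Hab [g [HC HF]].
have H0 := good_ne _ _ _ Hg; have Hw := good_sum _ _ _ Hg.
have HG := V_classG lam mu kap a b f g Hg HC.
have HW x : a < x < b -> WW lam mu g x = RtoC 0.
  move=> Hx; have /is_series_limC h := HF x Hx.
  apply: limC_unique (CS_lim _ (WW_summ lam mu kap a b g mu x Hg HG Hx (fun n => Nat.le_refl _))) _.
  by apply: limC_ext h => N; apply: Csum_ext => m _; rewrite taylor_F // lF_rL.
have [c [Hc Ec]] := V_expansion lam mu kap a b g Hg Hi Hab HG HW.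
exists c => x Hx; apply/is_series_limC.
have [[hf _] _] := HC; rewrite -hf // Ec //.
by apply: CS_lim; apply: (dblk_summ _ _ kap b _ 0) => //; lra.
Qed.

Lemma good_of_hyps lam mu : multiplicity_seq lam mu -> condA lam mu -> condB lam -> exists kap, good lam mu kap.
Proof.
move=> [h1 [h2 [h3 [h4 h5]]]] HA HB.
have [kap [hk hr]] := condB_kappa lam h1 HB.
exists kap; split=> //; split=> //.
by move=> n; apply: Rlt_le; apply: Rinv_0_lt_compat; apply/Cmod_gt_0.
Qed.

(** * Approximation by translates *)

Lemma fb_translate mu lam c h : supp mu c ->
  exists d, forall x, fb mu lam c (x + h) = fb mu lam d x.
Proof.
move=> Hc; have [e [He [E _]]] := difference_coef h mu c Hc.
set r := cexp (lam * RtoC h).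
exists (fun k => r * c k + r * e k)%C => x.
rewrite fb_lin /fb.
have -> : pv mu c (x + h) = (pv mu c x + pv mu e x)%C.
  by rewrite -E; ring.
have -> : (lam * RtoC (x + h) = lam * RtoC x + lam * RtoC h)%C by rewrite RtoC_plus; ring.
by rewrite cexp_plus -/r; ring.
Qed.

(** What the approximation uses of the function [x ^ p] with [p >= 1], isolated so that the
    estimates can be carried out on Riemann integrals of continuous functions. *)
Record power_like (K : R) (w : R -> R) : Prop := PowerLike {
  pl_K : 0 <= K;
  pl_ge0 : forall x, 0 <= w x;
  pl_mono : forall x y, 0 <= x <= y -> w x <= w y;
  pl_add : forall x y z, 0 <= x -> 0 <= y -> 0 <= z -> w (x + y + z) <= K * (w x + w y + w z);
  pl_small : forall e, 0 < e -> exists d, 0 < d /\ w d <= e;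
  pl_cont : forall x, 0 <= x -> forall e, 0 < e ->
    exists d, 0 < d /\ forall y, 0 <= y -> Rabs (y - x) < d -> Rabs (w y - w x) < e
}.

Lemma pl_continuous K w f x l : power_like K w -> RD f x l -> continuous (fun t => w (Cmod (f t))) x.
Proof.
move=> H [h1 h2]; apply/continuous_eps => e He.
have /continuous_eps c1 := ex_derive_continuous _ x (ex_intro _ _ h1).
have /continuous_eps c2 := ex_derive_continuous _ x (ex_intro _ _ h2).
have [d [Hd D]] := pl_cont _ _ H _ (Cmod_ge_0 (f x)) e He.
have [d1 [Hd1 D1]] := c1 (d / 2) ltac:(lra); have [d2 [Hd2 D2]] := c2 (d / 2) ltac:(lra).
exists (Rmin d1 d2); split; first exact: Rmin_pos.
move=> t Ht; have m1 := Rmin_l d1 d2; have m2 := Rmin_r d1 d2.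
apply: D; first exact: Cmod_ge_0.
have := D1 t ltac:(lra); have := D2 t ltac:(lra).
have := Cmod_Rabs_le (f t - f x).
have -> : Re (f t - f x) = Re (f t) - Re (f x) by [].
have -> : Im (f t - f x) = Im (f t) - Im (f x) by [].
have a1 := Cmod_triangle (f t - f x) (f x); have a2 := Cmod_triangle (f x - f t) (f t).
replace (f t - f x + f x)%C with (f t) in a1 by ring.
replace (f x - f t + f t)%C with (f x) in a2 by ring.
have a3 : Cmod (f x - f t) = Cmod (f t - f x) by rewrite -Cmod_opp; congr Cmod; ring.
move=> b1 b2 b3; apply: Rle_lt_trans (_ : Cmod (f t - f x) < d); last by lra.
by apply: Rabs_le; lra.
Qed.

Lemma ex_RInt_inside (q : R -> R) a b u v : (forall x, a < x < b -> continuous q x) ->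
  a < u < b -> a < v < b -> ex_RInt q u v.
Proof.
move=> Hc Hu Hv; apply: (ex_RInt_continuous (V := R_CompleteNormedModule)) => z.
by rewrite /Rmin /Rmax; case: Rle_dec => _ Hz; apply: Hc; lra.
Qed.

Lemma is_derive_RInt_inside (q : R -> R) a b s x : (forall x, a < x < b -> continuous q x) ->
  a < s < b -> a < x < b -> is_derive (fun u => RInt q s u) x (q x).
Proof.
move=> Hc Hs Hx; apply: (is_derive_RInt (V := R_NormedModule) q _ s); last by apply: Hc.
have hp : 0 < Rmin (x - a) (b - x) by apply: Rmin_pos; lra.
exists (mkposreal _ hp) => y; rewrite /ball /= /AbsRing_ball /abs /minus /plus /opp /= => Hy.
have m1 := Rmin_l (x - a) (b - x); have m2 := Rmin_r (x - a) (b - x).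
have [u1 u2] := Rabs_def2 _ _ Hy.
by apply: (RInt_correct (V := R_CompleteNormedModule)); apply: (ex_RInt_inside q a b) => //; lra.
Qed.

Lemma RInt_enlarge (q : R -> R) a b s' s t t' : (forall x, a < x < b -> continuous q x) ->
  (forall x, a < x < b -> 0 <= q x) -> a < s' <= s -> s <= t -> t <= t' < b ->
  RInt q s t <= RInt q s' t'.
Proof.
move=> Hc H0 Hs Hst Ht.
have hex u v : a < u -> u <= v -> v < b -> ex_RInt q u v.
  by move=> h1 h2 h3; apply: (ex_RInt_inside q a b) => //; lra.
have hge u v : a < u -> u <= v -> v < b -> 0 <= RInt q u v.
  by move=> h1 h2 h3; apply: RInt_ge_0 => // [|x Hx]; [apply: hex | apply: H0; lra].
have e1 := RInt_Chasles (V := R_CompleteNormedModule) q s' s t' (hex s' s ltac:(lra) ltac:(lra) ltac:(lra)) (hex s t' ltac:(lra) ltac:(lra) ltac:(lra)).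
have e2 := RInt_Chasles (V := R_CompleteNormedModule) q s t t' (hex s t ltac:(lra) ltac:(lra) ltac:(lra)) (hex t t' ltac:(lra) ltac:(lra) ltac:(lra)).
have h1 := hge s' s ltac:(lra) ltac:(lra) ltac:(lra).
have h2 := hge t t' ltac:(lra) ltac:(lra) ltac:(lra).
rewrite /plus /= in e1 e2; lra.
Qed.

(** The integrals from the midpoint are nondecreasing in the upper endpoint and bounded; beyond a
    point where they come within [e] of their supremum, at most [e] is left. *)
Lemma RInt_tail_small (q : R -> R) a b B e : a < b -> (forall x, a < x < b -> continuous q x) ->
  (forall x, a < x < b -> 0 <= q x) -> (forall s t, a < s -> s < t -> t < b -> RInt q s t <= B) -> 0 < e ->
  exists m, a < m < b /\ forall s t, m <= s -> s < t -> t < b -> RInt q s t <= e.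
Proof.
move=> Hab Hc H0 HB He; set m0 := (a + b) / 2.
set E := fun v => exists t, m0 < t < b /\ v = RInt q m0 t.
have [L [HL1 HL2]] : {L | is_lub E L}.
  apply: completeness.
  - by exists B => v [t [Ht ->]]; apply: HB; rewrite /m0 in Ht *; lra.
  - by exists (RInt q m0 ((m0 + b) / 2)), ((m0 + b) / 2); split=> //; rewrite /m0; lra.
have [t0 [Ht0 Hlt]] : exists t0, m0 < t0 < b /\ L - e < RInt q m0 t0.
  apply: Classical_Prop.NNPP => Hn.
  have : L <= L - e; last by lra.
  apply: HL2 => v [t [Ht ->]]; apply: Rnot_lt_le => Hl; apply: Hn; by exists t.
exists t0; split; first by rewrite /m0 in Ht0; lra.
move=> s t Hs Hst Ht.
have h1 : RInt q m0 t <= L by apply: HL1; exists t; split=> //; lra.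
have h2 : RInt q m0 t0 <= RInt q m0 s by apply: (RInt_enlarge q a b) => //; rewrite /m0 in Ht0 *; lra.
have hex u v : a < u -> u <= v -> v < b -> ex_RInt q u v.
  by move=> k1 k2 k3; apply: (ex_RInt_inside q a b) => //; lra.
have := RInt_Chasles (V := R_CompleteNormedModule) q m0 s t (hex m0 s ltac:(rewrite /m0; lra) ltac:(lra) ltac:(lra)) (hex s t ltac:(rewrite /m0 in Ht0; lra) ltac:(lra) ltac:(lra)).
rewrite /plus /=; lra.
Qed.

Lemma RInt_translate (q : R -> R) h s t : s < t ->
  (forall x, s <= x <= t -> continuous q (x + h)) ->
  RInt (fun x => q (x + h)) s t = RInt q (s + h) (t + h).
Proof.
move=> Hst Hc.
have := RInt_comp_lin (V := R_CompleteNormedModule) q 1 h s t.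
rewrite !Rmult_1_l => <-.
  by apply: RInt_ext => x _; rewrite /scal /= /mult /= !Rmult_1_l.
apply: (ex_RInt_continuous (V := R_CompleteNormedModule)) => z.
rewrite Rmin_left ?Rmax_right; try lra.
move=> Hz; have -> : z = (z - h) + h by ring.
by apply: Hc; lra.
Qed.

Lemma gsum_unif_bound lam mu kap b c m a y : good lam mu kap -> CB lam mu b c -> a <= y -> y < b ->
  exists B, 0 <= B /\ forall x, a <= x <= y -> Cmod (gsum lam mu c m x) <= B.
Proof.
move=> Hg Hc Hay Hy; set X := Rabs a + Rabs y + 1.
have hX : 1 <= X by rewrite /X; have := Rabs_pos a; have := Rabs_pos y; lra.
have hs := wt_summable lam mu kap b c X y (fun r => r ^ m) Hg Hc hX Hy (subexp_pow m).
exists (Series (fun n => wt lam mu c X y n * rad lam mu n ^ m)); split.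
  apply: Series_ge0 => // n; apply: Rmult_le_pos; [exact: wt_ge0 | apply: pow_le; apply: rad_ge0].
move=> x Hx; apply: CS_bound hs => n.
apply: (dblk_bound _ _ kap) => //; [exact: (proj1 Hc)| |lra].
apply: Rabs_le; rewrite /X; have := Rle_abs a; have := Rle_abs (- a); have := Rle_abs y; have := Rle_abs (- y).
by rewrite !Rabs_Ropp; have := Rabs_pos a; have := Rabs_pos y; lra.
Qed.

(** Translation by [h] moves the interval to the left of [b - h], where the expansion converges
    uniformly; by [fb_translate] the translated blocks remain in the span. *)
Lemma span_E_near lam mu kap b c a h eta : good lam mu kap -> CB lam mu b c -> a < b -> 0 < h -> 0 < eta ->
  exists P, span_E lam mu P /\ (forall x, exists l, RD P x l) /\
    forall x, a < x < b -> Cmod (gsum lam mu c 0 (x - h) - P x) <= eta.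
Proof.
move=> Hg Hc Hab Hh He; set y := b - h; set X := Rabs (a - h) + Rabs y + 1.
have hX : 1 <= X by rewrite /X; have := Rabs_pos (a - h); have := Rabs_pos y; lra.
have hs := wt_summable lam mu kap b c X y (fun r => r ^ 0) Hg Hc hX ltac:(rewrite /y; lra) (subexp_pow 0).
have h0 n : 0 <= wt lam mu c X y n * rad lam mu n ^ 0.
  by apply: Rmult_le_pos; [apply: wt_ge0 | apply: pow_le; apply: rad_ge0].
have [N HN] := Series_tail_small _ eta hs h0 He.
have [d Hd] : exists d : nat -> nat -> C, forall n x, fb (mu n) (lam n) (c n) (x - h) = fb (mu n) (lam n) (d n) x.
  have hex n := fb_translate (mu n) (lam n) (c n) (- h) (proj1 Hc n).
  exists (fun n => proj1_sig (constructive_indefinite_description _ (hex n))) => n.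
  exact: proj2_sig (constructive_indefinite_description _ (hex n)).
exists (fun x => Csum N (fun n => fb (mu n) (lam n) (c n) (x - h))); split; last split.
- by exists N, d => x; apply: Csum_ext => n _; rewrite Hd.
- move=> x; exists (Csum N (fun n => fb (mu n) (lam n) (Db (lam n) (c n)) (x - h))).
  apply: RD_Csum => n _.
  have [k1 k2] := RD_fb (mu n) (lam n) (c n) (x - h) (proj1 Hc n).
  have ht : is_derive (fun x => x - h) x 1 by auto_derive => //; ring.
  split.
  + have := is_derive_comp (V := R_NormedModule) (fun t => Re (fb (mu n) (lam n) (c n) t)) (fun x => x - h) x _ _ k1 ht.
    by rewrite /scal /= /mult /= Rmult_1_l.
  + have := is_derive_comp (V := R_NormedModule) (fun t => Im (fb (mu n) (lam n) (c n) t)) (fun x => x - h) x _ _ k2 ht.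
    by rewrite /scal /= /mult /= Rmult_1_l.
- move=> x Hx.
  have hsum : summ (fun n => dblk lam mu c 0 n (x - h)) by apply: (dblk_summ _ _ kap b) => //; lra.
  rewrite /gsum (CS_split _ N hsum).
  replace (Csum N _ + _ - _)%C with (CS (fun n => dblk lam mu c 0 (N + n) (x - h))); last first.
    by rewrite /dblk /=; set A := Csum _ _; set A' := CS _; ring.
  apply: Rle_trans (Rlt_le _ _ (HN N (Nat.le_refl _))).
  apply: CS_bound; last exact: (proj1 (ex_series_incr_n (V := R_NormedModule) _ N) hs).
  move=> n; apply: (dblk_bound _ _ kap) => //; [exact: (proj1 Hc)| |rewrite /y; lra].
  apply: Rabs_le; rewrite /X /y.
  have := Rle_abs (a - h); have := Rle_abs (- (a - h)); have := Rle_abs (b - h); have := Rle_abs (- (b - h)).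
  by rewrite !Rabs_Ropp; have := Rabs_pos (a - h); have := Rabs_pos (b - h); lra.
Qed.

(** To the left of [t1] both the effect of translation and the truncation error are at most [eta].
    To the right, [F], its translate and the error are bounded separately by [pl_add]; the first two
    integrals are tails beyond [t1 - h], at most [e] each. *)
Lemma RInt_shift_estimate K w (F P F' P' : R -> C) a b h eta e t1 :
  power_like K w -> a < t1 -> t1 < b -> 0 < h -> a < t1 - h -> 0 < eta ->
  (forall x, a < x < b -> RD F x (F' x)) -> (forall x, RD P x (P' x)) ->
  (forall x, a < x < b -> Cmod (F (x - h) - P x) <= eta) ->
  (forall x, a < x <= t1 -> Cmod (F x - F (x - h)) <= eta) ->
  (forall s t, t1 - h <= s -> s < t -> t < b -> RInt (fun x => w (Cmod (F x))) s t <= e) ->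
  forall s t, a < s -> s < t -> t < b ->
    RInt (fun x => w (Cmod (F x - P x))) s t <= w (2 * eta) * (b - a) + K * (2 * e + w (2 * eta) * (b - a)).
Proof.
move=> Hw Hat Htb Hh Hath He HF HP H1 H2 H3 s t Has Hst Htb'.
have HK := pl_K _ _ Hw.
have cpsi x : a < x < b -> continuous (fun x => w (Cmod (F x - P x))) x.
  by move=> Hx; apply: (pl_continuous K w (fun x => F x - P x)%C x _ Hw); apply: RD_minus; [apply: HF | apply: HP].
have cphi x : a < x < b -> continuous (fun x => w (Cmod (F x))) x.
  by move=> Hx; apply: (pl_continuous K w F x _ Hw); apply: HF.
have Hex (q : R -> R) u v : (forall x, a < x < b -> continuous q x) -> a < u -> u <= v -> v < b -> ex_RInt q u v.
  by move=> k0 k1 k2 k3; apply: (ex_RInt_inside q a b) => //; lra.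
(* The integrand is nonnegative, so the interval may be enlarged to one that contains [t1] with room
   on its right. *)
set s' := Rmin s t1; set t' := Rmax t ((t1 + b) / 2).
have s1 : s' <= s by apply: Rmin_l. have s2 : s' <= t1 by apply: Rmin_r.
have s3 : a < s' by apply: Rmin_glb_lt.
have r1 : t <= t' by apply: Rmax_l. have r2 : (t1 + b) / 2 <= t' by apply: Rmax_r.
have r3 : t' < b by apply: Rmax_lub_lt; lra.
apply: Rle_trans (RInt_enlarge _ a b s' s t t' cpsi _ _ _ _) _; try lra.
  by move=> x _; apply: (pl_ge0 _ _ Hw).
have E1 := RInt_Chasles (V := R_CompleteNormedModule) _ s' t1 t' (Hex _ s' t1 cpsi ltac:(lra) ltac:(lra) ltac:(lra))
  (Hex _ t1 t' cpsi ltac:(lra) ltac:(lra) ltac:(lra)).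
rewrite /plus /= in E1; rewrite -E1.
have w0 := pl_ge0 _ _ Hw (2 * eta).
apply: Rplus_le_compat.
- apply: (Rle_trans _ (RInt (fun _ => w (2 * eta)) s' t1)).
    apply: RInt_le => //; [exact: (Hex _ s' t1 cpsi s3 s2 Htb)|exact: ex_RInt_const|].
    move=> x Hx; apply: (pl_mono _ _ Hw); split; first exact: Cmod_ge_0.
    have := H1 x ltac:(lra); have := H2 x ltac:(lra); set fh := F (x - h).
    have := Cmod_triangle (F x - fh) (fh - P x).
    replace (F x - fh + (fh - P x))%C with (F x - P x)%C by ring.
    lra.
  rewrite RInt_const /scal /= /mult /= Rmult_comm; apply: Rmult_le_compat_l => //; lra.
- have ex1 : ex_RInt (fun x => w (Cmod (F x))) t1 t' by apply: Hex => //; lra.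
  have csh x : t1 <= x <= t' -> continuous (fun x => w (Cmod (F (x + - h)))) x.
    move=> Hx; apply: (continuous_comp (fun x => x + - h) (fun x => w (Cmod (F x)))).
      by apply: (continuous_plus (V := R_NormedModule)); [apply: continuous_id | apply: continuous_const].
    by apply: cphi; lra.
  have ex2 : ex_RInt (fun x => w (Cmod (F (x + - h)))) t1 t'.
    apply: (ex_RInt_continuous (V := R_CompleteNormedModule)) => z.
    by rewrite Rmin_left ?Rmax_right; try lra; apply: csh.
  have ex3 : ex_RInt (fun x => w (Cmod (F x)) + w (Cmod (F (x + - h)))) t1 t' by apply: (ex_RInt_plus (V := R_NormedModule)).
  have ex4 : ex_RInt (fun x => w (Cmod (F x)) + w (Cmod (F (x + - h))) + w (2 * eta)) t1 t'.
    by apply: (ex_RInt_plus (V := R_NormedModule)) => //; apply: ex_RInt_const.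
  apply: (Rle_trans _ (RInt (fun x => K * (w (Cmod (F x)) + w (Cmod (F (x + - h))) + w (2 * eta))) t1 t')).
    apply: RInt_le; first lra.
    + by apply: Hex => //; lra.
    + exact: (ex_RInt_scal (V := R_NormedModule) _ _ _ K ex4).
    + move=> x Hx; apply: (Rle_trans _ (w (Cmod (F x) + Cmod (F (x + - h)) + 2 * eta))).
        apply: (pl_mono _ _ Hw); split; first exact: Cmod_ge_0.
        have := H1 x ltac:(lra); rewrite /Rminus; set fh := F (x + - h).
        have := Cmod_triangle (F x - fh) (fh - P x); have := Cmod_triangle (F x) (- fh).
        replace (F x - fh + (fh - P x))%C with (F x - P x)%C by ring.
        rewrite Cmod_opp /Cminus; lra.
      by apply: (pl_add _ _ Hw); [apply: Cmod_ge_0 | apply: Cmod_ge_0 | lra].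
  have E2 := RInt_scal (V := R_CompleteNormedModule) _ t1 t' K ex4.
  have E3 := RInt_plus (V := R_CompleteNormedModule) _ _ t1 t' ex3 (ex_RInt_const (V := R_NormedModule) t1 t' (w (2 * eta))).
  have E4 := RInt_plus (V := R_CompleteNormedModule) _ _ t1 t' ex1 ex2.
  rewrite RInt_const in E3.
  rewrite /scal /= /mult /= in E2 E3; rewrite /plus /= in E3 E4.
  rewrite E2 E3 E4; apply: Rmult_le_compat_l => //.
  have -> : RInt (fun x => w (Cmod (F (x + - h)))) t1 t' = RInt (fun x => w (Cmod (F x))) (t1 + - h) (t' + - h).
    apply: (RInt_translate (fun x => w (Cmod (F x)))); first lra.
    by move=> x Hx; apply: cphi; lra.
  have h1 := H3 t1 t' ltac:(lra) ltac:(lra) ltac:(lra).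
  have h2 := H3 (t1 + - h) (t' + - h) ltac:(lra) ltac:(lra) ltac:(lra).
  have : (t' - t1) * w (2 * eta) <= w (2 * eta) * (b - a) by rewrite Rmult_comm; apply: Rmult_le_compat_l => //; lra.
  lra.
Qed.

Lemma span_E_approx lam mu kap a b c K w B : good lam mu kap -> CB lam mu b c -> a < b -> power_like K w ->
  (forall s t, a < s -> s < t -> t < b -> RInt (fun x => w (Cmod (gsum lam mu c 0 x))) s t <= B) ->
  forall e, 0 < e -> exists P, span_E lam mu P /\
    (forall x, a < x < b -> continuous (fun x => w (Cmod (gsum lam mu c 0 x - P x))) x) /\
    forall s t, a < s -> s < t -> t < b -> RInt (fun x => w (Cmod (gsum lam mu c 0 x - P x))) s t <= e.
Proof.
move=> Hg Hc Hab Hw HB e He; set F := gsum lam mu c 0; set F' := gsum lam mu c 1.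
have HK := pl_K _ _ Hw.
have HF x : x < b -> RD F x (F' x) by move=> Hx; apply: (RD_gsum _ _ kap b).
set e1 := e / (4 * (K + 1)).
have he1 : 0 < e1 by apply: Rdiv_lt_0_compat; lra.
have [t0 [Ht0 HT]] := RInt_tail_small (fun x => w (Cmod (F x))) a b B e1 Hab
  (fun x Hx => pl_continuous K w F x _ Hw (HF x (proj2 Hx))) (fun x _ => pl_ge0 _ _ Hw _) HB he1.
set t1 := (t0 + b) / 2.
set D := 2 * (1 + K) * (b - a + 1).
have hD : 0 < D by apply: Rmult_lt_0_compat; lra.
have [d [Hd Hdw]] := pl_small _ _ Hw (e / D) ltac:(apply: Rdiv_lt_0_compat; lra).
set eta := d / 2; have heta : 0 < eta by rewrite /eta; lra.
have [M [HM0 HM]] := gsum_unif_bound lam mu kap b c 1 (a - 2) ((t1 + b) / 2) Hg Hc ltac:(rewrite /t1; lra) ltac:(rewrite /t1; lra).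
(* With [h <= 1] the translates stay to the right of [a - 2], where the expansion still converges
   and its derivative is bounded by [M]. With [h <= t1 - t0] the tail estimate covers [t1 - h]. The
   last bound makes [F] move by at most [eta]. *)
set h := Rmin (Rmin 1 (t1 - t0)) (eta / (2 * M + 1)).
have q1 : 0 < eta / (2 * M + 1) by apply: Rdiv_lt_0_compat; lra.
have h0 : 0 < h by apply: Rmin_pos => //; apply: Rmin_pos; rewrite /t1; lra.
have h1 : h <= 1 by apply: Rle_trans (Rmin_l _ _) (Rmin_l _ _).
have h2 : h <= t1 - t0 by apply: Rle_trans (Rmin_l _ _) (Rmin_r _ _).
have h3 : 2 * M * h <= eta.
  have : h <= eta / (2 * M + 1) by apply: Rmin_r.
  move=> q; apply: (Rle_trans _ ((2 * M + 1) * (eta / (2 * M + 1)))); last by apply: Req_le; field; lra.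
  by apply: Rmult_le_compat; lra.
have [P [HP [HPd HPe]]] := span_E_near lam mu kap b c a h eta Hg Hc Hab h0 heta.
exists P; split=> //.
pose P' x := proj1_sig (constructive_indefinite_description _ (HPd x)).
have HP' x : RD P x (P' x) by apply: proj2_sig (constructive_indefinite_description _ (HPd x)).
split.
  by move=> x [_ Hx]; apply: (pl_continuous K w (fun x => F x - P x)%C x _ Hw); apply: RD_minus; [apply: HF | apply: HP'].
move=> s t Hs Hst Ht.
have Ht1 : t1 < b by rewrite /t1; lra.
apply: Rle_trans (RInt_shift_estimate K w F P F' P' a b h eta e1 t1 Hw _ Ht1 h0 _ heta _ HP' HPe _ _ s t Hs Hst Ht) _.
- by rewrite /t1; lra.
- by lra.
- by move=> x Hx; apply: HF; lra.
- move=> x Hx.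
  have := RD_lip F F' (a - 2) ((t1 + b) / 2) M (x - h) x (fun t Ht => HF t ltac:(lra)) (fun t Ht => HM t ltac:(lra)) ltac:(lra) ltac:(lra).
  have -> : x - (x - h) = h by ring.
  by rewrite (Rabs_pos_eq h); lra.
- by move=> s' t' q2 q3 q4; apply: HT => //; lra.
have -> : 2 * eta = d by rewrite /eta; field.
have w0 := pl_ge0 _ _ Hw d.
have p1 : w d * (b - a) * (1 + K) <= e / 2.
  have -> : e / 2 = e / D * (b - a + 1) * (1 + K) by rewrite /D; field; lra.
  apply: Rmult_le_compat_r; first lra.
  by apply: Rmult_le_compat; lra.
have p2 : K * (2 * e1) <= e / 2.
  have -> : e / 2 = (K + 1) * (2 * e1) by rewrite /e1; field; lra.
  by apply: Rmult_le_compat_r; lra.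
lra.
Qed.

(** * Riemann and Lebesgue integrals *)

Module Lp.
From mathcomp Require Import all_boot all_order all_algebra.
From mathcomp Require Import all_classical all_reals all_analysis.
From mathcomp Require Import measurable_realfun Rstruct Rstruct_topology.
Import Order.TTheory GRing.Theory Num.Theory.
Import numFieldNormedType.Exports.
Local Open Scope classical_set_scope.
Local Open Scope ring_scope.

Lemma continuous_for (q : R -> R) (x : R) : Continuity.continuous q x -> {for x, continuous (q : RR -> RR)}.
Proof. by move=> /continuity_pt_filterlim /continuity_pt_cvg. Qed.

Lemma derivable_of_is_derive (q : R -> R) (x l : R) : Derive.is_derive q x l ->
  derivable (q : RR -> RR) (x : RR) 1 /\ derive1 (q : RR -> RR) (x : RR) = l.
Proof.
move=> /is_derive_Reals H.
have Hc : (fun h : RR => h^-1 *: ((q (h + x) : RR) - q x)) @ (0 : RR)^' --> (l : RR).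
  apply/cvgrPdist_lt => e e0.
  have [d Hd] := H e (elimT RltP e0).
  near=> h.
  have h0 : h != 0 by near: h; exact: nbhs_dnbhs_neq.
  have hd : `|h| < pos d.
    near: h; apply: dnbhs0_lt; apply/RltP; exact: cond_pos.
  have /RltP := Hd h (elimN eqP h0) ltac:(by apply/RltP; rewrite RabsE).
  rewrite RabsE distrC; congr (_ < _); congr (`| _ |).
  by rewrite RminusE RdivE RplusE [x + h]addrC /GRing.scale /= mulrC.
split.
- suff E : (fun h : RR => h^-1 *: (((q : RR -> RR) \o shift (x : RR)) (h *: 1) - (q x : RR))) = (fun h : RR => h^-1 *: ((q (h + x) : RR) - q x)).
    by rewrite /derivable E; apply/cvg_ex; exists (l : RR).
  by apply/funext => h /=; rewrite /shift /= /GRing.scale /= mulr1.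
- by rewrite /derive1; apply/cvg_lim.
Unshelve. all: by end_near.
Qed.

Section integrals.
Variables (q : R -> R) (a b : R).
Hypothesis cq : forall x : R, Rlt a x /\ Rlt x b -> Continuity.continuous q x.
Hypothesis q0 : forall x : R, Rle 0 (q x).

Lemma within_continuous s t : Rlt a s -> Rlt t b -> {within `[s : RR, t : RR], continuous (q : RR -> RR)}.
Proof.
move=> /RltP has /RltP htb; apply: continuous_in_subspaceT => x; rewrite inE /= in_itv /= => /andP[sx xt].
by apply: continuous_for; apply: cq; split; apply/RltP; [exact: lt_le_trans sx | exact: le_lt_trans htb].
Qed.

(** The Riemann integral is an antiderivative of [q], so the fundamental theorem of calculus for the
    Lebesgue integral evaluates the left side. *)
Lemma integral_itv_RInt s t : Rlt a s -> Rlt s t -> Rlt t b ->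
  (\int[lebesgue_measure]_(x in `[s : RR, t : RR]) (q x : RR)%:E = (RInt q s t : RR)%:E)%E.
Proof.
move=> has hst htb.
have hd x : Rlt a x -> Rlt x b -> Derive.is_derive (fun u => RInt q s u) x (q x).
  by move=> h1 h2; apply: (is_derive_RInt_inside q a b) => //; lra.
have hc x : Rlt a x -> Rlt x b -> {for (x : RR), continuous (fun u : RR => RInt q s u : RR)}.
  by move=> h1 h2; apply: continuous_for; apply: (ex_derive_continuous (V := R_NormedModule)); exists (q x); apply: hd.
have := @continuous_FTC2 RR (q : RR -> RR) (fun u : RR => RInt q s u : RR) s t.
have -> : RInt q s s = 0 :> RR by exact: RInt_point.
rewrite sube0; apply.
- exact/RltP.
- exact: within_continuous.
- split.
  + move=> x; rewrite in_itv /= => /andP[/RltP h1 /RltP h2].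
    by have [h3 _] := derivable_of_is_derive _ _ _ (hd x ltac:(lra) ltac:(lra)).
  + by apply: cvg_at_right_filter; apply: hc; lra.
  + by apply: cvg_at_left_filter; apply: hc; lra.
- move=> x; rewrite in_itv /= => /andP[/RltP h1 /RltP h2].
  by have [_ h3] := derivable_of_is_derive _ _ _ (hd x ltac:(lra) ltac:(lra)).
Qed.

Let D := [set x : RR | ((a : RR) < x < (b : RR))%R].

Let measurable_ooE : D = [set` Interval (BRight (a : RR)) (BLeft (b : RR))].
Proof. by apply/seteqP; split=> x /=; rewrite in_itv. Qed.

Let measurable_q : measurable_fun D (fun x : RR => (q x : RR)).
Proof.
rewrite measurable_ooE; apply: subspace_continuous_measurable_fun => //.
apply: continuous_in_subspaceT => x; rewrite inE /= in_itv /= => /andP[/RltP h1 /RltP h2].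
by apply: continuous_for; apply: cq.
Qed.

Let mD : measurable (D : set (measurableTypeR RR)).
Proof. by rewrite measurable_ooE; exact: measurable_itv. Qed.

Let q0E x : (0 <= ((q x : RR)%:E : \bar RR))%E.
Proof. by rewrite lee_fin; apply/RleP. Qed.

Let measurable_Eq : measurable_fun D (fun x : RR => ((q x : RR)%:E : \bar RR)).
Proof. exact: (proj2 (measurable_EFinP D (fun x : RR => (q x : RR))) measurable_q). Qed.

Lemma RInt_le_integral s t : Rlt a s -> Rlt s t -> Rlt t b ->
  ((RInt q s t : RR)%:E <= \int[lebesgue_measure]_(x in D) (q x : RR)%:E)%E.
Proof.
move=> has hst htb; rewrite -integral_itv_RInt //; apply: (@ge0_subset_integral _ _ RR lebesgue_measure _ _ _ mD _ measurable_Eq); rewrite ?in_itv //.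
- by move=> x _; apply: q0E.
- move=> x /=; rewrite in_itv /= => /andP[sx xt].
  by apply/andP; split; [apply: (lt_le_trans _ sx) | apply: (le_lt_trans xt)]; apply/RltP.
Qed.

(** Monotone convergence along closed intervals that exhaust [(a, b)]. *)
Lemma integral_le_RInt B : Rlt a b ->
  (forall s t, Rlt a s -> Rlt s t -> Rlt t b -> Rle (RInt q s t) B) ->
  (\int[lebesgue_measure]_(x in D) (q x : RR)%:E <= (B : RR)%:E)%E.
Proof.
move=> hab HB.
(* The summand 3 gives [3 * w n <= b - a], so that [[a + w n, b - w n]] is never degenerate. *)
pose w (n : nat) : R := ((b - a) / (INR n + 3))%coqR.
have hn n : Rle 0 (INR n) by apply: pos_INR.
have hw n : Rlt 0 (w n) /\ Rle (3 * w n) (b - a).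
  have := hn n => h; split; first by apply: Rdiv_lt_0_compat; lra.
  have -> : (b - a)%coqR = (w n * (INR n + 3))%coqR by rewrite /w; field; lra.
  rewrite Rmult_comm; apply: Rmult_le_compat_l; last lra.
  by apply: Rlt_le; apply: Rdiv_lt_0_compat; lra.
have hwS n : Rle (w n.+1) (w n).
  rewrite /w; apply: Rmult_le_compat_l; first lra.
  by apply: Rinv_le_contravar; [have := hn n; lra | rewrite S_INR; lra].
pose I (n : nat) := [set` Interval (BLeft ((a + w n)%coqR : RR)) (BRight ((b - w n)%coqR : RR))].
have HI n : (\int[lebesgue_measure]_(x in I n) (q x : RR)%:E <= (B : RR)%:E)%E.
  have [h1 h2] := hw n.
  by rewrite integral_itv_RInt ?lee_fin; [apply/RleP; apply: HB | | |]; lra.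
have ID n : I n `<=` D.
  have [h1 h2] := hw n.
  move=> x; rewrite /I /D /= in_itv /= => /andP[/RleP h3 /RleP h4].
  by apply/andP; split; apply/RltP; lra.
have -> : D = \bigcup_n I n.
  apply/seteqP; split; last by move=> x [n _]; apply: ID.
  move=> x /= /andP[/RltP h1 /RltP h2].
  have hp : Rlt 0 (Rmin (x - a) (b - x)) by apply: Rmin_pos; lra.
  have [N HN] := nfloor_ex ((b - a) / Rmin (x - a) (b - x)) ltac:(apply: Rlt_le; apply: Rdiv_lt_0_compat; lra).
  have m1 := Rmin_l (x - a) (b - x); have m2 := Rmin_r (x - a) (b - x).
  have hwN : Rle (w N) (Rmin (x - a) (b - x)).
    have e : (b - a)%coqR = ((b - a) / Rmin (x - a) (b - x) * Rmin (x - a) (b - x))%coqR by field; lra.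
    rewrite /w {1}e /Rdiv Rmult_assoc (Rmult_comm _ (/ (INR N + 3))%coqR) -Rmult_assoc.
    rewrite -[X in Rle _ X]Rmult_1_l; apply: Rmult_le_compat_r; first lra.
    have := hn N => h; apply: (Rmult_le_reg_r (INR N + 3)); first lra.
    rewrite Rmult_assoc Rinv_l; lra.
  exists N => //; rewrite /I /= in_itv /=; apply/andP; split; apply/RleP; lra.
have nd : nondecreasing_seq I.
  apply/nondecreasing_seqP => n; apply/subsetPset => x; rewrite /I /= !in_itv /= => /andP[/RleP h3 /RleP h4].
  by have := hwS n => h; apply/andP; split; apply/RleP; lra.
have mI n : measurable (I n : set (measurableTypeR RR)) by exact: measurable_itv.
pose qE (x : measurableTypeR RR) : \bar RR := (q x : RR)%:E.
have mfI n : measurable_fun (I n : set (measurableTypeR RR)) qE by apply: (measurable_funS mD (ID n) measurable_Eq).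
have cvI := @ge0_nondecreasing_set_cvg_integral _ (measurableTypeR RR) RR I qE lebesgue_measure nd mI mfI (fun n x _ => q0E x).
rewrite -(cvg_lim _ cvI) //; apply: lime_le; first exact: cvgP cvI.
exact: nearW.
Qed.

End integrals.
Lemma powR_le_id (p x : R) : Rle 1 p -> Rle 0 x -> Rle x 1 -> Rle ((x : RR) `^ (p : RR)) x.
Proof.
move=> /RleP hp /RleP x0 /RleP x1; apply/RleP.
move: x0; rewrite le_eqVlt => /orP[/eqP <-|x0].
  by rewrite powR0 //; apply/eqP => hp0; rewrite hp0 ler10 in hp.
by apply: ge1r_powR => //; rewrite x0.
Qed.

Lemma powR_power_like (p : R) : Rle 1 p ->
  power_like (((3%:R : RR) `^ (p : RR)) : R) (fun x : R => ((x : RR) `^ (p : RR) : R)).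
Proof.
move=> hp; have hp0 : (0 <= (p : RR)) by apply/RleP; change (Rle 0 p); lra.
have wge x : Rle 0 ((x : RR) `^ (p : RR)) by apply/RleP; exact: powR_ge0.
have wmono (x y : R) : Rle 0 x /\ Rle x y -> Rle ((x : RR) `^ (p : RR)) ((y : RR) `^ (p : RR)).
  move=> [/RleP h1 /RleP h2]; apply/RleP; apply: ge0_ler_powR => //; rewrite nnegrE //.
  exact: le_trans h2.
split=> //.
- move=> x y z hx hy hz.
  (* The constant [3 ^ p] comes from bounding [x + y + z] by three times the maximum. *)
  set m := Rmax x (Rmax y z).
  have m1 : Rle x m by apply: Rmax_l.
  have m2 : Rle y m by apply: Rle_trans (Rmax_l _ _) (Rmax_r _ _).
  have m3 : Rle z m by apply: Rle_trans (Rmax_r _ _) (Rmax_r _ _).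
  have hm : Rle 0 m by lra.
  have E : ((3%:R : RR) * m) `^ p = (3%:R : RR) `^ p * (m : RR) `^ p.
    by rewrite powRM //; apply/RleP.
  apply: (Rle_trans _ (((3%:R : RR) * m) `^ p)).
    apply: wmono; split; first lra.
    have -> : (3%:R : RR) * m = (m + m + m)%coqR by rewrite mulr_natl !mulrS mulr0n addr0 addrA.
    lra.
  rewrite E; apply: Rmult_le_compat_l; first exact: wge.
  have w1 := wge x; have w2 := wge y; have w3 := wge z.
  have : m = x \/ m = y \/ m = z.
    by rewrite /m /Rmax; case: Rle_dec => _; auto; case: Rle_dec; auto.
  by case=> [->|[->|->]]; lra.
(* On [[0, 1]] the power [x ^ p] is at most [x]. *)
- move=> e He; exists (Rmin 1 e); split; first by apply: Rmin_pos; lra.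
  have h1 := Rmin_l 1 e; have h2 := Rmin_r 1 e.
  have h3 : Rlt 0 (Rmin 1 e) by apply: Rmin_pos; lra.
  have := powR_le_id p (Rmin 1 e) hp; lra.
- move=> x hx e He.
  (* At positive points the power is differentiable; at 0 continuity follows from the comparison
     with the identity. *)
  have [x0|x0] : Rlt 0 x \/ 0%coqR = x by lra.
  + suff /continuous_eps h : Continuity.continuous (fun t : R => (t : RR) `^ (p : RR) : R) x.
      by have [d [Hd D]] := h e He; exists d; split=> // y _; apply: D.
    apply/continuity_pt_filterlim/continuity_pt_cvg.
    have hd : derivable (fun t : RR => t `^ (p : RR)) (x : RR) 1.
      by apply: derivable_powR; rewrite in_itv /= andbT; apply/RltP.
    by move/derivable1_diffP/differentiable_continuous: hd.
  + have w0 : (x : RR) `^ (p : RR) = 0.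
      by rewrite -x0 powR0 //; apply/eqP => hq; move: hp; rewrite hq; have : (0 : RR) = 0%coqR by []; move=> ->; lra.
    exists (Rmin 1 e); split; first by apply: Rmin_pos; lra.
    have h1 := Rmin_l 1 e; have h2 := Rmin_r 1 e.
    move=> y hy; rewrite w0 -x0 !Rminus_0_r => hy2.
    have hy3 := Rle_abs y.
    have := powR_le_id p y hp hy ltac:(lra); rewrite Rabs_pos_eq; last exact: wge.
    lra.
Qed.

(** The finite integral of [|f| ^ p] bounds the Riemann integrals over compact subintervals, which
    is the hypothesis of [span_E_approx]; [integral_le_RInt] carries its conclusion back to the
    Lebesgue integral. *)
Lemma W_closed_span lam mu kap a b f p : good lam mu kap -> Rlt a b -> Wclass lam mu a b f ->
  Rle 1 p -> in_Lp a b p f -> in_closed_span_Lp lam mu a b p f.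
Proof.
move=> Hg hab [c0 Hc0] hp [_ Hfin] e He.
have [Hc Ef] := W_CB lam mu kap a b f c0 Hg hab Hc0.
set c := trunc mu c0 in Hc Ef.
pose w (x : R) : R := (x : RR) `^ (p : RR).
have Hw : power_like (((3%:R : RR) `^ (p : RR)) : R) w by exact: powR_power_like.
pose F := gsum lam mu c 0.
have cF x : Rlt a x /\ Rlt x b -> Continuity.continuous (fun x => w (Cmod (F x))) x.
  by move=> [_ hx]; apply: (pl_continuous _ w F x _ Hw); exact: (RD_gsum lam mu kap b c 0 x Hg Hc hx).
have EF : Lp_int a b p f = (\int[lebesgue_measure]_(x in [set x : RR | ((a : RR) < x < (b : RR))%R]) (w (Cmod (F x)) : RR)%:E)%E.
  apply: eq_integral => x; rewrite inE /= => /andP[/RltP h1 /RltP h2].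
  by rewrite Ef.
pose B : R := fine (Lp_int a b p f).
have HB s t : Rlt a s -> Rlt s t -> Rlt t b -> Rle (RInt (fun x => w (Cmod (F x))) s t) B.
  move=> h1 h2 h3; apply/RleP; rewrite -lee_fin /B fineK.
    by rewrite EF; apply: (RInt_le_integral _ a b cF) => // x; exact: (pl_ge0 _ _ Hw).
  rewrite ge0_fin_numE //; apply: integral_ge0 => x _; exact: powR_ge0.
(* Half of the allowed value, because the closed span is defined by a strict inequality. *)
have e0 : Rlt 0 (w e / 2).
  by apply: Rdiv_lt_0_compat; [apply/RltP; apply: powR_gt0; exact: He | lra].
have [P [HP [cP IP]]] := span_E_approx lam mu kap a b c _ w B Hg Hc hab Hw HB _ e0.
exists P; split=> //.
apply: (@le_lt_trans _ _ ((w e / 2)%coqR : RR)%:E); last first.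
  by rewrite lte_fin; apply/RltP; rewrite -/(w e); lra.
have -> : Lp_int a b p (fun x => Cminus (f x) (P x)) =
    (\int[lebesgue_measure]_(x in [set x : RR | ((a : RR) < x < (b : RR))%R]) (w (Cmod (Cminus (F x) (P x))) : RR)%:E)%E.
  apply: eq_integral => x; rewrite inE /= => /andP[/RltP h1 /RltP h2].
  by rewrite Ef.
by apply: (integral_le_RInt _ a b cP) => // x; exact: (pl_ge0 _ _ Hw).
Qed.
End Lp.

Theorem theorem10p2 (lam : nat -> C) (mu : nat -> nat) (gamma beta : R) :
  multiplicity_seq lam mu ->
  ABCD lam mu ->
  gamma < beta ->
  (* (i)  V(Lambda,gamma,beta) = W(Lambda,gamma,beta) *)
  (forall f : R -> C,
     Vclass lam mu gamma beta f <-> Wclass lam mu gamma beta f) /\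
  (* (ii) *)
  (forall (f : R -> C) (p : R),
     Wclass lam mu gamma beta f ->
     1 <= p ->
     in_Lp gamma beta p f ->
     in_closed_span_Lp lam mu gamma beta p f).
Proof.
move=> Hmult [HA [HBc [HC _]]] Hab.
have [kap Hg] := good_of_hyps lam mu Hmult HA HBc.
have Hint := interpolating_interpC lam mu (good_mu _ _ _ Hg) HC.
split=> [f|f p HW Hp Hf].
  by split; [apply: (V_sub_W _ _ kap) | apply: (W_sub_V _ _ kap)].
exact: (Lp.W_closed_span lam mu kap).
Qed.
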